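(* Let $F$ be a nonnegative compactly supported time-independent Hamiltonian on the cylinder $T^*\mathbb T^1$ with $\max F=1$. Then $E(F)=\mu(F)$.
   Context: $T^*\mathbb T^1=\mathbb R(p)\times S^1(q)$ carries the symplectic form $dp\wedge dq$. The Hamiltonian flow $\{f_t\}$ of $F$ is the flow of $\operatorname{sgrad}F$, $i_{\operatorname{sgrad}F}\Omega=-dF$. $\mathrm{Ham}$ is the group of time-one maps of flows of compactly supported time-dependent Hamiltonians; Hofer length of a path generated by $F$ on $[a,b]$ is $\int_a^b(\max_xF_t-\min_xF_t)dt$ and the Hofer metric $\rho(\phi,\psi)$ is the infimum of lengths of Hamiltonian paths from $\phi$ to $\psi$. $\|F\|=\max F-\min F$. The asymptotic growth is $\mu(F)=\lim_{t\to+\infty}\rho(\mathrm{id},f_t)/(t\|F\|)$ (the limit exists). $E(F)$ is the supremum of those real $E$ for which the level set $\{F=E\}$ contains a non-contractible embedded circle. *)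

(* Defs.v *)
From Stdlib Require Import Reals List ZArith.
From Coquelicot Require Import Coquelicot.
Open Scope R_scope.

(* The cylinder T^*T^1 = R(p) x S^1(q) with S^1 = R/Z is represented through
   its universal cover R x R (coordinates (p,q)); functions on the cylinder are
   functions on R x R that are 1-periodic in q; maps of the cylinder are
   represented by lifts R x R -> R x R. *)

Definition Ham3 := R -> R -> R -> R.

Definition partial (i : nat) (H : Ham3) : Ham3 :=
  match i with
  | 0%nat => fun t p q => Derive (fun s => H s p q) t
  | 1%nat => fun t p q => Derive (fun s => H t s q) p
  | _ => fun t p q => Derive (fun s => H t p s) q
  end.

Definition ex_partial (i : nat) (H : Ham3) (t p q : R) : Prop :=
  match i with
  | 0%nat => ex_derive (fun s => H s p q) t
  | 1%nat => ex_derive (fun s => H t s q) p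
  | _ => ex_derive (fun s => H t p s) q
  end.

Definition dpart (l : list nat) (H : Ham3) : Ham3 := fold_right partial H l.

Definition smooth3 (H : Ham3) : Prop :=
  forall l : list nat,
    (forall i t p q, (i < 3)%nat -> ex_partial i (dpart l H) t p q) /\
    (forall x : R * R * R,
        continuous (fun y : R * R * R => dpart l H (fst (fst y)) (snd (fst y)) (snd y)) x).

Definition q_periodic (H : Ham3) : Prop :=
  forall t p q, H t p (q + 1) = H t p q.

Definition compact_supp (H : Ham3) : Prop :=
  exists K : R, forall t p q, K < Rabs p -> H t p q = 0.

Definition admissible (H : Ham3) : Prop :=
  smooth3 H /\ q_periodic H /\ compact_supp H.

Definition autonomous (F : R -> R -> R) : Ham3 := fun _ p q => F p q.

(* Hamiltonian flow: f t x is the flow of sgrad H_t, where i_{sgrad H} (dp/\dq) = -dH,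
   i.e.  dp/dt = - dH/dq,  dq/dt = dH/dp. *)
Definition is_flow (H : Ham3) (f : R -> R * R -> R * R) : Prop :=
  forall x : R * R,
    f 0 x = x /\
    forall t : R,
      is_derive (fun s => fst (f s x)) t (- partial 2 H t (fst (f t x)) (snd (f t x))) /\
      is_derive (fun s => snd (f s x)) t (partial 1 H t (fst (f t x)) (snd (f t x))).

Definition same_cyl_map (g h : R * R -> R * R) : Prop :=
  forall x, fst (g x) = fst (h x) /\ exists n : Z, snd (g x) = snd (h x) + IZR n.

Definition osc (G : R -> R -> R) : R :=
  real (Lub_Rbar (fun y => exists p q, y = G p q))
  - real (Glb_Rbar (fun y => exists p q, y = G p q)).

Definition hofer_length (H : Ham3) : R := RInt (fun t => osc (H t)) 0 1.

Definition hofer_dist_id (phi : R * R -> R * R) : R :=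
  real (Glb_Rbar (fun l => exists (H : Ham3) (g : R -> R * R -> R * R),
          admissible H /\ is_flow H g /\ same_cyl_map (g 1) phi /\ l = hofer_length H)).

(* gamma (lifted to R -> R x R, period 1 in s) parametrizes an embedded
   non-contractible circle in the cylinder contained in {F = E}. *)
Definition noncontractible_embedded_circle_in_level
    (F : R -> R -> R) (E : R) (gamma : R -> R * R) : Prop :=
  (forall s, continuous gamma s) /\
  (exists n : Z, n <> 0%Z /\
     forall s, gamma (s + 1) = (fst (gamma s), snd (gamma s) + IZR n)) /\
  (forall s s', fst (gamma s) = fst (gamma s') ->
     (exists m : Z, snd (gamma s) = snd (gamma s') + IZR m) ->
     exists k : Z, s = s' + IZR k) /\
  (forall s, F (fst (gamma s)) (snd (gamma s)) = E).

Definition E_level (F : R -> R -> R) : R :=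
  real (Lub_Rbar (fun E => exists gamma, noncontractible_embedded_circle_in_level F E gamma)).

(* Main.v *)
(* The value of the theorem is E = E(F), and both bounds rest on Sard: arbitrarily close to any level there is an
   interval [c1, c2] of regular values, whose orbits close up modulo the deck group. An orbit is essential when it
   closes up only after a nonzero deck shift.

   Upper bound. Just above E no orbit of a regular band c1 < F < c2 is essential, since an essential one would be an
   embedded non-contractible circle. The maximum of q along an orbit is then an equivariant first integral on the band,
   and integrating it produces a single-valued branch W of q near {F >= c2}. Cutting W off gives Hamiltonians which
   translate {F >= c2} along p, hence displace it disjointly as often as one wants. Averaging F over n such
   translates changes f_t by a conjugation of bounded length and divides the part of the oscillation above c2 by n,
   so rho(id, f_t) <= t (E + eps) + C.

   Lower bound. Below E there is a regular band with an essential orbit, for otherwise q would have a single-valued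
   branch along a circle at a higher level. Let P <= F be a bump with maximum c1 supported on the essential orbits of
   that band. Its flow is f run for the time tau * slope(x), and essential orbits never close up in the cover, so the
   flow of tau P has no fixed point on its support, and the only action values are 0 and tau c1. If H generates f_t, then H followed by
   - t F + tau P generates the flow of tau P. A minimax value of the discretized action functional is continuous in
   tau and equals 0 or the action of the maximum of P; for tau = 0 it is the latter, hence so it is for tau = t,
   and this forces t c1 <= length(H). Almost critical points of the discrete functional suffice, since they are tracked
   by exact trajectories up to O(1/m); the linking argument is the mod 2 Brouwer theorem on cubical grids. *)
Require Import Defs.
From Stdlib Require Import Reals Lra Lia Psatz ZArith List Bool FunctionalExtensionality Classical ClassicalEpsilon.
From Coquelicot Require Import Coquelicot.
Open Scope R_scope.

(** * Real analysis *)

(** The error in the upper bound does not grow with time because each averaging step costs a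
    commutator of the flow with a fixed translation, whose length is at most twice that of the
    translation. In the lower bound the two candidate values coincide at tau = 0, where the composed
    flow is the identity. One extra discrete step of v P, with a small fixed v > 0, is therefore
    appended. It moves the candidates to 0 and - (tau + v) c, at least v c apart for every tau, so a
    minimax value that varies slowly with tau cannot change branch. The step has to be small because
    a single Euler step only approximates a flow, and its error must be absorbed by the escape rate.
    Almost critical points only show that the slope dP/dF is small; hence P is shaped so that a
    small slope forces a value near 0 or near its maximum. At tau = T the unwinding Hamiltonian T (P
    - F) is nonpositive and drops out of the lower estimate of the minimax value; what remains is
    the length of H and a term v c that cancels. *)

Notation isotopy := (R -> R * R -> R * R) (only parsing).
Notation adm F := (admissible (autonomous F)) (only parsing).
Notation flow_of F f := (is_flow (autonomous F) f) (only parsing).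
Notation em := excluded_middle_informative (only parsing).
Notation cid := (constructive_indefinite_description _) (only parsing).

Lemma Rmin_lt_inv (x a b : R) : x < Rmin a b -> x < a /\ x < b.
Proof. intros H. assert (h1 := Rmin_l a b). assert (h2 := Rmin_r a b). lra. Qed.

Lemma Rabs_self (x : R) : - Rabs x <= x <= Rabs x.
Proof. apply Rabs_le_between, Rle_refl. Qed.

Ltac pos := first [lra | assumption | apply Rabs_pos | apply exp_pos | apply pos_INR | apply cond_pos | apply Rle_refl
  | apply Rmin_pos; pos | apply Rdiv_lt_0_compat; pos | apply Rinv_0_lt_compat; pos | apply Rlt_le, Rinv_0_lt_compat; pos
  | apply Rmult_lt_0_compat; pos | apply Rmult_le_pos; pos | apply Rmult_le_compat_l; pos | apply Rmult_le_compat_r; pos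
  | apply Rmult_le_compat; pos | match goal with x := _ : R |- _ => subst x; pos end].

Ltac abs_fact x := lazymatch goal with _ : - Rabs x <= x <= Rabs x |- _ => fail | _ => let h := fresh in assert (h := Rabs_self x) end.
Ltac rabs := repeat match goal with |- context [Rabs ?x] => abs_fact x | _ : context [Rabs ?x] |- _ => abs_fact x end;
  first [lra | apply Rabs_le_between; lra | apply Rabs_lt_between; lra].

Ltac abs h := first [apply Rabs_le_between in h | apply Rabs_lt_between in h].
Tactic Notation "rmin" hyp(h) simple_intropattern(p) := apply Rmin_lt_inv in h; destruct h as p.
Tactic Notation "ext" := apply functional_extensionality; intro.
Tactic Notation "ext" ident(x) := apply functional_extensionality; intro x.
Tactic Notation "via" uconstr(t) := eapply Rle_trans; [apply t|].
Tactic Notation "lt_via" uconstr(t) := eapply Rle_lt_trans; [apply t|].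

Lemma Dv (f : R -> R) (x l : R) : is_derive f x l -> Derive (fun y => f y) x = l.
Proof. exact (is_derive_unique f x l). Qed.

Lemma Rabs_sqr (x : R) : x*x = Rabs x*Rabs x.
Proof. rewrite <- Rabs_mult. symmetry. apply Rabs_pos_eq. nra. Qed.

Lemma sqr_ge0 (x : R) : 0 <= x*x.
Proof. exact (Rle_0_sqr x). Qed.

(** A Lebesgue number argument: every x lies in the ball of radius [delta t] around some t with
    [delta t] at least d, and monotonicity of Q shrinks the radius from [delta t] to d. Uniformity
    over compact boxes is later obtained by iterating this. *)
Lemma compact_unif (a b : R) (Q : R -> R -> Prop) :
  (forall x r r', Q x r -> 0 < r' <= r -> Q x r') ->
  (forall x, a <= x <= b -> exists r, 0 < r /\ forall y, Rabs (y - x) < r -> Q y r) ->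
  exists r, 0 < r /\ forall x, a <= x <= b -> Q x r.
Proof.
  intros Hm Hl.
  assert (Hd : forall x, exists d : posreal,
            a <= x <= b -> forall y, Rabs (y - x) < d -> Q y d).
  { intros x. destruct (classic (a <= x <= b)) as [Hx|Hx].
    - destruct (Hl x Hx) as [r [Hr H]]. exists (mkposreal r Hr). intros _. exact H.
    - exists (mkposreal 1 Rlt_0_1). intros; contradiction. }
  set (delta := fun x => proj1_sig (constructive_indefinite_description _ (Hd x))).
  assert (Hdelta : forall x, a <= x <= b -> forall y, Rabs (y - x) < delta x -> Q y (delta x)).
  { intros x. unfold delta.
    destruct (constructive_indefinite_description _ (Hd x)) as [d H]. exact H. }
  destruct (compactness_value_1d a b delta) as [d H].
  exists d. split; [apply cond_pos|]. intros x Hx.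
  destruct (NNPP _ (H x Hx)) as [t [Ht [H1 H2]]].
  apply (Hm x (delta t)); [apply Hdelta; assumption|]. split; [apply cond_pos|exact H2].
Qed.

Lemma mvt (f df : R -> R) (a b : R) :
  (forall x, Rmin a b <= x <= Rmax a b -> is_derive f x (df x)) ->
  exists c, Rmin a b <= c <= Rmax a b /\ f b - f a = df c*(b - a).
Proof.
  intros H. apply (MVT_gen f a b df).
  - intros x Hx. apply H. lra.
  - intros x Hx. apply continuity_pt_filterlim.
    apply (ex_derive_continuous f x). exists (df x). apply H. exact Hx.
Qed.

Lemma is_derive_cont (f : R -> R) (x l : R) : is_derive f x l -> continuous f x.
Proof. intros H. apply (ex_derive_continuous f). exists l. exact H. Qed.

Lemma mvt_bound (f df : R -> R) (a b M : R) :
  (forall x, Rmin a b <= x <= Rmax a b -> is_derive f x (df x) /\ Rabs (df x) <= M) ->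
  Rabs (f b - f a) <= M*Rabs (b - a).
Proof.
  intros H. destruct (mvt f df a b) as [c [Hc Hf]].
  - intros x Hx. apply H. exact Hx.
  - rewrite Hf, Rabs_mult. apply Rmult_le_compat_r; [apply Rabs_pos|]. apply H. exact Hc.
Qed.

Lemma between_dist (a b x : R) : Rmin a b <= x <= Rmax a b -> Rabs (x - a) <= Rabs (b - a).
Proof.
  unfold Rmin, Rmax. destruct (Rle_dec a b); intros H; unfold Rabs;
  destruct (Rcase_abs (x - a)), (Rcase_abs (b - a)); lra.
Qed.

Lemma Rabs_le_inv_trick (x r : R) : 0 < r -> exists d, 0 < d <= r /\ forall y, Rabs (y - x) < 1 -> Rabs y <= / d.
Proof.
  intros Hr. assert (h := Rabs_pos x). exists (Rmin r (/ (Rabs x + 1))).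
  assert (hi : 0 < / (Rabs x + 1)) by (apply Rinv_0_lt_compat; lra). split.
  - split; [apply Rmin_pos; assumption|apply Rmin_l].
  - intros y Hy. apply Rle_trans with (Rabs x + 1).
    + replace y with ((y - x) + x) by ring. assert (h' := Rabs_triang (y - x) x). lra.
    + rewrite <- (Rinv_inv (Rabs x + 1)) at 1. apply Rinv_le_contravar; [apply Rmin_pos; assumption|apply Rmin_r].
Qed.

Lemma is_derive_zero_const (f : R -> R) :
  (forall x, is_derive f x 0) -> forall a b, f a = f b.
Proof.
  intros H a b. destruct (mvt f (fun _ => 0) a b) as [c [_ Hc]].
  - intros; apply H.
  - lra.
Qed.

Lemma continuous_eps (f : R -> R) (x eps : R) : continuous f x -> 0 < eps ->
  exists d, 0 < d /\ forall y, Rabs (y - x) < d -> Rabs (f y - f x) < eps.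
Proof.
  intros H He. destruct (proj1 (filterlim_locally f (f x)) H (mkposreal eps He)) as [d Hd].
  exists d. split; [apply cond_pos|]. intros y Hy. apply (Hd y). exact Hy.
Qed.

Lemma eps_continuous (f : R -> R) (x : R) :
  (forall eps, 0 < eps -> exists d, 0 < d /\ forall y, Rabs (y - x) < d -> Rabs (f y - f x) < eps) ->
  continuous f x.
Proof.
  intros H. apply filterlim_locally. intros eps.
  destruct (H eps (cond_pos eps)) as [d [Hd H1]]. exists (mkposreal d Hd).
  intros y Hy. apply (H1 y). exact Hy.
Qed.

Lemma integer_valued_const (f : R -> R) :
  (forall x, continuous f x) -> (forall x, exists n : Z, f x = IZR n) -> forall a b, f a = f b.
Proof.
  intros Hc Hz.
  assert (Hle : forall a b, f a < f b -> False).
  { intros a b Hab. destruct (Hz a) as [n Hn].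
    destruct (Hz b) as [m Hm]. rewrite Hn, Hm in Hab. apply lt_IZR in Hab.
    assert (Hm1 : IZR m >= IZR n + 1) by (rewrite <- plus_IZR; apply Rle_ge, IZR_le; lia).
    destruct (IVT_gen f a b (IZR n + / 2)) as [x [_ Hx]].
    - intros x. apply continuity_pt_filterlim. apply Hc.
    - rewrite Hn, Hm. unfold Rmin, Rmax. destruct (Rle_dec (IZR n) (IZR m)); lra.
    - destruct (Hz x) as [k Hk]. rewrite Hk in Hx.
      assert (IZR n < IZR k < IZR (n + 1)) by (rewrite plus_IZR; lra).
      destruct H as [H1 H2]. apply lt_IZR in H1. apply lt_IZR in H2. lia. }
  intros a b. destruct (Rtotal_order (f a) (f b)) as [H|[H|H]]; [|exact H|];
  exfalso; eapply Hle; exact H.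
Qed.

Lemma lub_real (S : R -> Prop) (x0 M : R) : S x0 -> (forall y, S y -> y <= M) ->
  (forall y, S y -> y <= real (Lub_Rbar S)) /\ (forall m, (forall y, S y -> y <= m) -> real (Lub_Rbar S) <= m).
Proof.
  intros H0 HM. destruct (Lub_Rbar_correct S) as [U L]. assert (h1 := U x0 H0). assert (h2 := L (Finite M) HM).
  destruct (Lub_Rbar S); try contradiction. exact (conj U (fun m => L (Finite m))).
Qed.

Lemma glb_real (S : R -> Prop) (x0 M : R) : S x0 -> (forall y, S y -> M <= y) ->
  (forall y, S y -> real (Glb_Rbar S) <= y) /\ (forall m, (forall y, S y -> m <= y) -> m <= real (Glb_Rbar S)).
Proof.
  intros H0 HM. destruct (Glb_Rbar_correct S) as [U L]. assert (h1 := U x0 H0). assert (h2 := L (Finite M) HM).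
  destruct (Glb_Rbar S); try contradiction. exact (conj U (fun m => L (Finite m))).
Qed.

(** * Smooth functions of three variables *)

(** The slope m replaces the difference quotient: it is defined at y = x as well, and slopes can be
    multiplied and added without dividing by an increment. *)
Lemma slope_derive (f : R -> R) (x l : R) :
  (forall eps, 0 < eps -> exists d, 0 < d /\ forall y, Rabs (y - x) < d ->
     exists m, f y - f x = m*(y - x) /\ Rabs (m - l) < eps) -> is_derive f x l.
Proof.
  intros H. apply is_derive_Reals. intros eps He.
  destruct (H eps He) as [d [Hd H1]]. exists (mkposreal d Hd). intros h Hh Hhd.
  destruct (H1 (x + h)) as [m [Hm Hl]].
  - replace (x + h - x) with h by ring. exact Hhd.
  - rewrite Hm. replace (m*(x + h - x)/h - l) with (m - l) by (field; exact Hh). exact Hl.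
Qed.

Lemma derive_slope (f : R -> R) (x l : R) : is_derive f x l ->
  forall eps, 0 < eps -> exists d, 0 < d /\ forall y, Rabs (y - x) < d ->
     exists m, f y - f x = m*(y - x) /\ Rabs (m - l) < eps.
Proof.
  intros H eps He. apply is_derive_Reals in H. destruct (H eps He) as [d Hd].
  exists d. split; [pos|]. intros y Hy. destruct (Req_dec y x) as [->|Hn].
  - exists l. split; [ring|]. unfold Rminus. rewrite Rplus_opp_r, Rabs_R0. exact He.
  - exists ((f y - f x)/(y - x)). split; [field; lra|].
    assert (Hn' : y - x <> 0) by lra. specialize (Hd (y - x) Hn' Hy).
    replace (x + (y - x)) with y in Hd by ring. exact Hd.
Qed.

Lemma mult_close (a l eps : R) : 0 < eps -> exists d, 0 < d /\
  forall a' l', Rabs (a' - a) < d -> Rabs (l' - l) < d -> Rabs (a'*l' - a*l) < eps.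
Proof.
  intros He. set (M := Rabs a + Rabs l + 1).
  assert (Ha := Rabs_pos a). assert (Hl := Rabs_pos l).
  assert (HM : 0 < M) by pos.
  exists (Rmin 1 (eps/(2*M))). split.
  - apply Rmin_pos; [lra|]. apply Rdiv_lt_0_compat; lra.
  - intros a' l' H1 H2.
    assert (h1 := Rmin_l 1 (eps/(2*M))). assert (h2 := Rmin_r 1 (eps/(2*M))).
    replace (a'*l' - a*l) with ((a' - a)*(l' - l) + (a' - a)*l + a*(l' - l)) by ring.
    lt_via Rabs_triang.
    eapply Rle_lt_trans; [apply Rplus_le_compat_r, Rabs_triang|].
    rewrite !Rabs_mult.
    set (x := Rabs (a' - a)) in *. set (y := Rabs (l' - l)) in *.
    assert (x*y <= x*1) by pos.
    assert (He2 : eps = 2*M*(eps/(2*M))) by (field; lra).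
    assert (x*(1 + Rabs l) <= x*M) by pos.
    assert (Rabs a*y <= M*y) by pos.
    nra.
Qed.

Definition unc (u : Ham3) : R * R * R -> R := fun y => u (fst (fst y)) (snd (fst y)) (snd y).
Definition cont3 (u : Ham3) : Prop := forall x, continuous (unc u) x.

Lemma cont3_eps (u : Ham3) : cont3 u -> forall t p q eps, 0 < eps -> exists d, 0 < d /\
  forall t' p' q', Rabs (t' - t) < d -> Rabs (p' - p) < d -> Rabs (q' - q) < d ->
  Rabs (u t' p' q' - u t p q) < eps.
Proof.
  intros H t p q eps He.
  destruct (proj1 (filterlim_locally (unc u) (unc u ((t, p), q))) (H ((t, p), q)) (mkposreal eps He)) as [d Hd].
  exists d. split; [pos|]. intros t' p' q' H1 H2 H3.
  apply (Hd ((t', p'), q')). split; [split|]; assumption.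
Qed.

Lemma eps_cont3 (u : Ham3) : (forall t p q eps, 0 < eps -> exists d, 0 < d /\
  forall t' p' q', Rabs (t' - t) < d -> Rabs (p' - p) < d -> Rabs (q' - q) < d ->
  Rabs (u t' p' q' - u t p q) < eps) -> cont3 u.
Proof.
  intros H [[t p] q]. apply filterlim_locally. intros eps.
  destruct (H t p q eps (cond_pos eps)) as [d [Hd H1]]. exists (mkposreal d Hd).
  intros [[t' p'] q'] [[h1 h2] h3]. apply H1; assumption.
Qed.

Lemma cont3_const (c : R) : cont3 (fun _ _ _ => c).
Proof. intros x. apply continuous_const. Qed.
Lemma cont3_t : cont3 (fun t _ _ => t).
Proof. intros x. apply (continuous_comp (fun y : R * R * R => fst y) fst); apply continuous_fst. Qed.
Lemma cont3_p : cont3 (fun _ p _ => p).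
Proof. intros x. apply (continuous_comp (fun y : R * R * R => fst y) snd); [apply continuous_fst|apply continuous_snd]. Qed.
Lemma cont3_q : cont3 (fun _ _ q => q).
Proof. intros x. apply continuous_snd. Qed.
Lemma cont3_plus (u v : Ham3) : cont3 u -> cont3 v -> cont3 (fun t p q => u t p q + v t p q).
Proof. intros Hu Hv x. apply (continuous_plus (unc u) (unc v)); [apply Hu|apply Hv]. Qed.
Lemma cont3_mult (u v : Ham3) : cont3 u -> cont3 v -> cont3 (fun t p q => u t p q*v t p q).
Proof. intros Hu Hv x. apply (continuous_mult (unc u) (unc v)); [apply Hu|apply Hv]. Qed.
Lemma cont3_comp (G a b c : Ham3) : cont3 G -> cont3 a -> cont3 b -> cont3 c ->
  cont3 (fun t p q => G (a t p q) (b t p q) (c t p q)).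
Proof.
  intros HG Ha Hb Hc. apply eps_cont3. intros t p q eps He.
  destruct (cont3_eps G HG (a t p q) (b t p q) (c t p q) eps He) as [d [Hd H]].
  destruct (cont3_eps a Ha t p q d Hd) as [d1 [Hd1 H1]].
  destruct (cont3_eps b Hb t p q d Hd) as [d2 [Hd2 H2]].
  destruct (cont3_eps c Hc t p q d Hd) as [d3 [Hd3 H3]].
  exists (Rmin d1 (Rmin d2 d3)). split; [pos|].
  intros t' p' q' h1 h2 h3.
  assert (m1 := Rmin_l d1 (Rmin d2 d3)). assert (m2 := Rmin_r d1 (Rmin d2 d3)).
  assert (m3 := Rmin_l d2 d3). assert (m4 := Rmin_r d2 d3).
  apply H; [apply H1|apply H2|apply H3]; lra.
Qed.

Definition has_partials (u ut up uq : Ham3) : Prop := forall t p q,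
  is_derive (fun s => u s p q) t (ut t p q) /\
  is_derive (fun s => u t s q) p (up t p q) /\
  is_derive (fun s => u t p s) q (uq t p q).

(** Changing one coordinate at a time writes the increment of G as three mean value terms. Each is a
    partial derivative at a nearby point times a slope of a, b or c, and continuity keeps each
    product within eps/3 of its limit. *)
Lemma chain3 (G Gt Gp Gq : Ham3) (a b c : R -> R) (x la lb lc : R) :
  has_partials G Gt Gp Gq -> cont3 Gt -> cont3 Gp -> cont3 Gq ->
  is_derive a x la -> is_derive b x lb -> is_derive c x lc ->
  is_derive (fun s => G (a s) (b s) (c s)) x
    (Gt (a x) (b x) (c x)*la + Gp (a x) (b x) (c x)*lb + Gq (a x) (b x) (c x)*lc).
Proof.
  intros HG Ct Cp Cq Ha Hb Hc. apply slope_derive. intros eps He.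
  set (A := a x). set (B := b x). set (C := c x).
  assert (He3 : 0 < eps/3) by lra.
  destruct (mult_close (Gt A B C) la (eps/3) He3) as [e1 [He1 M1]].
  destruct (mult_close (Gp A B C) lb (eps/3) He3) as [e2 [He2 M2]].
  destruct (mult_close (Gq A B C) lc (eps/3) He3) as [e3 [He3' M3]].
  destruct (cont3_eps Gt Ct A B C e1 He1) as [d1 [Hd1 K1]].
  destruct (cont3_eps Gp Cp A B C e2 He2) as [d2 [Hd2 K2]].
  destruct (cont3_eps Gq Cq A B C e3 He3') as [d3 [Hd3 K3]].
  set (d := Rmin d1 (Rmin d2 d3)).
  assert (Hd : 0 < d) by pos.
  assert (hd1 : d <= d1) by apply Rmin_l.
  assert (hd2 : d <= d2) by (eapply Rle_trans; [apply Rmin_r|apply Rmin_l]).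
  assert (hd3 : d <= d3) by (eapply Rle_trans; [apply Rmin_r|apply Rmin_r]).
  destruct (continuous_eps a x d (is_derive_cont _ _ _ Ha) Hd) as [r1 [Hr1 R1]].
  destruct (continuous_eps b x d (is_derive_cont _ _ _ Hb) Hd) as [r2 [Hr2 R2]].
  destruct (continuous_eps c x d (is_derive_cont _ _ _ Hc) Hd) as [r3 [Hr3 R3]].
  destruct (derive_slope a x la Ha e1 He1) as [s1 [Hs1 S1]].
  destruct (derive_slope b x lb Hb e2 He2) as [s2 [Hs2 S2]].
  destruct (derive_slope c x lc Hc e3 He3') as [s3 [Hs3 S3]].
  exists (Rmin (Rmin r1 (Rmin r2 r3)) (Rmin s1 (Rmin s2 s3))).
  split; [pos|]. intros y Hy.
  assert (Hy1 : Rabs (y - x) < r1 /\ Rabs (y - x) < r2 /\ Rabs (y - x) < r3 /\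
     Rabs (y - x) < s1 /\ Rabs (y - x) < s2 /\ Rabs (y - x) < s3).
  { rmin Hy [Hy1 Hy2].
    apply Rmin_lt_inv in Hy1. apply Rmin_lt_inv in Hy2. destruct Hy1 as [? Hy1]. destruct Hy2 as [? Hy2].
    apply Rmin_lt_inv in Hy1. apply Rmin_lt_inv in Hy2. tauto. }
  destruct Hy1 as [h1 [h2 [h3 [h4 [h5 h6]]]]].
  specialize (R1 y h1). specialize (R2 y h2). specialize (R3 y h3).
  destruct (S1 y h4) as [m1 [E1 L1]]. destruct (S2 y h5) as [m2 [E2 L2]].
  destruct (S3 y h6) as [m3 [E3 L3]].
  fold A in R1, E1. fold B in R2, E2. fold C in R3, E3.
  destruct (mvt (fun s => G s (b y) (c y)) (fun s => Gt s (b y) (c y)) A (a y)) as [x1 [X1 Y1]].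
  { intros; apply HG. }
  destruct (mvt (fun s => G A s (c y)) (fun s => Gp A s (c y)) B (b y)) as [x2 [X2 Y2]].
  { intros; apply HG. }
  destruct (mvt (fun s => G A B s) (fun s => Gq A B s) C (c y)) as [x3 [X3 Y3]].
  { intros; apply HG. }
  apply between_dist in X1. apply between_dist in X2. apply between_dist in X3.
  exists (Gt x1 (b y) (c y)*m1 + Gp A x2 (c y)*m2 + Gq A B x3*m3). split.
  - rewrite E1 in Y1. rewrite E2 in Y2. rewrite E3 in Y3. lra.
  - assert (Z : forall w, Rabs (w - w) < d).
    { intros w. rabs. }
    assert (Q1 : Rabs (Gt x1 (b y) (c y)*m1 - Gt A B C*la) < eps/3).
    { apply M1; [|lra]. apply K1; lra. }
    assert (Q2 : Rabs (Gp A x2 (c y)*m2 - Gp A B C*lb) < eps/3).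
    { apply M2; [|lra]. apply K2; try lra. rabs. }
    assert (Q3 : Rabs (Gq A B x3*m3 - Gq A B C*lc) < eps/3).
    { apply M3; [|lra]. specialize (Z A) as ZA. specialize (Z B) as ZB. apply K3; lra. }
    rabs.
Qed.

(** [smooth3] speaks of iterated [Derive]; here the partial derivatives are carried as witnesses, so
    that closure under sums, products, composition and limits of construction is an induction on k.
    [smooth3_smooth] identifies the two notions. *)
Fixpoint CK (k : nat) (u : Ham3) : Prop :=
  match k with
  | O => cont3 u
  | S k => cont3 u /\ exists ut up uq, has_partials u ut up uq /\ CK k ut /\ CK k up /\ CK k uq
  end.
Definition smooth (u : Ham3) : Prop := forall k, CK k u.

Lemma CK_cont (k : nat) (u : Ham3) : CK k u -> cont3 u.
Proof. destruct k; [trivial|intros [H _]; exact H]. Qed.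

Lemma CK_pred (k : nat) : forall u, CK (S k) u -> CK k u.
Proof.
  induction k as [|k IH]; intros u [H1 H2]; [pos|].
  split; [pos|]. destruct H2 as [ut [up [uq [H [A [B C]]]]]].
  exists ut, up, uq. auto.
Qed.

Lemma CK_const (c : R) (k : nat) : CK k (fun _ _ _ => c).
Proof.
  revert c. induction k as [|k IH]; intros c; [apply cont3_const|].
  split; [apply cont3_const|]. exists (fun _ _ _ => 0), (fun _ _ _ => 0), (fun _ _ _ => 0).
  split; [|auto]. intros t p q. split; [|split]; apply @is_derive_const.
Qed.

Lemma CK_t (k : nat) : CK k (fun t _ _ => t).
Proof.
  destruct k; [apply cont3_t|]. split; [apply cont3_t|].
  exists (fun _ _ _ => 1), (fun _ _ _ => 0), (fun _ _ _ => 0).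
  split; [|split; [|split]; apply CK_const]. intros t p q.
  split; [apply @is_derive_id|split; apply @is_derive_const].
Qed.
Lemma CK_p (k : nat) : CK k (fun _ p _ => p).
Proof.
  destruct k; [apply cont3_p|]. split; [apply cont3_p|].
  exists (fun _ _ _ => 0), (fun _ _ _ => 1), (fun _ _ _ => 0).
  split; [|split; [|split]; apply CK_const]. intros t p q.
  split; [apply @is_derive_const|split; [apply @is_derive_id|apply @is_derive_const]].
Qed.
Lemma CK_q (k : nat) : CK k (fun _ _ q => q).
Proof.
  destruct k; [apply cont3_q|]. split; [apply cont3_q|].
  exists (fun _ _ _ => 0), (fun _ _ _ => 0), (fun _ _ _ => 1).
  split; [|split; [|split]; apply CK_const]. intros t p q.
  split; [apply @is_derive_const|split; [apply @is_derive_const|apply @is_derive_id]].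
Qed.

Lemma is_derive_mult_R (f g : R -> R) (x a b : R) :
  is_derive f x a -> is_derive g x b -> is_derive (fun s => f s*g s) x (a*g x + f x*b).
Proof.
  intros Hf Hg. auto_derive.
  - repeat split; [exists a; exact Hf|exists b; exact Hg].
  - rewrite (Dv _ _ _ Hf), (Dv _ _ _ Hg). ring.
Qed.

Lemma CK_plus (k : nat) : forall u v, CK k u -> CK k v -> CK k (fun t p q => u t p q + v t p q).
Proof.
  induction k as [|k IH]; intros u v Hu Hv; [apply cont3_plus; assumption|].
  destruct Hu as [Cu [ut [up [uq [Pu [A [B C]]]]]]]. destruct Hv as [Cv [vt [vp [vq [Pv [A' [B' C']]]]]]].
  split; [apply cont3_plus; assumption|].
  exists (fun t p q => ut t p q + vt t p q), (fun t p q => up t p q + vp t p q), (fun t p q => uq t p q + vq t p q).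
  split; [|auto].
  intros t p q. destruct (Pu t p q) as [h1 [h2 h3]]. destruct (Pv t p q) as [k1 [k2 k3]].
  split; [|split]; apply @is_derive_plus; assumption.
Qed.

Lemma CK_mult (k : nat) : forall u v, CK k u -> CK k v -> CK k (fun t p q => u t p q*v t p q).
Proof.
  induction k as [|k IH]; intros u v Hu Hv; [apply cont3_mult; assumption|].
  assert (Hu' := CK_pred _ _ Hu). assert (Hv' := CK_pred _ _ Hv).
  destruct Hu as [Cu [ut [up [uq [Pu [A [B C]]]]]]]. destruct Hv as [Cv [vt [vp [vq [Pv [A' [B' C']]]]]]].
  split; [apply cont3_mult; assumption|].
  exists (fun t p q => ut t p q*v t p q + u t p q*vt t p q),
    (fun t p q => up t p q*v t p q + u t p q*vp t p q),
    (fun t p q => uq t p q*v t p q + u t p q*vq t p q).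
  split; [|split; [|split]; apply CK_plus; apply IH; assumption].
  intros t p q. destruct (Pu t p q) as [h1 [h2 h3]]. destruct (Pv t p q) as [k1 [k2 k3]].
  split; [apply (is_derive_mult_R (fun s => u s p q) (fun s => v s p q))|
    split; [apply (is_derive_mult_R (fun s => u t s q) (fun s => v t s q))|
            apply (is_derive_mult_R (fun s => u t p s) (fun s => v t p s))]]; assumption.
Qed.

Lemma CK_comp (k : nat) : forall G a b c, CK k G -> CK k a -> CK k b -> CK k c ->
  CK k (fun t p q => G (a t p q) (b t p q) (c t p q)).
Proof.
  induction k as [|k IH]; intros G a b c HG Ha Hb Hc; [apply cont3_comp; assumption|].
  assert (Ha' := CK_pred _ _ Ha). assert (Hb' := CK_pred _ _ Hb). assert (Hc' := CK_pred _ _ Hc).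
  destruct HG as [CG [Gt [Gp [Gq [PG [G1 [G2 G3]]]]]]].
  destruct Ha as [Ca [at_ [ap [aq [Pa [a1 [a2 a3]]]]]]].
  destruct Hb as [Cb [bt [bp [bq [Pb [b1 [b2 b3]]]]]]].
  destruct Hc as [Cc [ct [cp [cq [Pc [c1 [c2 c3]]]]]]].
  split; [apply cont3_comp; assumption|].
  exists (fun t p q => Gt (a t p q) (b t p q) (c t p q)*at_ t p q +
       Gp (a t p q) (b t p q) (c t p q)*bt t p q + Gq (a t p q) (b t p q) (c t p q)*ct t p q),
     (fun t p q => Gt (a t p q) (b t p q) (c t p q)*ap t p q +
       Gp (a t p q) (b t p q) (c t p q)*bp t p q + Gq (a t p q) (b t p q) (c t p q)*cp t p q),
     (fun t p q => Gt (a t p q) (b t p q) (c t p q)*aq t p q +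
       Gp (a t p q) (b t p q) (c t p q)*bq t p q + Gq (a t p q) (b t p q) (c t p q)*cq t p q).
  split; [|split; [|split]; repeat apply CK_plus; apply CK_mult; try assumption; apply IH; assumption].
  intros t p q. destruct (Pa t p q) as [h1 [h2 h3]]. destruct (Pb t p q) as [k1 [k2 k3]].
  destruct (Pc t p q) as [l1 [l2 l3]].
  assert (Ct := CK_cont _ _ G1). assert (Cp := CK_cont _ _ G2). assert (Cq := CK_cont _ _ G3).
  split; [|split].
  - apply (chain3 G Gt Gp Gq (fun s => a s p q) (fun s => b s p q) (fun s => c s p q)); assumption.
  - apply (chain3 G Gt Gp Gq (fun s => a t s q) (fun s => b t s q) (fun s => c t s q)); assumption.
  - apply (chain3 G Gt Gp Gq (fun s => a t p s) (fun s => b t p s) (fun s => c t p s)); assumption.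
Qed.

Lemma cont3_inv (u : Ham3) : (forall t p q, u t p q <> 0) -> cont3 u -> cont3 (fun t p q => / u t p q).
Proof.
  intros Hn Hu x. apply (continuous_comp (unc u) Rinv); [apply Hu|].
  apply (continuous_Rinv _). apply Hn.
Qed.

Lemma CK_inv (k : nat) : forall u, (forall t p q, u t p q <> 0) -> CK k u -> CK k (fun t p q => / u t p q).
Proof.
  induction k as [|k IH]; intros u Hn Hu; [apply cont3_inv; assumption|].
  assert (Hu' := CK_pred _ _ Hu). destruct Hu as [Cu [ut [up [uq [Pu [A [B C]]]]]]].
  split; [apply cont3_inv; assumption|].
  assert (Hi : CK k (fun t p q => / u t p q)) by auto.
  exists (fun t p q => (- 1)*(ut t p q*(/ u t p q * / u t p q))),
   (fun t p q => (- 1)*(up t p q*(/ u t p q * / u t p q))),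
   (fun t p q => (- 1)*(uq t p q*(/ u t p q * / u t p q))).
  split; [|split; [|split]; apply CK_mult; try apply CK_const; apply CK_mult; try assumption;
           apply (CK_mult k (fun t p q => / u t p q) (fun t p q => / u t p q)); assumption].
  assert (Hd : forall (f : R -> R) x l, is_derive f x l -> f x <> 0 ->
            is_derive (fun s => / f s) x (- 1*(l*(/ f x * / f x)))).
  { intros f x l Hf Hx. auto_derive.
    - split; [exists l; exact Hf|auto].
    - rewrite (Dv _ _ _ Hf). field. exact Hx. }
  intros t p q. destruct (Pu t p q) as [h1 [h2 h3]].
  split; [apply (Hd (fun s => u s p q))|split; [apply (Hd (fun s => u t s q))|auto]];
  auto.
Qed.

Lemma smooth_const (c : R) : smooth (fun _ _ _ => c).
Proof. intros k; apply CK_const. Qed.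
Lemma smooth_plus (u v : Ham3) : smooth u -> smooth v -> smooth (fun t p q => u t p q + v t p q).
Proof. intros Hu Hv k; apply CK_plus; auto. Qed.
Lemma smooth_mult (u v : Ham3) : smooth u -> smooth v -> smooth (fun t p q => u t p q*v t p q).
Proof. intros Hu Hv k; apply CK_mult; auto. Qed.
Lemma smooth_comp (G a b c : Ham3) : smooth G -> smooth a -> smooth b -> smooth c ->
  smooth (fun t p q => G (a t p q) (b t p q) (c t p q)).
Proof. intros HG Ha Hb Hc k; apply CK_comp; auto. Qed.
Lemma smooth_inv (u : Ham3) : (forall t p q, u t p q <> 0) -> smooth u -> smooth (fun t p q => / u t p q).
Proof. intros Hn Hu k; apply CK_inv; auto. Qed.
Lemma smooth_t : smooth (fun t _ _ => t). Proof. intros k; apply CK_t. Qed.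
Lemma smooth_p : smooth (fun _ p _ => p). Proof. intros k; apply CK_p. Qed.
Lemma smooth_q : smooth (fun _ _ q => q). Proof. intros k; apply CK_q. Qed.
Lemma smooth_opp (u : Ham3) : smooth u -> smooth (fun t p q => - u t p q).
Proof.
  intros Hu. assert (H := smooth_mult _ _ (smooth_const (- 1)) Hu).
  replace (fun t p q => - u t p q) with (fun t p q => - 1*u t p q); [exact H|].
  do 3 ext. ring.
Qed.
Lemma smooth_minus (u v : Ham3) : smooth u -> smooth v -> smooth (fun t p q => u t p q - v t p q).
Proof. intros Hu Hv. apply (smooth_plus u (fun t p q => - v t p q)); [pos|apply smooth_opp; exact Hv]. Qed.

Lemma partials_unique (u ut up uq : Ham3) : has_partials u ut up uq ->
  partial 0 u = ut /\ partial 1 u = up /\ partial 2 u = uq.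
Proof.
  intros H. split; [|split]; do 3 ext;
  apply is_derive_unique; apply H.
Qed.

Lemma CK_partials (k : nat) (u : Ham3) : CK (S k) u ->
  has_partials u (partial 0 u) (partial 1 u) (partial 2 u) /\ forall i, CK k (partial i u).
Proof.
  intros [_ [ut [up [uq [P [A [B C]]]]]]]. destruct (partials_unique _ _ _ _ P) as [<- [<- <-]].
  split; [exact P|]. intros [|[|i]]; assumption.
Qed.

Lemma smooth_partials (u : Ham3) : smooth u ->
  has_partials u (partial 0 u) (partial 1 u) (partial 2 u) /\ forall i, smooth (partial i u).
Proof. intros H. split; [apply (CK_partials 0 u (H 1%nat))|]. intros i k. apply (CK_partials k u (H (S k))). Qed.

Lemma smooth3_smooth (u : Ham3) : smooth3 u <-> smooth u.
Proof.
  split.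
  - intros H k. assert (G : forall k l, CK k (dpart l u)).
    { clear k. induction k as [|k IH]; intros l.
      - intros x. apply (proj2 (H l) x).
      - split; [intros x; apply (proj2 (H l) x)|].
        exists (dpart (0%nat :: l) u), (dpart (1%nat :: l) u), (dpart (2%nat :: l) u).
        split; [|auto]. intros t p q. destruct (H l) as [H1 _].
        split; [|split]; apply Derive_correct.
        + apply (H1 0%nat t p q). lia.
        + apply (H1 1%nat t p q). lia.
        + apply (H1 2%nat t p q). lia. }
    apply (G k nil).
  - intros H l. assert (Hl : smooth (dpart l u)).
    { induction l as [|i l IH]; [exact H|]. apply (smooth_partials _ IH). }
    split.
    + intros i t p q Hi. destruct (smooth_partials _ Hl) as [P _]. destruct (P t p q) as [A [B C]].
      destruct i as [|[|i]]; eexists; eassumption.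
    + exact (Hl O).
Qed.

Lemma is_derive_near (f g : R -> R) (x l r : R) : 0 < r ->
  (forall y, Rabs (y - x) < r -> f y = g y) -> is_derive g x l -> is_derive f x l.
Proof.
  intros Hr H Hg. apply (is_derive_ext_loc g); [|pos].
  exists (mkposreal r Hr). intros y Hy. symmetry. auto.
Qed.

(** Needed for functions glued from pieces: the cut-off branch of q in the upper bound and the
    plateau in the lower bound are described by different smooth formulas near different points. *)
Lemma smooth_local (u : Ham3) :
  (forall t p q, exists r v, 0 < r /\ smooth v /\ forall t' p' q',
     Rabs (t' - t) < r -> Rabs (p' - p) < r -> Rabs (q' - q) < r -> u t' p' q' = v t' p' q') ->
  smooth u.
Proof.
  intros H k. revert u H. induction k as [|k IH]; intros u H.
  - apply eps_cont3. intros t p q eps He. destruct (H t p q) as [r [v [Hr [Sv Hv]]]].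
    destruct (cont3_eps v (Sv O) t p q eps He) as [d [Hd Hc]].
    exists (Rmin r d). split; [pos|]. intros t' p' q' h1 h2 h3.
    assert (m1 := Rmin_l r d). assert (m2 := Rmin_r r d).
    assert (Z : forall w, Rabs (w - w) < r).
    { intros w. rabs. }
    rewrite (Hv t' p' q'), (Hv t p q) by rabs. apply Hc; lra.
  - assert (Hh : has_partials u (partial 0 u) (partial 1 u) (partial 2 u) /\
       forall i t p q, exists r v, 0 < r /\ smooth v /\ forall t' p' q',
     Rabs (t' - t) < r -> Rabs (p' - p) < r -> Rabs (q' - q) < r -> partial i u t' p' q' = v t' p' q').
    { assert (Hl : forall t p q, exists r v, 0 < r /\ smooth v /\ forall t' p' q',
          Rabs (t' - t) < r -> Rabs (p' - p) < r -> Rabs (q' - q) < r ->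
          is_derive (fun s => u s p' q') t' (partial 0 v t' p' q') /\
          is_derive (fun s => u t' s q') p' (partial 1 v t' p' q') /\
          is_derive (fun s => u t' p' s) q' (partial 2 v t' p' q')).
      { intros t p q. destruct (H t p q) as [r [v [Hr [Sv Hv]]]].
        exists (r/2), v. split; [lra|]. split; [pos|]. intros t' p' q' h1 h2 h3.
        destruct (smooth_partials v Sv) as [P _]. destruct (P t' p' q') as [A [B C]].
        assert (Tr : forall x y z, Rabs (y - x) < r/2 -> Rabs (z - y) < r/2 -> Rabs (z - x) < r).
        { intros x y z g1 g2. rabs. }
        split; [|split]; (eapply (is_derive_near _ _ _ _ (r/2)); [lra| |eassumption]);
        intros y Hy; apply Hv; try lra; (eapply Tr; [|exact Hy]; assumption). }
      split.
      - intros t p q. destruct (Hl t p q) as [r [v [Hr [Sv Hv]]]].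
        assert (Z : forall w, Rabs (w - w) < r).
        { intros w. rabs. }
        destruct (Hv t p q (Z t) (Z p) (Z q)) as [A [B C]].
        split; [|split]; apply Derive_correct; eexists; eassumption.
      - intros i t p q. destruct (Hl t p q) as [r [v [Hr [Sv Hv]]]].
        exists r, (partial i v). split; [lra|]. split; [apply (smooth_partials v Sv)|].
        intros t' p' q' h1 h2 h3. destruct (Hv t' p' q' h1 h2 h3) as [A [B C]].
        destruct i as [|[|i]]; apply is_derive_unique; assumption. }
    destruct Hh as [P Hi]. split.
    + apply eps_cont3. intros t p q eps He. destruct (H t p q) as [r [v [Hr [Sv Hv]]]].
      destruct (cont3_eps v (Sv O) t p q eps He) as [d [Hd Hc]].
      exists (Rmin r d). split; [pos|]. intros t' p' q' h1 h2 h3.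
      assert (m1 := Rmin_l r d). assert (m2 := Rmin_r r d).
      rewrite (Hv t' p' q'), (Hv t p q) by rabs. apply Hc; lra.
    + exists (partial 0 u), (partial 1 u), (partial 2 u). auto.
Qed.

(** * Flat functions and smooth cutoffs *)

Lemma pow_le_exp (m : nat) (y : R) : 0 <= y -> y ^ m <= INR (fact m)*exp y.
Proof.
  revert y. induction m as [|m IH]; intros y Hy.
  - simpl. assert (h := exp_ineq1_le y). lra.
  - set (g := fun s => INR (fact (S m))*exp s - s ^ S m).
    destruct (mvt g (fun s => INR (fact (S m))*exp s - INR (S m)*s ^ m) 0 y) as [c [Hc Hg]].
    + intros x _. unfold g. auto_derive; [trivial|].
      change (INR (fact m + m*fact m)) with (INR (fact (S m))).
      change (match m with O => 1 | S _ => INR m + 1 end) with (INR (S m)). ring.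
    + rewrite Rmin_left, Rmax_right in Hc by lra.
      assert (H : 0 <= INR (fact (S m))*exp c - INR (S m)*c ^ m).
      { change (fact (S m)) with (S m*fact m)%nat. rewrite mult_INR.
        assert (h := IH c (proj1 Hc)). assert (h' := pos_INR (S m)). nra. }
      assert (g0 : g 0 = INR (fact (S m))).
      { unfold g. rewrite exp_0. simpl pow. ring. }
      assert (h := lt_0_INR _ (lt_O_fact (S m))). unfold g in Hg, g0.
      nra.
Qed.

(* The derivatives of exp(-1/x) extended by 0 stay in the span of this family. *)
Definition flat (n : nat) (x : R) : R := if Rlt_dec 0 x then (/ x) ^ n*exp (- / x) else 0.

Lemma flat_neg (n : nat) (x : R) : x <= 0 -> flat n x = 0.
Proof. intros H. unfold flat. destruct (Rlt_dec 0 x); lra. Qed.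
Lemma flat_pos_eq (n : nat) (x : R) : 0 < x -> flat n x = (/ x) ^ n*exp (- / x).
Proof. intros H. unfold flat. destruct (Rlt_dec 0 x); lra. Qed.
Lemma flat_nonneg (n : nat) (x : R) : 0 <= flat n x.
Proof.
  unfold flat. destruct (Rlt_dec 0 x) as [h|h]; [|lra].
  apply Rmult_le_pos; [apply pow_le; left; apply Rinv_0_lt_compat; exact h|left; apply exp_pos].
Qed.
Lemma flat_gt0 (x : R) : 0 < x -> 0 < flat 0 x.
Proof. intros h. rewrite flat_pos_eq by exact h. pos. Qed.

Lemma flat_le (n : nat) (x : R) : 0 < x -> flat n x <= INR (fact (S n))*x.
Proof.
  intros h. rewrite flat_pos_eq by exact h.
  assert (hx := Rinv_0_lt_compat x h). assert (H := pow_le_exp (S n) (/ x) (Rlt_le _ _ hx)).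
  rewrite exp_Ropp.
  apply (Rmult_le_reg_r (exp (/ x))); [pos|].
  rewrite Rmult_assoc, Rinv_l by (apply Rgt_not_eq, exp_pos). rewrite Rmult_1_r.
  apply (Rmult_le_reg_l (/ x)); [lra|].
  replace (/ x*(INR (fact (S n))*x*exp (/ x))) with (INR (fact (S n))*exp (/ x)) by (field; lra).
  exact H.
Qed.

Lemma flat_derive (n : nat) (x : R) :
  is_derive (flat n) x (flat (S (S n)) x - INR n*flat (S n) x).
Proof.
  destruct (Rtotal_order x 0) as [h|[h|h]].
  - rewrite !flat_neg by lra. replace (0 - INR n*0) with 0 by ring.
    apply (is_derive_near _ (fun _ => 0) _ _ (- x)); [lra| |apply @is_derive_const].
    intros y Hy. abs Hy. apply flat_neg. lra.
  - subst x. rewrite !flat_neg by lra. replace (0 - INR n*0) with 0 by ring.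
    apply slope_derive. intros eps He.
    set (C := INR (fact (S (S n)))). assert (HC : 0 < C) by apply lt_0_INR, lt_O_fact.
    exists (eps/C). split; [pos|]. intros y Hy. rewrite Rminus_0_r in Hy.
    exists (flat (S n) y). destruct (Rlt_dec 0 y) as [hy|hy].
    + split.
      * rewrite (flat_neg n 0) by lra. rewrite !flat_pos_eq by exact hy. simpl. field. lra.
      * rewrite Rminus_0_r, Rabs_pos_eq by apply flat_nonneg.
        eapply Rle_lt_trans; [apply flat_le; exact hy|]. fold C.
        rewrite Rabs_pos_eq in Hy by lra. apply (Rmult_lt_reg_r (/ C)); [pos|].
        replace (C*y * / C) with y by (field; lra). exact Hy.
    + rewrite !flat_neg by lra. split; [ring|]. rewrite Rminus_0_r, Rabs_R0. exact He.
  - rewrite !flat_pos_eq by exact h.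
    apply (is_derive_near _ (fun y => (/ y) ^ n*exp (- / y)) _ _ x); [exact h| |].
    + intros y Hy. abs Hy. apply flat_pos_eq. lra.
    + auto_derive; [lra|].
      destruct n as [|n]; [simpl; field; lra|]. simpl pred. rewrite <- !tech_pow_Rmult. field. lra.
Qed.

Lemma flat_CK (k : nat) : forall n, CK k (fun t _ _ => flat n t).
Proof.
  induction k as [|k IH]; intros n.
  - intros x. apply (continuous_comp (fun y : R * R * R => fst (fst y)) (flat n)).
    + apply (cont3_t x).
    + apply (is_derive_cont _ _ _ (flat_derive n _)).
  - split.
    + intros x. apply (continuous_comp (fun y : R * R * R => fst (fst y)) (flat n)).
      * apply (cont3_t x).
      * apply (is_derive_cont _ _ _ (flat_derive n _)).
    + exists (fun t _ _ => flat (S (S n)) t + (- INR n)*flat (S n) t), (fun _ _ _ => 0), (fun _ _ _ => 0).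
      split; [|split; [|split; apply CK_const]].
      * intros t p q. split; [|split; apply @is_derive_const].
        replace (flat (S (S n)) t + - INR n*flat (S n) t) with (flat (S (S n)) t - INR n*flat (S n) t) by ring.
        apply flat_derive.
      * apply (CK_plus k (fun t _ _ => flat (S (S n)) t)); [apply IH|].
        apply (CK_mult k (fun _ _ _ => - INR n)); [apply CK_const|apply IH].
Qed.

Definition smooth1 (f : R -> R) : Prop := smooth (fun t _ _ => f t).

Lemma smooth1_comp (f : R -> R) (u : Ham3) : smooth1 f -> smooth u -> smooth (fun t p q => f (u t p q)).
Proof.
  intros Hf Hu. apply (smooth_comp (fun t _ _ => f t) u (fun _ _ _ => 0) (fun _ _ _ => 0)); auto using smooth_const.
Qed.

Lemma smooth1_derive (f : R -> R) : smooth1 f -> smooth1 (Derive f) /\ forall x, is_derive f x (Derive f x).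
Proof.
  intros H. destruct (smooth_partials _ H) as [P S]. split; [apply (S O)|].
  intros x. apply Derive_correct. exists (partial 0 (fun t _ _ => f t) x 0 0). apply (P x 0 0).
Qed.

Definition step (a b x : R) : R := flat 0 (x - a)/(flat 0 (x - a) + flat 0 (b - x)).

Lemma step_den (a b x : R) : a < b -> 0 < flat 0 (x - a) + flat 0 (b - x).
Proof.
  intros h. assert (h1 := flat_nonneg 0 (x - a)). assert (h2 := flat_nonneg 0 (b - x)).
  destruct (Rlt_dec a x) as [hx|hx].
  - assert (0 < flat 0 (x - a)) by (apply flat_gt0; lra). lra.
  - assert (0 < flat 0 (b - x)) by (apply flat_gt0; lra). lra.
Qed.

Lemma step_smooth (a b : R) : a < b -> smooth1 (step a b).
Proof.
  intros h. assert (F : smooth1 (flat 0)) by (intros k; apply flat_CK).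
  assert (S1 : smooth (fun t _ _ => flat 0 (t - a))).
  { apply (smooth1_comp (flat 0) (fun t _ _ => t - a) F). apply (smooth_minus (fun t _ _ => t)); [apply smooth_t|apply smooth_const]. }
  assert (S2 : smooth (fun t _ _ => flat 0 (b - t))).
  { apply (smooth1_comp (flat 0) (fun t _ _ => b - t) F). apply (smooth_minus (fun _ _ _ => b)); [apply smooth_const|apply smooth_t]. }
  apply (smooth_mult (fun t _ _ => flat 0 (t - a)) (fun t _ _ => / (flat 0 (t - a) + flat 0 (b - t)))); [pos|].
  apply (smooth_inv (fun t _ _ => flat 0 (t - a) + flat 0 (b - t))).
  - intros t _ _. apply Rgt_not_eq, step_den, h.
  - apply (smooth_plus (fun t _ _ => flat 0 (t - a))); assumption.
Qed.

Lemma step_0 (a b x : R) : x <= a -> step a b x = 0.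
Proof. intros h. unfold step. rewrite (flat_neg 0 (x - a)) by lra. lra. Qed.
Lemma step_1 (a b x : R) : a < b -> b <= x -> step a b x = 1.
Proof.
  intros h hx. unfold step. rewrite (flat_neg 0 (b - x)) by lra. rewrite Rplus_0_r.
  apply Rinv_r. apply Rgt_not_eq, flat_gt0. lra.
Qed.
Lemma step_range (a b x : R) : a < b -> 0 <= step a b x <= 1.
Proof.
  intros h. assert (hd := step_den a b x h). unfold step.
  assert (h1 := flat_nonneg 0 (x - a)). assert (h2 := flat_nonneg 0 (b - x)). split.
  - apply Rmult_le_pos; [lra|]. left. apply Rinv_0_lt_compat. exact hd.
  - apply (Rmult_le_reg_r (flat 0 (x - a) + flat 0 (b - x))); [lra|].
    unfold Rdiv. rewrite Rmult_assoc, Rinv_l by lra. lra.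
Qed.

Lemma locally_const_derive0 (f : R -> R) (a b c x : R) :
  (forall y, a < y < b -> f y = c) -> a < x < b -> is_derive f x 0.
Proof.
  intros H Hx. apply (is_derive_near _ (fun _ => c) _ _ (Rmin (x - a) (b - x))).
  - apply Rmin_pos; lra.
  - intros y Hy. rmin Hy [H1 H2].
    abs H1. abs H2. apply H. lra.
  - apply @is_derive_const.
Qed.

(** * Ordinary differential equations *)

Lemma cont_bounded (f : R -> R) (a b : R) : (forall x, continuous f x) ->
  exists M, 0 < M /\ forall x, a <= x <= b -> Rabs (f x) <= M.
Proof.
  (* The bound is written as / r to make it monotone in r, which is the form that [compact_unif]
     accepts. *)
  intros H. destruct (compact_unif a b (fun x r => Rabs (f x) <= / r)) as [r [Hr Hb]].
  - intros x r r' Hx Hr. eapply Rle_trans; [exact Hx|]. apply Rinv_le_contravar; lra.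
  - intros x _. destruct (continuous_eps f x 1 (H x) Rlt_0_1) as [d [Hd Hy]].
    destruct (Rabs_le_inv_trick (f x) d Hd) as [r [Hr Hi]]. exists r. split; [lra|]. intros y h. apply Hi, Hy. lra.
  - exists (/ r). split; [pos|pos].
Qed.

Lemma bool_unif (P : bool -> R -> Prop) : (forall i d d', P i d -> 0 < d' <= d -> P i d') ->
  (forall i, exists d, 0 < d /\ P i d) -> exists d, 0 < d /\ forall i, P i d.
Proof.
  intros Hm H. destruct (H true) as [d [Hd h]]. destruct (H false) as [e [He k]]. exists (Rmin d e).
  assert (h1 := Rmin_l d e). assert (h2 := Rmin_r d e). assert (h3 := Rmin_pos d e Hd He).
  split; [lra|]. intros [|]; [apply (Hm _ d)|apply (Hm _ e)]; auto.
Qed.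

Lemma bool_bound (P : bool -> R -> Prop) : (forall i M M', P i M -> M <= M' -> P i M') ->
  (forall i, exists M, 0 < M /\ P i M) -> exists M, 0 < M /\ forall i, P i M.
Proof.
  intros Hm H. destruct (H true) as [M [HM h]]. destruct (H false) as [N [HN k]]. exists (M + N).
  split; [lra|]. intros [|]; [apply (Hm _ M)|apply (Hm _ N)]; auto; lra.
Qed.

Lemma signed (t : R) : exists e, (e = 1 \/ e = -1) /\ t = e*Rabs t.
Proof. unfold Rabs. destruct (Rcase_abs t); [exists (-1)|exists 1]; split; auto; ring. Qed.

Lemma exp_mono (x y : R) : x <= y -> exp x <= exp y.
Proof. intros H. destruct (Rle_lt_or_eq_dec x y H) as [h| ->]; [left; apply exp_increasing; exact h|lra]. Qed.

(** The exponential is the integrating factor for the squared norm, and 1 + T pays for the source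
    eps^2 accumulated up to time T. Since the whole is at least 1, it may stand for its own square
    root. *)
Definition gron (L T : R) : R := (1 + T)*exp ((4*L + 2)*T).

(* The squared norm [N] satisfies [|N'| <= (4L+2) N + eps^2]. *)
Lemma gronwall (d : bool -> R -> R) (L T eps : R) : 0 <= L -> 0 <= eps -> 0 <= T ->
  (forall i t, Rabs t <= T -> exists e, is_derive (d i) t e /\ Rabs e <= L*(Rabs (d true t) + Rabs (d false t)) + eps) ->
  forall i t, Rabs t <= T -> Rabs (d i t) <= gron L T*(Rabs (d true 0) + Rabs (d false 0) + eps).
Proof.
  (* Negative times are reduced to positive ones by following s -> sg*s for s in [0, |t|]. *)
  intros HL He HT H i t Ht. destruct (signed t) as [sg [Hsg Et]]. set (r := Rabs t) in *. assert (Hr : 0 <= r) by apply Rabs_pos.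
  set (a := 4*L + 2). set (N := fun s => d true s*d true s + d false s*d false s).
  set (dN := fun s => 2*(d true s*Derive (d true) s + d false s*Derive (d false) s)).
  assert (HN : forall s, Rabs s <= T -> is_derive N s (dN s) /\ sg*dN s <= a*N s + eps*eps).
  { intros s Hs. destruct (H true s Hs) as [e1 [D1 B1]]. destruct (H false s Hs) as [e2 [D2 B2]].
    unfold N, dN. rewrite (is_derive_unique _ _ _ D1), (is_derive_unique _ _ _ D2). split.
    - auto_derive; [repeat split; first [exists e1; exact D1|exists e2; exact D2]|].
      change (Derive (fun x => d true x) s) with (Derive (d true) s). change (Derive (fun x => d false x) s) with (Derive (d false) s).
      rewrite (is_derive_unique _ _ _ D1), (is_derive_unique _ _ _ D2). ring.
    - set (x := d true s) in *. set (y := d false s) in *.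
      assert (M1 : forall u v w, Rabs v <= w -> sg*(u*v) <= Rabs u*w).
      { intros u v w h. apply Rle_trans with (Rabs u*Rabs v); [|pos].
        rewrite <- Rabs_mult. assert (h' := Rabs_le_between' (u*v) 0 (Rabs (u*v))). rewrite Rminus_0_r in h'.
        nra. }
      assert (m1 := M1 x e1 _ B1). assert (m2 := M1 y e2 _ B2). rewrite (Rabs_sqr x), (Rabs_sqr y). unfold a.
      set (X := Rabs x) in *. set (Y := Rabs y) in *.
      assert (q1 := sqr_ge0 (X + Y - eps)). assert (q2 := sqr_ge0 (X - Y)). nra. }
  assert (Hst : forall s, 0 <= s <= r -> Rabs (sg*s) <= T).
  { intros s Hs. rewrite Rabs_mult, (Rabs_pos_eq s) by lra. destruct Hsg as [-> | ->]; unfold Rabs; destruct Rcase_abs; lra. }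
  (* By the differential inequality and exp (- (a*s)) <= 1, this function has nonpositive
     derivative. *)
  destruct (mvt (fun s => N (sg*s)*exp (- (a*s)) - eps*eps*s)
    (fun s => sg*dN (sg*s)*exp (- (a*s)) + N (sg*s)*(- a*exp (- (a*s))) - eps*eps) 0 r) as [x [Hx Hm]].
  { intros x Hx. rewrite Rmin_left, Rmax_right in Hx by lra. destruct (HN _ (Hst x Hx)) as [D _].
    auto_derive; [exists (dN (sg*x)); exact D|]. change (Derive (fun x => N x) (sg*x)) with (Derive N (sg*x)).
    rewrite (is_derive_unique _ _ _ D). ring. }
  rewrite Rmin_left, Rmax_right in Hx by lra. destruct (HN _ (Hst x Hx)) as [_ B].
  assert (E1 : exp (- (a*x)) <= 1). { rewrite <- exp_0. apply exp_mono. assert (0 <= a*x) by pos. lra. }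
  assert (E0 := exp_pos (- (a*x))). set (E := exp (- (a*x))) in *.
  assert (C1 : N (sg*r)*exp (- (a*r)) <= N 0 + eps*eps*r).
  { rewrite !Rmult_0_r, Ropp_0, exp_0 in Hm.
    assert ((sg*dN (sg*x) - a*N (sg*x) - eps*eps)*E <= 0*E) by pos.
    assert (eps*eps*E <= eps*eps*1) by pos.
    nra. }
  rewrite <- Et in C1. set (D0 := Rabs (d true 0) + Rabs (d false 0) + eps).
  assert (h1 := Rabs_pos (d true 0)). assert (h2 := Rabs_pos (d false 0)).
  assert (C2 : N t <= (1 + T)*(D0*D0)*exp (a*T)).
  { apply Rle_trans with ((1 + T)*(D0*D0)*exp (a*r)).
    2:{ apply Rmult_le_compat_l; [pos|]. apply exp_mono, Rmult_le_compat_l; [pos|lra]. }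
    replace (N t) with (N t*exp (- (a*r))*exp (a*r))
      by (rewrite Rmult_assoc, <- exp_plus; replace (- (a*r) + a*r) with 0 by ring; rewrite exp_0; ring).
    apply Rmult_le_compat_r; [left; apply exp_pos|]. eapply Rle_trans; [exact C1|]. unfold N, D0.
    rewrite (Rabs_sqr (d true 0)), (Rabs_sqr (d false 0)). set (X := Rabs (d true 0)) in *. set (Y := Rabs (d false 0)) in *.
    assert (eps*eps*r <= eps*eps*T) by pos.
    assert (X*X + Y*Y <= (X + Y + eps)*(X + Y + eps)) by nra.
    assert (eps*eps*T <= (X + Y + eps)*(X + Y + eps)*T) by pos. lra. }
  assert (E2 : 1 <= exp (a*T)). { rewrite <- exp_0. apply exp_mono, Rmult_le_pos; unfold a; lra. }
  assert (K1 : 1 <= gron L T) by (unfold gron; fold a; nra).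
  replace ((1 + T)*(D0*D0)*exp (a*T)) with (gron L T*(D0*D0)) in C2 by (unfold gron, a; ring).
  rewrite <- (Rabs_pos_eq (gron L T*D0)) by pos.
  apply Rsqr_le_abs_0. unfold Rsqr. assert (hi : d i t*d i t <= N t).
  { unfold N. assert (q1 := sqr_ge0 (d true t)). assert (q2 := sqr_ge0 (d false t)). destruct i; lra. }
  nra.
Qed.

(** Integration in the norm weighted by exp (a |t|) gains a factor 1/a. A large a thus makes the
    Picard map a contraction on all of [-T, T], without subdividing the interval. *)
Lemma exp_growth (u du : R -> R) (A a T : R) : 0 < a -> 0 <= A -> u 0 = 0 ->
  (forall t, Rabs t <= T -> is_derive u t (du t) /\ Rabs (du t) <= A*exp (a*Rabs t)) ->
  forall t, Rabs t <= T -> Rabs (u t) <= A/a*exp (a*Rabs t).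
Proof.
  intros Ha HA H0 H t Ht. destruct (signed t) as [sg [Hsg Et]]. set (r := Rabs t) in *. assert (Hr : 0 <= r) by apply Rabs_pos.
  assert (Hst : forall s, 0 <= s -> Rabs (sg*s) = s).
  { intros s Hs. rewrite Rabs_mult, (Rabs_pos_eq s) by lra. destruct Hsg as [-> | ->]; unfold Rabs; destruct Rcase_abs; lra. }
  assert (P : forall e, e = 1 \/ e = -1 -> e*u t <= A/a*exp (a*r)).
  { intros e He. destruct (mvt (fun s => e*u (sg*s) - A/a*exp (a*s)) (fun s => e*(sg*du (sg*s)) - A*exp (a*s)) 0 r) as [c [Hc Hm]].
    - intros x Hx. rewrite Rmin_left, Rmax_right in Hx by lra. destruct (H (sg*x)) as [D _]; [rewrite Hst; lra|].
      auto_derive; [exists (du (sg*x)); exact D|]. change (Derive (fun x => u x) (sg*x)) with (Derive u (sg*x)).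
      rewrite (is_derive_unique _ _ _ D). field. lra.
    - rewrite Rmin_left, Rmax_right in Hc by lra. destruct (H (sg*c)) as [_ B]; [rewrite Hst; lra|]. rewrite Hst in B by lra.
      rewrite <- Et, !Rmult_0_r, H0, exp_0 in Hm. abs B.
      assert (0 <= (A*exp (a*c) - e*(sg*du (sg*c)))*r) by (apply Rmult_le_pos; [destruct He as [-> | ->], Hsg as [-> | ->]; lra|lra]).
      assert (0 <= A/a) by pos. lra. }
  assert (h1 := P 1 (or_introl eq_refl)). assert (h2 := P (-1) (or_intror eq_refl)). rabs.
Qed.

Lemma half_pow_pos (n : nat) : 0 < (/ 2) ^ n.
Proof. apply pow_lt. lra. Qed.

Lemma half_pow_small (K eps : R) : 0 < eps -> exists n, K*(/ 2) ^ n < eps.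
Proof.
  intros He. assert (hk := Rabs_pos K). assert (hk' := Rle_abs K).
  destruct (pow_lt_1_zero (/ 2)) with (y := eps/(Rabs K + 1)) as [N HN]; [rabs|pos|].
  exists N. specialize (HN N (Nat.le_refl N)). assert (Hp := half_pow_pos N). rewrite Rabs_pos_eq in HN by lra.
  assert (eps = (Rabs K + 1)*(eps/(Rabs K + 1))) by (field; lra). nra.
Qed.

Lemma half_pow_zero (x K : R) : (forall n, Rabs x <= K*(/ 2) ^ n) -> x = 0.
Proof.
  intros H. apply NNPP. intros Hn. destruct (half_pow_small K (Rabs x)) as [n h]; [rabs|].
  specialize (H n). lra.
Qed.

Lemma geometric_cauchy (u : nat -> R) (K : R) : (forall n, Rabs (u (S n) - u n) <= K*(/ 2) ^ n) ->
  forall n, Rabs (u n - real (Lim_seq u)) <= 2*K*(/ 2) ^ n.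
Proof.
  intros H.
  assert (H1 : forall n k, Rabs (u (k + n)%nat - u n) <= 2*K*(/ 2) ^ n - 2*K*(/ 2) ^ (k + n)).
  { intros n k. induction k as [|k IH]; simpl; [rabs|]. specialize (H (k + n)%nat).
    rabs. }
  assert (HK : 0 <= K). { assert (h := H O). rabs. }
  assert (H2 : forall n k, Rabs (u (k + n)%nat - u n) <= 2*K*(/ 2) ^ n).
  { intros n k. via H1. assert (h := half_pow_pos (k + n)). nra. }
  destruct (proj2 (ex_lim_seq_cauchy_corr u)) as [l Hl].
  { intros eps. destruct (half_pow_small (4*K) eps (cond_pos eps)) as [N HN]. exists N. intros n m Hn Hm.
    assert (a := H2 N (n - N)%nat). assert (b := H2 N (m - N)%nat). rewrite Nat.sub_add in a, b by assumption.
    rabs. }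
  intros n. rewrite (is_lim_seq_unique _ _ Hl). rewrite Rabs_minus_sym.
  apply (is_lim_seq_le (fun k => Rabs (u (k + n)%nat - u n)) (fun _ => 2*K*(/ 2) ^ n) (Rabs (l - u n)) (2*K*(/ 2) ^ n));
    [apply H2| |apply is_lim_seq_const].
  apply (is_lim_seq_abs _ (Finite (l - u n))). apply is_lim_seq_minus'; [apply (is_lim_seq_incr_n u n); exact Hl|apply is_lim_seq_const].
Qed.

Lemma primitive_derive (g : R -> R) : (forall s, continuous g s) -> forall t, is_derive (fun t => RInt g 0 t) t (g t).
Proof.
  intros Hg t. apply (is_derive_RInt g _ 0); [|apply Hg]. exists (mkposreal 1 Rlt_0_1). intros s _.
  apply (RInt_correct (V := R_CompleteNormedModule) g 0 s), (ex_RInt_continuous (V := R_CompleteNormedModule) g). auto.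
Qed.

Lemma is_derive_plus_const (f : R -> R) (c x l : R) : is_derive f x l -> is_derive (fun t => c + f t) x l.
Proof. intros H. auto_derive; [exists l; exact H|]. rewrite (Dv _ _ _ H). ring. Qed.

Lemma is_derive_minus_R (f g : R -> R) (x a b : R) : is_derive f x a -> is_derive g x b ->
  is_derive (fun t => f t - g t) x (a - b).
Proof. intros Hf Hg. apply @is_derive_minus; assumption. Qed.

Lemma cont3_curve (V : Ham3) (x y : R -> R) (t : R) : cont3 V -> continuous x t -> continuous y t ->
  continuous (fun s => V s (x s) (y s)) t.
Proof.
  intros HV Hx Hy. apply eps_continuous. intros eps He.
  destruct (cont3_eps V HV t (x t) (y t) eps He) as [d [Hd H]].
  destruct (continuous_eps x t d Hx Hd) as [d1 [Hd1 H1]]. destruct (continuous_eps y t d Hy Hd) as [d2 [Hd2 H2]].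
  exists (Rmin d (Rmin d1 d2)). split; [pos|].
  intros s Hs. rmin Hs [h1 Hs]. apply Rmin_lt_inv in Hs. destruct Hs. auto.
Qed.

(* Planar systems are indexed by [bool]: [true] is the p-component, [false] the q-component. *)
Definition along (V : bool -> Ham3) (x : bool -> R -> R) (i : bool) (t : R) : R := V i t (x true t) (x false t).
Definition solves (V : bool -> Ham3) (x : bool -> R -> R) : Prop := forall i t, is_derive (x i) t (along V x i t).
Definition lipODE (V : bool -> Ham3) : Prop := (forall i, cont3 (V i)) /\ forall T, exists L, 0 <= L /\
  forall i t p q p' q', Rabs t <= T -> Rabs (V i t p q - V i t p' q') <= L*(Rabs (p - p') + Rabs (q - q')).

Definition picard_map (V : bool -> Ham3) (c : bool -> R) (x : bool -> R -> R) (i : bool) (t : R) : R :=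
  c i + RInt (along V x i) 0 t.

Lemma picard_map_derive (V : bool -> Ham3) (c : bool -> R) (x : bool -> R -> R) : (forall i, cont3 (V i)) ->
  (forall i t, continuous (x i) t) -> forall i t, is_derive (picard_map V c x i) t (along V x i t).
Proof. intros CV Cx i t. apply is_derive_plus_const, primitive_derive. intros s. apply cont3_curve; auto. Qed.

Lemma picard_map_0 (V : bool -> Ham3) (c : bool -> R) (x : bool -> R -> R) (i : bool) : picard_map V c x i 0 = c i.
Proof. unfold picard_map. rewrite RInt_point. apply Rplus_0_r. Qed.

(** Picard iteration in the weighted norm. With a = 4L + 1 the factor 2L/a is below 1/2, so
    consecutive iterates differ by O(2^-n) on every [-T, T]; the limit is global because T is
    arbitrary. *)
Theorem ode_exists (V : bool -> Ham3) (c : bool -> R) : lipODE V -> exists x, (forall i, x i 0 = c i) /\ solves V x.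
Proof.
  intros [CV HL]. set (xn := fun n => Nat.iter n (picard_map V c) (fun i _ => c i)).
  assert (Hc : forall n i t, continuous (xn n i) t).
  { induction n as [|n IH]; intros i t; [apply continuous_const|]. eapply is_derive_cont, (picard_map_derive V c (xn n)); auto. }
  assert (Hd : forall n i t, is_derive (xn (S n) i) t (along V (xn n) i t)) by (intros n; apply picard_map_derive; auto).
  assert (H0 : forall n i, xn n i 0 = c i) by (intros [|n] i; [reflexivity|apply picard_map_0]).
  assert (HC : forall T, exists K, forall n i t, Rabs t <= T -> Rabs (xn (S n) i t - xn n i t) <= K*(/ 2) ^ n).
  { intros T. destruct (HL T) as [L [HL0 Hlip]]. set (a := 4*L + 1).
    destruct (bool_bound (fun i M => forall t, - T <= t <= T -> Rabs (xn 1%nat i t - xn O i t) <= M)) as [M [HM B]].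
    { intros i M M' h hM t Ht. specialize (h t Ht). lra. }
    { intros i. apply (cont_bounded (fun t => xn 1%nat i t - xn O i t)). intros t. apply (continuous_minus (xn 1%nat i) (xn O i)); apply Hc. }
    assert (Hind : forall n i t, Rabs t <= T -> Rabs (xn (S n) i t - xn n i t) <= M*(/ 2) ^ n*exp (a*Rabs t)).
    { induction n as [|n IH]; intros i t Ht.
      - specialize (B i t (proj1 (Rabs_le_between _ _) Ht)). rewrite Rmult_1_r.
        assert (h : exp 0 <= exp (a*Rabs t)) by (apply exp_mono, Rmult_le_pos; [pos|pos]). rewrite exp_0 in h. nra.
      - assert (Hp := half_pow_pos n). assert (Hm : 0 <= M*(/ 2) ^ n) by pos.
        apply Rle_trans with (L*(2*(M*(/ 2) ^ n))/a*exp (a*Rabs t)).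
        + apply (exp_growth (fun s => xn (S (S n)) i s - xn (S n) i s) (fun s => along V (xn (S n)) i s - along V (xn n) i s) _ _ T);
            [unfold a; lra|apply Rmult_le_pos; lra|rewrite !H0; ring| |exact Ht].
          intros s Hs. split; [apply is_derive_minus_R; apply Hd|]. eapply Rle_trans; [apply Hlip, Hs|].
          rewrite Rmult_assoc. apply Rmult_le_compat_l; [lra|]. assert (h1 := IH true s Hs). assert (h2 := IH false s Hs). lra.
        + apply Rmult_le_compat_r; [left; apply exp_pos|]. apply (Rmult_le_reg_r a); [pos|].
          unfold Rdiv. rewrite Rmult_assoc, Rinv_l by pos. simpl pow. pos. }
    exists (M*exp (a*T)). intros n i t Ht. eapply Rle_trans; [auto|]. assert (Hp := half_pow_pos n).
    replace (M*exp (a*T)*(/ 2) ^ n) with (M*(/ 2) ^ n*exp (a*T)) by ring.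
    apply Rmult_le_compat_l; [pos|]. apply exp_mono, Rmult_le_compat_l; [pos|lra]. }
  set (x := fun i t => real (Lim_seq (fun n => xn n i t))).
  assert (HU : forall T, exists K, 0 <= K /\ forall n i t, Rabs t <= T -> Rabs (xn n i t - x i t) <= K*(/ 2) ^ n).
  { intros T. destruct (HC T) as [K HK]. exists (Rabs (2*K)). split; [pos|]. intros n i t Ht.
    apply Rle_trans with (2*K*(/ 2) ^ n); [apply (geometric_cauchy (fun n => xn n i t)); intros m; apply HK, Ht|].
    apply Rmult_le_compat_r; [left; apply half_pow_pos|rabs]. }
  assert (Cx : forall i t, continuous (x i) t).
  { intros i t. apply eps_continuous. intros eps He. destruct (HU (Rabs t + 1)) as [K [HK Hn]].
    destruct (half_pow_small K (eps/3)) as [n Hs]; [lra|]. destruct (continuous_eps (xn n i) t (eps/3) (Hc n i t)) as [d [Hdp Hy]]; [lra|].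
    exists (Rmin 1 d). split; [pos|]. intros s Hst. rmin Hst [h1 h2].
    assert (h := Rabs_triang (s - t) t). replace (s - t + t) with s in h by ring.
    assert (a1 := Hn n i t ltac:(lra)). assert (a2 := Hn n i s ltac:(lra)). specialize (Hy s h2).
    rabs. }
  (* Both sides lie within a multiple of 2^-n of the iterate n + 1. *)
  assert (Fix : x = picard_map V c x).
  { do 2 ext. rename x0 into i. rename x1 into t.
    destruct (HL (Rabs t)) as [L [HL0 Hlip]]. destruct (HU (Rabs t)) as [K [HK Hn]].
    apply Rminus_diag_uniq, (half_pow_zero _ (K + L*(2*K)*Rabs t)). intros n. assert (Hp := half_pow_pos n).
    assert (b := mvt_bound (fun s => xn (S n) i s - picard_map V c x i s) (fun s => along V (xn n) i s - along V x i s) 0 t (L*(2*(K*(/ 2) ^ n)))).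
    cbv beta in b. rewrite H0, picard_map_0, Rminus_diag, !Rminus_0_r in b.
    assert (b1 := Hn (S n) i t (Rle_refl _)). simpl pow in b1. assert (0 <= K*(/ 2) ^ n) by pos.
    replace (x i t - picard_map V c x i t) with (- (xn (S n) i t - x i t) + (xn (S n) i t - picard_map V c x i t)) by ring.
    via Rabs_triang. rewrite Rabs_Ropp. enough (Rabs (xn (S n) i t - picard_map V c x i t) <= L*(2*(K*(/ 2) ^ n))*Rabs t) by lra.
    apply b. intros s Hs. apply between_dist in Hs. rewrite !Rminus_0_r in Hs.
    split; [apply is_derive_minus_R; [apply Hd|apply picard_map_derive; auto]|].
    eapply Rle_trans; [apply Hlip, Hs|]. apply Rmult_le_compat_l; [lra|].
    assert (h1 := Hn n true s Hs). assert (h2 := Hn n false s Hs). lra. }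
  exists x. split; intros i; [rewrite Fix; apply picard_map_0|]. intros t.
  assert (D := picard_map_derive V c x CV Cx i t). rewrite <- Fix in D. exact D.
Qed.

Lemma ode_dep (V : bool -> Ham3) : lipODE V -> forall T, 0 <= T -> exists C, 0 < C /\
  forall x x', solves V x -> solves V x' -> forall i t, Rabs t <= T ->
  Rabs (x i t - x' i t) <= C*(Rabs (x true 0 - x' true 0) + Rabs (x false 0 - x' false 0)).
Proof.
  intros [_ HL] T HT. destruct (HL T) as [L [HL0 Hlip]]. exists (gron L T). split; [pos|].
  intros x x' Hc Hc' i t Ht. assert (G := gronwall (fun i t => x i t - x' i t) L T 0 HL0 (Rle_refl 0) HT). rewrite Rplus_0_r in G.
  apply G; [|lra]. intros j s Hs. rewrite Rplus_0_r. eexists. split; [apply is_derive_minus_R; [apply Hc|apply Hc'] |apply Hlip, Hs].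
Qed.

(** * Hamiltonian flows *)

Lemma box3_unif (a b c d e f : R) (Q : R -> R -> R -> R -> Prop) :
  (forall x y z r r', Q x y z r -> 0 < r' <= r -> Q x y z r') ->
  (forall x y z, a <= x <= b -> c <= y <= d -> e <= z <= f -> exists r, 0 < r /\
     forall x' y' z', Rabs (x' - x) < r -> Rabs (y' - y) < r -> Rabs (z' - z) < r -> Q x' y' z' r) ->
  exists r, 0 < r /\ forall x y z, a <= x <= b -> c <= y <= d -> e <= z <= f -> Q x y z r.
Proof.
  intros Hm Hl.
  destruct (compact_unif a b (fun x r => forall y z, c <= y <= d -> e <= z <= f -> Q x y z r)) as [r [Hr H]].
  - intros x r r' Hx Hr y z Hy Hz. apply (Hm x y z r); auto.
  - intros x Hx.
    destruct (compact_unif c d (fun y r => forall x', Rabs (x' - x) < r -> forall z, e <= z <= f -> Q x' y z r)) as [r [Hr H]].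
    + intros y r r' Hy Hr x' Hx' z Hz. apply (Hm x' y z r); [|lra]. apply Hy; [lra|lra].
    + intros y Hy.
      destruct (compact_unif e f (fun z r => forall x' y', Rabs (x' - x) < r -> Rabs (y' - y) < r -> Q x' y' z r)) as [r [Hr H]].
      * intros z r r' Hz Hr x' y' Hx' Hy'. apply (Hm x' y' z r); [|lra]. apply Hz; lra.
      * intros z Hz. destruct (Hl x y z Hx Hy Hz) as [r [Hr H]]. exists r. split; [lra|]. auto.
      * exists r. split; [lra|]. auto.
    + exists r. split; [lra|]. auto.
  - exists r. auto.
Qed.

Lemma cont3_box_bounded (u : Ham3) (a b c d e f : R) : cont3 u ->
  exists M, 0 < M /\ forall t p q, a <= t <= b -> c <= p <= d -> e <= q <= f -> Rabs (u t p q) <= M.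
Proof.
  intros Hu. destruct (box3_unif a b c d e f (fun t p q r => Rabs (u t p q) <= / r)) as [r [Hr H]].
  - intros x y z r r' Hx Hr. eapply Rle_trans; [exact Hx|]. apply Rinv_le_contravar; lra.
  - intros t p q _ _ _. destruct (cont3_eps u Hu t p q 1 Rlt_0_1) as [r0 [Hr0 H0]].
    destruct (Rabs_le_inv_trick (u t p q) r0 Hr0) as [r [Hr H]].
    exists r. split; [lra|]. intros t' p' q' h1 h2 h3. apply H. apply H0; lra.
  - exists (/ r). split; [pos|exact H].
Qed.

Definition pc (u : Ham3) : Prop := q_periodic u /\ compact_supp u.

Lemma periodic_Z (g : R -> R) : (forall q, g (q + 1) = g q) -> forall n q, g (q + IZR n) = g q.
Proof.
  intros H. assert (Hn : forall n q, g (q + INR n) = g q).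
  { induction n as [|n IH]; intros q; [simpl; rewrite Rplus_0_r; reflexivity|].
    rewrite S_INR, <- Rplus_assoc, H. apply IH. }
  intros n q. destruct (Z_le_gt_dec 0 n) as [h|h].
  - rewrite <- (Z2Nat.id n h), <- INR_IZR_INZ. apply Hn.
  - replace n with (- Z.of_nat (Z.to_nat (- n)))%Z by (rewrite Z2Nat.id; lia).
    rewrite opp_IZR, <- INR_IZR_INZ. rewrite <- (Hn (Z.to_nat (- n)) (q + - INR (Z.to_nat (- n)))).
    f_equal. ring.
Qed.

Lemma floor_ex (q : R) : exists n : Z, 0 <= q - IZR n < 1.
Proof.
  exists (up q - 1)%Z. destruct (archimed q) as [h1 h2]. rewrite minus_IZR. lra.
Qed.

Lemma pc_bounded (u : Ham3) : cont3 u -> pc u -> forall T, exists M, 0 < M /\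
  forall t p q, Rabs t <= T -> Rabs (u t p q) <= M.
Proof.
  intros Hu [Hp [K HK]] T.
  destruct (cont3_box_bounded u (- T) T (- Rabs K) (Rabs K) 0 1 Hu) as [M [HM H]].
  exists M. split; [lra|]. intros t p q Ht.
  destruct (Rle_dec (Rabs p) (Rabs K)) as [h|h].
  - destruct (floor_ex q) as [n Hn].
    replace (u t p q) with (u t p (q - IZR n)).
    + apply H; [rabs|rabs|lra].
    + rewrite <- (periodic_Z (u t p) (Hp t p) n (q - IZR n)). f_equal. ring.
  - rewrite HK; [rabs|]. rabs.
Qed.

Lemma pc_partial (u : Ham3) (i : nat) : smooth u -> pc u -> pc (partial i u).
Proof.
  intros Su [Hp [K HK]]. destruct (smooth_partials u Su) as [P _]. split.
  - intros t p q. destruct (P t p q) as [A [B C]]. destruct (P t p (q + 1)) as [A' [B' C']].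
    destruct i as [|[|i]]; simpl.
    + f_equal. apply functional_extensionality. intros s. apply Hp.
    + f_equal. apply functional_extensionality. intros s. apply Hp.
    + change (partial 2 u t p (q + 1) = Derive (fun s => u t p s) q). symmetry. apply is_derive_unique.
      apply (is_derive_ext (fun s => u t p (s + 1))); [auto|].
      replace (partial 2 u t p (q + 1)) with (scal 1 (partial 2 u t p (q + 1)))
        by (unfold scal; simpl; unfold mult; simpl; ring).
      apply (is_derive_comp (fun s => u t p s) (fun s => s + 1)); [pos|].
      auto_derive; [trivial|ring].
  - exists (Rabs K). intros t p q h. assert (hK : K <= Rabs K) by apply Rle_abs.
    assert (Hz : forall y, Rabs (y - p) < Rabs p - Rabs K -> forall t q, u t y q = 0).
    { intros y Hy t' q'. apply HK. assert (h' := Rabs_triang_inv p (p - y)).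
      replace (p - (p - y)) with y in h' by ring. rewrite (Rabs_minus_sym p y) in h'. lra. }
    assert (Hz0 : forall t q, u t p q = 0) by (apply Hz; unfold Rminus at 1; rewrite Rplus_opp_r, Rabs_R0; lra).
    destruct i as [|[|i]]; simpl; apply is_derive_unique.
    + apply (is_derive_ext (fun _ => 0)); [auto|apply @is_derive_const].
    + apply (is_derive_near _ (fun _ => 0) _ _ (Rabs p - Rabs K)); [lra| |apply @is_derive_const].
      intros; apply Hz; assumption.
    + apply (is_derive_ext (fun _ => 0)); [auto|apply @is_derive_const].
Qed.

Lemma partials_lipschitz (u : Ham3) (t M p q p' q' : R) : smooth u ->
  (forall p q, Rabs (partial 1 u t p q) <= M) -> (forall p q, Rabs (partial 2 u t p q) <= M) ->
  Rabs (u t p q - u t p' q') <= M*(Rabs (p - p') + Rabs (q - q')).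
Proof.
  intros Su H1 H2. destruct (smooth_partials u Su) as [P _].
  replace (u t p q - u t p' q') with ((u t p q - u t p' q) + (u t p' q - u t p' q')) by ring.
  via Rabs_triang. rewrite Rmult_plus_distr_l. apply Rplus_le_compat.
  - apply (mvt_bound (fun s => u t s q) (fun s => partial 1 u t s q)). intros s _. split; [apply P|apply H1].
  - apply (mvt_bound (fun s => u t p' s) (fun s => partial 2 u t p' s)). intros s _. split; [apply P|apply H2].
Qed.

Lemma admissible_smooth (H : Ham3) : admissible H -> smooth H /\ pc H.
Proof. intros [A [B C]]. split; [apply smooth3_smooth; exact A|split; assumption]. Qed.

Lemma smooth_pc_lipschitz (u : Ham3) : smooth u -> pc u -> forall T, exists M, 0 < M /\
  forall t p q p' q', Rabs t <= T -> Rabs (u t p q - u t p' q') <= M*(Rabs (p - p') + Rabs (q - q')).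
Proof.
  intros Su Pu T. destruct (smooth_partials u Su) as [_ S].
  destruct (pc_bounded _ (S 1%nat O) (pc_partial u 1 Su Pu) T) as [M1 [h1 B1]].
  destruct (pc_bounded _ (S 2%nat O) (pc_partial u 2 Su Pu) T) as [M2 [h2 B2]].
  exists (M1 + M2). split; [lra|]. intros t p q p' q' Ht. apply partials_lipschitz; [pos| |]; intros.
  - eapply Rle_trans; [auto|lra].
  - eapply Rle_trans; [auto|lra].
Qed.

Definition sg1 (H : Ham3) : Ham3 := fun t p q => - partial 2 H t p q.
Definition sg2 (H : Ham3) : Ham3 := partial 1 H.
Definition sg (H : Ham3) (i : bool) : Ham3 := if i then sg1 H else sg2 H.

Lemma pc_opp (u : Ham3) : pc u -> pc (fun t p q => - u t p q).
Proof.
  intros [A [K B]]. split; [intros t p q; rewrite A; reflexivity|].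
  exists K. intros t p q h. rewrite B by exact h. ring.
Qed.

Lemma sg_smooth (H : Ham3) : admissible H -> (smooth (sg1 H) /\ pc (sg1 H)) /\ (smooth (sg2 H) /\ pc (sg2 H)).
Proof.
  intros A. destruct (admissible_smooth H A) as [S P]. destruct (smooth_partials H S) as [_ Sp].
  split; (split; [try apply smooth_opp; apply Sp|try apply pc_opp; apply pc_partial; assumption]).
Qed.

Lemma ham_lipODE (H : Ham3) : admissible H -> lipODE (sg H).
Proof.
  intros A. destruct (sg_smooth H A) as [S1 S2]. assert (S : forall i, smooth (sg H i) /\ pc (sg H i)) by (intros [|]; assumption).
  split; [intros i; apply (proj1 (S i) O)|]. intros T.
  destruct (bool_bound (fun i M => forall t p q p' q', Rabs t <= T -> Rabs (sg H i t p q - sg H i t p' q') <= M*(Rabs (p - p') + Rabs (q - q')))) as [M [HM B]].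
  - intros i M M' h hM t p q p' q' Ht. eapply Rle_trans; [apply h, Ht|]. apply Rmult_le_compat_r; [|lra].
    assert (h1 := Rabs_pos (p - p')). assert (h2 := Rabs_pos (q - q')). lra.
  - intros i. apply smooth_pc_lipschitz; apply S.
  - exists M. split; [lra|exact B].
Qed.

Definition ode_curve (V1 V2 : Ham3) (x y : R -> R) : Prop := forall t,
  is_derive x t (V1 t (x t) (y t)) /\ is_derive y t (V2 t (x t) (y t)).

Lemma ode_curve_solves (H : Ham3) (x y : R -> R) : ode_curve (sg1 H) (sg2 H) x y <-> solves (sg H) (fun i => if i then x else y).
Proof. split; [intros h [|] t; apply h|intros h t; split; [apply (h true)|apply (h false)]]. Qed.

Lemma is_derive_shift (f : R -> R) (c t l : R) : is_derive f (c + t) l -> is_derive (fun s => f (c + s)) t l.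
Proof.
  intros H. replace l with (scal 1 l) by (unfold scal; simpl; unfold mult; simpl; ring).
  apply (is_derive_comp f (fun s => c + s)); [exact H|]. auto_derive; [trivial|ring].
Qed.

Definition shift_time (c : R) (V : bool -> Ham3) (i : bool) : Ham3 := fun t p q => V i (c + t) p q.

Lemma lipODE_shift (V : bool -> Ham3) (c : R) : lipODE V -> lipODE (shift_time c V).
Proof.
  intros [CV HL]. split.
  - intros i. apply (cont3_comp (V i) (fun t _ _ => c + t)); auto using cont3_p, cont3_q.
    apply cont3_plus; [apply cont3_const|apply cont3_t].
  - intros T. destruct (HL (Rabs c + T)) as [L [h H]]. exists L. split; [exact h|].
    intros i t p q p' q' Ht. apply H. rabs.
Qed.

Lemma solves_shift (V : bool -> Ham3) (c : R) (x : bool -> R -> R) : solves V x -> solves (shift_time c V) (fun i t => x i (c + t)).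
Proof. intros h i t. apply is_derive_shift, h. Qed.

Lemma ode_unique (V : bool -> Ham3) (x x' : bool -> R -> R) (t0 : R) : lipODE V ->
  solves V x -> solves V x' -> (forall i, x i t0 = x' i t0) -> forall i t, x i t = x' i t.
Proof.
  intros HV Hc Hc' E i t.
  destruct (ode_dep _ (lipODE_shift V t0 HV) (Rabs (t - t0)) (Rabs_pos _)) as [C [HC H]].
  assert (G := H _ _ (solves_shift V t0 x Hc) (solves_shift V t0 x' Hc') i (t - t0) (Rle_refl _)). cbv beta in G.
  rewrite Rplus_0_r, !E, !Rminus_diag, Rabs_R0, Rplus_0_r, Rmult_0_r in G. replace (t0 + (t - t0)) with t in G by ring.
  rabs.
Qed.

Lemma flow_curve (H : Ham3) (f : isotopy) (x : R * R) : is_flow H f ->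
  ode_curve (sg1 H) (sg2 H) (fun t => fst (f t x)) (fun t => snd (f t x)).
Proof. intros Hf t. destruct (Hf x) as [_ Hd]. auto. Qed.

Lemma flow_0 (H : Ham3) (f : isotopy) (x : R * R) : is_flow H f -> f 0 x = x.
Proof. intros Hf. apply (Hf x). Qed.

Lemma flow_unique (H : Ham3) (f : isotopy) (x y : R -> R) (t0 : R) (z : R * R) : admissible H ->
  is_flow H f -> ode_curve (sg1 H) (sg2 H) x y -> f t0 z = (x t0, y t0) -> forall t, f t z = (x t, y t).
Proof.
  intros A Hf Hc E t.
  assert (U := ode_unique _ _ _ t0 (ham_lipODE H A) (proj1 (ode_curve_solves H _ _) (flow_curve H f z Hf)) (proj1 (ode_curve_solves H _ _) Hc)).
  assert (E' : forall i : bool, (if i then fun t => fst (f t z) else fun t => snd (f t z)) t0 = (if i then x else y) t0)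
    by (intros [|]; rewrite E; reflexivity).
  rewrite (surjective_pairing (f t z)). f_equal; [apply (U E' true)|apply (U E' false)].
Qed.

Lemma ham_flow_exists (H : Ham3) : admissible H -> exists f, is_flow H f.
Proof.
  intros A. assert (He := fun z : R * R => ode_exists (sg H) (fun i => if i then fst z else snd z) (ham_lipODE H A)).
  exists (fun t z => let x := proj1_sig (cid (He z)) in (x true t, x false t)).
  intros z. destruct (cid (He z)) as [x [h0 Hc]]. simpl.
  split; [rewrite !h0; symmetry; apply surjective_pairing|]. auto.
Qed.

(* Every point is reached at time t0 by a flow line: solve the equation backwards. *)
Lemma flow_surj (H : Ham3) (f : isotopy) (t0 : R) : admissible H -> is_flow H f ->
  forall y, exists x, f t0 x = y.
Proof.
  intros A Hf y.
  destruct (ode_exists (shift_time t0 (sg H)) (fun i => if i then fst y else snd y) (lipODE_shift _ t0 (ham_lipODE H A))) as [x [h0 Hc]].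
  assert (Hc' : ode_curve (sg1 H) (sg2 H) (fun t => x true (- t0 + t)) (fun t => x false (- t0 + t))).
  { intros t. assert (S := fun i => solves_shift _ (- t0) x Hc i t). unfold along, shift_time in S.
    assert (E : forall r : R, t0 + (- t0 + r) = r) by (intros; ring). setoid_rewrite E in S.
    auto. }
  exists (x true (- t0), x false (- t0)). rewrite (flow_unique H f _ _ 0 (x true (- t0), x false (- t0)) A Hf Hc').
  - replace (- t0 + t0) with 0 by ring. rewrite !h0. symmetry. apply surjective_pairing.
  - rewrite (flow_0 H f _ Hf), Rplus_0_r. reflexivity.
Qed.

Lemma flow_inj (H : Ham3) (f : isotopy) (t0 : R) (x y : R * R) : admissible H -> is_flow H f ->
  f t0 x = f t0 y -> x = y.
Proof.
  intros A Hf E.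
  assert (G := flow_unique H f (fun t => fst (f t y)) (fun t => snd (f t y)) t0 x A Hf (flow_curve H f y Hf)).
  rewrite <- (flow_0 H f x Hf), <- (flow_0 H f y Hf).
  rewrite G; [destruct (f 0 y); reflexivity|]. rewrite E. destruct (f t0 y); reflexivity.
Qed.

Lemma flow_lipschitz (H : Ham3) (f : isotopy) : admissible H -> is_flow H f ->
  forall T, 0 <= T -> exists C, 0 < C /\ forall t x y, Rabs t <= T ->
  Rabs (fst (f t x) - fst (f t y)) + Rabs (snd (f t x) - snd (f t y)) <=
  C*(Rabs (fst x - fst y) + Rabs (snd x - snd y)).
Proof.
  intros A Hf T HT. destruct (ode_dep _ (ham_lipODE H A) T HT) as [C [HC G]]. exists (2*C). split; [lra|].
  intros t x y Ht.
  assert (g := fun i => G _ _ (proj1 (ode_curve_solves H _ _) (flow_curve H f x Hf)) (proj1 (ode_curve_solves H _ _) (flow_curve H f y Hf)) i t Ht).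
  cbv beta iota in g. rewrite !(flow_0 H f _ Hf) in g. assert (g1 := g true). assert (g2 := g false). lra.
Qed.

Lemma flow_speed (H : Ham3) (f : isotopy) : admissible H -> is_flow H f ->
  forall T, exists M, 0 < M /\ forall t s x, Rabs t <= T -> Rabs s <= T ->
  Rabs (fst (f t x) - fst (f s x)) <= M*Rabs (t - s) /\ Rabs (snd (f t x) - snd (f s x)) <= M*Rabs (t - s).
Proof.
  intros A Hf T. destruct (sg_smooth H A) as [[S1 P1] [S2 P2]].
  destruct (pc_bounded _ (S1 O) P1 T) as [M1 [h1 B1]]. destruct (pc_bounded _ (S2 O) P2 T) as [M2 [h2 B2]].
  exists (M1 + M2). split; [lra|]. intros t s x Ht Hs.
  assert (Hb : forall r, Rmin s t <= r <= Rmax s t -> Rabs r <= T).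
  { intros r Hr. abs Ht. abs Hs. apply Rabs_le_between.
    revert Hr. unfold Rmin, Rmax. destruct (Rle_dec s t); lra. }
  assert (Fc := flow_curve H f x Hf). split.
  - apply (mvt_bound (fun t => fst (f t x)) (fun t => sg1 H t (fst (f t x)) (snd (f t x)))).
    intros r Hr. split; [apply Fc|]. eapply Rle_trans; [auto|lra].
  - apply (mvt_bound (fun t => snd (f t x)) (fun t => sg2 H t (fst (f t x)) (snd (f t x)))).
    intros r Hr. split; [apply Fc|]. eapply Rle_trans; [auto|lra].
Qed.

Lemma flow_cont3 (H : Ham3) (f : isotopy) : admissible H -> is_flow H f ->
  cont3 (fun t p q => fst (f t (p, q))) /\ cont3 (fun t p q => snd (f t (p, q))).
Proof.
  intros A Hf.
  assert (G : forall t p q eps, 0 < eps -> exists d, 0 < d /\ forall t' p' q',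
    Rabs (t' - t) < d -> Rabs (p' - p) < d -> Rabs (q' - q) < d ->
    Rabs (fst (f t' (p', q')) - fst (f t (p, q))) < eps /\ Rabs (snd (f t' (p', q')) - snd (f t (p, q))) < eps).
  { intros t p q eps He. assert (hT := Rabs_pos t).
    destruct (flow_lipschitz H f A Hf (Rabs t + 1)) as [C [HC L]]; [lra|].
    destruct (flow_speed H f A Hf (Rabs t + 1)) as [M [HM S]].
    set (d := Rmin 1 (eps/(2*C + M + 1))).
    assert (Hd : 0 < d) by pos.
    exists d. split; [lra|]. intros t' p' q' h1 h2 h3.
    assert (d1 : d <= 1) by apply Rmin_l. assert (d2 : d <= eps/(2*C + M + 1)) by apply Rmin_r.
    assert (Ht' : Rabs t' <= Rabs t + 1) by rabs.
    assert (l := L t' (p', q') (p, q) Ht'). destruct (S t' t (p, q) Ht') as [s1 s2]; [lra|].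
    simpl in l.
    assert (He2 : eps = (2*C + M + 1)*(eps/(2*C + M + 1))) by (field; lra).
    set (e := eps/(2*C + M + 1)) in *.
    assert (b1 : C*(Rabs (p' - p) + Rabs (q' - q)) <= C*(2*e)) by pos.
    assert (b2 : M*Rabs (t' - t) <= M*e) by pos.
    split.
    - all: rabs.
    - all: lra. }
  split; apply eps_cont3; intros t p q eps He; destruct (G t p q eps He) as [d [Hd h]];
  exists d; (split; [lra|]); intros; apply h; assumption.
Qed.

Lemma flow_equivariant (H : Ham3) (f : isotopy) : admissible H -> is_flow H f ->
  forall t p q n, f t (p, q + IZR n) = (fst (f t (p, q)), snd (f t (p, q)) + IZR n).
Proof.
  intros A Hf t p q n.
  apply (flow_unique H f (fun t => fst (f t (p, q))) (fun t => snd (f t (p, q)) + IZR n) 0 _ A Hf).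
  - intros s. destruct (flow_curve H f (p, q) Hf s) as [h1 h2].
    destruct (sg_smooth H A) as [[_ [P1 _]] [_ [P2 _]]]. split.
    + rewrite (periodic_Z (sg1 H s (fst (f s (p, q)))) (P1 s _)). exact h1.
    + rewrite (periodic_Z (sg2 H s (fst (f s (p, q)))) (P2 s _)).
      apply (is_derive_ext (fun s => IZR n + snd (f s (p, q)))); [intros; apply Rplus_comm|].
      apply is_derive_plus_const. exact h2.
  - rewrite !(flow_0 H f _ Hf). reflexivity.
Qed.

Lemma flow_outside (H : Ham3) (f : isotopy) (K : R) : admissible H -> is_flow H f ->
  (forall t p q, K < Rabs p -> H t p q = 0) -> forall t p q, K < Rabs p -> f t (p, q) = (p, q).
Proof.
  intros A Hf HK t p q Hp.
  apply (flow_unique H f (fun _ => p) (fun _ => q) 0 (p, q) A Hf); [|apply (flow_0 H f _ Hf)].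
  assert (Hz : forall y, Rabs (y - p) < Rabs p - K -> forall t q, H t y q = 0).
  { intros y Hy t' q'. apply HK. assert (h' := Rabs_triang_inv p (p - y)).
    replace (p - (p - y)) with y in h' by ring. rewrite (Rabs_minus_sym p y) in h'. lra. }
  assert (Z0 : forall t q, H t p q = 0) by auto.
  intros s. assert (E1 : sg1 H s p q = 0).
  { unfold sg1, partial. replace (Derive (fun s0 => H s p s0) q) with 0; [ring|]. symmetry.
    apply is_derive_unique. apply (is_derive_ext (fun _ => 0)); [auto|apply @is_derive_const]. }
  assert (E2 : sg2 H s p q = 0).
  { apply is_derive_unique.
    apply (is_derive_near _ (fun _ => 0) _ _ (Rabs p - K)); [lra| |apply @is_derive_const].
    auto. }
  rewrite E1, E2. split; apply @is_derive_const.
Qed.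

(** * Smooth dependence on initial conditions *)

Lemma cont3_tube (u : Ham3) (T p0 q0 eps : R) : cont3 u -> 0 < eps -> exists d, 0 < d /\
  forall s p q, Rabs s <= T -> Rabs (p - p0) < d -> Rabs (q - q0) < d -> Rabs (u s p q - u s p0 q0) < eps.
Proof.
  intros Hu He.
  destruct (compact_unif (- T) T (fun s d => forall p q, Rabs (p - p0) < d -> Rabs (q - q0) < d ->
    Rabs (u s p q - u s p0 q0) < eps)) as [d [Hd H]].
  - intros s r r' Hs Hr p q h1 h2. apply Hs; lra.
  - intros s _. destruct (cont3_eps u Hu s p0 q0 (eps/2)) as [d [Hd H]]; [lra|].
    exists d. split; [lra|]. intros s' Hs' p q h1 h2.
    assert (g1 := H s' p q Hs' h1 h2).
    assert (g2 : Rabs (u s' p0 q0 - u s p0 q0) < eps/2).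
    { apply H; [lra| |]; rewrite Rminus_diag, Rabs_R0; exact Hd. }
    abs g1. abs g2. apply Rabs_lt_between. lra.
  - exists d. split; [lra|]. intros s p q Hs. apply H. rabs.
Qed.

Lemma cont3_slice (u : Ham3) (p q t : R) : cont3 u -> continuous (fun s => u s p q) t.
Proof. intros Hu. apply (cont3_curve u (fun _ => p) (fun _ => q)); [pos| |]; apply continuous_const. Qed.

Lemma tubes (u : bool -> bool -> Ham3) (T p0 q0 eps : R) : (forall i j, cont3 (u i j)) -> 0 < eps -> exists d, 0 < d /\
  forall i j s p q, Rabs s <= T -> Rabs (p - p0) < d -> Rabs (q - q0) < d -> Rabs (u i j s p q - u i j s p0 q0) < eps.
Proof.
  intros Hu He.
  apply (bool_unif (fun i d => forall j s p q, Rabs s <= T -> Rabs (p - p0) < d ->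
    Rabs (q - q0) < d -> Rabs (u i j s p q - u i j s p0 q0) < eps)).
  - intros i d d' h hd. intros. apply h; lra.
  - intros i. apply (bool_unif (fun j d => forall s p q, Rabs s <= T -> Rabs (p - p0) < d -> Rabs (q - q0) < d -> Rabs (u i j s p q - u i j s p0 q0) < eps)).
    + intros j d d' h hd. intros. apply h; lra.
    + intros j. apply cont3_tube; auto.
Qed.

Lemma coef_bounded (u : bool -> bool -> R -> R) (T : R) : (forall i j t, continuous (u i j) t) ->
  exists M, 0 < M /\ forall i j t, Rabs t <= T -> Rabs (u i j t) <= M.
Proof.
  intros Hu. apply (bool_bound (fun i M => forall j t, Rabs t <= T -> Rabs (u i j t) <= M)).
  - intros i M M' h hM j t Ht. specialize (h j t Ht). lra.
  - intros i. apply (bool_bound (fun j M => forall t, Rabs t <= T -> Rabs (u i j t) <= M)).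
    + intros j M M' h hM t Ht. specialize (h t Ht). lra.
    + intros j. destruct (cont_bounded (u i j) (- T) T (Hu i j)) as [M [HM B]]. exists M. split; [lra|].
      intros t Ht. apply B, Rabs_le_between, Ht.
Qed.

Lemma lin_bound (a b c x y M e : R) : Rabs a <= M -> Rabs b <= M -> Rabs c <= e ->
  Rabs (a*x + b*y + c) <= M*(Rabs x + Rabs y) + e.
Proof.
  intros h1 h2 h3. assert (k1 := Rabs_triang (a*x + b*y) c). assert (k2 := Rabs_triang (a*x) (b*y)). rewrite !Rabs_mult in k2.
  assert (Rabs a*Rabs x <= M*Rabs x) by pos.
  assert (Rabs b*Rabs y <= M*Rabs y) by pos. lra.
Qed.

Section Stability.
Variables (b : bool -> bool -> R -> R) (s z : bool -> R -> R) (T : R).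
Hypothesis HT : 0 <= T.
Hypothesis Cb : forall i j t, continuous (b i j) t.
Hypothesis Dz : forall i t, is_derive (z i) t (b i true t*z true t + b i false t*z false t + s i t).

(** The difference w - z solves the perturbed system with an error term (a - b) z + (r - s), of size
    at most (2Y + 1) eta when Y bounds z, and Gronwall applies. C depends on b, z and T but not on w
    or eta, which is what allows eta to tend to 0. *)
Lemma linear_stability : exists C, 0 < C /\ forall (eta : R) (w : bool -> R -> R), 0 <= eta <= 1 ->
  (forall i t, Rabs t <= T -> exists a1 a2 r, is_derive (w i) t (a1*w true t + a2*w false t + r) /\
     Rabs (a1 - b i true t) <= eta /\ Rabs (a2 - b i false t) <= eta /\ Rabs (r - s i t) <= eta) ->
  (forall i, w i 0 = z i 0) -> forall i t, Rabs t <= T -> Rabs (w i t - z i t) <= C*eta.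
Proof.
  destruct (coef_bounded b T Cb) as [M [HM BM]].
  destruct (coef_bounded (fun i _ => z i) T) as [Y [HY BY]]; [intros i _ t; eapply is_derive_cont, Dz|].
  exists (gron (M + 1) T*(2*Y + 1)). split; [pos|].
  intros eta w He Dw W0 i t Ht. assert (N := gronwall (fun i t => w i t - z i t) (M + 1) T ((2*Y + 1)*eta)).
  cbv beta in N. rewrite !W0, !Rminus_diag, Rabs_R0, !Rplus_0_l, <- Rmult_assoc in N.
  apply N; [lra|pos|lra| |lra]. clear i t Ht. intros i t Ht.
  destruct (Dw i t Ht) as [a1 [a2 [r [D [h1 [h2 h3]]]]]]. eexists. split; [apply is_derive_minus_R; [exact D|apply Dz]|].
  replace (a1*w true t + a2*w false t + r - (b i true t*z true t + b i false t*z false t + s i t)) with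
    (a1*(w true t - z true t) + a2*(w false t - z false t) + ((a1 - b i true t)*z true t + (a2 - b i false t)*z false t + (r - s i t))) by ring.
  assert (b1 := BM i true t Ht). assert (b2 := BM i false t Ht). assert (y1 := BY true true t Ht). assert (y2 := BY false true t Ht).
  apply lin_bound; [rabs|rabs|].
  eapply Rle_trans; [apply lin_bound; eassumption|]. nra.
Qed.

(* Difference quotients solve a linear system whose coefficients converge. *)
Lemma slope_limit (y : bool -> R -> R -> R) (p0 : R) :
  (forall eta, 0 < eta -> exists d, 0 < d /\ forall p, p <> p0 -> Rabs (p - p0) < d -> forall i t, Rabs t <= T -> exists a1 a2 r,
     is_derive (fun t => y i t p - y i t p0) t (a1*(y true t p - y true t p0) + a2*(y false t p - y false t p0) + r*(p - p0)) /\
     Rabs (a1 - b i true t) <= eta /\ Rabs (a2 - b i false t) <= eta /\ Rabs (r - s i t) <= eta) ->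
  (forall i p, y i 0 p - y i 0 p0 = (p - p0)*z i 0) -> forall i t, Rabs t <= T -> is_derive (fun p => y i t p) p0 (z i t).
Proof.
  intros H Y0 i t Ht. destruct linear_stability as [C [HC St]]. apply slope_derive. intros eps He.
  set (eta := Rmin 1 (eps/(2*C))).
  assert (Hp : 0 < eta) by pos. assert (E1 : eta <= 1) by apply Rmin_l. assert (E2 : eta <= eps/(2*C)) by apply Rmin_r.
  destruct (H eta Hp) as [d [Hd D]]. exists d. split; [lra|]. intros p Hpd. destruct (Req_dec p p0) as [->|Hn].
  { exists (z i t). split; [ring|]. rabs. }
  assert (Hh : p - p0 <> 0) by lra. set (w := fun i t => / (p - p0)*(y i t p - y i t p0)). exists (w i t). split; [unfold w; field; exact Hh|].
  apply Rle_lt_trans with (C*eta).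
  - apply (St eta w); [lra| |intros j; unfold w; rewrite Y0; field; exact Hh|lra]. intros j r Hr.
    destruct (D p Hn Hpd j r Hr) as [a1 [a2 [c [Dw B]]]]. exists a1, a2, c. split; [|exact B].
    assert (S := is_derive_scal _ r (/ (p - p0)) _ Dw). match type of S with is_derive _ _ ?l => replace (a1*w true r + a2*w false r + c) with l; [exact S|] end.
    match goal with |- ?u = ?v => change (u = v :> R) end. unfold w. field. exact Hh.
  - assert (eps = 2*C*(eps/(2*C))) by (field; lra). nra.
Qed.
End Stability.

Definition lin (a : bool -> bool -> Ham3) (r y : bool -> Ham3) (i : bool) : Ham3 := fun t p q =>
  a i true t p q*y true t p q + a i false t p q*y false t p q + r i t p q.
Definition linear_solution (a : bool -> bool -> Ham3) (r y : bool -> Ham3) : Prop :=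
  forall i (t p q : R), is_derive (fun s => y i s p q) t (lin a r y i t p q).

Lemma CK_lin (k : nat) (a : bool -> bool -> Ham3) (r y : bool -> Ham3) (i : bool) :
  (forall i j, CK k (a i j)) -> (forall i, CK k (r i)) -> (forall i, CK k (y i)) -> CK k (lin a r y i).
Proof. intros. repeat apply CK_plus; try apply CK_mult; auto. Qed.

Lemma linear_exists (a : bool -> bool -> Ham3) (r : bool -> Ham3) (c : bool -> R) : (forall i j, cont3 (a i j)) -> (forall i, cont3 (r i)) ->
  exists y, linear_solution a r y /\ forall i p q, y i 0 p q = c i.
Proof.
  intros Ca Cr.
  assert (E : forall p q, exists x, (forall i, x i 0 = c i) /\ solves (fun i t u v => a i true t p q*u + a i false t p q*v + r i t p q) x).
  { intros p q. assert (Cur : forall u, cont3 u -> cont3 (fun t _ _ => u t p q)).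
    { intros u Hu. apply (cont3_comp u (fun t _ _ => t) (fun _ _ _ => p) (fun _ _ _ => q)); auto using cont3_t, cont3_const. }
    apply ode_exists. split.
    - intros i. repeat apply cont3_plus; try apply cont3_mult; auto using cont3_p, cont3_q.
    - intros T. destruct (coef_bounded (fun i j t => a i j t p q) T) as [M [HM B]]; [intros; apply cont3_slice, Ca|].
      exists M. split; [lra|]. intros i t u v u' v' Ht.
      replace (a i true t p q*u + a i false t p q*v + r i t p q - (a i true t p q*u' + a i false t p q*v' + r i t p q))
        with (a i true t p q*(u - u') + a i false t p q*(v - v') + 0) by ring.
      rewrite <- (Rplus_0_r (M*_)). apply lin_bound; [apply B, Ht|apply B, Ht|rabs]. }
  exists (fun i t p q => proj1_sig (cid (E p q)) i t).
  split; intros i; intros; unfold lin; destruct (cid (E p q)) as [x [h0 Hx]]; [auto|apply h0].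
Qed.

Lemma linear_solution_cont (a : bool -> bool -> Ham3) (r y : bool -> Ham3) (c : bool -> R) : (forall i j, cont3 (a i j)) -> (forall i, cont3 (r i)) ->
  linear_solution a r y -> (forall i p q, y i 0 p q = c i) -> forall i, cont3 (y i).
Proof.
  intros Ca Cr Hy I i. apply eps_cont3. intros t0 p0 q0 eps He. set (T := Rabs t0 + 1). assert (hT : 0 <= T) by (unfold T; assert (h := Rabs_pos t0); lra).
  destruct (linear_stability (fun i j t => a i j t p0 q0) (fun i t => r i t p0 q0) (fun i t => y i t p0 q0) T hT) as [C [HC St]].
  { intros; apply cont3_slice, Ca. } { auto. }
  set (eta := Rmin 1 (eps/(2*C))).
  assert (Hp : 0 < eta) by pos. assert (E1 : eta <= 1) by apply Rmin_l. assert (E2 : eta <= eps/(2*C)) by apply Rmin_r.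
  destruct (tubes a T p0 q0 eta Ca Hp) as [d1 [e1 U1]]. destruct (tubes (fun i _ => r i) T p0 q0 eta (fun i _ => Cr i) Hp) as [d2 [e2 U2]].
  destruct (continuous_eps (fun s => y i s p0 q0) t0 (eps/2)) as [d3 [e3 U3]]; [eapply is_derive_cont, Hy|lra|].
  exists (Rmin (Rmin 1 d3) (Rmin d1 d2)). split; [pos|]. intros t p q h1 h2 h3.
  apply Rmin_lt_inv in h1, h2, h3. destruct h1 as [h1 _], h2 as [_ h2], h3 as [_ h3]. apply Rmin_lt_inv in h1, h2, h3. destruct h1, h2, h3.
  assert (Ht := Rabs_triang (t - t0) t0). replace (t - t0 + t0) with t in Ht by ring. specialize (U3 t ltac:(lra)).
  assert (B := St eta (fun i t => y i t p q) ltac:(lra)).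
  assert (B' : Rabs (y i t p q - y i t p0 q0) <= C*eta).
  { apply B; [|intros j; rewrite !I; reflexivity|pos]. intros j s Hs. exists (a j true s p q), (a j false s p q), (r j s p q).
    split; [apply Hy|]. split; [|split]; left; [apply U1|apply U1|auto]; assumption. }
  assert (eps = 2*C*(eps/(2*C))) by (field; lra). assert (C*eta <= C*(eps/(2*C))) by pos.
  rabs.
Qed.

(** Formally differentiating y' = a y + r in p gives z' = a z + (b y + s), with zero initial value
    as that of y is constant. The difference quotients of y solve a system whose coefficients
    converge to this one, by the mean value theorem applied to a and r. *)
Lemma linear_derivative_p (a b : bool -> bool -> Ham3) (r s y z : bool -> Ham3) (c : bool -> R) :
  (forall i j, cont3 (a i j)) -> (forall i j, cont3 (b i j)) -> (forall i, cont3 (s i)) ->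
  (forall i j (t p q : R), is_derive (fun x => a i j t x q) p (b i j t p q)) -> (forall i (t p q : R), is_derive (fun x => r i t x q) p (s i t p q)) ->
  linear_solution a r y -> (forall i p q, y i 0 p q = c i) -> linear_solution a (lin b s y) z -> (forall i p q, z i 0 p q = 0) ->
  forall i (t p q : R), is_derive (fun x => y i t x q) p (z i t p q).
Proof.
  intros Ca Cb Cs Da Dr Hy I Hz J i t p q.
  apply (slope_limit (fun i j t => a i j t p q) (fun i t => lin b s y i t p q) (fun i t => z i t p q) (Rabs t) (Rabs_pos t)) with (y := fun i t x => y i t x q);
    [intros; apply cont3_slice, Ca|intros j t'; apply Hz| |intros j x; rewrite !I, J; ring|apply Rle_refl].
  intros eta He. destruct (coef_bounded (fun i _ t => y i t p q) (Rabs t)) as [Y [HY BY]]; [intros j _ t'; eapply is_derive_cont, Hy|].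
  set (e1 := eta/(2*Y + 1)). assert (He1 : 0 < e1) by pos. assert (Ee : eta = (2*Y + 1)*e1) by (unfold e1; field; lra).
  destruct (tubes a (Rabs t) p q eta Ca He) as [d1 [g1 U1]]. destruct (tubes b (Rabs t) p q e1 Cb He1) as [d2 [g2 U2]].
  destruct (tubes (fun i _ => s i) (Rabs t) p q e1 (fun i _ => Cs i) He1) as [d3 [g3 U3]].
  exists (Rmin d1 (Rmin d2 d3)). split; [pos|]. intros x Hx Hd j t' Ht.
  rmin Hd [x1 Hd]. rmin Hd [x2 x3].
  assert (Z : forall d, 0 < d -> Rabs (q - q) < d) by (intros d h; rewrite Rminus_diag, Rabs_R0; exact h).
  assert (Sl : forall (u v : Ham3) d, Rabs (x - p) < d -> (forall p, is_derive (fun x => u t' x q) p (v t' p q)) ->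
    (forall x, Rabs (x - p) < d -> Rabs (v t' x q - v t' p q) < e1) -> exists k, u t' x q - u t' p q = k*(x - p) /\ Rabs (k - v t' p q) <= e1).
  { intros u v d hd Du Hv. destruct (mvt (fun x => u t' x q) (fun x => v t' x q) p x) as [w [Hw Em]]; [auto|].
    exists (v t' w q). split; [lra|]. left. apply Hv. apply between_dist in Hw. lra. }
  destruct (Sl (a j true) (b j true) d2 x2) as [k1 [K1 L1]]; [auto|auto|].
  destruct (Sl (a j false) (b j false) d2 x2) as [k2 [K2 L2]]; [auto|auto|].
  destruct (Sl (r j) (s j) d3 x3) as [k3 [K3 L3]]; [auto|auto|].
  exists (a j true t' x q), (a j false t' x q), (k1*y true t' p q + k2*y false t' p q + k3). split; [|split; [left; apply U1; auto|split; [left; apply U1; auto|]]].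
  - replace (_ + _*(x - p)) with (lin a r y j t' x q - lin a r y j t' p q); [apply is_derive_minus_R; apply Hy|]. unfold lin.
    replace ((k1*y true t' p q + k2*y false t' p q + k3)*(x - p)) with (k1*(x - p)*y true t' p q + k2*(x - p)*y false t' p q + k3*(x - p)) by ring.
    rewrite <- K1, <- K2, <- K3. lra.
  - unfold lin. replace (_ - _) with ((k1 - b j true t' p q)*y true t' p q + (k2 - b j false t' p q)*y false t' p q + (k3 - s j t' p q)) by ring.
    eapply Rle_trans; [apply lin_bound; eassumption|]. assert (y1 := BY true true t' Ht). assert (y2 := BY false true t' Ht).
    nra.
Qed.

(** The increment of V along two neighbouring solutions is D at intermediate points times the
    difference of the solutions. Hence difference quotients solve linear systems that converge to
    the variational equation. *)
Lemma family_derivative_p (V x z : bool -> Ham3) (D : bool -> bool -> Ham3) (c : bool -> R) :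
  (forall i (t p q : R), is_derive (fun x => V i t x q) p (D i true t p q) /\ is_derive (fun x => V i t p x) q (D i false t p q)) ->
  (forall T, exists N, 0 < N /\ forall i j t p q p' q', Rabs t <= T -> Rabs (D i j t p q - D i j t p' q') <= N*(Rabs (p - p') + Rabs (q - q'))) ->
  (forall i j, cont3 (fun t p q => D i j t (x true t p q) (x false t p q))) -> (forall i, cont3 (x i)) ->
  (forall p q, solves V (fun i t => x i t p q)) -> (forall i p p' q, x i 0 p' q - x i 0 p q = (p' - p)*c i) ->
  linear_solution (fun i j t p q => D i j t (x true t p q) (x false t p q)) (fun _ _ _ _ => 0) z -> (forall i p q, z i 0 p q = c i) ->
  forall i (t p q : R), is_derive (fun y => x i t y q) p (z i t p q).
Proof.
  intros DV LD CD Cx Hx I Hz J i t p q.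
  apply (slope_limit (fun i j t => D i j t (x true t p q) (x false t p q)) (fun _ _ => 0) (fun i t => z i t p q) (Rabs t) (Rabs_pos t)) with (y := fun i t y => x i t y q);
    [intros; apply (cont3_slice _ p q _ (CD _ _))|intros j t'; apply Hz| |intros j y; rewrite J; apply I|apply Rle_refl].
  intros eta He. destruct (LD (Rabs t)) as [N [HN L]]. set (e := eta/(2*N)). assert (Hep : 0 < e) by pos.
  assert (Ee : eta = N*(2*e)) by (unfold e; field; lra). destruct (tubes (fun i _ => x i) (Rabs t) p q e (fun i _ => Cx i) Hep) as [d [Hd U]].
  exists d. split; [lra|]. intros y Hn Hy j t' Ht.
  assert (Z : Rabs (q - q) < d) by rabs. assert (u1 := U true true t' y q Ht Hy Z). assert (u2 := U false true t' y q Ht Hy Z).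
  assert (X1 := Hx y q j t'). assert (X2 := Hx p q j t').
  set (a := x true t' y q) in *. set (b := x false t' y q) in *. set (a0 := x true t' p q) in *. set (b0 := x false t' p q) in *.
  destruct (mvt (fun y => V j t' y b) (fun y => D j true t' y b) a0 a) as [v [Hv Em]]; [intros; apply DV|].
  destruct (mvt (fun y => V j t' a0 y) (fun y => D j false t' a0 y) b0 b) as [w [Hw Em']]; [intros; apply DV|]. apply between_dist in Hv, Hw.
  assert (Cl : forall k c c', Rabs (c - a0) + Rabs (c' - b0) <= 2*e -> Rabs (D j k t' c c' - D j k t' a0 b0) <= eta).
  { intros k c1 c2 h. eapply Rle_trans; [apply L, Ht|]. nra. }
  exists (D j true t' v b), (D j false t' a0 w), 0. split; [|split; [apply Cl; lra|split; [apply Cl; rewrite Rminus_diag, Rabs_R0; lra|rabs]]].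
  replace (_ + 0*(y - p)) with (V j t' a b - V j t' a0 b0) by lra. apply is_derive_minus_R; assumption.
Qed.

(** Exchanging the two parameters turns results on p-derivatives into results on q-derivatives. *)
Definition swap_pq (u : Ham3) : Ham3 := fun t p q => u t q p.

Lemma CK_swap (k : nat) (u : Ham3) : CK k u -> CK k (swap_pq u).
Proof.
  intros Hu. apply (CK_comp k u (fun t _ _ => t) (fun _ _ q => q) (fun _ p _ => p)); [pos|apply CK_t|apply CK_q|apply CK_p].
Qed.

(** The p- and q-derivatives of a solution solve linear systems of the same kind, whose coefficients
    and source are one degree less regular; by induction they are of class k, so the solution is of
    class k + 1. *)
Lemma linear_CK (k : nat) : forall (a : bool -> bool -> Ham3) (r y : bool -> Ham3) (c : bool -> R), (forall i j, CK k (a i j)) -> (forall i, CK k (r i)) ->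
  linear_solution a r y -> (forall i p q, y i 0 p q = c i) -> forall i, CK k (y i).
Proof.
  induction k as [|k IH]; [exact linear_solution_cont|].
  assert (Part : forall (a : bool -> bool -> Ham3) (r y : bool -> Ham3) (c : bool -> R), (forall i j, CK (S k) (a i j)) -> (forall i, CK (S k) (r i)) ->
    linear_solution a r y -> (forall i p q, y i 0 p q = c i) -> exists z, (forall i, CK k (z i)) /\ forall i (t p q : R), is_derive (fun x => y i t x q) p (z i t p q)).
  { intros a r y c A R Hy I. assert (A' := fun i j => CK_pred _ _ (A i j)). assert (Y := IH a r y c A' (fun i => CK_pred _ _ (R i)) Hy I).
    set (b := fun i j => partial 1 (a i j)). set (s := fun i => partial 1 (r i)).
    assert (B : forall i j, CK k (b i j)) by (intros; apply CK_partials; auto). assert (S : forall i, CK k (s i)) by (intros; apply CK_partials; auto).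
    assert (Q : forall i, CK k (lin b s y i)) by (intros; apply CK_lin; assumption).
    destruct (linear_exists a (lin b s y) (fun _ => 0)) as [z [Hz J]]; [intros; eapply CK_cont; auto|intros; eapply CK_cont; auto|].
    exists z. split; [exact (IH a _ z _ A' Q Hz J)|].
    apply (linear_derivative_p a b r s y z c); try assumption; try (intros; eapply CK_cont; auto; fail).
    - intros i j t p q. apply (CK_partials _ _ (A i j)).
    - intros i t p q. apply (CK_partials _ _ (R i)). }
  intros a r y c A R Hy I. destruct (Part a r y c A R Hy I) as [z [Z DZ]].
  destruct (Part (fun i j => swap_pq (a i j)) (fun i => swap_pq (r i)) (fun i => swap_pq (y i)) c) as [w [W DW]];
    [intros; apply CK_swap, A|intros; apply CK_swap, R|intros i t p q; apply (Hy i t q p)|intros; apply I|].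
  assert (Y := IH a r y c (fun i j => CK_pred _ _ (A i j)) (fun i => CK_pred _ _ (R i)) Hy I).
  intros i. split; [eapply CK_cont, Y|]. exists (lin a r y i), (z i), (swap_pq (w i)).
  split; [intros t p q; split; [apply Hy|split; [apply DZ|apply (DW i t q p)]]|].
  split; [apply CK_lin; auto; intros; apply CK_pred; auto|split; [apply Z|apply CK_swap, W]].
Qed.

Lemma smooth_schwarz (u : Ham3) : smooth u -> forall t p q, partial 1 (partial 2 u) t p q = partial 2 (partial 1 u) t p q.
Proof.
  intros Su t p q. destruct (smooth_partials u Su) as [P SP].
  destruct (smooth_partials _ (SP 1%nat)) as [P1 SP1]. destruct (smooth_partials _ (SP 2%nat)) as [P2 SP2].
  assert (C2 : forall v : Ham3, cont3 v -> forall a b, continuity_2d_pt (fun x y => v t x y) a b).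
  { intros v Hv a b eps. destruct (cont3_eps v Hv t a b eps (cond_pos eps)) as [d [Hd H]].
    exists (mkposreal d Hd). intros x y Hx Hy. apply H; try assumption. rabs. }
  assert (E := Schwarz (fun x y => u t x y) p q).
  assert (G : Derive (fun z => Derive (fun y => u t z y) q) p = Derive (fun z => Derive (fun x => u t x z) p) q).
  { apply E.
    - exists (mkposreal 1 Rlt_0_1). intros x y _ _.
      split; [exists (partial 1 u t x y); exact (proj1 (proj2 (P t x y)))|].
      split; [exists (partial 2 u t x y); exact (proj2 (proj2 (P t x y)))|].
      split; [exists (partial 1 (partial 2 u) t x y); exact (proj1 (proj2 (P2 t x y)))|].
      exists (partial 2 (partial 1 u) t x y); exact (proj2 (proj2 (P1 t x y))).
    - apply (C2 _ (SP2 1%nat O)).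
    - apply (C2 _ (SP1 2%nat O)). }
  exact G.
Qed.

(* The spatial derivative of a Hamiltonian flow solves the variational equation; it is as regular as the flow
   itself, so regularity bootstraps, and the trace of the equation vanishes. *)
Theorem flow_smooth (H : Ham3) (f : isotopy) : admissible H -> is_flow H f ->
  let x1 := fun t p q => fst (f t (p, q)) in let x2 := fun t p q => snd (f t (p, q)) in
  smooth x1 /\ smooth x2 /\
  forall t p q, partial 1 x1 t p q*partial 2 x2 t p q - partial 2 x1 t p q*partial 1 x2 t p q = 1.
Proof.
  intros A Hf x1 x2. set (x := fun i : bool => if i then x1 else x2).
  destruct (sg_smooth H A) as [S1 S2]. assert (S : forall i, smooth (sg H i) /\ pc (sg H i)) by (intros [|]; assumption).
  set (D := fun i j : bool => partial (if j then 1 else 2) (sg H i)).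
  assert (SD : forall i j, smooth (D i j) /\ pc (D i j)).
  { intros i j. destruct (S i) as [s P]. split; [apply (smooth_partials _ s)|apply pc_partial; assumption]. }
  assert (DV : forall i (t p q : R), is_derive (fun x => sg H i t x q) p (D i true t p q) /\ is_derive (fun x => sg H i t p x) q (D i false t p q)).
  { intros i t p q. exact (proj2 (proj1 (smooth_partials _ (proj1 (S i))) t p q)). }
  assert (LD : forall T, exists N, 0 < N /\ forall i j t p q p' q', Rabs t <= T -> Rabs (D i j t p q - D i j t p' q') <= N*(Rabs (p - p') + Rabs (q - q'))).
  { intros T. assert (Mo : forall (u : Ham3) M M', M <= M' ->
      (forall t p q p' q', Rabs t <= T -> Rabs (u t p q - u t p' q') <= M*(Rabs (p - p') + Rabs (q - q'))) ->
      forall t p q p' q', Rabs t <= T -> Rabs (u t p q - u t p' q') <= M'*(Rabs (p - p') + Rabs (q - q'))).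
    { intros u M M' hM h t p q p' q' Ht. eapply Rle_trans; [apply h, Ht|]. apply Rmult_le_compat_r; [rabs|lra]. }
    apply (bool_bound (fun i N => forall j t p q p' q', Rabs t <= T -> Rabs (D i j t p q - D i j t p' q') <= N*(Rabs (p - p') + Rabs (q - q')))).
    - intros i M M' h hM j. exact (Mo _ M M' hM (h j)).
    - intros i. apply (bool_bound (fun j N => forall t p q p' q', Rabs t <= T -> Rabs (D i j t p q - D i j t p' q') <= N*(Rabs (p - p') + Rabs (q - q')))).
      + intros j M M' h hM. exact (Mo _ M M' hM h).
      + intros j. apply smooth_pc_lipschitz; apply SD. }
  assert (Hcur : forall p q, solves (sg H) (fun i t => x i t p q)).
  { intros p q. assert (C := proj1 (ode_curve_solves H _ _) (flow_curve H f (p, q) Hf)). intros [|]; [exact (C true)|exact (C false)]. }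
  assert (Hi : forall i p q, x i 0 p q = if i then p else q) by (intros [|] p q; unfold x, x1, x2; rewrite (flow_0 H f _ Hf); reflexivity).
  (* Stated for an arbitrary family of solutions, this serves the flow as well as the flow with
     exchanged parameters; c is the derivative of the initial value in the first parameter. *)
  assert (Var : forall k y, (forall i, CK k (y i)) -> (forall p q, solves (sg H) (fun i t => y i t p q)) -> forall c,
    (forall i p p' q, y i 0 p' q - y i 0 p q = (p' - p)*c i) -> exists z, (forall i, CK k (z i)) /\ (forall i p q, z i 0 p q = c i) /\
      linear_solution (fun i j t p q => D i j t (y true t p q) (y false t p q)) (fun _ _ _ _ => 0) z /\
      forall i (t p q : R), is_derive (fun s => y i t s q) p (z i t p q)).
  { intros k y Y Hc c I.
    assert (Q : forall i j, CK k (fun t p q => D i j t (y true t p q) (y false t p q))).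
    { intros i j. apply (CK_comp k (D i j) (fun t _ _ => t)); [apply SD|apply CK_t|apply Y|apply Y]. }
    assert (CQ := fun i j => CK_cont _ _ (Q i j)).
    destruct (linear_exists _ (fun _ _ _ _ => 0) c CQ (fun _ => cont3_const 0)) as [z [Hz J]]. exists z.
    split; [apply (linear_CK k _ _ z c Q (fun _ => CK_const 0 k) Hz J)|]. split; [exact J|]. split; [pos|].
    apply (family_derivative_p (sg H) y z D c); try assumption. intros i. eapply CK_cont, Y. }
  set (xs := fun i => swap_pq (x i)). assert (Hcs : forall p q, solves (sg H) (fun i t => xs i t p q)) by (intros p q; apply (Hcur q p)).
  assert (I1 : forall i p p' q, x i 0 p' q - x i 0 p q = (p' - p)*(if i then 1 else 0)) by (intros [|] p p' q; rewrite !Hi; ring).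
  assert (I2 : forall i p p' q, xs i 0 p' q - xs i 0 p q = (p' - p)*(if i then 0 else 1)) by (intros [|] p p' q; unfold xs, swap_pq; rewrite !Hi; ring).
  assert (CKx : forall k i, CK k (x i)).
  { induction k as [|k IH]; intros i; [destruct (flow_cont3 H f A Hf); destruct i; assumption|].
    destruct (Var k x IH Hcur _ I1) as [z [Z [_ [_ DZ]]]]. destruct (Var k xs (fun i => CK_swap k _ (IH i)) Hcs _ I2) as [w [W [_ [_ DW]]]].
    split; [eapply CK_cont, IH|]. exists (fun t p q => sg H i t (x true t p q) (x false t p q)), (z i), (swap_pq (w i)).
    split; [intros t p q; split; [apply (Hcur p q i t)|split; [apply DZ|apply (DW i t q p)]]|].
    split; [apply (CK_comp k (sg H i) (fun t _ _ => t)); [apply S|apply CK_t|apply IH|apply IH]|split; [apply Z|apply CK_swap, W]]. }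
  split; [intros k; apply (CKx k true)|split; [intros k; apply (CKx k false)|]]. intros t p q.
  destruct (Var O x (CKx O) Hcur _ I1) as [z [_ [J [Lz DZ]]]]. destruct (Var O xs (fun i => CK_swap O _ (CKx O i)) Hcs _ I2) as [w [_ [K [Lw DW]]]].
  assert (e1 := is_derive_unique _ _ _ (DZ true t p q) : partial 1 x1 t p q = z true t p q).
  assert (e2 := is_derive_unique _ _ _ (DZ false t p q) : partial 1 x2 t p q = z false t p q).
  assert (e3 := is_derive_unique _ _ _ (DW true t q p) : partial 2 x1 t p q = w true t q p).
  assert (e4 := is_derive_unique _ _ _ (DW false t q p) : partial 2 x2 t p q = w false t q p). rewrite e1, e2, e3, e4.
  assert (Dd : forall s, is_derive (fun s => z true s p q*w false s q p - w true s q p*z false s p q) s 0).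
  { intros s. assert (Tr : D true true s (x1 s p q) (x2 s p q) = - D false false s (x1 s p q) (x2 s p q)).
    { destruct (admissible_smooth H A) as [SH _]. unfold D. rewrite <- (smooth_schwarz H SH). apply is_derive_unique.
      destruct (smooth_partials _ (proj2 (smooth_partials H SH) 2%nat)) as [PH _].
      exact (is_derive_opp _ _ _ (proj1 (proj2 (PH s (x1 s p q) (x2 s p q))))). }
    assert (m := is_derive_minus_R _ _ _ _ _ (is_derive_mult_R _ _ _ _ _ (Lz true s p q) (Lw false s q p))
      (is_derive_mult_R _ _ _ _ _ (Lw true s q p) (Lz false s p q))).
    match type of m with is_derive _ _ ?l => replace 0 with l; [exact m|] end.
    unfold lin, xs, swap_pq, x. nra. }
  rewrite (is_derive_zero_const _ Dd t 0), !J, !K. ring.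
Qed.

(** * Autonomous flows *)

Definition dP (F : R -> R -> R) (p q : R) : R := Derive (fun s => F s q) p.
Definition dQ (F : R -> R -> R) (p q : R) : R := Derive (fun s => F p s) q.

Lemma autonomous_partials (F : R -> R -> R) : adm F ->
  forall p q, is_derive (fun s => F s q) p (dP F p q) /\ is_derive (fun s => F p s) q (dQ F p q).
Proof.
  intros A p q. destruct (smooth_partials _ (proj1 (admissible_smooth _ A))) as [P _].
  destruct (P 0 p q) as [_ H]. exact H.
Qed.

Lemma smooth_autonomous_comp (F : R -> R -> R) (a b : R -> R) (x la lb : R) : adm F ->
  is_derive a x la -> is_derive b x lb ->
  is_derive (fun s => F (a s) (b s)) x (dP F (a x) (b x)*la + dQ F (a x) (b x)*lb).
Proof.
  intros A Ha Hb. destruct (smooth_partials _ (proj1 (admissible_smooth _ A))) as [P S].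
  assert (C := chain3 (autonomous F) _ _ _ (fun _ => 0) a b x 0 la lb P (S O O) (S 1%nat O) (S 2%nat O)
    (is_derive_const _ _) Ha Hb).
  match type of C with is_derive _ _ ?l => replace (dP F (a x) (b x)*la + dQ F (a x) (b x)*lb) with l; [exact C|] end.
  rewrite Rmult_0_r, Rplus_0_l. reflexivity.
Qed.

Lemma flow_sg (F : R -> R -> R) (f : isotopy) (x : R * R) (t : R) : flow_of F f ->
  is_derive (fun s => fst (f s x)) t (- dQ F (fst (f t x)) (snd (f t x))) /\
  is_derive (fun s => snd (f s x)) t (dP F (fst (f t x)) (snd (f t x))).
Proof. intros Hf. exact (flow_curve _ f x Hf t). Qed.

Lemma flow_conserves (F : R -> R -> R) (f : isotopy) : adm F ->
  flow_of F f -> forall t x, F (fst (f t x)) (snd (f t x)) = F (fst x) (snd x).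
Proof.
  intros A Hf t x.
  rewrite (is_derive_zero_const (fun t => F (fst (f t x)) (snd (f t x)))) with (b := 0).
  - rewrite (flow_0 _ f x Hf). reflexivity.
  - intros s. destruct (flow_sg F f x s Hf) as [h1 h2].
    assert (C := smooth_autonomous_comp F _ _ s _ _ A h1 h2).
    match type of C with is_derive _ _ ?l => replace 0 with l; [exact C|ring] end.
Qed.

Lemma flow_group (F : R -> R -> R) (f : isotopy) : adm F ->
  flow_of F f -> forall s t x, f (s + t) x = f s (f t x).
Proof.
  intros A Hf s t x. symmetry.
  rewrite (flow_unique _ f (fun s => fst (f (t + s) x)) (fun s => snd (f (t + s) x)) 0 (f t x) A Hf).
  - rewrite Rplus_comm. destruct (f (s + t) x); reflexivity.
  - intros r. destruct (flow_curve _ f x Hf (t + r)) as [h1 h2].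
    split; [exact (is_derive_shift _ _ _ _ h1)|exact (is_derive_shift _ _ _ _ h2)].
  - rewrite (flow_0 _ f _ Hf), Rplus_0_r. destruct (f t x); reflexivity.
Qed.

(** As dG = m dF, the field of G is m times that of F, and m is constant along the orbits of f. Each
    orbit is therefore run at a constant multiple of its speed. This gives the flow of a function of
    F and that of the plateau. *)
Lemma time_change (F G : R -> R -> R) (f g : isotopy) (m : R * R -> R) :
  adm F -> flow_of F f -> adm G -> flow_of G g ->
  (forall t x, m (f t x) = m x) -> (forall p q, dP G p q = m (p, q)*dP F p q /\ dQ G p q = m (p, q)*dQ F p q) ->
  forall t x, g t x = f (t*m x) x.
Proof.
  intros A Hf B Hg Hm HG t x.
  rewrite (flow_unique _ g (fun t => fst (f (t*m x) x)) (fun t => snd (f (t*m x) x)) 0 x B Hg).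
  - destruct (f (t*m x) x); reflexivity.
  - intros s. destruct (flow_sg F f x (s*m x) Hf) as [h1 h2].
    set (y := f (s*m x) x) in *. destruct (HG (fst y) (snd y)) as [e1 e2].
    assert (Em : m (fst y, snd y) = m x) by (rewrite <- surjective_pairing; apply Hm).
    rewrite Em in e1, e2.
    assert (Sc : forall (u : R -> R) l, is_derive u (s*m x) l -> is_derive (fun t => u (t*m x)) s (m x*l)).
    { intros u l Hu. apply (is_derive_comp u (fun t => t*m x)); [pos|]. auto_derive; [trivial|ring]. }
    split.
    + change (sg1 (autonomous G) s (fst y) (snd y)) with (- dQ G (fst y) (snd y)). rewrite e2.
      replace (- (m x*dQ F (fst y) (snd y))) with (m x * - dQ F (fst y) (snd y)) by ring. exact (Sc (fun t => fst (f t x)) _ h1).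
    + change (sg2 (autonomous G) s (fst y) (snd y)) with (dP G (fst y) (snd y)). rewrite e1.
      exact (Sc (fun t => snd (f t x)) _ h2).
  - rewrite (flow_0 _ g _ Hg), Rmult_0_l, (flow_0 _ f _ Hf). destruct x; reflexivity.
Qed.

(** * Finite covers by closed intervals of small total length *)

Definition covered (X : R -> Prop) (len : R) : Prop := exists l : list (R * R),
  (forall y, X y -> exists I, In I l /\ fst I <= y <= snd I) /\ (forall I, In I l -> fst I <= snd I) /\
  fold_right (fun I s => snd I - fst I + s) 0 l <= len.

Lemma covered_mono (X Y : R -> Prop) (a b : R) : (forall y, Y y -> X y) -> a <= b -> covered X a -> covered Y b.
Proof. intros H Hab [l [h1 [h2 h3]]]. exists l. split; [auto|split; [pos|lra]]. Qed.

Lemma covered_union (X Y : R -> Prop) (a b : R) : covered X a -> covered Y b -> covered (fun y => X y \/ Y y) (a + b).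
Proof.
  intros [l [h1 [h2 h3]]] [l' [k1 [k2 k3]]]. exists (l ++ l'). split; [|split].
  - intros y [Hy|Hy].
    + destruct (h1 y Hy) as [I [HI HH]]. exists I. split; [apply in_or_app; left; exact HI|lra].
    + destruct (k1 y Hy) as [I [HI HH]]. exists I. split; [apply in_or_app; right; exact HI|lra].
  - intros I HI. apply in_app_or in HI. destruct HI; auto.
  - assert (E : fold_right (fun I s => snd I - fst I + s) 0 (l ++ l') =
       fold_right (fun I s => snd I - fst I + s) 0 l + fold_right (fun I s => snd I - fst I + s) 0 l').
    { clear. induction l as [|I l IH]; simpl; [ring|]. lra. }
    lra.
Qed.

Lemma covered_iter (X : nat -> R -> Prop) (n : nat) (a : R) :
  (forall i, (i < n)%nat -> covered (X i) a) -> covered (fun y => exists i, (i < n)%nat /\ X i y) (INR n*a).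
Proof.
  induction n as [|n IH]; intros H.
  - exists nil. split; [intros y [i [Hi _]]; lia|]. split; [intros I []|]. simpl. lra.
  - apply (covered_mono (fun y => (exists i, (i < n)%nat /\ X i y) \/ X n y) _ (INR n*a + a)).
    + intros y [i [Hi Hy]]. destruct (Nat.eq_dec i n) as [->|Hn]; [auto|left; exists i; split; [lia|pos]].
    + rewrite S_INR. lra.
    + apply covered_union; [auto|apply H; lia].
Qed.

Lemma covered_cluster (X : R -> Prop) (d : R) : 0 <= d -> (forall x y, X x -> X y -> Rabs (x - y) <= d) -> covered X (2*d).
Proof.
  intros Hd H. destruct (classic (exists x, X x)) as [[x Hx]|Hn].
  - exists ((x - d, x + d) :: nil). split; [|split].
    + intros y Hy. exists (x - d, x + d). split; [left; reflexivity|]. simpl.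
      specialize (H x y Hx Hy). abs H. lra.
    + intros I [<-|[]]. simpl. lra.
    + simpl. lra.
  - exists nil. split; [intros y Hy; exfalso; apply Hn; exists y; exact Hy|]. split; [intros I []|]. simpl. lra.
Qed.

Definition clip (a b x : R) : R := Rmin (Rmax x a) b.
(** Total length, with multiplicity, of the parts of the intervals inside [a, b]: the difference of
    the clipped end points is the length of the intersection. *)
Definition overlap (a b : R) (l : list (R * R)) : R := fold_right (fun I s => clip a b (snd I) - clip a b (fst I) + s) 0 l.

Ltac minmax := unfold clip, Rmin, Rmax in *; repeat match goal with |- context [Rle_dec ?u ?v] => destruct (Rle_dec u v)
   | H : context [Rle_dec ?u ?v] |- _ => destruct (Rle_dec u v) end; try lra.

Lemma overlap_split (a u v b : R) (l : list (R * R)) : a <= u -> u <= v -> v <= b -> (forall I, In I l -> fst I <= snd I) ->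
  overlap a u l + overlap v b l <= overlap a b l.
Proof.
  intros h1 h2 h3. induction l as [|I l IH]; intros Hl; [simpl; lra|].
  assert (IH' := IH (fun J HJ => Hl J (or_intror HJ))). assert (HI := Hl I (or_introl eq_refl)).
  simpl.
  assert (clip a u (snd I) - clip a u (fst I) + (clip v b (snd I) - clip v b (fst I)) <= clip a b (snd I) - clip a b (fst I)).
  { minmax. }
  lra.
Qed.

(** Cut the first interval [u, v] out of [a, b]. Since overlaps with disjoint pieces add up, one of
    [a, u] and [v, b] is still longer than its overlap with the remaining list, and the induction
    continues there. *)
Lemma overlap_avoid (l : list (R * R)) : (forall I, In I l -> fst I <= snd I) -> forall a b, a <= b -> overlap a b l < b - a ->
  exists c1 c2, a < c1 /\ c1 < c2 /\ c2 < b /\ forall I, In I l -> forall y, c1 <= y <= c2 -> ~ (fst I <= y <= snd I).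
Proof.
  induction l as [|I l IH]; intros Hl a b Hab Ho.
  - simpl in Ho. exists (a + (b - a)/3), (a + (b - a)/2). split; [lra|split; [lra|split; [lra|]]]. intros I [].
  - assert (Hl' : forall J, In J l -> fst J <= snd J) by (intros; apply Hl; right; assumption).
    assert (HI := Hl I (or_introl eq_refl)).
    set (u := clip a b (fst I)). set (v := clip a b (snd I)).
    assert (h1 : a <= u) by (unfold u; clear Ho; minmax). assert (h2 : u <= v) by (unfold u, v; clear Ho; minmax).
    assert (h3 : v <= b) by (unfold v; clear Ho; minmax).
    assert (Hs := overlap_split a u v b l h1 h2 h3 Hl').
    change (overlap a b (I :: l)) with (v - u + overlap a b l) in Ho.
    destruct (Rlt_dec (overlap a u l) (u - a)) as [g|g].
    + destruct (IH Hl' a u h1 g) as [c1 [c2 [k1 [k2 [k3 k4]]]]]. exists c1, c2.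
      split; [lra|split; [lra|split; [lra|]]]. intros J [<-|HJ] y Hy.
      * assert (u <= fst I \/ u = a) by (unfold u; clear - Hab; minmax; ((left; lra) || (right; lra))). lra.
      * apply k4; assumption.
    + destruct (IH Hl' v b h3) as [c1 [c2 [k1 [k2 [k3 k4]]]]]; [lra|]. exists c1, c2.
      split; [lra|split; [lra|split; [lra|]]]. intros J [<-|HJ] y Hy.
      * assert (snd I <= v \/ v = b) by (unfold v; clear - Hab; minmax; ((left; lra) || (right; lra))). lra.
      * auto.
Qed.

Lemma covered_avoid (X : R -> Prop) (a b len : R) : a < b -> len < b - a -> covered X len ->
  exists c1 c2, a < c1 /\ c1 < c2 /\ c2 < b /\ forall y, c1 <= y <= c2 -> ~ X y.
Proof.
  intros Hab Hlen [l [h1 [h2 h3]]].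
  assert (Ho : overlap a b l <= fold_right (fun I s => snd I - fst I + s) 0 l).
  { clear h1 h3. induction l as [|I l IH]; [pos|]. simpl.
    assert (IH' := IH (fun J HJ => h2 J (or_intror HJ))). assert (HI := h2 I (or_introl eq_refl)).
    assert (clip a b (snd I) - clip a b (fst I) <= snd I - fst I) by (clear IH IH'; minmax). lra. }
  destruct (overlap_avoid l h2 a b) as [c1 [c2 [k1 [k2 [k3 k4]]]]]; [lra|lra|].
  exists c1, c2. split; [lra|split; [lra|split; [lra|]]]. intros y Hy HX.
  destruct (h1 y HX) as [I [HI HH]]. exact (k4 I HI y Hy HH).
Qed.

(** * Sard's theorem in the plane *)

Definition has_grad (u up uq : R -> R -> R) : Prop := forall p q, is_derive (fun s => u s q) p (up p q) /\ is_derive (fun s => u p s) q (uq p q).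

(* [G] is the gradient and [a] the Hessian of [F]; the index [true] stands for p. *)
Definition jet (F : R -> R -> R) (G : bool -> R -> R -> R) (a : bool -> bool -> R -> R -> R) : Prop :=
  has_grad F (G true) (G false) /\ forall i, has_grad (G i) (a i true) (a i false).

Definition in_square (p0 q0 s p q : R) : Prop := p0 <= p <= p0 + s /\ q0 <= q <= q0 + s.

Lemma in_between (a b x l h : R) : l <= a <= h -> l <= b <= h -> Rmin a b <= x <= Rmax a b -> l <= x <= h.
Proof. unfold Rmin, Rmax. destruct (Rle_dec a b); lra. Qed.

Lemma mvt2_bound (u up uq : R -> R -> R) (p q p' q' M : R) : has_grad u up uq ->
  (forall r, Rmin p p' <= r <= Rmax p p' -> Rabs (up r q) <= M) -> (forall r, Rmin q q' <= r <= Rmax q q' -> Rabs (uq p' r) <= M) ->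
  Rabs (u p' q' - u p q) <= M*(Rabs (p' - p) + Rabs (q' - q)).
Proof.
  intros D H1 H2. replace (u p' q' - u p q) with ((u p' q - u p q) + (u p' q' - u p' q)) by ring.
  via Rabs_triang. rewrite Rmult_plus_distr_l. apply Rplus_le_compat.
  - apply (mvt_bound (fun r => u r q) (fun r => up r q)). intros r Hr. split; [exact (proj1 (D r q))|auto].
  - apply (mvt_bound (fun r => u p' r) (fun r => uq p' r)). intros r Hr. split; [exact (proj2 (D p' r))|auto].
Qed.

Lemma grid_index (k : nat) (h x : R) : (0 < k)%nat -> 0 <= x <= INR k*h ->
  exists i, (i < k)%nat /\ INR i*h <= x <= INR (S i)*h.
Proof.
  induction k as [|k IH]; intros Hk Hx; [lia|]. destruct (Rle_dec x (INR k*h)) as [g|g].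
  - destruct k as [|k].
    + exists O. split; [lia|]. simpl in *. lra.
    + destruct IH as [i [Hi H]]; [lia|lra|]. exists i. split; [lia|exact H].
  - exists k. split; [lia|]. lra.
Qed.

Lemma exists_large_nat (x : R) : exists k, (0 < k)%nat /\ x <= INR k.
Proof.
  exists (S (Z.to_nat (up x))). split; [lia|]. destruct (archimed x) as [h _].
  rewrite S_INR, INR_IZR_INZ. destruct (Z_le_gt_dec 0 (up x)) as [g|g].
  - rewrite Z2Nat.id by exact g. lra.
  - assert (IZR (up x) < 0) by (apply IZR_lt; lia). assert (0 <= IZR (Z.of_nat (Z.to_nat (up x)))) by (apply IZR_le; lia). lra.
Qed.

Section Sard.
Context (F : R -> R -> R) (G : bool -> R -> R -> R) (a : bool -> bool -> R -> R -> R) (p0 q0 s : R).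
Context (HJ : jet F G a) (Hs : 0 <= s).

(** The gradient vanishes at (p, q), so it is at most M r on the box between the points; integrating
    once more gives M r^2. *)
Lemma critical_quadratic (M p q p' q' : R) : (forall i j p q, in_square p0 q0 s p q -> Rabs (a i j p q) <= M) -> 0 <= M ->
  in_square p0 q0 s p q -> in_square p0 q0 s p' q' -> (forall i, G i p q = 0) ->
  Rabs (F p' q' - F p q) <= M*(Rabs (p' - p) + Rabs (q' - q))*(Rabs (p' - p) + Rabs (q' - q)).
Proof.
  intros HM HM0 [x1 x2] [y1 y2] E. set (r := Rabs (p' - p) + Rabs (q' - q)).
  assert (Rr : forall u v : R, Rmin u v <= u <= Rmax u v /\ Rmin u v <= v <= Rmax u v) by (intros u v; unfold Rmin, Rmax; destruct (Rle_dec u v); lra).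
  assert (HG : forall i x y, Rmin p p' <= x <= Rmax p p' -> Rmin q q' <= y <= Rmax q q' -> Rabs (G i x y) <= M*r).
  { intros i x y hx hy. assert (sx := in_between _ _ _ _ _ x1 y1 hx). assert (sy := in_between _ _ _ _ _ x2 y2 hy).
    rewrite <- (Rminus_0_r (G i x y)), <- (E i). apply Rle_trans with (M*(Rabs (x - p) + Rabs (y - q))).
    - apply (mvt2_bound (G i) (a i true) (a i false) p q x y M (proj2 HJ i)); intros z hz; apply HM; split; try assumption.
      + exact (in_between _ _ _ _ _ x1 sx hz). + exact (in_between _ _ _ _ _ x2 sy hz).
    - apply Rmult_le_compat_l; [lra|]. apply between_dist in hx. apply between_dist in hy. pos. }
  apply (mvt2_bound F (G true) (G false) p q p' q' (M*r) (proj1 HJ)); intros z hz; apply HG; try assumption; apply Rr.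
Qed.

Definition crit_values (y : R) : Prop := exists p q, in_square p0 q0 s p q /\ (forall i, G i p q = 0) /\ y = F p q.

Lemma crit_cluster (X : R -> R -> Prop) (M d : R) : (forall i j p q, in_square p0 q0 s p q -> Rabs (a i j p q) <= M) -> 0 <= M -> 0 <= d ->
  (forall p q p' q', X p q -> X p' q' -> in_square p0 q0 s p q -> in_square p0 q0 s p' q' -> (forall i, G i p q = 0) -> (forall i, G i p' q' = 0) ->
    Rabs (p - p') + Rabs (q - q') <= d) ->
  covered (fun y => exists p q, X p q /\ in_square p0 q0 s p q /\ (forall i, G i p q = 0) /\ y = F p q) (2*(M*d*d)).
Proof.
  intros HM HM0 Hd H. apply covered_cluster; [pos|].
  intros x y [p [q [Xx [Sx [E1 ->]]]]] [p' [q' [Xy [Sy [E2 ->]]]]].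
  eapply Rle_trans; [apply (critical_quadratic M p' q' p q); assumption|]. specialize (H p q p' q' Xx Xy Sx Sy E1 E2).
  assert (g1 := Rabs_pos (p - p')). assert (g2 := Rabs_pos (q - q')).
  pos.
Qed.

(* Where one second derivative is bounded below, the critical set lies on a Lipschitz graph. *)
Lemma sard_strip (g gp gq : R -> R -> R) (M eta : R) (k : nat) : 0 < eta -> (0 < k)%nat -> 0 <= M ->
  (forall i j p q, in_square p0 q0 s p q -> Rabs (a i j p q) <= M) -> (forall p q, (forall i, G i p q = 0) -> g p q = 0) -> has_grad g gp gq ->
  (forall p q, in_square p0 q0 s p q -> eta <= Rabs (gp p q) /\ Rabs (gq p q) <= M) ->
  covered crit_values (INR k*(2*(M*((1 + M/eta)*(s/INR k))*((1 + M/eta)*(s/INR k))))).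
Proof.
  intros Heta Hk HM0 HM Hg Dg Bg. assert (HkR : 0 < INR k) by (apply lt_0_INR; exact Hk). set (h := s/INR k).
  (* In one of the k strips of height h = s/k the critical points lie within (1 + M/eta) h of each
     other, so their values need a length of order h^2. The total is of order 1/k. *)
  assert (HMe : 0 <= M/eta) by pos. eapply covered_mono; [|pos|apply covered_iter; intros i _;
    apply (crit_cluster (fun p q => INR i*h <= q - q0 <= INR (S i)*h) M ((1 + M/eta)*h) HM HM0); [pos|]].
  - intros y [p [q [Sx [E1 E2]]]]. destruct (grid_index k h (q - q0) Hk) as [i [Hi Hq]].
    + destruct Sx as [_ l]. replace (INR k*h) with s by (unfold h; field; lra). lra.
    + exists i. split; [pos|]. exists p, q. auto.
  - intros p q p' q' Qx Qy Sx Sy E1 E2.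
    assert (hq : Rabs (q - q') <= h) by (rewrite S_INR in Qx, Qy; apply Rabs_le_between; lra).
    destruct (mvt (fun r => g r q) (fun r => gp r q) p' p) as [c [Hc Em]]; [intros r _; exact (proj1 (Dg r q))|].
    destruct (mvt (fun r => g p' r) (fun r => gq p' r) q' q) as [d [Hd Em']]; [intros r _; exact (proj2 (Dg p' r))|].
    rewrite (Hg p q E1) in Em. rewrite (Hg p' q' E2) in Em'. destruct Sx as [u1 u2]. destruct Sy as [v1 v2].
    destruct (Bg c q (conj (in_between _ _ _ _ _ v1 u1 Hc) u2)) as [b1 _]. destruct (Bg p' d (conj v1 (in_between _ _ _ _ _ v2 u2 Hd))) as [_ b2].
    assert (E : Rabs (gp c q)*Rabs (p - p') = Rabs (gq p' d)*Rabs (q - q')).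
    { rewrite <- !Rabs_mult, <- Em, <- Em', Rminus_0_l, Rminus_0_r. apply Rabs_Ropp. }
    assert (i1 : eta*Rabs (p - p') <= Rabs (gp c q)*Rabs (p - p')) by pos.
    assert (i2 : Rabs (gq p' d)*Rabs (q - q') <= M*h) by pos.
    assert (hp : Rabs (p - p') <= M/eta*h); [|lra]. apply (Rmult_le_reg_l eta); [lra|].
    replace (eta*(M/eta*h)) with (M*h) by (field; lra). lra.
Qed.

(** If the entry exceeds 2e somewhere, it stays at least e on the square because it oscillates by at
    most e, and the strip argument applies with as many strips as are needed to get below 16 e
    s^2. *)
Lemma sard_dichotomy (M e : R) (i : bool) : 0 < e -> 0 <= M -> (forall i j p q, in_square p0 q0 s p q -> Rabs (a i j p q) <= M) ->
  (forall j p q p' q', in_square p0 q0 s p q -> in_square p0 q0 s p' q' -> Rabs (a i j p q - a i j p' q') <= e) ->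
  covered crit_values (16*e*(s*s)) \/ forall p q, in_square p0 q0 s p q -> Rabs (a i true p q) <= 2*e.
Proof.
  intros He HM0 HM Ho. destruct (classic (exists p q, in_square p0 q0 s p q /\ 2*e < Rabs (a i true p q))) as [[p [q [h1 h2]]]|Hn].
  2:{ right. intros p q h. apply Rnot_lt_le. intros Hlt. apply Hn. exists p, q. auto. }
  left. destruct (exists_large_nat (2*M*((1 + M/e)*(1 + M/e))/(16*e))) as [k [Hk Hkl]].
  assert (HkR : 0 < INR k) by (apply lt_0_INR; exact Hk).
  eapply covered_mono; [intros y hy; exact hy| |apply (sard_strip (G i) (a i true) (a i false) M e k He Hk HM0 HM); [intros; auto|exact (proj2 HJ i)|]].
  - replace (INR k*(2*(M*((1 + M/e)*(s/INR k))*((1 + M/e)*(s/INR k))))) with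
      ((2*M*((1 + M/e)*(1 + M/e))/INR k)*(s*s)) by (field; lra).
    apply Rmult_le_compat_r; [pos|]. apply (Rmult_le_compat_r (16*e/INR k)) in Hkl; [|pos].
    replace (INR k*(16*e/INR k)) with (16*e) in Hkl by (field; lra).
    replace (2*M*((1 + M/e)*(1 + M/e))/INR k) with (2*M*((1 + M/e)*(1 + M/e))/(16*e)*(16*e/INR k)) by (field; lra). exact Hkl.
  - intros p' q' h'. split; [|apply HM, h']. assert (h := Ho true p q p' q' h1 h').
    assert (t := Rabs_triang (a i true p q - a i true p' q') (a i true p' q')).
    replace (a i true p q - a i true p' q' + a i true p' q') with (a i true p q) in t by ring. lra.
Qed.
End Sard.

(** If none of the four Hessian entries is large, all are at most 2e and the critical points of the
    square form one cluster of diameter 2s, which costs 2 (2e) (2s)^2 = 16 e s^2. Otherwise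
    [sard_dichotomy] gives the same bound, after exchanging p and q for the derivatives in q. *)
Lemma sard_square (F : R -> R -> R) (G : bool -> R -> R -> R) (a : bool -> bool -> R -> R -> R) (p0 q0 s M e : R) : jet F G a -> 0 <= s -> 0 < e -> 0 <= M ->
  (forall i j p q, in_square p0 q0 s p q -> Rabs (a i j p q) <= M) ->
  (forall i j p q p' q', in_square p0 q0 s p q -> in_square p0 q0 s p' q' -> Rabs (a i j p q - a i j p' q') <= e) ->
  covered (crit_values F G p0 q0 s) (16*e*(s*s)).
Proof.
  intros HJ Hs He HM0 HM Ho.
  set (a' := fun i j p q => a (negb i) (negb j) q p).
  assert (Sq : forall p q, in_square q0 p0 s p q -> in_square p0 q0 s q p) by (intros p q [u v]; split; assumption).
  assert (D := fun i => sard_dichotomy F G a p0 q0 s HJ Hs M e i He HM0 HM (Ho i)).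
  assert (D' := fun i => sard_dichotomy (fun p q => F q p) (fun i p q => G (negb i) q p) a' q0 p0 s
    (conj (fun p q => conj (proj2 (proj1 HJ q p)) (proj1 (proj1 HJ q p))) (fun i p q => conj (proj2 (proj2 HJ (negb i) q p)) (proj1 (proj2 HJ (negb i) q p)))) Hs
    M e i He HM0 (fun i j p q h => HM _ _ _ _ (Sq p q h)) (fun j p q p' q' h h' => Ho _ _ _ _ _ _ (Sq p q h) (Sq p' q' h'))).
  assert (Csw : covered (crit_values (fun p q => F q p) (fun i p q => G (negb i) q p) q0 p0 s) (16*e*(s*s)) -> covered (crit_values F G p0 q0 s) (16*e*(s*s))).
  { apply covered_mono; [|lra]. intros y [p [q [[u v] [E1 E2]]]]. exists q, p. split; [split; assumption|auto]. }
  destruct (D true) as [c|b1]; [exact c|]. destruct (D false) as [c|b2]; [exact c|]. destruct (D' true) as [c|b3]; [auto|]. destruct (D' false) as [c|b4]; [auto|].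
  replace (16*e*(s*s)) with (2*(2*e*(2*s)*(2*s))) by ring.
  eapply covered_mono; [|pos|apply (crit_cluster F G a p0 q0 s HJ (fun _ _ => True) (2*e) (2*s)); try lra].
  - intros y [p [q h]]. exists p, q. auto.
  - intros [|] [|] p q h; [apply b1, h|apply (b4 q p)|apply b2, h|apply (b3 q p)]; destruct h; split; assumption.
  - intros p q p' q' _ _ [u1 u2] [v1 v2] _ _. assert (h1 : Rabs (p - p') <= s) by rabs.
    assert (h2 : Rabs (q - q') <= s) by rabs. lra.
Qed.

Definition regular_on (F : R -> R -> R) (c1 c2 : R) : Prop :=
  forall p q, c1 <= F p q <= c2 -> dP F p q <> 0 \/ dQ F p q <> 0.

(** Critical values above a >= 0 come from the support, so a fundamental domain of 2 K' N^2 squares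
    of side s = 1/N suffices. The Hessian oscillates by at most 2 M s on each, so each costs 16 (2 M
    s) s^2, and the total 64 K' M s drops below b - a for large N. *)
Theorem regular_interval (F : R -> R -> R) (a b : R) : adm F -> 0 <= a -> a < b ->
  exists c1 c2, a < c1 /\ c1 < c2 /\ c2 < b /\ regular_on F c1 c2.
Proof.
  intros A Ha0 Hab. destruct (admissible_smooth _ A) as [S P]. destruct (smooth_partials _ S) as [D SP].
  set (d := fun i : bool => if i then 1%nat else 2%nat). set (g := fun i => partial (d i) (autonomous F)).
  assert (Sg : forall i, smooth (g i) /\ pc (g i)) by (intros i; split; [apply SP|apply pc_partial; assumption]).
  set (h := fun i j => partial (d j) (g i)).
  assert (Sh : forall i j, smooth (h i j) /\ pc (h i j)).
  { intros i j. destruct (Sg i) as [s0 c0]. split; [apply (smooth_partials _ s0)|apply pc_partial; assumption]. }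
  assert (HJ : jet F (fun i => g i 0) (fun i j => h i j 0)).
  { split; [intros p q; exact (proj2 (D 0 p q))|]. intros i p q. exact (proj2 (proj1 (smooth_partials _ (proj1 (Sg i))) 0 p q)). }
  set (Pb := fun (u : Ham3) M => (forall p q, Rabs (u 0 p q) <= M) /\ forall p q p' q', Rabs (u 0 p q - u 0 p' q') <= M*(Rabs (p - p') + Rabs (q - q'))).
  assert (Mo : forall u M M', Pb u M -> M <= M' -> Pb u M').
  { intros u M M' [k l] hM. split; intros; [eapply Rle_trans; [apply k|lra]|]. via l.
    apply Rmult_le_compat_r; [rabs|lra]. }
  destruct (bool_bound (fun i M => forall j, Pb (h i j) M)) as [M [HM Bd]].
  { intros i M M' k hM j. eapply Mo; eauto. }
  { intros i. apply (bool_bound (fun j M => Pb (h i j) M)); [intros j M M'; apply Mo|]. intros j. destruct (Sh i j) as [Su Pu].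
    destruct (pc_bounded _ (Su O) Pu 0) as [M1 [h1 B1]]. destruct (smooth_pc_lipschitz _ Su Pu 0) as [M2 [h2 B2]].
    assert (z : Rabs 0 <= 0) by rabs. exists (M1 + M2). split; [lra|]. split; intros; [eapply Rle_trans; [apply B1, z|lra]|].
    eapply Rle_trans; [apply B2, z|]. apply Rmult_le_compat_r; [rabs|lra]. }
  destruct P as [Pq [K HK]].
  destruct (exists_large_nat (Rabs K)) as [K' [HK0 HK']].
  assert (HKR : 0 < INR K') by (apply lt_0_INR; exact HK0).
  destruct (exists_large_nat (2*(64*INR K'*M)/(b - a))) as [N [HN0 HN]].
  assert (HNR : 0 < INR N) by (apply lt_0_INR; exact HN0).
  set (s := / INR N). assert (Hs : 0 < s) by pos.
  assert (Cov : covered (fun y => exists p q, dP F p q = 0 /\ dQ F p q = 0 /\ y = F p q /\ a < y) (64*INR K'*M*s)).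
  { apply (covered_mono (fun y => exists i, (i < 2*K'*N)%nat /\ exists j, (j < N)%nat /\
       crit_values F (fun i => g i 0) (- INR K' + INR i*s) (INR j*s) s y) _
       (INR (2*K'*N)*(INR N*(16*(2*M*s)*(s*s))))).
    - intros y [p [q [E1 [E2 [E3 Ey]]]]].
      assert (Hp : Rabs p <= INR K').
      { apply Rnot_lt_le. intros Hlt. assert (hK : K <= Rabs K) by apply Rle_abs.
        assert (Z := HK 0 p q). unfold autonomous in Z. lra. }
      destruct (floor_ex q) as [n Hn].
      assert (Epq : forall u : R -> R -> R, (forall p q, u p (q + 1) = u p q) -> u p (q - IZR n) = u p q).
      { intros u Hg. rewrite <- (periodic_Z (u p) (Hg p) n (q - IZR n)). f_equal. ring. }
      abs Hp.
      destruct (grid_index (2*K'*N) s (p + INR K')) as [i [Hi Hpi]].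
      { lia. } { rewrite !mult_INR. unfold s. simpl (INR 2). replace ((1 + 1)*INR K'*INR N * / INR N) with (2*INR K') by (field; lra). lra. }
      destruct (grid_index N s (q - IZR n)) as [j [Hj Hqj]].
      { lia. } { rewrite Rinv_r by lra. lra. }
      exists i. split; [pos|]. exists j. split; [pos|]. rewrite S_INR in Hpi, Hqj.
      exists p, (q - IZR n). split; [unfold in_square; lra|].
      split; [intros [|]; [rewrite <- E1|rewrite <- E2]; apply Epq; [exact (proj1 (proj2 (Sg true)) 0)|exact (proj1 (proj2 (Sg false)) 0)]|].
      rewrite (Epq F); [lra|]. intros p1 q1. exact (Pq 0 p1 q1).
    - rewrite !mult_INR. unfold s. simpl (INR 2). right. field. lra.
    - apply covered_iter. intros i _. apply covered_iter. intros j _.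
      apply (sard_square F (fun i => g i 0) (fun i j => h i j 0) _ _ s M); try lra; [pos|pos|intros; apply Bd|].
      intros u v p q p' q' [u1 u2] [v1 v2]. via Bd. replace (2*M*s) with (M*(2*s)) by ring. apply Rmult_le_compat_l; [lra|].
      assert (g1 : Rabs (p - p') <= s) by rabs. assert (g2 : Rabs (q - q') <= s) by rabs. lra. }
  assert (Hlen : 64*INR K'*M*s < b - a).
  { assert (Hb : 2*(64*INR K'*M) <= INR N*(b - a)).
    { apply (Rmult_le_reg_r (/ (b - a))); [pos|].
      replace (INR N*(b - a) * / (b - a)) with (INR N) by (field; lra). exact HN. }
    assert (Hpos : 0 < 64*INR K'*M) by pos.
    apply (Rmult_lt_reg_r (INR N)); [lra|]. unfold s. rewrite Rmult_assoc, Rinv_l by lra. lra. }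
  destruct (covered_avoid _ a b _ Hab Hlen Cov) as [c1 [c2 [h1 [h2 [h3 h4]]]]].
  exists c1, c2. split; [lra|split; [lra|split; [lra|]]].
    intros p q Hc. apply NNPP. intros Hn. apply not_or_and in Hn. destruct Hn as [n1 n2].
    apply (h4 (F p q) Hc). exists p, q. lra.
Qed.

(** * Regular level sets *)

Definition shiftq (x : R * R) (k : Z) : R * R := (fst x, snd x + IZR k).

Definition near (r : R) (x y : R * R) : Prop := Rabs (fst y - fst x) < r /\ Rabs (snd y - snd x) < r.

Lemma near_triang (a b : R) (x y z : R * R) : near a x y -> near b y z -> near (a + b) x z.
Proof.
  intros [h1 h2] [h3 h4]. split.
  - all: rabs.
Qed.
Lemma near_sym (r : R) (x y : R * R) : near r x y -> near r y x.
Proof. intros [h1 h2]. split; rewrite Rabs_minus_sym; assumption. Qed.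
Lemma near_mono (r r' : R) (x y : R * R) : near r x y -> r <= r' -> near r' x y.
Proof. intros [h1 h2] h. split; lra. Qed.
Lemma near_refl (r : R) (x : R * R) : 0 < r -> near r x x.
Proof. intros h. split; rewrite Rminus_diag, Rabs_R0; exact h. Qed.

Lemma shiftq_shiftq (x : R * R) (k l : Z) : shiftq (shiftq x k) l = shiftq x (k + l).
Proof. unfold shiftq. simpl. rewrite plus_IZR. f_equal. ring. Qed.
Lemma shiftq_0 (x : R * R) : shiftq x 0 = x.
Proof. unfold shiftq. rewrite Rplus_0_r. destruct x; reflexivity. Qed.
Lemma shiftq_inj (x y : R * R) (k : Z) : shiftq x k = shiftq y k -> x = y.
Proof. destruct x, y. intros H. injection H as H1 H2. f_equal; [lra|lra]. Qed.
Lemma near_shift (r : R) (x y : R * R) (k : Z) : near r x y -> near r (shiftq x k) (shiftq y k).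
Proof.
  intros [h1 h2]. split; simpl; [lra|]. rabs.
Qed.

Lemma is_derive_lincomb (a b : R -> R) (x la lb c d a0 b0 : R) : is_derive a x la -> is_derive b x lb ->
  is_derive (fun s => (a s - a0)*c + (b s - b0)*d) x (la*c + lb*d).
Proof.
  intros Ha Hb. auto_derive.
  - split; [exists la; exact Ha|split; [exists lb; exact Hb|trivial]].
  - rewrite (Dv _ _ _ Ha), (Dv _ _ _ Hb). ring.
Qed.

Section Orbits.
Context (F : R -> R -> R) (f : isotopy).
Context (A : adm F) (Hf : flow_of F f).

Definition val (x : R * R) : R := F (fst x) (snd x).
Definition regular (x : R * R) : Prop := dP F (fst x) (snd x) <> 0 \/ dQ F (fst x) (snd x) <> 0.

Lemma val_shift (x : R * R) (k : Z) : val (shiftq x k) = val x.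
Proof.
  apply (periodic_Z (F (fst x))). intros q.
  destruct A as [_ [P _]]. exact (P 0 (fst x) q).
Qed.

Lemma flow_shift (t : R) (x : R * R) (k : Z) : f t (shiftq x k) = shiftq (f t x) k.
Proof. destruct x as [p q]. exact (flow_equivariant _ f A Hf t p q k). Qed.

Lemma val_flow (t : R) (x : R * R) : val (f t x) = val x.
Proof. exact (flow_conserves F f A Hf t x). Qed.

Lemma flow_add (s t : R) (x : R * R) : f (s + t) x = f s (f t x).
Proof. exact (flow_group F f A Hf s t x). Qed.

Lemma flow_zero (x : R * R) : f 0 x = x.
Proof. exact (flow_0 _ f x Hf). Qed.

Lemma flow_inv (t : R) (x : R * R) : f (- t) (f t x) = x.
Proof. rewrite <- flow_add, Rplus_opp_l. apply flow_zero. Qed.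

Lemma cont3_near (u : Ham3) (x : R * R) (eps : R) : cont3 u -> 0 < eps -> exists r, 0 < r /\ forall y, near r x y ->
  Rabs (u 0 (fst y) (snd y) - u 0 (fst x) (snd x)) < eps.
Proof.
  intros Hu He. destruct (cont3_eps u Hu 0 (fst x) (snd x) eps He) as [r [Hr H]]. exists r. split; [lra|].
  intros y [h1 h2]. apply H; try assumption. rabs.
Qed.

Lemma val_near (x : R * R) (eps : R) : 0 < eps -> exists r, 0 < r /\ forall y, near r x y -> Rabs (val y - val x) < eps.
Proof. apply (cont3_near (autonomous F)). exact (proj1 (admissible_smooth _ A) O). Qed.

Lemma gradient_near (x : R * R) (eps : R) : 0 < eps -> exists r, 0 < r /\ forall y, near r x y ->
  Rabs (dP F (fst y) (snd y) - dP F (fst x) (snd x)) < eps /\ Rabs (dQ F (fst y) (snd y) - dQ F (fst x) (snd x)) < eps.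
Proof.
  intros He. destruct (smooth_partials _ (proj1 (admissible_smooth _ A))) as [_ S].
  destruct (cont3_near _ x eps (S 1%nat O) He) as [r1 [h1 H1]].
  destruct (cont3_near _ x eps (S 2%nat O) He) as [r2 [h2 H2]].
  exists (Rmin r1 r2). split; [pos|]. intros y Hy.
  split; [apply H1|apply H2]; apply (near_mono _ _ _ _ Hy); [apply Rmin_l|apply Rmin_r].
Qed.

Lemma flow_near (T : R) (t : R) (x : R * R) (eps : R) : 0 < eps -> exists r, 0 < r /\ forall y s, near r x y -> Rabs (s - t) < r -> near eps (f t x) (f s y).
Proof.
  intros He. destruct (flow_cont3 _ f A Hf) as [C1 C2].
  destruct (cont3_eps _ C1 t (fst x) (snd x) eps He) as [r1 [h1 H1]].
  destruct (cont3_eps _ C2 t (fst x) (snd x) eps He) as [r2 [h2 H2]].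
  exists (Rmin r1 r2). split; [pos|]. intros y s [n1 n2] Hs.
  apply Rmin_lt_inv in n1. apply Rmin_lt_inv in n2. apply Rmin_lt_inv in Hs.
  rewrite <- !surjective_pairing in H1, H2.
  assert (E1 := H1 s (fst y) (snd y)). assert (E2 := H2 s (fst y) (snd y)).
  rewrite <- !surjective_pairing in E1, E2. split; [lra|lra]; tauto.
Qed.

(** (- gq, gp) is the Hamiltonian field at x0. By continuity of the gradient, orbits near x0 advance
    in this fixed direction at rate at least G/2, the rate at x0 itself being G. *)
Lemma flow_transit (x0 : R * R) : regular x0 ->
  let gp := dP F (fst x0) (snd x0) in let gq := dQ F (fst x0) (snd x0) in let G := gp*gp + gq*gq in
  0 < G /\ exists r, 0 < r /\ exists a, 0 < a /\
   (forall y, near r x0 y -> G/2 <= dP F (fst y) (snd y)*gp + dQ F (fst y) (snd y)*gq) /\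
   (forall y s, near (r/2) x0 y -> Rabs s <= a -> near r x0 (f s y)) /\
   (forall y s s', near (r/2) x0 y -> - a <= s <= s' -> s' <= a ->
       G/2*(s' - s) <= (fst (f s' y) - fst (f s y)) * - gq + (snd (f s' y) - snd (f s y))*gp).
Proof.
  intros Hx gp gq G.
  assert (HG : 0 < G).
  { unfold G. destruct Hx as [h|h].
    - fold gp in h. assert (0 < gp*gp) by nra. assert (0 <= gq*gq) by nra. lra.
    - fold gq in h. nra. }
  split; [lra|].
  set (S := Rabs gp + Rabs gq + 1). assert (h1 := Rabs_pos gp). assert (h2 := Rabs_pos gq).
  destruct (gradient_near x0 (G/(2*S))) as [r [Hr Hgr]]; [pos|].
  destruct (flow_speed _ f A Hf 1) as [M [HM Sp]].
  exists r. split; [lra|]. set (a := Rmin 1 (r/(4*M))).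
  assert (Ha : 0 < a) by pos.
  exists a. split; [lra|].
  assert (P1 : forall y, near r x0 y -> G/2 <= dP F (fst y) (snd y)*gp + dQ F (fst y) (snd y)*gq).
  { intros y Hy. destruct (Hgr y Hy) as [k1 k2].
    set (u := dP F (fst y) (snd y)) in *. set (v := dQ F (fst y) (snd y)) in *.
    assert (E : u*gp + v*gq = G + ((u - gp)*gp + (v - gq)*gq)) by pos.
    assert (B : Rabs ((u - gp)*gp + (v - gq)*gq) <= G/(2*S)*S).
    { via Rabs_triang. rewrite !Rabs_mult.
      assert (Rabs (u - gp)*Rabs gp <= G/(2*S)*Rabs gp) by pos.
      assert (Rabs (v - gq)*Rabs gq <= G/(2*S)*Rabs gq) by pos.
      assert (0 < G/(2*S)) by pos.
      pos. }
    replace (G/(2*S)*S) with (G/2) in B by (field; unfold S; lra).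
    rabs. }
  assert (P2 : forall y s, near (r/2) x0 y -> Rabs s <= a -> near r x0 (f s y)).
  { intros y s Hy Hs. replace r with (r/2 + r/2) by field. apply (near_triang _ _ _ y); [pos|].
    assert (a1 : a <= 1) by apply Rmin_l. assert (a2 : a <= r/(4*M)) by apply Rmin_r.
    destruct (Sp s 0 y) as [s1 s2]; [lra|rabs|]. rewrite flow_zero, Rminus_0_r in s1, s2.
    assert (M*Rabs s <= M*(r/(4*M))) by pos.
    replace (M*(r/(4*M))) with (r/4) in H by (field; lra). split; lra. }
  split; [pos|split; [pos|]].
  intros y s s' Hy Hs Hs'.
  destruct (mvt (fun t => (fst (f t y) - fst (f s y)) * - gq + (snd (f t y) - snd (f s y))*gp)
    (fun t => - dQ F (fst (f t y)) (snd (f t y)) * - gq + dP F (fst (f t y)) (snd (f t y))*gp) s s') as [c [Hc Em]].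
  - intros t _. destruct (flow_sg F f y t Hf) as [d1 d2].
    exact (is_derive_lincomb _ _ t _ _ (- gq) gp (fst (f s y)) (snd (f s y)) d1 d2).
  - rewrite Rmin_left, Rmax_right in Hc by lra.
    assert (Hn : near r x0 (f c y)) by (apply P2; [pos|rabs]).
    specialize (P1 _ Hn).
    nra.
Qed.

(** Move y along its orbit until it agrees with y' in the flow direction, which the intermediate
    value theorem allows. The difference is then a multiple of the gradient at x0; as F is strictly
    monotone in that direction and takes the same value at both points, the difference is zero. *)
Lemma flow_box (x0 : R * R) (a : R) : regular x0 -> 0 < a -> exists r, 0 < r /\ forall y y',
  near r x0 y -> near r x0 y' -> val y = val y' -> exists s, Rabs s < a /\ f s y = y'.
Proof.
  intros Hx Ha. destruct (flow_transit x0 Hx) as [HG [r [Hr [b [Hb [P1 [P2 P3]]]]]]].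
  set (gp := dP F (fst x0) (snd x0)) in *. set (gq := dQ F (fst x0) (snd x0)) in *. set (G := gp*gp + gq*gq) in *.
  set (c := Rmin b (a/2)). assert (Hc : 0 < c) by pos.
  assert (cb : c <= b) by apply Rmin_l. assert (ca : c <= a/2) by apply Rmin_r.
  set (S := Rabs gp + Rabs gq + 1). assert (h1 := Rabs_pos gp). assert (h2 := Rabs_pos gq).
  set (d := Rmin (r/2) (c*G/(8*S))).
  assert (HcG : 0 < c*G) by pos.
  assert (Hd : 0 < d) by pos.
  exists d. split; [lra|]. intros y y' Hy Hy' Ev.
  assert (d1 : d <= r/2) by apply Rmin_l. assert (d2 : d <= c*G/(8*S)) by apply Rmin_r.
  assert (Hyr : near (r/2) x0 y) by (apply (near_mono d); assumption).
  assert (Hyr' : near r x0 y') by (apply (near_mono d); [pos|lra]).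
  set (tau := fun s => (fst (f s y) - fst y') * - gq + (snd (f s y) - snd y')*gp).
  assert (T0 : Rabs (tau 0) < c*G/2).
  { unfold tau. rewrite flow_zero. assert (Hn := near_triang _ _ _ _ _ (near_sym _ _ _ Hy') Hy). destruct Hn as [n1 n2].
    lt_via Rabs_triang. rewrite !Rabs_mult, Rabs_Ropp.
    assert (k1 := Rabs_pos (fst y - fst y')). assert (k2 := Rabs_pos (snd y - snd y')).
    assert (e1 : Rabs (fst y - fst y')*Rabs gq <= (2*d)*Rabs gq) by pos.
    assert (e2 : Rabs (snd y - snd y')*Rabs gp <= (2*d)*Rabs gp) by pos.
    assert (e3 : d*S <= c*G/8).
    { apply Rle_trans with (c*G/(8*S)*S); [pos|].
      right. field. pos. }
    pos. }
  assert (Tc : 0 <= tau c).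
  { assert (h := P3 y 0 c Hyr). rewrite flow_zero in h. abs T0. unfold tau in *. rewrite flow_zero in T0.
    lra. }
  assert (Tc' : tau (- c) <= 0).
  { assert (h := P3 y (- c) 0 Hyr). rewrite flow_zero in h. abs T0. unfold tau in *. rewrite flow_zero in T0.
    lra. }
  destruct (IVT_gen tau (- c) c 0) as [s [Hs Es]].
  { intros s. apply continuity_pt_filterlim. destruct (flow_sg F f y s Hf) as [k1 k2].
    exact (is_derive_cont _ _ _ (is_derive_lincomb _ _ s _ _ (- gq) gp (fst y') (snd y') k1 k2)). }
  { rewrite Rmin_left, Rmax_right by lra. lra. }
  rewrite Rmin_left, Rmax_right in Hs by lra.
  exists s. split; [rabs|].
  set (z := f s y) in *. assert (Hz : near r x0 z) by (apply P2; [pos|rabs]).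
  unfold tau in Es. fold z in Es. set (u := fst z - fst y') in *. set (v := snd z - snd y') in *.
  destruct (mvt (fun w => F (fst y' + w*u) (snd y' + w*v))
    (fun w => dP F (fst y' + w*u) (snd y' + w*v)*u + dQ F (fst y' + w*u) (snd y' + w*v)*v) 0 1) as [w [Hw Em]].
  { intros w _. apply (smooth_autonomous_comp F (fun w => fst y' + w*u) (fun w => snd y' + w*v) w u v A);
    auto_derive; trivial; ring. }
  rewrite Rmin_left, Rmax_right in Hw by lra.
  assert (E1 : F (fst y' + 1*u) (snd y' + 1*v) = val z) by (unfold val, u, v; f_equal; ring).
  assert (E0 : F (fst y' + 0*u) (snd y' + 0*v) = val y') by (unfold val; f_equal; ring).
  rewrite E1, E0 in Em. unfold z in Em at 1. rewrite val_flow, Ev in Em.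
  set (m := (fst y' + w*u, snd y' + w*v)).
  assert (Hm : near r x0 m).
  { assert (Cv : forall a b c0 r0, Rabs (a - c0) < r0 -> Rabs (b - c0) < r0 -> Rabs (a + w*(b - a) - c0) < r0).
    { intros x x' c0 r0 k1 k2. abs k1. abs k2. apply Rabs_lt_between.
      replace (x + w*(x' - x) - c0) with ((1 - w)*(x - c0) + w*(x' - c0)) by ring.
      set (X := x - c0) in *. destruct (Rlt_dec w 1) as [g|g].
      - all: nra.
      - all: lra. }
    destruct Hz as [z1 z2]. destruct Hyr' as [y1 y2]. split; apply Cv; assumption. }
  specialize (P1 m Hm). simpl in P1.
  set (U := dP F (fst y' + w*u) (snd y' + w*v)) in *. set (W := dQ F (fst y' + w*u) (snd y' + w*v)) in *.
  set (k := (u*gp + v*gq)/G).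
  assert (Eu : u = k*gp) by (unfold k; apply (Rmult_eq_reg_r G); [|lra]; replace ((u*gp + v*gq)/G*gp*G) with ((u*gp + v*gq)*gp) by (field; lra); unfold G; apply Rminus_diag_uniq; replace (u*(gp*gp + gq*gq) - (u*gp + v*gq)*gp) with (- gq*(u * - gq + v*gp)) by ring; rewrite Es; ring).
  assert (Evv : v = k*gq) by (unfold k; apply (Rmult_eq_reg_r G); [|lra]; replace ((u*gp + v*gq)/G*gq*G) with ((u*gp + v*gq)*gq) by (field; lra); unfold G; apply Rminus_diag_uniq; replace (v*(gp*gp + gq*gq) - (u*gp + v*gq)*gq) with (gp*(u * - gq + v*gp)) by ring; rewrite Es; ring).
  assert (k = 0) by nra.
  rewrite H, Rmult_0_l in Eu, Evv. unfold u in Eu. unfold v in Evv.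
  rewrite (surjective_pairing z), (surjective_pairing y'). f_equal; lra.
Qed.

(** * Periods modulo the deck group *)

Definition per (x : R * R) (t : R) (k : Z) : Prop := f t x = shiftq x k.

Lemma per_add (x : R * R) (s t : R) (k l : Z) : per x s k -> per x t l -> per x (s + t) (k + l).
Proof. unfold per. intros Hs Ht. rewrite flow_add, Ht, flow_shift, Hs, shiftq_shiftq. reflexivity. Qed.
Lemma per_opp (x : R * R) (t : R) (k : Z) : per x t k -> per x (- t) (- k).
Proof.
  intros Ht. apply (shiftq_inj _ _ k). rewrite <- flow_shift, <- Ht, flow_inv, shiftq_shiftq.
  replace (- k + k)%Z with 0%Z by ring. rewrite shiftq_0. reflexivity.
Qed.
Lemma per_0 (x : R * R) : per x 0 0.
Proof. unfold per. rewrite flow_zero, shiftq_0. reflexivity. Qed.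
Lemma per_mul (x : R * R) (t : R) (k : Z) (j : Z) : per x t k -> per x (IZR j*t) (j*k).
Proof.
  intros H. assert (Hn : forall n : nat, per x (INR n*t) (Z.of_nat n*k)).
  { induction n as [|n IH]; [rewrite Rmult_0_l; apply per_0|].
    rewrite S_INR, Rmult_plus_distr_r, Rmult_1_l, Nat2Z.inj_succ, Z.mul_succ_l. apply per_add; assumption. }
  destruct (Z_le_gt_dec 0 j) as [h|h].
  - specialize (Hn (Z.to_nat j)). rewrite INR_IZR_INZ, Z2Nat.id in Hn by exact h. exact Hn.
  - specialize (Hn (Z.to_nat (- j))). rewrite INR_IZR_INZ, Z2Nat.id in Hn by lia. apply per_opp in Hn.
    rewrite opp_IZR in Hn. replace (- (- IZR j*t)) with (IZR j*t) in Hn by ring.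
    replace (- (- j*k))%Z with (j*k)%Z in Hn by ring. exact Hn.
Qed.
Lemma per_flow (x : R * R) (s t : R) (k : Z) : per x t k -> per (f s x) t k.
Proof. unfold per. intros H. rewrite <- flow_add, Rplus_comm, flow_add, H, flow_shift. reflexivity. Qed.
Lemma per_shift (x : R * R) (t : R) (k l : Z) : per x t k -> per (shiftq x l) t k.
Proof. unfold per. intros H. rewrite flow_shift, H, !shiftq_shiftq. f_equal. ring. Qed.

Definition essential (x : R * R) : Prop := exists t k, k <> 0%Z /\ per x t k.

Lemma essential_flow (x : R * R) (s : R) : essential x -> essential (f s x).
Proof. intros [t [k [Hk H]]]. exists t, k. split; [pos|apply per_flow, H]. Qed.
Lemma essential_shift (x : R * R) (l : Z) : essential x -> essential (shiftq x l).
Proof. intros [t [k [Hk H]]]. exists t, k. split; [pos|apply per_shift, H]. Qed.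

Lemma orbit_q_cont (x : R * R) (t : R) : continuous (fun s => snd (f s x)) t.
Proof. apply (is_derive_cont _ _ _ (proj2 (flow_sg F f x t Hf))). Qed.

(** An orbit that closes up in the cover keeps q bounded, whereas iterating a period with nonzero
    deck shift moves q arbitrarily far. *)
Lemma closed_orbit_inessential (x : R * R) (t : R) : t <> 0 -> per x t 0 -> ~ essential x.
Proof.
  intros Ht H [s [k [Hk Hs]]].
  destruct (cont_bounded (fun s => snd (f s x)) (- Rabs t) (Rabs t) (orbit_q_cont x)) as [M [HM B]].
  assert (Bd : forall r, Rabs (snd (f r x)) <= M).
  { intros r. assert (Hp : exists j, - Rabs t <= r - IZR j*t <= Rabs t).
    { destruct (floor_ex (r/t)) as [j Hj]. exists j.
      assert (E : r - IZR j*t = (r/t - IZR j)*t) by (field; exact Ht). rewrite E.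
      apply Rabs_le_between. rewrite Rabs_mult. rewrite (Rabs_pos_eq (r/t - IZR j)) by lra.
      assert (h := Rabs_pos t). nra. }
    destruct Hp as [j Hj]. assert (P := per_mul x t 0 j H). rewrite Z.mul_0_r in P. unfold per in P. rewrite shiftq_0 in P.
    replace r with ((r - IZR j*t) + IZR j*t) by ring. rewrite flow_add, P. apply B, Hj. }
  destruct (exists_large_nat (2*M + 1)) as [n [Hn HnR]].
  assert (P := per_mul x s k (Z.of_nat n) Hs).
  assert (b1 := Bd (IZR (Z.of_nat n)*s)). assert (b0 := Bd 0). rewrite P in b1. rewrite flow_zero in b0. simpl in b1.
  assert (Hbig : 2*M + 1 <= Rabs (IZR (Z.of_nat n*k))).
  { rewrite mult_IZR, Rabs_mult, <- INR_IZR_INZ, (Rabs_pos_eq (INR n)) by apply pos_INR.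
    assert (1 <= Rabs (IZR k)) by (rewrite <- abs_IZR; apply IZR_le; lia).
    nra. }
  assert (t1 := Rabs_triang (snd x + IZR (Z.of_nat n*k)) (- snd x)). rewrite Rabs_Ropp in t1.
  replace (snd x + IZR (Z.of_nat n*k) + - snd x) with (IZR (Z.of_nat n*k)) in t1 by ring. lra.
Qed.

(** For x near x0 the point f t x, shifted back by k, is again near x0 and on the level of x, so a
    short piece of orbit closes the gap. The winding number k persists, which makes being essential
    an open and closed condition in a regular band. *)
Lemma per_stable (x0 : R * R) (t a : R) (k : Z) : regular x0 -> per x0 t k -> 0 < a ->
  exists r, 0 < r /\ forall x, near r x0 x -> exists t', Rabs (t' - t) < a /\ per x t' k.
Proof.
  intros Hx Ht Ha. destruct (flow_box x0 a Hx Ha) as [r [Hr Bx]].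
  destruct (flow_near 0 t x0 r Hr) as [r' [Hr' Fn]].
  exists (Rmin r r'). split; [pos|]. intros x Hn.
  assert (n1 : near r x0 x) by (apply (near_mono _ _ _ _ Hn), Rmin_l).
  assert (n2 : near r' x0 x) by (apply (near_mono _ _ _ _ Hn), Rmin_r).
  assert (n3 : near r x0 (shiftq (f t x) (- k))).
  { assert (h := Fn x t n2). rewrite Rminus_diag, Rabs_R0 in h. specialize (h Hr'). rewrite Ht in h.
    apply (near_shift _ _ _ (- k)) in h. rewrite shiftq_shiftq in h.
    replace (k + - k)%Z with 0%Z in h by ring. rewrite shiftq_0 in h. exact h. }
  destruct (Bx _ _ n3 n1) as [s [Hs Es]]; [rewrite val_shift, val_flow; reflexivity|].
  exists (s + t). split; [rabs|].
  unfold per. rewrite flow_add. rewrite flow_shift in Es. apply (shiftq_inj _ _ (- k)).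
  rewrite Es, shiftq_shiftq. replace (k + - k)%Z with 0%Z by ring. rewrite shiftq_0. reflexivity.
Qed.

Lemma infinite_pigeonhole (N : nat) (Q : nat -> nat -> Prop) : (forall n, exists i, (i < N)%nat /\ Q n i) ->
  exists i, forall m, exists n, (m <= n)%nat /\ Q n i.
Proof.
  revert Q. induction N as [|N IH]; intros Q H; [destruct (H O) as [i [Hi _]]; lia|].
  destruct (classic (forall m, exists n, (m <= n)%nat /\ Q n N)) as [h|h]; [exists N; exact h|].
  apply not_all_ex_not in h. destruct h as [m0 Hm0].
  destruct (IH (fun n i => Q (m0 + n)%nat i)) as [i Hi].
  - intros n. destruct (H (m0 + n)%nat) as [i [Hi HQ]]. exists i. split; [|pos].
    destruct (Nat.eq_dec i N) as [->|]; [|lia]. exfalso. apply Hm0. exists (m0 + n)%nat. split; [lia|pos].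
  - exists i. intros m. destruct (Hi m) as [n [Hn HQ]]. exists (m0 + n)%nat. split; [lia|pos].
Qed.

Lemma level_bounded : exists K, 0 < K /\ forall x, val x <> 0 -> - K <= fst x <= K.
Proof.
  destruct A as [_ [_ [K HK]]]. exists (Rabs K + 1). split; [rabs|].
  intros x Hx. apply Rabs_le_between. apply Rnot_lt_le. intros Hlt. apply Hx.
  apply (HK 0). rabs.
Qed.

Lemma exists_frac (x : R * R) : exists k, 0 <= snd (shiftq x k) <= 1.
Proof.
  destruct (floor_ex (snd x)) as [n Hn]. exists (- n)%Z. simpl. rewrite opp_IZR. lra.
Qed.

(* The orbit visits a compact set modulo the deck group, so it returns close to itself; by the flow box it then closes up. *)
Lemma regular_level_periodic (c : R) : c <> 0 -> (forall x, val x = c -> regular x) ->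
  forall x, val x = c -> exists t k, 0 < t /\ per x t k.
Proof.
  intros Hc Hreg x Hx. destruct level_bounded as [K [HK0 HK]].
  destruct (box3_unif 0 0 (- K) K 0 1 (fun _ p q r => forall y y', near r (p, q) y -> near r (p, q) y' -> val y = c -> val y' = c ->
     exists s, Rabs s < / 2 /\ f s y = y')) as [r [Hr Bx]].
  - intros z0 p q r r' H [h1 h2] y y' n1 n2. apply H; eapply near_mono; eassumption.
  - intros z0 p q _ _ _. destruct (Req_dec (val (p, q)) c) as [e|e].
    + destruct (flow_box (p, q) (/ 2) (Hreg _ e)) as [r [Hr Bx]]; [lra|].
      exists (r/2). split; [lra|]. intros z1 p' q' _ h1 h2 y y' n1 n2 e1 e2.
      assert (n0 : near (r/2) (p, q) (p', q')) by (split; assumption).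
      apply Bx; [| |lra]; replace r with (r/2 + r/2) by field; apply (near_triang _ _ _ (p', q')); assumption.
    + assert (He : 0 < Rabs (val (p, q) - c)) by rabs.
      destruct (val_near (p, q) _ He) as [r [Hr Hv]].
      exists (r/2). split; [lra|]. intros z1 p' q' _ h1 h2 y y' n1 n2 e1 e2. exfalso.
      assert (n0 : near (r/2) (p, q) (p', q')) by (split; assumption).
      assert (n3 : near r (p, q) y) by (replace r with (r/2 + r/2) by field; apply (near_triang _ _ _ (p', q')); assumption).
      specialize (Hv y n3). rewrite e1, Rabs_minus_sym in Hv. lra.
  - set (h := r/2).
    destruct (exists_large_nat (2*K/h)) as [N1 [HN1 HN1']]. destruct (exists_large_nat (1/h)) as [N2 [HN2 HN2']].
    assert (Hh : 0 < h) by pos.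
    assert (G1 : 2*K <= INR N1*h).
    { apply (Rmult_le_reg_r (/ h)); [pos|]. replace (INR N1*h * / h) with (INR N1) by (field; lra). exact HN1'. }
    assert (G2 : 1 <= INR N2*h).
    { apply (Rmult_le_reg_r (/ h)); [pos|]. replace (INR N2*h * / h) with (INR N2) by (field; lra). exact HN2'. }
    (* At the integer times n, the cell (a, b) of side h = r/2 that contains the normalized orbit
       point is numbered a N2 + b. *)
    destruct (infinite_pigeonhole (N1*N2) (fun n i => exists a b k, (i = a*N2 + b)%nat /\ (b < N2)%nat /\
       INR a*h <= fst (f (INR n) x) + K <= INR (S a)*h /\
       INR b*h <= snd (shiftq (f (INR n) x) k) <= INR (S b)*h /\ 0 <= snd (shiftq (f (INR n) x) k) <= 1)) as [i Hi].
    + intros n. assert (Hv : val (f (INR n) x) <> 0) by (rewrite val_flow, Hx; exact Hc).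
      assert (Hp := HK _ Hv). destruct (exists_frac (f (INR n) x)) as [k Hk].
      destruct (grid_index N1 h (fst (f (INR n) x) + K) HN1) as [a [Ha Ha']]; [lra|].
      destruct (grid_index N2 h (snd (shiftq (f (INR n) x) k)) HN2) as [b [Hb Hb']]; [lra|].
      exists (a*N2 + b)%nat. split; [nia|]. exists a, b, k. auto.
    + destruct (Hi O) as [m [_ [a [b [k [Ei [Hb [Ha1 [Hb1 Hq1]]]]]]]]].
      destruct (Hi (S m)) as [n [Hn [a' [b' [k' [Ei' [Hb' [Ha2 [Hb2 Hq2]]]]]]]]].
      assert (a' = a /\ b' = b) as [-> ->].
      { rewrite Ei in Ei'. assert (E1 := Nat.div_add_l a N2 b). assert (E2 := Nat.div_add_l a' N2 b').
        rewrite (Nat.div_small b N2) in E1 by exact Hb. rewrite (Nat.div_small b' N2) in E2 by exact Hb'.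
        assert (a' = a) by (rewrite <- (Nat.add_0_r a'), <- E2, <- Ei', E1; lia). subst a'. split; [reflexivity|lia]. }
      rewrite S_INR in Ha1, Ha2, Hb1, Hb2.
      set (ym := shiftq (f (INR m) x) k) in *. set (yn := shiftq (f (INR n) x) k') in *.
      assert (Em : val ym = c) by (unfold ym; rewrite val_shift, val_flow; exact Hx).
      assert (En : val yn = c) by (unfold yn; rewrite val_shift, val_flow; exact Hx).
      assert (Kb : - K <= fst ym <= K) by (apply HK; rewrite Em; exact Hc).
      destruct (Bx 0 (fst ym) (snd ym) (conj (Rle_refl 0) (Rle_refl 0)) Kb Hq1 yn ym) as [s [Hs Es]]; try assumption.
      * split; [change (Rabs (fst yn - fst ym) < r)|change (Rabs (snd yn - snd ym) < r)]; unfold h in *.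
        -- change (fst ym) with (fst (f (INR m) x)). change (fst yn) with (fst (f (INR n) x)).
           apply Rabs_lt_between; lra.
        -- apply Rabs_lt_between; lra.
      * rewrite <- surjective_pairing. apply near_refl, Hr.
      (* The correction s is below 1/2 in absolute value and n - m is at least 1, so the period is
         positive. *)
      * exists (s + INR n - INR m), (- k' + k)%Z. abs Hs. split.
        -- assert (INR (S m) <= INR n) by (apply le_INR; exact Hn). rewrite S_INR in H. lra.
        -- unfold per. unfold yn in Es. rewrite flow_shift, <- flow_add in Es. unfold ym in Es.
           replace (s + INR n - INR m) with (- INR m + (s + INR n)) by ring. rewrite flow_add.
           assert (E : f (s + INR n) x = shiftq (f (INR m) x) (- k' + k)).
           { apply (shiftq_inj _ _ k'). rewrite Es, shiftq_shiftq. f_equal. ring. }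
           rewrite E, flow_shift, flow_inv. reflexivity.
Qed.

End Orbits.

(** A nonzero deck shift needs a displacement of at least 1 in q, which takes time by the speed
    bound; with zero shift, the orbit would contradict the transit estimate near x. *)
Lemma no_short_period (F : R -> R -> R) (f : isotopy) (x : R * R) : adm F ->
  flow_of F f -> regular F x -> exists a, 0 < a /\ forall t k, 0 < t < a -> ~ per f x t k.
Proof.
  intros A Hf Hx. destruct (flow_transit F f A Hf x Hx) as [HG [r [Hr [a [Ha [_ [_ P3]]]]]]].
  destruct (flow_speed _ f A Hf 1) as [M [HM Sp]].
  exists (Rmin a (Rmin 1 (/ (2*M)))). split; [pos|].
  intros t k [Ht0 Ht] P. rmin Ht [t1 Ht]. rmin Ht [t2 t3].
  destruct (Sp t 0 x) as [_ s2]; [rabs|rabs|].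
  rewrite (flow_0 _ f x Hf), P, Rminus_0_r, (Rabs_pos_eq t) in s2 by lra. simpl in s2.
  replace (snd x + IZR k - snd x) with (IZR k) in s2 by ring.
  assert (M*t <= / 2). { apply Rle_trans with (M * / (2*M)); [pos|right; field; lra]. }
  assert (k = 0%Z).
  { rewrite <- abs_IZR in s2. assert (Hk : IZR (Z.abs k) < 1) by lra. apply lt_IZR in Hk. lia. }
  subst k. assert (Hr2 : 0 < r/2) by lra. assert (g := P3 x 0 t (near_refl (r/2) x Hr2)). rewrite P, (flow_0 _ f x Hf), shiftq_0, !Rminus_diag in g.
  nra.
Qed.

(** Choose a period T within a of the infimum - m of the positive periods. A smaller positive period
    t would make T - t a period below a, which [no_short_period] excludes; so T is least and divides
    every period. The periods are negated because [completeness] yields suprema. *)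
Lemma least_period (F : R -> R -> R) (f : isotopy) (x : R * R) : adm F ->
  flow_of F f -> regular F x -> (exists t k, 0 < t /\ per f x t k) ->
  exists T k0, 0 < T /\ per f x T k0 /\ forall t k, per f x t k -> exists j, t = IZR j*T.
Proof.
  intros A Hf Hx [t1 [k1 [Ht1 P1]]]. destruct (no_short_period F f x A Hf Hx) as [a [Ha Ns]].
  set (E := fun s => exists t, s = - t /\ 0 < t /\ exists k, per f x t k).
  assert (Bd : bound E). { exists 0. intros s [t [-> [Ht _]]]. lra. }
  destruct (completeness E Bd) as [m [Ub Lub]]; [exists (- t1), t1; split; [lra|split; [lra|exists k1; exact P1]]|].
  assert (Ex : exists t, 0 < t /\ t < - m + a /\ exists k, per f x t k).
  { apply NNPP. intros Hn. assert (h : m <= m - a); [|lra]. apply Lub. intros s [t [-> [Ht [k P]]]].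
    apply Rnot_lt_le. intros Hlt. apply Hn. exists t. split; [lra|]. split; [lra|exists k; exact P]. }
  destruct Ex as [T [HT [HTm [k0 PT]]]].
  assert (Hmin : forall t k, 0 < t < T -> ~ per f x t k).
  { intros t k Ht P. assert (h : - t <= m) by (apply Ub; exists t; split; [lra|split; [lra|exists k; exact P]]).
    apply (Ns (T - t) (k0 - k)%Z); [lra|]. apply (per_add F f A Hf x T (- t) k0 (- k)); [pos|].
    apply (per_opp F f A Hf), P. }
  exists T, k0. split; [lra|split; [pos|]]. intros t k P.
  destruct (floor_ex (t/T)) as [j Hj]. exists j.
  assert (Ej : t - IZR j*T = (t/T - IZR j)*T) by (field; lra).
  assert (Pj : per f x (t - IZR j*T) (k - j*k0)).
  { apply (per_add F f A Hf x t (- (IZR j*T)) k (- (j*k0))); [exact P|].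
    apply (per_opp F f A Hf), (per_mul F f A Hf), PT. }
  destruct (Req_dec (t - IZR j*T) 0) as [h|h]; [lra|]. exfalso.
  apply (Hmin (t - IZR j*T) (k - j*k0)%Z); [|pos]. rewrite Ej in *. split.
  - all: nra.
  - all: lra.
Qed.

(** The circle is the orbit run through its least period modulo the deck group: that all such
    periods are multiples of T is exactly injectivity on the cylinder, and a zero shift k0 would
    make the orbit inessential. *)
Lemma essential_embedded_circle (F : R -> R -> R) (f : isotopy) (c : R) (x : R * R) : adm F ->
  flow_of F f -> c <> 0 -> (forall y, val F y = c -> regular F y) -> val F x = c -> essential f x ->
  exists gamma, noncontractible_embedded_circle_in_level F c gamma.
Proof.
  intros A Hf Hc Hreg Hx He.
  destruct (least_period F f x A Hf (Hreg x Hx) (regular_level_periodic F f A Hf c Hc Hreg x Hx)) as [T [k0 [HT [PT Hper]]]].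
  assert (Hk0 : k0 <> 0%Z).
  { intros ->. apply (closed_orbit_inessential F f A Hf x T); [lra|pos|pos]. }
  exists (fun s => f (s*T) x). split; [|split; [|split]].
  - intros s. apply filterlim_locally. intros eps.
    destruct (flow_near F f A Hf 0 (s*T) x eps (cond_pos eps)) as [r [Hr Fn]].
    assert (Hd : 0 < r/T) by pos. exists (mkposreal _ Hd). intros s' Hs'.
    assert (Hb : Rabs (s' - s) < r/T) by exact Hs'.
    destruct (Fn x (s'*T)) as [n1 n2]; [apply near_refl, Hr| |split; assumption].
    rewrite <- Rmult_minus_distr_r, Rabs_mult, (Rabs_pos_eq T) by lra.
    apply (Rmult_lt_reg_r (/ T)); [pos|]. rewrite Rmult_assoc, Rinv_r by lra. lra.
  - exists k0. split; [pos|]. intros s. rewrite Rmult_plus_distr_r, Rmult_1_l, (flow_add F f A Hf), PT, (flow_shift F f A Hf).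
    reflexivity.
  - intros s s' E1 [m E2]. assert (E : f (s*T) x = shiftq (f (s'*T) x) m).
    { rewrite (surjective_pairing (f (s*T) x)), E1, E2. reflexivity. }
    assert (P : per f x ((s - s')*T) m).
    { unfold per. replace ((s - s')*T) with (- (s'*T) + s*T) by ring. rewrite (flow_add F f A Hf), E.
      rewrite (flow_shift F f A Hf), (flow_inv F f A Hf). reflexivity. }
    destruct (Hper _ _ P) as [j Ej]. exists j. apply Rmult_eq_reg_r in Ej; lra.
  - intros s. rewrite <- Hx. apply (val_flow F f A Hf).
Qed.

(** * A branch of q above an inessential band *)

Lemma closed_orbit_reduce (F : R -> R -> R) (f : isotopy) (x : R * R) (T : R) : adm F ->
  flow_of F f -> 0 < T -> per f x T 0 -> forall t, exists t', 0 <= t' <= T /\ f t x = f t' x.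
Proof.
  intros A Hf HT P t. destruct (floor_ex (t/T)) as [j Hj]. exists (t - IZR j*T).
  assert (E : t - IZR j*T = (t/T - IZR j)*T) by (field; lra). split.
  - rewrite E. split; [pos|]. assert ((t/T - IZR j)*T <= 1*T) by pos. lra.
  - assert (Pj := per_mul F f A Hf x T 0 j P). rewrite Z.mul_0_r in Pj. unfold per in Pj. rewrite shiftq_0 in Pj.
    replace t with ((t - IZR j*T) + IZR j*T) at 1 by ring. rewrite (flow_add F f A Hf), Pj. reflexivity.
Qed.

Lemma RInt_cont_derive (g : R -> R) (a x : R) : (forall s, continuous g s) -> is_derive (fun t => RInt g a t) x (g x).
Proof.
  intros Hg. apply (is_derive_RInt g _ a).
  - exists (mkposreal 1 Rlt_0_1). intros s _. apply (RInt_correct (V := R_CompleteNormedModule) g a s).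
    apply (ex_RInt_continuous (V := R_CompleteNormedModule) g). all: auto.
Qed.

Lemma RInt_of_derive (u du : R -> R) (a b : R) : (forall x, Rmin a b <= x <= Rmax a b -> is_derive u x (du x)) ->
  (forall x, continuous du x) -> RInt du a b = u b - u a.
Proof.
  intros H Hc. apply (is_RInt_unique (V := R_CompleteNormedModule)). apply (is_RInt_derive (V := R_CompleteNormedModule) u du a b H).
  auto.
Qed.

Lemma RInt_chasles_R (g : R -> R) (a b c : R) : (forall x, continuous g x) -> RInt g a c = RInt g a b + RInt g b c.
Proof.
  intros Hg. symmetry. apply (RInt_Chasles g a b c);
  apply (ex_RInt_continuous (V := R_CompleteNormedModule) g); intros; apply Hg.
Qed.

Section Branch.
Context (F : R -> R -> R) (f : isotopy) (c1 c2 : R).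
Context (A : adm F) (Hf : flow_of F f).
Context (Hc1 : 0 < c1) (Hc12 : c1 < c2) (Hreg : regular_on F c1 c2).
Context (Hin : forall x, c1 < val F x < c2 -> ~ essential f x).

Lemma reg_point (x : R * R) : c1 <= val F x <= c2 -> regular F x.
Proof. intros H. exact (Hreg (fst x) (snd x) H). Qed.

Lemma closed_orbit (x : R * R) : c1 < val F x < c2 -> exists T, 0 < T /\ per f x T 0.
Proof.
  intros Hx. destruct (regular_level_periodic F f A Hf (val F x)) with (x := x) as [T [k [HT P]]]; [lra| |lra|].
  - intros y Hy. apply reg_point. rewrite Hy. lra.
  - exists T. split; [lra|]. destruct (Z.eq_dec k 0) as [->|Hk]; [exact P|].
    exfalso. apply (Hin x Hx). exists T, k. auto.
Qed.

Definition qbar (x : R * R) : R := real (Lub_Rbar (fun y => exists t, y = snd (f t x))).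

Lemma qbar_spec (x : R * R) : c1 < val F x < c2 -> (forall t, snd (f t x) <= qbar x) /\
  (forall m, (forall t, snd (f t x) <= m) -> qbar x <= m).
Proof.
  intros Hx. destruct (closed_orbit x Hx) as [T [HT P]].
  destruct (cont_bounded (fun s => snd (f s x)) 0 T (orbit_q_cont F f Hf x)) as [M [HM B]].
  assert (Bd : forall t, snd (f t x) <= M).
  { intros t. destruct (closed_orbit_reduce F f x T A Hf HT P t) as [t' [Ht' ->]].
    specialize (B t' Ht'). rabs. }
  destruct (lub_real (fun y => exists t, y = snd (f t x)) (snd (f 0 x)) M (ex_intro _ 0 eq_refl)) as [U L]; [intros y [t ->]; apply Bd|].
  split; [intros t; apply U; exists t; reflexivity|]. intros m Hm. apply L. intros y [t ->]. apply Hm.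
Qed.

Lemma qbar_flow (x : R * R) (s : R) : c1 < val F x < c2 -> qbar (f s x) = qbar x.
Proof.
  intros Hx. assert (Hs : c1 < val F (f s x) < c2) by (rewrite (val_flow F f A Hf); exact Hx).
  destruct (qbar_spec x Hx) as [u1 l1]. destruct (qbar_spec _ Hs) as [u2 l2]. apply Rle_antisym.
  - apply l2. intros t. rewrite <- (flow_add F f A Hf). apply u1.
  - apply l1. intros t. replace (f t x) with (f (t - s) (f s x)); [apply u2|]. rewrite <- (flow_add F f A Hf). f_equal. ring.
Qed.

Lemma qbar_shift (x : R * R) (k : Z) : c1 < val F x < c2 -> qbar (shiftq x k) = qbar x + IZR k.
Proof.
  intros Hx. assert (Hs : c1 < val F (shiftq x k) < c2) by (rewrite (val_shift F A); exact Hx).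
  destruct (qbar_spec x Hx) as [u1 l1]. destruct (qbar_spec _ Hs) as [u2 l2]. apply Rle_antisym.
  - apply l2. intros t. rewrite (flow_shift F f A Hf). simpl. specialize (u1 t). lra.
  - assert (h : qbar x <= qbar (shiftq x k) - IZR k); [|lra]. apply l1. intros t. specialize (u2 t).
    rewrite (flow_shift F f A Hf) in u2. simpl in u2. lra.
Qed.

Lemma val_open (x : R * R) (a b : R) : a < val F x < b -> exists r, 0 < r /\ forall y, near r x y -> a < val F y < b.
Proof.
  intros Hx. destruct (val_near F A x (Rmin (val F x - a) (b - val F x))) as [r [Hr H]]; [pos|].
  exists r. split; [lra|]. intros y Hy. specialize (H y Hy). apply Rmin_lt_inv in H. rabs.
Qed.

(** The nearby orbit closes up after a time below 2T, so the two maxima are compared by following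
    both orbits over [0, 2T], where the flow is uniformly continuous in its starting point. *)
Lemma qbar_near (x : R * R) (eps : R) : c1 < val F x < c2 -> 0 < eps ->
  exists r, 0 < r /\ forall y, near r x y -> Rabs (qbar y - qbar x) < eps.
Proof.
  intros Hx He. destruct (closed_orbit x Hx) as [T [HT P]].
  destruct (per_stable F f A Hf x T (T/2) 0) as [r1 [Hr1 S1]]; [apply reg_point; lra|exact P|lra|].
  destruct (val_open x c1 c2 Hx) as [r2 [Hr2 S2]].
  destruct (cont3_tube _ (2*T) (fst x) (snd x) (eps/2) (proj2 (flow_cont3 _ f A Hf))) as [r3 [Hr3 S3]]; [lra|].
  exists (Rmin r1 (Rmin r2 r3)). split; [pos|]. intros y Hy.
  assert (n1 : near r1 x y) by (apply (near_mono _ _ _ _ Hy), Rmin_l).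
  assert (n2 : near r2 x y) by (apply (near_mono _ _ _ _ Hy); eapply Rle_trans; [apply Rmin_r|apply Rmin_l]).
  assert (n3 : near r3 x y) by (apply (near_mono _ _ _ _ Hy); eapply Rle_trans; [apply Rmin_r|apply Rmin_r]).
  destruct (S1 y n1) as [T' [HT' P']]. abs HT'.
  assert (Hy' := S2 y n2). destruct n3 as [m1 m2].
  assert (Cl : forall t, 0 <= t <= 2*T -> Rabs (snd (f t y) - snd (f t x)) < eps/2).
  { intros t Ht. assert (h := S3 t (fst y) (snd y)). rewrite <- !surjective_pairing in h. apply h; try assumption.
    rabs. }
  destruct (qbar_spec x Hx) as [u1 l1]. destruct (qbar_spec y Hy') as [u2 l2].
  assert (B1 : qbar y <= qbar x + eps/2).
  { apply l2. intros t. destruct (closed_orbit_reduce F f y T' A Hf ltac:(lra) P' t) as [t' [Ht' ->]].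
    assert (h := Cl t' ltac:(lra)). abs h. specialize (u1 t'). lra. }
  assert (B2 : qbar x <= qbar y + eps/2).
  { apply l1. intros t. destruct (closed_orbit_reduce F f x T A Hf HT P t) as [t' [Ht' ->]].
    assert (h := Cl t' ltac:(lra)). abs h. specialize (u2 t'). lra. }
  rabs.
Qed.

(** [lam] rises from 0 to 1 within the middle third of the band, so its derivative vanishes towards
    the ends of the band, where nothing is known about [qbar]. *)
Let d1 := c1 + (c2 - c1)/3.
Let d2 := c1 + 2*(c2 - c1)/3.
Let lam := step d1 d2.
Let dlam := Derive lam.

Lemma d12 : c1 < d1 /\ d1 < d2 /\ d2 < c2.
Proof. pos. Qed.

Lemma lam_facts : (forall y, is_derive lam y (dlam y)) /\ (forall y, continuous dlam y) /\
  (forall y, y < d1 -> lam y = 0 /\ dlam y = 0) /\ (forall y, d2 < y -> lam y = 1 /\ dlam y = 0).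
Proof.
  destruct d12 as [h1 [h2 h3]]. destruct (smooth1_derive lam (step_smooth d1 d2 h2)) as [S D].
  split; [exact D|]. split.
  - intros y. destruct (smooth1_derive _ S) as [_ D']. exact (is_derive_cont _ _ _ (D' y)).
  - split; intros y Hy.
    + split; [apply step_0; lra|]. apply is_derive_unique. apply (locally_const_derive0 lam (y - 1) d1 0); [|lra].
      intros z Hz. apply step_0; lra.
    + split; [apply step_1; lra|]. apply is_derive_unique. apply (locally_const_derive0 lam d2 (y + 1) 1); [|lra].
      intros z Hz. apply step_1; lra.
Qed.

(** The form zeta dF + lam(F) dq, with components [betaP] and [betaQ], equals d(lam(F) q) - qbar
    lam'(F) dF in the band. It is closed because [qbar] is locally a function of F, and deck
    invariant because q and [qbar] shift together. It vanishes below the band and is dq above it, so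
    a primitive is a branch of q up to local constants. *)
Definition zeta (x : R * R) : R := if Rlt_dec c1 (val F x) then if Rlt_dec (val F x) c2 then (snd x - qbar x)*dlam (val F x) else 0 else 0.

Lemma zeta_in (x : R * R) : c1 < val F x < c2 -> zeta x = (snd x - qbar x)*dlam (val F x).
Proof. intros [h1 h2]. unfold zeta. destruct (Rlt_dec c1 (val F x)), (Rlt_dec (val F x) c2); try lra. Qed.

Lemma zeta_out (x : R * R) : val F x < d1 \/ d2 < val F x -> zeta x = 0.
Proof.
  intros H. destruct lam_facts as [_ [_ [L1 L2]]]. unfold zeta.
  destruct (Rlt_dec c1 (val F x)), (Rlt_dec (val F x) c2); try reflexivity.
  destruct H as [H|H]; [rewrite (proj2 (L1 _ H))|rewrite (proj2 (L2 _ H))]; ring.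
Qed.

Lemma zeta_shift (x : R * R) (k : Z) : zeta (shiftq x k) = zeta x.
Proof.
  unfold zeta. rewrite (val_shift F A). destruct (Rlt_dec c1 (val F x)), (Rlt_dec (val F x) c2); try reflexivity.
  rewrite qbar_shift by lra. simpl. ring.
Qed.

Lemma level_cases (x : R * R) : val F x < d1 \/ d2 < val F x \/ c1 < val F x < c2.
Proof. pos. Qed.

Lemma zeta_near (x : R * R) (eps : R) : 0 < eps -> exists r, 0 < r /\ forall y, near r x y -> Rabs (zeta y - zeta x) < eps.
Proof.
  intros He. destruct lam_facts as [LD [LC [L1 L2]]].
  assert (Out : forall a b, a < val F x < b -> (forall y, a < val F y < b -> zeta y = 0) ->
     exists r, 0 < r /\ forall y, near r x y -> Rabs (zeta y - zeta x) < eps).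
  { intros a b Hx Hz. destruct (val_open x a b Hx) as [r [Hr H]]. exists r. split; [lra|]. intros y Hy.
    rewrite (Hz y (H y Hy)), (Hz x Hx), Rminus_diag, Rabs_R0. exact He. }
  destruct (level_cases x) as [h|[h|h]].
  - apply (Out (val F x - 1) d1); [lra|]. intros y Hy. apply zeta_out. lra.
  - apply (Out d2 (val F x + 1)); [lra|]. intros y Hy. apply zeta_out. lra.
  - destruct (mult_close (snd x - qbar x) (dlam (val F x)) eps He) as [d [Hd Mc]].
    destruct (val_open x c1 c2 h) as [r1 [Hr1 S1]].
    destruct (qbar_near x (d/2) h) as [r2 [Hr2 S2]]; [lra|].
    destruct (continuous_eps dlam (val F x) d (LC _) Hd) as [e [Hee S3]].
    destruct (val_near F A x e Hee) as [r3 [Hr3 S4]].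
    exists (Rmin (d/2) (Rmin r1 (Rmin r2 r3))). split; [pos|]. intros y [Hy1 Hy2].
    rmin Hy1 [a1 Hy1]. rmin Hy1 [a2 Hy1].
    rmin Hy1 [a3 a4].
    rmin Hy2 [b1 Hy2]. rmin Hy2 [b2 Hy2].
    rmin Hy2 [b3 b4].
    rewrite (zeta_in x h), (zeta_in y) by (apply S1; split; assumption). apply Mc.
    + assert (g := S2 y (conj a3 b3)). abs g. abs b1. apply Rabs_lt_between. lra.
    + apply S3, S4. split; assumption.
Qed.

Definition betaP (p q : R) : R := zeta (p, q)*dP F p q.
Definition betaQ (p q : R) : R := zeta (p, q)*dQ F p q + lam (F p q).

Lemma beta_near (x : R * R) (eps : R) : 0 < eps -> exists r, 0 < r /\ forall y, near r x y ->
  Rabs (betaP (fst y) (snd y) - betaP (fst x) (snd x)) < eps /\ Rabs (betaQ (fst y) (snd y) - betaQ (fst x) (snd x)) < eps.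
Proof.
  intros He. destruct lam_facts as [LD [LC [L1 L2]]].
  destruct (mult_close (zeta x) (dP F (fst x) (snd x)) eps He) as [e1 [He1 M1]].
  destruct (mult_close (zeta x) (dQ F (fst x) (snd x)) (eps/2)) as [e2 [He2 M2]]; [lra|].
  set (e := Rmin e1 e2). assert (Hee : 0 < e) by pos.
  destruct (zeta_near x e Hee) as [r1 [Hr1 S1]]. destruct (gradient_near F A x e Hee) as [r2 [Hr2 S2]].
  destruct (continuous_eps lam (val F x) (eps/2) (is_derive_cont _ _ _ (LD _))) as [e3 [He3 S3]]; [lra|].
  destruct (val_near F A x e3 He3) as [r3 [Hr3 S4]].
  exists (Rmin r1 (Rmin r2 r3)). split; [pos|]. intros y Hy.
  assert (n1 : near r1 x y) by (apply (near_mono _ _ _ _ Hy), Rmin_l).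
  assert (n2 : near r2 x y) by (apply (near_mono _ _ _ _ Hy); eapply Rle_trans; [apply Rmin_r|apply Rmin_l]).
  assert (n3 : near r3 x y) by (apply (near_mono _ _ _ _ Hy); eapply Rle_trans; [apply Rmin_r|apply Rmin_r]).
  specialize (S1 y n1). destruct (S2 y n2) as [g1 g2]. specialize (S3 _ (S4 y n3)).
  apply Rmin_lt_inv in S1. apply Rmin_lt_inv in g1. apply Rmin_lt_inv in g2.
  unfold betaP, betaQ. rewrite <- !surjective_pairing. split; [apply M1; tauto|].
  assert (g3 : Rabs (zeta y*dQ F (fst y) (snd y) - zeta x*dQ F (fst x) (snd x)) < eps/2) by (apply M2; tauto).
  fold (val F y). fold (val F x). rabs.
Qed.

Lemma beta_cont (p q : R) : continuous (fun s => betaP s q) p /\ continuous (fun s => betaQ p s) q.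
Proof.
  split; apply eps_continuous; intros eps He; destruct (beta_near (p, q) eps He) as [r [Hr H]]; exists r; (split; [lra|]); intros y Hy.
  - apply (H (y, q)). split; [pos|simpl; rewrite Rminus_diag, Rabs_R0; exact Hr].
  - apply (H (p, y)). split; [simpl; rewrite Rminus_diag, Rabs_R0; exact Hr|pos].
Qed.

(** By the flow box, points near x0 on one level lie on one orbit and share [qbar]. The function g
    reads [qbar] off a short segment z through x0 in gradient direction, along which F increases at
    rate at least G/2; clipping the level makes g defined and continuous on all of R. *)
Lemma qbar_function_of_level (x0 : R * R) : c1 < val F x0 < c2 -> exists r g, 0 < r /\ (forall y, continuous g y) /\
  forall x, near r x0 x -> c1 < val F x < c2 /\ qbar x = g (val F x).
Proof.
  intros Hx. assert (Rx : regular F x0) by (apply reg_point; lra).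
  destruct (flow_transit F f A Hf x0 Rx) as [HG [r [Hr [_ [_ [P1 _]]]]]].
  set (gp := dP F (fst x0) (snd x0)) in *. set (gq := dQ F (fst x0) (snd x0)) in *. set (G := gp*gp + gq*gq) in *.
  destruct (flow_box F f A Hf x0 1 Rx Rlt_0_1) as [rb [Hrb Bx]].
  destruct (val_open x0 c1 c2 Hx) as [rv [Hrv Ov]].
  set (S := Rabs gp + Rabs gq + 1). assert (h1 := Rabs_pos gp). assert (h2 := Rabs_pos gq).
  set (m := Rmin r (Rmin rb rv)). assert (Hm : 0 < m) by pos.
  set (d := m/(2*S)). assert (Hd : 0 < d) by pos.
  set (z := fun u => (fst x0 + u*gp, snd x0 + u*gq)).
  assert (dS : d*S = m/2) by (unfold d; field; unfold S; lra).
  assert (Zn : forall u, Rabs u <= d -> near m x0 (z u)).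
  { intros u Hu. split; simpl.
    - replace (fst x0 + u*gp - fst x0) with (u*gp) by ring. rewrite Rabs_mult.
      assert (Rabs u*Rabs gp <= d*S) by pos. lra.
    - replace (snd x0 + u*gq - snd x0) with (u*gq) by ring. rewrite Rabs_mult.
      assert (Rabs u*Rabs gq <= d*S) by pos. lra. }
  assert (m1 : m <= r) by apply Rmin_l.
  assert (m2 : m <= rb) by (eapply Rle_trans; [apply Rmin_r|apply Rmin_l]).
  assert (m3 : m <= rv) by (eapply Rle_trans; [apply Rmin_r|apply Rmin_r]).
  set (phi := fun u => val F (z u)).
  assert (Dphi : forall u, is_derive phi u (dP F (fst (z u)) (snd (z u))*gp + dQ F (fst (z u)) (snd (z u))*gq)).
  { intros u. apply (smooth_autonomous_comp F (fun u => fst x0 + u*gp) (fun u => snd x0 + u*gq) u gp gq A);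
    auto_derive; trivial; ring. }
  assert (Mono : forall u v, - d <= u -> u <= v -> v <= d -> G/2*(v - u) <= phi v - phi u).
  { intros u v hu huv hv. destruct (mvt phi _ u v (fun w _ => Dphi w)) as [c [Hc Em]].
    rewrite Rmin_left, Rmax_right in Hc by lra. rewrite Em. apply Rmult_le_compat_r; [lra|].
    apply P1. apply (near_mono m); [apply Zn, Rabs_le_between; lra|lra]. }
  assert (phi0 : phi 0 = val F x0) by (unfold phi, z, val; simpl; f_equal; ring).
  assert (Hlo : phi (- d) < val F x0).
  { assert (h := Mono (- d) 0). nra. }
  assert (Hhi : val F x0 < phi d).
  { assert (h := Mono 0 d). nra. }
  assert (Inv : forall y, exists u, - d <= u <= d /\ phi u = clip (phi (- d)) (phi d) y).
  { intros y. destruct (IVT_gen phi (- d) d (clip (phi (- d)) (phi d) y)) as [u [Hu Eu]].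
    - intros u. apply continuity_pt_filterlim. apply (is_derive_cont _ _ _ (Dphi u)).
    - rewrite Rmin_left, Rmax_right by lra. minmax.
    - rewrite Rmin_left, Rmax_right in Hu by lra. exists u. auto. }
  set (uu := fun y => proj1_sig (cid (Inv y))).
  assert (Huu : forall y, - d <= uu y <= d /\ phi (uu y) = clip (phi (- d)) (phi d) y).
  { intros y. unfold uu. destruct (cid (Inv y)) as [u Hu]. exact Hu. }
  assert (Lip : forall y y', G/2*Rabs (uu y - uu y') <= Rabs (y - y')).
  { intros y y'. destruct (Huu y) as [k1 k2]. destruct (Huu y') as [k3 k4].
    assert (Cl : Rabs (clip (phi (- d)) (phi d) y - clip (phi (- d)) (phi d) y') <= Rabs (y - y')).
    { unfold Rabs. minmax; repeat (destruct (Rcase_abs _)); lra. }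
    eapply Rle_trans; [|exact Cl]. rewrite <- k2, <- k4. destruct (Rle_dec (uu y) (uu y')) as [g|g].
    - assert (hh := Mono (uu y) (uu y') (proj1 k1) g (proj2 k3)).
      assert (0 <= G/2*(uu y' - uu y)) by pos.
      rewrite Rabs_minus_sym, (Rabs_minus_sym (phi _)). rewrite !Rabs_pos_eq; lra.
    - assert (hh := Mono (uu y') (uu y) (proj1 k3) ltac:(lra) (proj2 k1)).
      assert (0 <= G/2*(uu y - uu y')) by pos. rewrite !Rabs_pos_eq; lra. }
  destruct (val_near F A x0 (Rmin (val F x0 - phi (- d)) (phi d - val F x0))) as [rw [Hrw Sw]]; [pos|].
  assert (Vz : forall y, c1 < val F (z (uu y)) < c2).
  { intros y. apply Ov. apply (near_mono m); [|lra]. apply Zn. apply Rabs_le_between. apply Huu. }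
  exists (Rmin m rw), (fun y => qbar (z (uu y))). split; [pos|]. split.
  - intros y. apply eps_continuous. intros eps He.
    destruct (qbar_near (z (uu y)) eps (Vz y) He) as [e [Hee Q]].
    exists (e*G/(2*S)). split; [pos|].
    intros y' Hy'. apply Q. assert (L := Lip y' y).
    assert (B : Rabs (uu y' - uu y)*S < e).
    { apply (Rmult_lt_reg_r (G/(2*S))); [pos|].
      replace (Rabs (uu y' - uu y)*S*(G/(2*S))) with (G/2*Rabs (uu y' - uu y)) by (field; unfold S; lra).
      lra. }
    split; simpl.
    + replace (fst x0 + uu y'*gp - (fst x0 + uu y*gp)) with ((uu y' - uu y)*gp) by ring. rewrite Rabs_mult.
      assert (Rabs (uu y' - uu y)*Rabs gp <= Rabs (uu y' - uu y)*S) by pos. lra.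
    + replace (snd x0 + uu y'*gq - (snd x0 + uu y*gq)) with ((uu y' - uu y)*gq) by ring. rewrite Rabs_mult.
      assert (Rabs (uu y' - uu y)*Rabs gq <= Rabs (uu y' - uu y)*S) by pos. lra.
  - intros x Hn. assert (n1 : near m x0 x) by (apply (near_mono _ _ _ _ Hn), Rmin_l).
    assert (n2 : near rw x0 x) by (apply (near_mono _ _ _ _ Hn), Rmin_r).
    assert (Vx : c1 < val F x < c2) by (apply Ov, (near_mono m); assumption). split; [lra|].
    specialize (Sw x n2). rmin Sw [w1 w2].
    abs w1. abs w2.
    destruct (Huu (val F x)) as [k1 k2].
    assert (Ev : val F (z (uu (val F x))) = val F x).
    { change (val F (z (uu (val F x)))) with (phi (uu (val F x))). rewrite k2. minmax. }
    destruct (Bx (z (uu (val F x))) x) as [s [_ Es]].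
    + apply (near_mono m); [apply Zn, Rabs_le_between, k1|lra].
    + apply (near_mono m); assumption.
    + exact Ev.
    + rewrite <- Es at 1. apply qbar_flow. apply Vz.
Qed.

Lemma beta_potential (x0 : R * R) : exists r u, 0 < r /\ forall p q, near r x0 (p, q) ->
  is_derive (fun s => u s q) p (betaP p q) /\ is_derive (fun s => u p s) q (betaQ p q).
Proof.
  destruct lam_facts as [LD [LC [L1 L2]]].
  destruct (level_cases x0) as [h|[h|h]].
  - destruct (val_open x0 (val F x0 - 1) d1) as [r [Hr H]]; [lra|].
    exists r, (fun _ _ => 0). split; [lra|]. intros p q Hn. assert (Hv := H _ Hn). unfold betaP, betaQ.
    rewrite zeta_out by lra. unfold val in Hv. simpl in Hv. rewrite (proj1 (L1 _ (proj2 Hv))).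
    replace (0*dP F p q) with 0 by ring. replace (0*dQ F p q + 0) with 0 by ring. split; apply @is_derive_const.
  - destruct (val_open x0 d2 (val F x0 + 1)) as [r [Hr H]]; [lra|].
    exists r, (fun _ q => q). split; [lra|]. intros p q Hn. assert (Hv := H _ Hn). unfold betaP, betaQ.
    rewrite zeta_out by lra. unfold val in Hv. simpl in Hv. rewrite (proj1 (L2 _ (proj1 Hv))).
    replace (0*dP F p q) with 0 by ring. replace (0*dQ F p q + 1) with 1 by ring.
    split; [apply @is_derive_const|apply @is_derive_id].
  - destruct (qbar_function_of_level x0 h) as [r [g [Hr [Cg Hg]]]].
    set (Th := fun y => RInt (fun s => g s*dlam s) 0 y).
    assert (DTh : forall y, is_derive Th y (g y*dlam y)).
    { intros y. apply (RInt_cont_derive (fun s => g s*dlam s)). intros s. apply (continuous_mult g dlam); [apply Cg|apply LC]. }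
    exists r, (fun p q => lam (F p q)*q - Th (F p q)). split; [lra|]. intros p q Hn.
    destruct (Hg _ Hn) as [Vx Q]. destruct (autonomous_partials F A p q) as [a1 a2]. unfold betaP, betaQ.
    rewrite (zeta_in (p, q) Vx), Q. unfold val. simpl.
    assert (Cmp : forall (H : R -> R) (v : R -> R) x lv lH, is_derive v x lv -> is_derive H (v x) lH -> is_derive (fun s => H (v s)) x (lv*lH)).
    { intros H v x lv lH D1 D2. apply (is_derive_comp H v x lH lv D2 D1). }
    split.
    + replace ((q - g (F p q))*dlam (F p q)*dP F p q) with
        ((dP F p q*dlam (F p q))*q + lam (F p q)*0 - dP F p q*(g (F p q)*dlam (F p q))) by ring.
      apply is_derive_minus_R.
      * apply (is_derive_mult_R (fun s => lam (F s q)) (fun _ => q)); [|apply @is_derive_const].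
        exact (Cmp lam (fun s => F s q) p _ _ a1 (LD _)).
      * exact (Cmp Th (fun s => F s q) p _ _ a1 (DTh _)).
    + replace ((q - g (F p q))*dlam (F p q)*dQ F p q + lam (F p q)) with
        ((dQ F p q*dlam (F p q))*q + lam (F p q)*1 - dQ F p q*(g (F p q)*dlam (F p q))) by ring.
      apply is_derive_minus_R.
      * apply (is_derive_mult_R (fun s => lam (F p s)) (fun s => s)); [|apply @is_derive_id].
        all: auto.
Qed.

(** W integrates [betaP] in p from a line left of the support. As [qbar] is only known to be
    continuous, closedness is available through the local potentials rather than through equal cross
    derivatives, and the q-derivative of W has to be found by hand. *)
Lemma branch_exists : exists W : R -> R -> R, (forall p q, W p (q + 1) = W p q) /\
  forall p0 q0, c2 <= F p0 q0 -> exists r, 0 < r /\ forall p q, near r (p0, q0) (p, q) -> W p q - q = W p0 q0 - q0.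
Proof.
  destruct lam_facts as [LD [LC [L1 L2]]]. destruct d12 as [e1 [e2 e3]].
  destruct (level_bounded F A) as [K [HK0 HK]].
  set (m := - (K + 1)).
  assert (Out : forall q, F m q = 0).
  { intros q. apply NNPP. intros Hn. assert (h := HK (m, q) Hn). simpl in h. pos. }
  set (W := fun p q => RInt (fun s => betaP s q) m p).
  set (J := fun p q h => RInt (fun s => betaQ p s) q (q + h)).
  assert (CP : forall q s, continuous (fun s => betaP s q) s) by (intros q s; apply (beta_cont s q)).
  assert (CQ : forall p s, continuous (fun s => betaQ p s) s) by (intros p s; apply (beta_cont p s)).
  (* By the local potentials, W p (q + h) - W p q - J p q h is locally constant in p, and it
     vanishes at p = m. A uniform radius rho carries this across [m, P] in steps of rho/2. *)
  assert (Creep : forall P q, m <= P -> exists rho, 0 < rho /\ forall p h, m <= p <= P -> Rabs h < rho -> W p (q + h) - W p q = J p q h).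
  { intros P q HP.
    destruct (compact_unif m P (fun c rho => forall p p' h, Rabs (p - c) < rho -> Rabs (p' - c) < rho -> Rabs h < rho ->
       W p (q + h) - W p q - J p q h = W p' (q + h) - W p' q - J p' q h)) as [rho [Hrho U]].
    - intros x r r' H Hr p p' h h1 h2 h3. apply H; lra.
    - intros c _. destruct (beta_potential (c, q)) as [r [u [Hr Hu]]].
      exists (r/2). split; [lra|]. intros c' Hc' p p' h h1 h2 h3.
      assert (Hp : Rabs (p - c) < r) by rabs.
      assert (Hp' : Rabs (p' - c) < r) by rabs.
      assert (EW : forall y, Rabs (y - q) < r -> W p y - W p' y = u p y - u p' y).
      { intros y Hy. unfold W. rewrite (RInt_chasles_R (fun s => betaP s y) m p' p (CP y)).
        rewrite (RInt_of_derive (fun s => u s y) (fun s => betaP s y) p' p); [ring| |apply CP].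
        intros x Hx. apply Hu. split; simpl; [|lra].
        abs Hp. abs Hp'. apply Rabs_lt_between.
        revert Hx. unfold Rmin, Rmax. destruct (Rle_dec p' p); lra. }
      assert (EJ : forall x, Rabs (x - c) < r -> J x q h = u x (q + h) - u x q).
      { intros x Hx. apply (RInt_of_derive (fun s => u x s) (fun s => betaQ x s)); [|apply CQ].
        intros y Hy. apply Hu. split; simpl; [lra|]. apply between_dist in Hy.
        replace (q + h - q) with h in Hy by ring. lra. }
      assert (Hq : Rabs (q - q) < r) by rabs.
      assert (Hqh : Rabs (q + h - q) < r) by rabs.
      assert (a1 := EW (q + h) Hqh). assert (a2 := EW q Hq). rewrite (EJ p Hp), (EJ p' Hp'). lra.
    - exists rho. split; [lra|]. intros p h Hp Hh.
      assert (Base : W m (q + h) - W m q - J m q h = 0).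
      { unfold W, J. rewrite !RInt_point.
        rewrite (RInt_ext _ (fun _ => 0)).
        - rewrite RInt_const. unfold scal; simpl; unfold mult; simpl. ring.
        - intros s _. assert (Eb : betaQ m s = 0); [|lra]. unfold betaQ.
          rewrite zeta_out by (left; unfold val; simpl; rewrite Out; lra).
          rewrite Out, (proj1 (L1 0 ltac:(lra))). ring. }
      assert (Step : forall n : nat, forall p, m <= p <= P -> p <= m + INR n*(rho/2) -> W p (q + h) - W p q - J p q h = 0).
      { induction n as [|n IH]; intros p' Hp' Hpn.
        - simpl in Hpn. replace p' with m by lra. exact Base.
        - rewrite S_INR in Hpn. destruct (Rle_dec p' (m + INR n*(rho/2))) as [g|g]; [auto|].
          set (c := Rmax m (p' - rho/2)).
          assert (hc1 : m <= c) by apply Rmax_l. assert (hc2 : p' - rho/2 <= c) by apply Rmax_r.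
          assert (hn : 0 <= INR n) by apply pos_INR.
          assert (hc4 : c <= m + INR n*(rho/2)).
          { apply Rmax_lub; [|lra]. nra. }
          rewrite <- (IH c ltac:(lra) hc4). apply (U c ltac:(lra)); [|rabs|lra].
          rabs. }
      destruct (exists_large_nat ((p - m)/(rho/2))) as [n [_ Hn]].
      assert (E := Step n p Hp). assert (W p (q + h) - W p q - J p q h = 0); [|lra]. apply E.
      assert (p - m <= INR n*(rho/2)); [|lra].
      apply (Rmult_le_reg_r (/ (rho/2))); [pos|].
      replace (INR n*(rho/2) * / (rho/2)) with (INR n) by (field; lra). exact Hn. }
  exists W. split.
  - intros p q. apply RInt_ext. intros s _. unfold betaP.
    assert (E : zeta (s, q + 1) = zeta (s, q)) by (apply (zeta_shift (s, q) 1)). rewrite E.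
    destruct (pc_partial _ 1 (proj1 (admissible_smooth _ A)) (proj2 (admissible_smooth _ A))) as [Pp _].
    f_equal. exact (Pp 0 s q).
  - intros p0 q0 H0.
    assert (Hp0 : m <= p0). { assert (h := HK (p0, q0)). unfold val in h. simpl in h. pos. }
    destruct (val_open (p0, q0) d2 (F p0 q0 + 1)) as [r [Hr Or]]; [unfold val; simpl; lra|].
    destruct (Creep (p0 + r) q0) as [rho [Hrho Cr]]; [lra|].
    exists (Rmin (Rmin r rho) 1). split; [pos|]. intros p q [n1 n2]. simpl in n1, n2.
    rmin n1 [n1 n3]. rmin n1 [n1 n4].
    rmin n2 [n2 n5]. rmin n2 [n2 n6].
    assert (Zr : forall s t, Rabs (s - p0) < r -> Rabs (t - q0) < r -> betaP s t = 0 /\ betaQ s t = 1).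
    { intros s t g1 g2. assert (V := Or (s, t) (conj g1 g2)). unfold betaP, betaQ. rewrite zeta_out by lra.
      unfold val in V. simpl in V. rewrite (proj1 (L2 _ (proj1 V))). lra. }
    assert (Hpm : m <= p).
    { assert (V := Or (p, q0)). assert (Vn : near r (p0, q0) (p, q0)) by (split; simpl; [lra|rabs]).
      specialize (V Vn). assert (h := HK (p, q0)). simpl in h. pos. }
    assert (E1 : W p q - W p q0 = q - q0).
    { replace q with (q0 + (q - q0)) at 1 by ring. rewrite Cr; [|rabs|lra].
      unfold J. rewrite (RInt_ext _ (fun _ => 1)).
      - rewrite RInt_const. unfold scal; simpl; unfold mult; simpl. ring.
      - intros s Hs. apply Zr; [lra|]. abs n2. apply Rabs_lt_between.
        revert Hs. replace (q0 + (q - q0)) with q by ring. unfold Rmin, Rmax. destruct (Rle_dec q0 q); lra. }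
    assert (E2 : W p q0 = W p0 q0).
    { unfold W. rewrite (RInt_chasles_R (fun s => betaP s q0) m p0 p (CP q0)). rewrite (RInt_ext (fun s => betaP s q0) (fun _ => 0) p0 p).
      - rewrite RInt_const. unfold scal; simpl; unfold mult; simpl. ring.
      - intros s Hs. apply Zr; [|rabs]. abs n1. apply Rabs_lt_between.
        revert Hs. unfold Rmin, Rmax. destruct (Rle_dec p0 p); lra. }
    lra.
Qed.

End Branch.

(* An essential loop above the level c2 forces an essential orbit below it: otherwise q would have a
   single-valued branch along the loop. *)
Lemma essential_orbit_below_loop (F : R -> R -> R) (f : isotopy) (c1 c2 E : R) (gamma : R -> R * R) :
  adm F -> flow_of F f -> 0 < c1 -> c1 < c2 -> regular_on F c1 c2 -> c2 <= E ->
  noncontractible_embedded_circle_in_level F E gamma -> exists x, c1 < val F x < c2 /\ essential f x.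
Proof.
  intros A Hf Hc1 Hc12 Hreg HE [Cg [[n [Hn Pg]] [_ Lv]]].
  apply NNPP. intros Hno.
  destruct (branch_exists F f c1 c2 A Hf Hc1 Hc12 Hreg) as [W [PW LW]].
  { intros x Hx He. apply Hno. exists x. auto. }
  set (w := fun s => W (fst (gamma s)) (snd (gamma s)) - snd (gamma s)).
  assert (Dw : forall s, is_derive w s 0).
  { intros s. destruct (LW (fst (gamma s)) (snd (gamma s))) as [r [Hr H]]; [rewrite Lv; exact HE|].
    destruct (proj1 (filterlim_locally gamma (gamma s)) (Cg s) (mkposreal r Hr)) as [d Hd].
    apply (is_derive_near _ (fun _ => w s) _ _ d (cond_pos d)); [|apply @is_derive_const].
    intros y Hy. destruct (Hd y Hy) as [b1 b2]. apply H. split; assumption. }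
  assert (E0 := is_derive_zero_const w Dw 1 0). unfold w in E0.
  assert (Pg0 := Pg 0). rewrite Rplus_0_l in Pg0. rewrite Pg0 in E0. simpl in E0.
  rewrite (periodic_Z (W (fst (gamma 0))) (PW _)) in E0.
  apply Hn. apply eq_IZR. lra.
Qed.

(** * Paths of Hamiltonian diffeomorphisms *)

Definition bounded2 (G : R -> R -> R) : Prop := exists M, forall p q, Rabs (G p q) <= M.

Lemma osc_spec (G : R -> R -> R) : bounded2 G -> (forall p q p' q', G p q - G p' q' <= osc G) /\
  (forall m, (forall p q p' q', G p q - G p' q' <= m) -> osc G <= m).
Proof.
  intros [M HM]. unfold osc. set (S := fun y => exists p q, y = G p q). assert (S0 : forall p q, S (G p q)) by (intros p q; exists p, q; reflexivity).
  destruct (lub_real S (G 0 0) M (S0 0 0)) as [U1 L1]; [intros y [p [q ->]]; specialize (HM p q); abs HM; lra|].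
  destruct (glb_real S (G 0 0) (- M) (S0 0 0)) as [U2 L2]; [intros y [p [q ->]]; specialize (HM p q); abs HM; lra|].
  split.
  - intros p q p' q'. assert (h1 := U1 _ (S0 p q)). assert (h2 := U2 _ (S0 p' q')). lra.
  - intros m Hm. enough (real (Lub_Rbar S) - m <= real (Glb_Rbar S)) by lra. apply L2. intros y [p' [q' ->]].
    enough (real (Lub_Rbar S) <= m + G p' q') by lra. apply L1. intros z [p [q ->]]. specialize (Hm p q p' q'). lra.
Qed.

Lemma osc_nonneg (G : R -> R -> R) : bounded2 G -> 0 <= osc G.
Proof. intros H. destruct (osc_spec G H) as [U _]. specialize (U 0 0 0 0). lra. Qed.

Lemma osc_scal (c : R) (G : R -> R -> R) : 0 <= c -> bounded2 G -> osc (fun p q => c*G p q) = c*osc G.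
Proof.
  intros Hc HG. assert (HcG : bounded2 (fun p q => c*G p q)).
  { destruct HG as [M HM]. exists (c*M). intros p q. rewrite Rabs_mult, (Rabs_pos_eq c) by exact Hc.
    apply Rmult_le_compat_l; [lra|apply HM]. }
  destruct (osc_spec G HG) as [U1 L1]. destruct (osc_spec _ HcG) as [U2 L2]. apply Rle_antisym.
  - apply L2. intros p q p' q'. rewrite <- Rmult_minus_distr_l. apply Rmult_le_compat_l; [lra|apply U1].
  - destruct (Rle_lt_or_eq_dec 0 c Hc) as [Hp|<-].
    + assert (h : osc G <= / c*osc (fun p q => c*G p q)).
      { apply L1. intros p q p' q'. specialize (U2 p q p' q'). rewrite <- Rmult_minus_distr_l in U2.
        apply (Rmult_le_reg_l c); [lra|]. rewrite <- Rmult_assoc, Rinv_r, Rmult_1_l by lra. exact U2. }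
      apply (Rmult_le_compat_l c) in h; [|lra]. rewrite <- Rmult_assoc, Rinv_r, Rmult_1_l in h by lra. exact h.
    + rewrite Rmult_0_l. apply osc_nonneg. exact HcG.
Qed.

Lemma osc_close (G G' : R -> R -> R) (e : R) : bounded2 G -> bounded2 G' -> (forall p q, Rabs (G p q - G' p q) <= e) ->
  Rabs (osc G - osc G') <= 2*e.
Proof.
  intros B B' H. destruct (osc_spec G B) as [U1 L1]. destruct (osc_spec G' B') as [U2 L2].
  assert (h1 : osc G <= osc G' + 2*e).
  { apply L1. intros p q p' q'. assert (a := H p q). assert (b := H p' q'). specialize (U2 p q p' q').
    rabs. }
  assert (h2 : osc G' <= osc G + 2*e).
  { apply L2. intros p q p' q'. assert (a := H p q). assert (b := H p' q'). specialize (U1 p q p' q').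
    rabs. }
  rabs.
Qed.

Lemma osc_reindex (G G' : R -> R -> R) : bounded2 G -> bounded2 G' ->
  (forall p q, exists p' q', G p q = G' p' q') -> (forall p q, exists p' q', G' p q = G p' q') -> osc G = osc G'.
Proof.
  intros B B' H1 H2. destruct (osc_spec G B) as [U1 L1]. destruct (osc_spec G' B') as [U2 L2]. apply Rle_antisym.
  - apply L1. intros p q p' q'. destruct (H1 p q) as [a [b ->]]. destruct (H1 p' q') as [a' [b' ->]]. apply U2.
  - apply L2. intros p q p' q'. destruct (H2 p q) as [a [b ->]]. destruct (H2 p' q') as [a' [b' ->]]. apply U1.
Qed.

Lemma admissible_bounded (H : Ham3) (t : R) : admissible H -> bounded2 (H t).
Proof.
  intros A. destruct (admissible_smooth H A) as [S P]. destruct (pc_bounded H (S O) P (Rabs t)) as [M [_ B]].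
  exists M. intros p q. apply B. lra.
Qed.

Lemma admissible_time_lipschitz (H : Ham3) (T : R) : admissible H -> exists M, 0 < M /\ forall t s p q, Rabs t <= T -> Rabs s <= T ->
  Rabs (H t p q - H s p q) <= M*Rabs (t - s).
Proof.
  intros A. destruct (admissible_smooth H A) as [S P]. destruct (smooth_partials H S) as [D SP].
  destruct (pc_bounded _ (SP O O) (pc_partial H 0 S P) T) as [M [HM B]]. exists M. split; [lra|].
  intros t s p q Ht Hs. apply (mvt_bound (fun r => H r p q) (fun r => partial 0 H r p q)). intros r Hr.
  split; [exact (proj1 (D r p q))|]. apply B. abs Ht. abs Hs.
  apply Rabs_le_between. apply (in_between s t); [lra|lra|lra].
Qed.

Lemma osc_continuous (H : Ham3) : admissible H -> forall t, continuous (fun t => osc (H t)) t.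
Proof.
  intros A t. apply eps_continuous. intros eps He.
  destruct (admissible_time_lipschitz H (Rabs t + 1) A) as [M [HM L]].
  exists (Rmin 1 (eps/(2*M + 1))). split; [pos|].
  intros s Hs. rmin Hs [h1 h2].
  assert (hs : Rabs s <= Rabs t + 1) by rabs.
  eapply Rle_lt_trans.
  - apply (osc_close (H s) (H t) (M*Rabs (s - t))); try apply admissible_bounded; try exact A.
    intros p q. apply L; lra.
  - assert (e1 : eps = (2*M + 1)*(eps/(2*M + 1))) by (field; lra).
    nra.
Qed.

Lemma ex_RInt_cont (g : R -> R) (a b : R) : (forall x, continuous g x) -> ex_RInt g a b.
Proof. intros H. apply (ex_RInt_continuous (V := R_CompleteNormedModule) g). auto. Qed.

Lemma hofer_length_nonneg (H : Ham3) : admissible H -> 0 <= hofer_length H.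
Proof.
  intros A. apply RInt_ge_0; [lra| |].
  - apply ex_RInt_cont, osc_continuous, A.
  - intros t _. apply osc_nonneg, admissible_bounded, A.
Qed.

(** A certificate that the distance is at most len. The time-one map is prescribed in the cover, not
    only up to deck shifts, so that certificates compose without bookkeeping. *)
Definition reach (phi : R * R -> R * R) (len : R) : Prop := exists (H : Ham3) (g : isotopy),
  admissible H /\ is_flow H g /\ (forall x, g 1 x = phi x) /\ hofer_length H <= len.

Lemma hofer_dist_spec (phi : R * R -> R * R) (m l0 : R) : reach phi l0 ->
  (forall (H : Ham3) (g : isotopy), admissible H -> is_flow H g -> same_cyl_map (g 1) phi -> m <= hofer_length H) ->
  m <= hofer_dist_id phi <= l0.
Proof.
  intros [H0 [g0 [A0 [Hg0 [E0 L0]]]]] Hl.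
  set (S := fun l => exists (H : Ham3) (g : isotopy), admissible H /\ is_flow H g /\ same_cyl_map (g 1) phi /\ l = hofer_length H).
  assert (HS : S (hofer_length H0)).
  { exists H0, g0. split; [pos|split; [pos|split; [|lra]]]. intros x. rewrite E0. split; [lra|]. exists 0%Z. ring. }
  assert (B : forall l, S l -> m <= l) by (intros l [H [g [A [Hg [Hs ->]]]]]; exact (Hl H g A Hg Hs)).
  destruct (glb_real S _ m HS B) as [U L]. split; [auto|exact (Rle_trans _ _ _ (U _ HS) L0)].
Qed.

Lemma hofer_dist_le (phi : R * R -> R * R) (len : R) : reach phi len -> hofer_dist_id phi <= len.
Proof. intros H. apply (hofer_dist_spec phi 0 len H). intros K g A _ _. apply hofer_length_nonneg, A. Qed.

Lemma hofer_dist_ge (phi : R * R -> R * R) (len : R) : (exists l, reach phi l) ->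
  (forall (H : Ham3) (g : isotopy), admissible H -> is_flow H g -> same_cyl_map (g 1) phi -> len <= hofer_length H) ->
  len <= hofer_dist_id phi.
Proof. intros [l H] Hl. apply (hofer_dist_spec phi len l H Hl). Qed.

Lemma is_derive_comp_R (u v : R -> R) (x lu lv : R) : is_derive u (v x) lu -> is_derive v x lv ->
  is_derive (fun s => u (v s)) x (lv*lu).
Proof. intros Hu Hv. exact (is_derive_comp u v x lu lv Hu Hv). Qed.

Lemma flat_increasing (x y : R) : x <= y -> flat 0 x <= flat 0 y.
Proof.
  intros h. destruct (mvt (flat 0) (fun s => flat 2 s - INR 0*flat 1 s) x y) as [c [_ Em]].
  - intros s _. apply (flat_derive 0).
  - simpl INR in Em. assert (g := flat_nonneg 2 c). nra.
Qed.

Lemma step_increasing (a b x y : R) : a < b -> x <= y -> step a b x <= step a b y.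
Proof.
  intros hab hxy. assert (dx := step_den a b x hab). assert (dy := step_den a b y hab). unfold step.
  assert (h1 := flat_increasing (x - a) (y - a) ltac:(lra)). assert (h2 := flat_increasing (b - y) (b - x) ltac:(lra)).
  assert (g1 := flat_nonneg 0 (x - a)). assert (g2 := flat_nonneg 0 (b - y)).
  set (A := flat 0 (x - a)) in *. set (B := flat 0 (b - x)) in *. set (A' := flat 0 (y - a)) in *. set (B' := flat 0 (b - y)) in *.
  apply (Rmult_le_reg_r ((A + B)*(A' + B'))); [pos|].
  replace (A/(A + B)*((A + B)*(A' + B'))) with (A*(A' + B')) by (field; lra).
  replace (A'/(A' + B')*((A + B)*(A' + B'))) with (A'*(A + B)) by (field; lra).
  nra.
Qed.

Lemma increasing_derive_nonneg (u : R -> R) (x l : R) : (forall a b, a <= b -> u a <= u b) -> is_derive u x l -> 0 <= l.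
Proof.
  intros Hm Hd. apply Rnot_lt_le. intros Hl.
  destruct (derive_slope u x l Hd (- l)) as [d [Hd0 H]]; [lra|].
  destruct (H (x + d/2)) as [m [Em Lm]].
  { rabs. }
  abs Lm. assert (h := Hm x (x + d/2) ltac:(lra)).
  nra.
Qed.

Lemma step_derive_facts (a b : R) : a < b -> let s := step a b in
  smooth1 (Derive s) /\ (forall x, is_derive s x (Derive s x)) /\ (forall x, 0 <= Derive s x) /\
  (forall x, x < a \/ b < x -> Derive s x = 0).
Proof.
  intros hab s. destruct (smooth1_derive s (step_smooth a b hab)) as [S D]. split; [exact S|split; [exact D|split]].
  - intros x. apply (increasing_derive_nonneg s x); [|apply D]. intros; apply step_increasing; assumption.
  - intros x [h|h]; apply is_derive_unique.
    + apply (locally_const_derive0 s (x - 1) a 0); [|lra]. intros; apply step_0; lra.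
    + apply (locally_const_derive0 s b (x + 1) 1); [|lra]. intros; apply step_1; lra.
Qed.

Lemma smooth_time (H : Ham3) (u : R -> R) : smooth H -> smooth1 u -> smooth (fun t p q => H (u t) p q).
Proof. intros SH Su. exact (smooth_comp H (fun t _ _ => u t) _ _ SH Su smooth_p smooth_q). Qed.

Lemma admissible_plus (H K : Ham3) : admissible H -> admissible K -> admissible (fun t p q => H t p q + K t p q).
Proof.
  intros [SH [PH [a Ha]]] [SK [PK [b Hb]]]. split; [|split].
  - apply smooth3_smooth, smooth_plus; apply smooth3_smooth; assumption.
  - intros t p q. rewrite PH, PK. reflexivity.
  - exists (Rmax a b). intros t p q h. assert (h1 := Rmax_l a b). assert (h2 := Rmax_r a b).
    rewrite Ha, Hb by lra. ring.
Qed.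

Lemma admissible_time_scal (H : Ham3) (u v : R -> R) : admissible H -> smooth1 u -> smooth1 v ->
  admissible (fun t p q => v t*H (u t) p q).
Proof.
  intros [SH [PH [a Ha]]] Su Sv. split; [|split].
  - apply smooth3_smooth, (smooth_mult (fun t _ _ => v t)); [pos|]. apply smooth_time; [|pos]. apply smooth3_smooth; assumption.
  - intros t p q. rewrite PH. reflexivity.
  - exists a. intros t p q h. rewrite Ha by exact h. ring.
Qed.

Lemma sg_time_scal (H : Ham3) (u v : R -> R) : admissible H -> forall t p q,
  sg1 (fun t p q => v t*H (u t) p q) t p q = v t*sg1 H (u t) p q /\
  sg2 (fun t p q => v t*H (u t) p q) t p q = v t*sg2 H (u t) p q.
Proof.
  intros A t p q. destruct (smooth_partials H (proj1 (admissible_smooth H A))) as [D _].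
  destruct (D (u t) p q) as [_ [h1 h2]].
  assert (Sc : forall (w : R -> R) x l, is_derive w x l -> Derive (fun s => v t*w s) x = v t*l).
  { intros w x l Hw. apply is_derive_unique. replace (v t*l) with (0*w x + v t*l) by ring.
    apply (is_derive_mult_R (fun _ => v t) w); [apply @is_derive_const|pos]. }
  split.
  - unfold sg1. unfold partial at 1. rewrite (Sc _ _ _ h2). ring.
  - unfold sg2. unfold partial at 1. auto.
Qed.

Lemma sg_plus (H K : Ham3) : admissible H -> admissible K -> forall t p q,
  sg1 (fun t p q => H t p q + K t p q) t p q = sg1 H t p q + sg1 K t p q /\
  sg2 (fun t p q => H t p q + K t p q) t p q = sg2 H t p q + sg2 K t p q.
Proof.
  intros A B t p q. destruct (smooth_partials H (proj1 (admissible_smooth H A))) as [D _].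
  destruct (smooth_partials K (proj1 (admissible_smooth K B))) as [D' _].
  destruct (D t p q) as [_ [h1 h2]]. destruct (D' t p q) as [_ [k1 k2]]. split.
  - unfold sg1. assert (E : partial 2 (fun t p q => H t p q + K t p q) t p q = partial 2 H t p q + partial 2 K t p q).
    { apply is_derive_unique. exact (is_derive_plus _ _ _ _ _ h2 k2). }
    rewrite E. ring.
  - apply is_derive_unique. exact (is_derive_plus _ _ _ _ _ h1 k1).
Qed.

Lemma flow_reparam (H : Ham3) (g : isotopy) (u : R -> R) (s l : R) (x : R * R) : is_flow H g -> is_derive u s l ->
  is_derive (fun r => fst (g (u r) x)) s (l*sg1 H (u s) (fst (g (u s) x)) (snd (g (u s) x))) /\
  is_derive (fun r => snd (g (u r) x)) s (l*sg2 H (u s) (fst (g (u s) x)) (snd (g (u s) x))).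
Proof.
  intros Hg Hu. destruct (flow_curve H g x Hg (u s)) as [h1 h2]. split.
  - exact (is_derive_comp_R (fun t => fst (g t x)) u s _ _ h1 Hu).
  - exact (is_derive_comp_R (fun t => snd (g t x)) u s _ _ h2 Hu).
Qed.

Lemma flow_from_sg (H : Ham3) (g : isotopy) : (forall x, g 0 x = x) ->
  (forall x, ode_curve (sg1 H) (sg2 H) (fun t => fst (g t x)) (fun t => snd (g t x))) -> is_flow H g.
Proof. intros H0 Hc x. split; [apply H0|exact (Hc x)]. Qed.

(* The two paths are run one after the other, each reparametrized so as to be stationary near its ends. *)
Lemma reach_comp (phi1 phi2 : R * R -> R * R) (l1 l2 : R) : reach phi1 l1 -> reach phi2 l2 ->
  reach (fun x => phi2 (phi1 x)) (l1 + l2).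
Proof.
  intros [H1 [g1 [A1 [F1 [E1 L1]]]]] [H2 [g2 [A2 [F2 [E2 L2]]]]].
  set (u1 := step (/ 10) (4/10)). set (u2 := step (6/10) (9/10)).
  destruct (step_derive_facts (/ 10) (4/10) ltac:(lra)) as [S1 [D1 [P1 Z1]]]. fold u1 in S1, D1, P1, Z1.
  destruct (step_derive_facts (6/10) (9/10) ltac:(lra)) as [S2 [D2 [P2 Z2]]]. fold u2 in S2, D2, P2, Z2.
  assert (Su1 : smooth1 u1) by (apply step_smooth; lra). assert (Su2 : smooth1 u2) by (apply step_smooth; lra).
  set (K1 := fun t p q => Derive u1 t*H1 (u1 t) p q). set (K2 := fun t p q => Derive u2 t*H2 (u2 t) p q).
  assert (AK1 : admissible K1) by (apply admissible_time_scal; assumption).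
  assert (AK2 : admissible K2) by (apply admissible_time_scal; assumption).
  assert (AK : admissible (fun t p q => K1 t p q + K2 t p q)) by (apply admissible_plus; assumption).
  exists (fun t p q => K1 t p q + K2 t p q), (fun s x => g2 (u2 s) (g1 (u1 s) x)). split; [pos|]. split; [|split].
  - apply flow_from_sg.
    + intros x. unfold u1, u2. rewrite !step_0 by lra. rewrite (flow_0 _ _ _ F1), (flow_0 _ _ _ F2). reflexivity.
    + intros x s. destruct (sg_plus K1 K2 AK1 AK2 s (fst (g2 (u2 s) (g1 (u1 s) x))) (snd (g2 (u2 s) (g1 (u1 s) x)))) as [e1 e2].
      rewrite e1, e2. set (y := g2 (u2 s) (g1 (u1 s) x)).
      destruct (sg_time_scal H1 u1 (Derive u1) A1 s (fst y) (snd y)) as [a1 a2]. fold K1 in a1, a2.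
      destruct (sg_time_scal H2 u2 (Derive u2) A2 s (fst y) (snd y)) as [b1 b2]. fold K2 in b1, b2.
      rewrite a1, a2, b1, b2. destruct (Rlt_dec s (/ 2)) as [hs|hs].
      * rewrite (Z2 s) by lra. rewrite !Rmult_0_l, !Rplus_0_r.
        assert (U2 : forall r, Rabs (r - s) < / 20 -> u2 r = 0).
        { intros r Hr. abs Hr. apply step_0. lra. }
        assert (Ey : y = g1 (u1 s) x).
        { unfold y. rewrite U2 by rabs. apply (flow_0 _ _ _ F2). }
        rewrite Ey. destruct (flow_reparam H1 g1 u1 s _ x F1 (D1 s)) as [d1 d2].
        split; [apply (is_derive_near _ (fun r => fst (g1 (u1 r) x)) _ _ (/ 20)); [lra| |pos]
               |apply (is_derive_near _ (fun r => snd (g1 (u1 r) x)) _ _ (/ 20)); [lra| |pos]];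
        intros r Hr; rewrite U2 by exact Hr; rewrite (flow_0 _ _ _ F2); reflexivity.
      * rewrite (Z1 s) by lra. rewrite !Rmult_0_l, !Rplus_0_l.
        assert (U1 : forall r, Rabs (r - s) < / 20 -> u1 r = 1).
        { intros r Hr. abs Hr. apply step_1; lra. }
        assert (Ey : y = g2 (u2 s) (g1 1 x)).
        { unfold y. rewrite U1 by rabs. reflexivity. }
        rewrite Ey. destruct (flow_reparam H2 g2 u2 s _ (g1 1 x) F2 (D2 s)) as [d1 d2].
        split; [apply (is_derive_near _ (fun r => fst (g2 (u2 r) (g1 1 x))) _ _ (/ 20)); [lra| |pos]
               |apply (is_derive_near _ (fun r => snd (g2 (u2 r) (g1 1 x))) _ _ (/ 20)); [lra| |pos]];
        intros r Hr; rewrite U1 by exact Hr; reflexivity.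
  - intros x. unfold u1, u2. rewrite !step_1 by lra. rewrite E1, E2. reflexivity.
  -
    assert (Ch : RInt (fun t => osc (fun p q => K1 t p q + K2 t p q)) 0 1 =
      RInt (fun t => osc (fun p q => K1 t p q + K2 t p q)) 0 (/ 2) + RInt (fun t => osc (fun p q => K1 t p q + K2 t p q)) (/ 2) 1).
    { apply (RInt_chasles_R (fun t => osc (fun p q => K1 t p q + K2 t p q))). exact (osc_continuous _ AK). }
    change (RInt (fun t => osc (fun p q => K1 t p q + K2 t p q)) 0 1 <= l1 + l2).
    (* The oscillation is homogeneous for the nonnegative factor [Derive u], so substitution shows
       that reparametrization preserves length. *)
    assert (Part : forall (H : Ham3) u, admissible H -> smooth1 (Derive u) -> (forall x, is_derive u x (Derive u x)) -> (forall x, 0 <= Derive u x) ->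
       forall a b, u a = 0 -> u b = 1 -> RInt (fun t => osc (fun p q => Derive u t*H (u t) p q)) a b = hofer_length H).
    { intros H u A Sd D P a b ua ub.
      assert (E : RInt (fun t => scal (Derive u t) (osc (H (u t)))) a b = RInt (fun t => osc (H t)) (u a) (u b)).
      { apply (RInt_comp (fun t => osc (H t)) u (Derive u) a b).
        - intros x _. apply osc_continuous, A.
        - intros x _. split; [apply D|]. destruct (smooth1_derive _ Sd) as [_ D']. exact (is_derive_cont _ _ _ (D' x)). }
      rewrite ua, ub in E. unfold hofer_length. rewrite <- E. apply RInt_ext.
      intros t _. apply (osc_scal (Derive u t) (H (u t)) (P t)). apply admissible_bounded, A. }
    assert (I1 : RInt (fun t => osc (fun p q => K1 t p q + K2 t p q)) 0 (/ 2) = hofer_length H1).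
    { rewrite <- (Part H1 u1 A1 S1 D1 P1 0 (/ 2)); [|apply step_0; lra|apply step_1; lra].
      apply RInt_ext. intros t Ht. rewrite Rmin_left, Rmax_right in Ht by lra. f_equal.
      ext p. ext q.
      unfold K1, K2. rewrite (Z2 t) by lra. ring. }
    assert (I2 : RInt (fun t => osc (fun p q => K1 t p q + K2 t p q)) (/ 2) 1 = hofer_length H2).
    { rewrite <- (Part H2 u2 A2 S2 D2 P2 (/ 2) 1); [|apply step_0; lra|apply step_1; lra].
      apply RInt_ext. intros t Ht. rewrite Rmin_left, Rmax_right in Ht by lra. f_equal.
      ext p. ext q.
      unfold K1, K2. rewrite (Z1 t) by lra. ring. }
    lra.
Qed.

Lemma smooth1_affine (a b : R) : smooth1 (fun t => a + b*t).
Proof.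
  apply (smooth_plus (fun _ _ _ => a)); [apply smooth_const|]. apply (smooth_mult (fun _ _ _ => b)); [apply smooth_const|apply smooth_t].
Qed.

(** The path g (1 - t) psi runs backwards from g 1 psi, which is the identity, to psi. Its
    Hamiltonian - H (1 - t) has the oscillation of H. *)
Lemma reach_inverse (phi : R * R -> R * R) (l : R) : reach phi l -> exists psi, reach psi l /\
  (forall x, phi (psi x) = x) /\ (forall x, psi (phi x) = x).
Proof.
  intros [H [g [A [Fg [E L]]]]].
  assert (Sj : forall y, exists x, phi x = y).
  { intros y. destruct (flow_surj H g 1 A Fg y) as [x Hx]. exists x. rewrite <- E. exact Hx. }
  set (psi := fun y => proj1_sig (cid (Sj y))).
  assert (Hpsi : forall y, phi (psi y) = y).
  { intros y. unfold psi. destruct (cid (Sj y)) as [x Hx]. exact Hx. }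
  exists psi. split; [|split; [pos|]].
  2:{ intros x. apply (flow_inj H g 1 _ _ A Fg). rewrite !E. apply Hpsi. }
  set (u := fun t : R => 1 + - (1)*t). assert (Su : smooth1 u) by apply smooth1_affine.
  assert (Du : forall t, is_derive u t (- (1))) by (intros t; unfold u; auto_derive; [trivial|ring]).
  assert (AK : admissible (fun t p q => - (1)*H (u t) p q)).
  { apply (admissible_time_scal H u (fun _ => - (1))); [exact A|pos|exact (smooth_const _)]. }
  exists (fun t p q => - (1)*H (u t) p q), (fun s x => g (u s) (psi x)). split; [pos|]. split; [|split].
  - apply flow_from_sg.
    + intros x. unfold u. rewrite Rmult_0_r, Rplus_0_r, E. apply Hpsi.
    + intros x s. destruct (sg_time_scal H u (fun _ => - (1)) A s (fst (g (u s) (psi x))) (snd (g (u s) (psi x)))) as [a1 a2].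
      rewrite a1, a2. apply (flow_reparam H g u s (- (1)) (psi x) Fg (Du s)).
  - intros x. unfold u. replace (1 + - (1)*1) with 0 by ring. apply (flow_0 _ _ _ Fg).
  - eapply Rle_trans; [|exact L]. right. unfold hofer_length.
    assert (Eq : RInt (fun t => osc (fun p q => - (1)*H (u t) p q)) 0 1 = RInt (fun t => osc (H (u t))) 0 1).
    { apply RInt_ext. intros t _.
      assert (B1 : bounded2 (H (u t))) by (apply admissible_bounded, A).
      assert (B2 : bounded2 (fun p q => - (1)*H (u t) p q)) by (apply (admissible_bounded _ t AK)).
      destruct (osc_spec _ B1) as [U1 L1']. destruct (osc_spec _ B2) as [U2 L2']. apply Rle_antisym.
      - apply L2'. intros p q p' q'. specialize (U1 p' q' p q). lra.
      - apply L1'. intros p q p' q'. specialize (U2 p' q' p q). lra. }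
    rewrite Eq.
    assert (C : RInt (fun t => scal (- (1)) (osc (H (u t)))) 0 1 = RInt (fun t => osc (H t)) (u 0) (u 1)).
    { apply (RInt_comp (fun t => osc (H t)) u (fun _ => - (1)) 0 1).
      - intros x _. apply osc_continuous, A.
      - intros x _. split; [apply Du|apply continuous_const]. }
    assert (S : RInt (fun t => scal (- (1)) (osc (H (u t)))) 0 1 = - (1)*RInt (fun t => osc (H (u t))) 0 1).
    { apply (RInt_scal (fun t => osc (H (u t))) 0 1 (- (1))). apply ex_RInt_cont. intros x.
      apply (continuous_comp u (fun t => osc (H t))); [exact (is_derive_cont _ _ _ (Du x))|apply osc_continuous, A]. }
    assert (Sw : - RInt (fun t => osc (H t)) 0 1 = RInt (fun t => osc (H t)) 1 0).
    { apply (opp_RInt_swap (fun t => osc (H t)) 0 1), ex_RInt_cont, osc_continuous, A. }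
    replace (u 0) with 1 in C by (unfold u; ring). replace (u 1) with 0 in C by (unfold u; ring).
    lra.
Qed.

Lemma reach_autonomous (G : R -> R -> R) (r : isotopy) (t : R) : 0 <= t -> adm G ->
  flow_of G r -> reach (r t) (t*osc G).
Proof.
  intros Ht A Fr. exists (fun s p q => t*autonomous G (t*s) p q), (fun s x => r (t*s) x).
  assert (Su : smooth1 (fun s => t*s)).
  { apply (smooth_mult (fun _ _ _ => t)); [apply smooth_const|apply smooth_t]. }
  split; [apply (admissible_time_scal (autonomous G) (fun s => t*s) (fun _ => t)); [exact A|pos|exact (smooth_const _)]|].
  split; [|split].
  - apply flow_from_sg.
    + intros x. rewrite Rmult_0_r. apply (flow_0 _ _ _ Fr).
    + intros x s. destruct (sg_time_scal (autonomous G) (fun s => t*s) (fun _ => t) A s (fst (r (t*s) x)) (snd (r (t*s) x))) as [a1 a2].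
      rewrite a1, a2. apply (flow_reparam (autonomous G) r (fun s => t*s) s t x Fr). auto_derive; [trivial|ring].
  - intros x. rewrite Rmult_1_r. reflexivity.
  - unfold hofer_length. rewrite (RInt_ext _ (fun _ => t*osc G)).
    + rewrite RInt_const. unfold scal; simpl; unfold mult; simpl. lra.
    + intros s _. apply (osc_scal t G Ht). apply (admissible_bounded (autonomous G) 0 A).
Qed.

(** Determinant 1 says that the change of coordinates preserves dp /\ dq, and such a map carries the
    field of the pulled back Hamiltonian to that of K. *)
Lemma conjugate_sg (K : Ham3) (Y1 Y2 : Ham3) (t s p q : R) : smooth K -> smooth Y1 -> smooth Y2 ->
  partial 1 Y1 t p q*partial 2 Y2 t p q - partial 2 Y1 t p q*partial 1 Y2 t p q = 1 ->
  let H := fun s p q => K s (Y1 t p q) (Y2 t p q) in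
  partial 1 Y1 t p q*sg1 H s p q + partial 2 Y1 t p q*sg2 H s p q = sg1 K s (Y1 t p q) (Y2 t p q) /\
  partial 1 Y2 t p q*sg1 H s p q + partial 2 Y2 t p q*sg2 H s p q = sg2 K s (Y1 t p q) (Y2 t p q).
Proof.
  intros SK SY1 SY2 Hdet H.
  destruct (smooth_partials K SK) as [DK CK_]. destruct (smooth_partials Y1 SY1) as [D1 _]. destruct (smooth_partials Y2 SY2) as [D2 _].
  assert (Hp : partial 1 H s p q = partial 1 K s (Y1 t p q) (Y2 t p q)*partial 1 Y1 t p q + partial 2 K s (Y1 t p q) (Y2 t p q)*partial 1 Y2 t p q).
  { apply is_derive_unique.
    assert (C := chain3 K _ _ _ (fun _ => s) (fun r => Y1 t r q) (fun r => Y2 t r q) p 0 _ _ DK (CK_ O O) (CK_ 1%nat O) (CK_ 2%nat O)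
      (is_derive_const _ _) (proj1 (proj2 (D1 t p q))) (proj1 (proj2 (D2 t p q)))).
    rewrite Rmult_0_r, Rplus_0_l in C. exact C. }
  assert (Hq : partial 2 H s p q = partial 1 K s (Y1 t p q) (Y2 t p q)*partial 2 Y1 t p q + partial 2 K s (Y1 t p q) (Y2 t p q)*partial 2 Y2 t p q).
  { apply is_derive_unique.
    assert (C := chain3 K _ _ _ (fun _ => s) (fun r => Y1 t p r) (fun r => Y2 t p r) q 0 _ _ DK (CK_ O O) (CK_ 1%nat O) (CK_ 2%nat O)
      (is_derive_const _ _) (proj2 (proj2 (D1 t p q))) (proj2 (proj2 (D2 t p q)))).
    rewrite Rmult_0_r, Rplus_0_l in C. exact C. }
  unfold sg1, sg2. rewrite Hp, Hq.
  set (a := partial 1 K s (Y1 t p q) (Y2 t p q)) in *. set (b := partial 2 K s (Y1 t p q) (Y2 t p q)) in *.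
  set (w := partial 1 Y1 t p q) in *. set (x := partial 2 Y1 t p q) in *. set (y := partial 1 Y2 t p q) in *. set (z := partial 2 Y2 t p q) in *.
  split.
  - replace (w * - (a*x + b*z) + x*(a*w + b*y)) with (- b*(w*z - x*y)) by ring. rewrite Hdet. ring.
  - replace (y * - (a*x + b*z) + z*(a*w + b*y)) with (a*(w*z - x*y)) by ring. rewrite Hdet. ring.
Qed.

(** Conjugation by an area-preserving map replaces H by its composition with the inverse map, which
    takes the same values at each time and so has the same oscillation. *)
Lemma reach_conjugate (G : R -> R -> R) (y : isotopy) (t : R) (phi : R * R -> R * R) (l : R) :
  adm G -> flow_of G y -> reach phi l -> reach (fun x => y t (phi (y (- t) x))) l.
Proof.
  intros AG Fy [H [g [A [Fg [E L]]]]].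
  destruct (flow_smooth _ y AG Fy) as [S1 [S2 Hdet]].
  destruct (smooth_partials _ S1) as [D1 C1]. destruct (smooth_partials _ S2) as [D2 C2].
  destruct (admissible_smooth H A) as [SH [PH [a Ha]]].
  set (Y1 := fun t p q => fst (y t (p, q))) in *. set (Y2 := fun t p q => snd (y t (p, q))) in *.
  set (K := fun s p q => H s (Y1 (- t) p q) (Y2 (- t) p q)).
  assert (Fix : forall u : Ham3, smooth u -> smooth (fun _ p q => u (- t) p q)).
  { intros u Su. exact (smooth_comp u (fun _ _ _ => - t) _ _ Su (smooth_const _) smooth_p smooth_q). }
  assert (SK : smooth K).
  { apply (smooth_comp H (fun s _ _ => s) (fun _ p q => Y1 (- t) p q) (fun _ p q => Y2 (- t) p q)); auto using smooth_t. }
  assert (Gr1 : forall x, y (- t) (y t x) = x).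
  { intros x. rewrite <- (Ropp_involutive t) at 2. rewrite <- (flow_group G y AG Fy).
    replace (- t + - - t) with 0 by ring. apply (flow_0 _ _ _ Fy). }
  assert (Gr2 : forall x, y t (y (- t) x) = x).
  { intros x. rewrite <- (flow_group G y AG Fy). replace (t + - t) with 0 by ring. apply (flow_0 _ _ _ Fy). }
  assert (AK : admissible K).
  { split; [apply smooth3_smooth, SK|split].
    - intros s p q. unfold K, Y1, Y2. assert (Eq := flow_equivariant _ y AG Fy (- t) p q 1).
      rewrite Eq. apply PH.
    - destruct (proj2 (proj2 AG)) as [b Hb]. exists (Rmax a b). intros s p q h. assert (h1 := Rmax_l a b). assert (h2 := Rmax_r a b).
      unfold K, Y1, Y2. rewrite (flow_outside _ y b AG Fy Hb) by lra. apply Ha. simpl. lra. }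
  exists K, (fun s x => y t (g s (y (- t) x))). split; [pos|]. split; [|split].
  - apply flow_from_sg.
    + intros x. rewrite (flow_0 _ _ _ Fg). apply Gr2.
    + intros x s. set (z := g s (y (- t) x)).
      destruct (conjugate_sg K Y1 Y2 t s (fst z) (snd z) SK S1 S2 (Hdet t (fst z) (snd z))) as [e1 e2].
      assert (EH : (fun s p q => K s (Y1 t p q) (Y2 t p q)) = H).
      { ext s'. ext p. ext q.
        unfold K, Y1, Y2. rewrite <- surjective_pairing, Gr1. reflexivity. }
      rewrite EH in e1, e2.
      destruct (flow_curve H g (y (- t) x) Fg s) as [c1 c2].
      assert (EY : forall w, fst (y t w) = Y1 t (fst w) (snd w) /\ snd (y t w) = Y2 t (fst w) (snd w)).
      { intros w. unfold Y1, Y2. rewrite <- surjective_pairing. auto. }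
      rewrite !(proj1 (EY z)), !(proj2 (EY z)), <- e1, <- e2.
      split.
      * apply (is_derive_ext (fun r => Y1 t (fst (g r (y (- t) x))) (snd (g r (y (- t) x))))); [intros r; symmetry; apply EY|].
        assert (C := chain3 Y1 _ _ _ (fun _ => t) _ _ s 0 _ _ D1 (C1 O O) (C1 1%nat O) (C1 2%nat O) (is_derive_const _ _) c1 c2).
        rewrite Rmult_0_r, Rplus_0_l in C. exact C.
      * apply (is_derive_ext (fun r => Y2 t (fst (g r (y (- t) x))) (snd (g r (y (- t) x))))); [intros r; symmetry; apply EY|].
        assert (C := chain3 Y2 _ _ _ (fun _ => t) _ _ s 0 _ _ D2 (C2 O O) (C2 1%nat O) (C2 2%nat O) (is_derive_const _ _) c1 c2).
        rewrite Rmult_0_r, Rplus_0_l in C. exact C.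
  - intros x. rewrite E. reflexivity.
  - eapply Rle_trans; [|exact L]. right. apply RInt_ext. intros s _.
    apply osc_reindex; try (apply admissible_bounded; assumption).
    + intros p q. exists (Y1 (- t) p q), (Y2 (- t) p q). reflexivity.
    + intros p q. exists (Y1 t p q), (Y2 t p q). unfold K, Y1, Y2. rewrite <- surjective_pairing, Gr1. reflexivity.
Qed.

(** * The upper bound *)

Lemma is_derive_plus_const_r (f : R -> R) (c x l : R) : is_derive f x l -> is_derive (fun t => f t + c) x l.
Proof.
  intros H. auto_derive; [exists l; exact H|]. rewrite (Dv _ _ _ H). ring.
Qed.

Lemma flow_stationary (F : R -> R -> R) (f : isotopy) (x : R * R) : adm F ->
  flow_of F f -> dP F (fst x) (snd x) = 0 -> dQ F (fst x) (snd x) = 0 -> forall t, f t x = x.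
Proof.
  intros A Hf h1 h2 t.
  rewrite (flow_unique _ f (fun _ => fst x) (fun _ => snd x) 0 x A Hf).
  - destruct x; reflexivity.
  - intros s. split.
    + change (sg1 (autonomous F) s (fst x) (snd x)) with (- dQ F (fst x) (snd x)). rewrite h2, Ropp_0. apply @is_derive_const.
    + change (sg2 (autonomous F) s (fst x) (snd x)) with (dP F (fst x) (snd x)). rewrite h1. apply @is_derive_const.
  - rewrite (flow_0 _ f x Hf). destruct x; reflexivity.
Qed.

Lemma gradient_locally_const (F : R -> R -> R) (x : R * R) (c r : R) : 0 < r -> (forall y, near r x y -> val F y = c) ->
  dP F (fst x) (snd x) = 0 /\ dQ F (fst x) (snd x) = 0.
Proof.
  intros Hr H. split; apply is_derive_unique.
  - apply (is_derive_near _ (fun _ => c) _ _ r Hr); [|apply @is_derive_const]. intros y Hy. apply (H (y, snd x)). split; simpl; [lra|].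
    rewrite Rminus_diag, Rabs_R0. exact Hr.
  - apply (is_derive_near _ (fun _ => c) _ _ r Hr); [|apply @is_derive_const]. intros y Hy. apply (H (fst x, y)). split; simpl; [|lra].
    rabs.
Qed.

Lemma admissible_post (F : R -> R -> R) (u : R -> R) : adm F -> smooth1 u -> u 0 = 0 ->
  admissible (autonomous (fun p q => u (F p q))) /\
  (forall p q, dP (fun p q => u (F p q)) p q = Derive u (F p q)*dP F p q /\ dQ (fun p q => u (F p q)) p q = Derive u (F p q)*dQ F p q).
Proof.
  intros A Su U0. split.
  - destruct A as [S [P [K HK]]]. split; [|split].
    + apply smooth3_smooth. apply (smooth1_comp u (autonomous F)); [pos|]. apply smooth3_smooth; exact S.
    + intros t p q. unfold autonomous. f_equal. exact (P t p q).
    + exists K. intros t p q h. unfold autonomous. assert (e := HK t p q h). unfold autonomous in e. rewrite e. exact U0.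
  - intros p q. destruct (autonomous_partials F A p q) as [d1 d2]. destruct (smooth1_derive u Su) as [_ D].
    rewrite !(Rmult_comm (Derive u _)). split; apply is_derive_unique.
    + exact (is_derive_comp_R u (fun s => F s q) p _ _ (D _) d1).
    + exact (is_derive_comp_R u (fun s => F p s) q _ _ (D _) d2).
Qed.

Definition translate (d : R) (G : R -> R -> R) (p q : R) : R := G (p - d) q.

Lemma admissible_translate (d : R) (G : R -> R -> R) : adm G -> admissible (autonomous (translate d G)) /\
  (forall p q, dP (translate d G) p q = dP G (p - d) q /\ dQ (translate d G) p q = dQ G (p - d) q).
Proof.
  intros A. split.
  - destruct A as [S [P [K HK]]]. split; [|split].
    + apply smooth3_smooth. apply (smooth_comp (autonomous G) (fun t _ _ => t) (fun _ p _ => p - d) (fun _ _ q => q));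
        [apply smooth3_smooth; exact S|apply smooth_t| |apply smooth_q]. apply (smooth_minus (fun _ p _ => p)); [apply smooth_p|apply smooth_const].
    + intros t p q. exact (P t (p - d) q).
    + exists (K + Rabs d). intros t p q h. apply (HK t (p - d) q).
      assert (h1 := Rabs_triang (p - d) d). replace (p - d + d) with p in h1 by ring. lra.
  - intros p q. destruct (autonomous_partials G A (p - d) q) as [d1 d2]. split; [|reflexivity].
    apply is_derive_unique. replace (dP G (p - d) q) with (1*dP G (p - d) q) by ring.
    apply (is_derive_comp_R (fun s => G s q) (fun s => s - d)); [pos|]. auto_derive; [trivial|ring].
Qed.

Lemma flow_translate (d : R) (G : R -> R -> R) (g : isotopy) : adm G -> flow_of G g ->
  is_flow (autonomous (translate d G)) (fun t x => (fst (g t (fst x - d, snd x)) + d, snd (g t (fst x - d, snd x)))).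
Proof.
  intros A Hg. apply flow_from_sg.
  - intros x. rewrite (flow_0 _ g _ Hg). simpl. rewrite Rplus_comm. unfold Rminus. rewrite (Rplus_comm (fst x)), <- Rplus_assoc, Rplus_opp_r, Rplus_0_l.
    destruct x; reflexivity.
  - intros x t. destruct (flow_sg G g (fst x - d, snd x) t Hg) as [h1 h2]. simpl. set (y := g t (fst x - d, snd x)) in *.
    destruct (proj2 (admissible_translate d G A) (fst y + d) (snd y)) as [e1 e2].
    replace (fst y + d - d) with (fst y) in e1, e2 by ring. split.
    + change (sg1 (autonomous (translate d G)) t (fst y + d) (snd y)) with (- dQ (translate d G) (fst y + d) (snd y)). rewrite e2.
      apply (is_derive_plus_const_r (fun s => fst (g s (fst x - d, snd x))) d). exact h1.
    + change (sg2 (autonomous (translate d G)) t (fst y + d) (snd y)) with (dP (translate d G) (fst y + d) (snd y)). rewrite e1. exact h2.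
Qed.

(** The strip c - 1 < p < c + 1 is fixed by both flows, so neither crosses p = c. On either side one
    of the two flows is the identity and the composition is the other one. *)
Lemma flow_sum (G1 G2 : R -> R -> R) (g1 g2 : isotopy) (c : R) : adm G1 -> adm G2 ->
  flow_of G1 g1 -> flow_of G2 g2 -> (forall p q, c - 1 < p -> G1 p q = 0) -> (forall p q, p < c + 1 -> G2 p q = 0) ->
  admissible (autonomous (fun p q => G1 p q + G2 p q)) /\ is_flow (autonomous (fun p q => G1 p q + G2 p q)) (fun t x => g2 t (g1 t x)).
Proof.
  intros A1 A2 F1 F2 Z1 Z2. assert (A : admissible (autonomous (fun p q => G1 p q + G2 p q))) by (apply (admissible_plus _ _ A1 A2)).
  split; [exact A|].
  assert (D1 : forall x, c - 1 < fst x -> dP G1 (fst x) (snd x) = 0 /\ dQ G1 (fst x) (snd x) = 0).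
  { intros x Hx. apply (gradient_locally_const G1 x 0 (fst x - (c - 1))); [lra|]. intros y [hy _]. apply Z1. rabs. }
  assert (D2 : forall x, fst x < c + 1 -> dP G2 (fst x) (snd x) = 0 /\ dQ G2 (fst x) (snd x) = 0).
  { intros x Hx. apply (gradient_locally_const G2 x 0 (c + 1 - fst x)); [lra|]. intros y [hy _]. apply Z2. rabs. }
  assert (S1 : forall x t, c - 1 < fst x -> g1 t x = x).
  { intros x t Hx. destruct (D1 x Hx). apply (flow_stationary G1); assumption. }
  assert (S2 : forall x t, fst x < c + 1 -> g2 t x = x).
  { intros x t Hx. destruct (D2 x Hx). apply (flow_stationary G2); assumption. }
  assert (I1 : forall x t, fst x < c -> fst (g1 t x) < c).
  { intros x t Hx. apply Rnot_le_lt. intros h. assert (e : g1 (- t) (g1 t x) = g1 t x) by (apply S1; lra).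
    rewrite (flow_inv G1 g1 A1 F1) in e. rewrite <- e in h. lra. }
  assert (I2 : forall x t, c <= fst x -> c <= fst (g2 t x)).
  { intros x t Hx. apply Rnot_lt_le. intros h. assert (e : g2 (- t) (g2 t x) = g2 t x) by (apply S2; lra).
    rewrite (flow_inv G2 g2 A2 F2) in e. rewrite <- e in h. lra. }
  apply flow_from_sg.
  - intros x. rewrite (flow_0 _ g1 _ F1). apply (flow_0 _ g2 _ F2).
  - intros x t. destruct (sg_plus _ _ A1 A2 t (fst (g2 t (g1 t x))) (snd (g2 t (g1 t x)))) as [e1 e2].
    change (fun t p q => autonomous G1 t p q + autonomous G2 t p q) with (autonomous (fun p q => G1 p q + G2 p q)) in e1, e2.
    rewrite e1, e2. destruct (Rlt_dec (fst x) c) as [h|h].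
    + assert (E : forall s, g2 s (g1 s x) = g1 s x) by (intros s; apply S2; specialize (I1 x s h); lra).
      rewrite E. destruct (D2 (g1 t x)) as [k1 k2]; [specialize (I1 x t h); lra|].
      change (sg1 (autonomous G2) t (fst (g1 t x)) (snd (g1 t x))) with (- dQ G2 (fst (g1 t x)) (snd (g1 t x))).
      change (sg2 (autonomous G2) t (fst (g1 t x)) (snd (g1 t x))) with (dP G2 (fst (g1 t x)) (snd (g1 t x))).
      rewrite k1, k2, Ropp_0, !Rplus_0_r. destruct (flow_curve _ g1 x F1 t) as [h1 h2].
      split; [apply (is_derive_ext (fun s => fst (g1 s x)))|apply (is_derive_ext (fun s => snd (g1 s x)))]; try assumption; intros s; rewrite E; reflexivity.
    + assert (E : forall s, g2 s (g1 s x) = g2 s x) by (intros s; rewrite S1 by lra; reflexivity).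
      rewrite E. destruct (D1 (g2 t x)) as [k1 k2]; [specialize (I2 x t ltac:(lra)); lra|].
      change (sg1 (autonomous G1) t (fst (g2 t x)) (snd (g2 t x))) with (- dQ G1 (fst (g2 t x)) (snd (g2 t x))).
      change (sg2 (autonomous G1) t (fst (g2 t x)) (snd (g2 t x))) with (dP G1 (fst (g2 t x)) (snd (g2 t x))).
      rewrite k1, k2, Ropp_0, !Rplus_0_l. destruct (flow_curve _ g2 x F2 t) as [h1 h2].
      split; [apply (is_derive_ext (fun s => fst (g2 s x)))|apply (is_derive_ext (fun s => snd (g2 s x)))]; try assumption; intros s; rewrite E; reflexivity.
Qed.

(* The moving Hamiltonian [- d tau'(t) V(p - d tau(t), q)] pushes U upwards along with itself, because its [q]-derivative
   is [- d tau'] and its [p]-derivative vanishes on the image of U. *)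
Lemma reach_translation (V : R -> R -> R) (d : R) : adm V -> exists psi l, reach psi l /\
  (forall x y, psi x = psi y -> x = y) /\
  (forall x, (exists c r, 0 < r /\ forall y, near r x y -> val V y = snd y + c) -> psi x = (fst x + d, snd x)).
Proof.
  intros AV. destruct (step_derive_facts 0 1 Rlt_0_1) as [Sd [Dd [Pd Zd]]]. set (tau := step 0 1) in *.
  assert (St : smooth1 tau) by (apply step_smooth; lra).
  set (H := fun t p q => - d*Derive tau t*V (p - d*tau t) q).
  assert (AH : admissible H).
  { destruct AV as [S [P [K HK]]]. split; [|split].
    - apply smooth3_smooth. apply (smooth_mult (fun t _ _ => - d*Derive tau t)).
      + apply (smooth_mult (fun _ _ _ => - d)); [apply smooth_const|pos].
      + apply (smooth_comp (autonomous V) (fun t _ _ => t) (fun t p _ => p - d*tau t) (fun _ _ q => q)); [apply smooth3_smooth; exact S|apply smooth_t| |apply smooth_q].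
        apply (smooth_minus (fun _ p _ => p)); [apply smooth_p|]. apply (smooth_mult (fun _ _ _ => d)); [apply smooth_const|pos].
    - intros t p q. unfold H. f_equal. exact (P t (p - d*tau t) q).
    - exists (K + Rabs d). intros t p q h. unfold H. assert (e := HK t (p - d*tau t) q). unfold autonomous in e. rewrite e; [lra|].
      assert (h1 := Rabs_triang (p - d*tau t) (d*tau t)). replace (p - d*tau t + d*tau t) with p in h1 by ring.
      rewrite (Rabs_mult d) in h1. assert (h2 := step_range 0 1 t Rlt_0_1). fold tau in h2. rewrite (Rabs_pos_eq (tau t)) in h1 by lra.
      assert (Rabs d*tau t <= Rabs d*1) by pos. lra. }
  destruct (ham_flow_exists H AH) as [g Hg]. exists (g 1), (hofer_length H). split; [|split].
  - exists H, g. split; [pos|split; [pos|split; [reflexivity|lra]]].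
  - intros x y. apply (flow_inj H g 1 x y AH Hg).
  - intros x [c [r [Hr Hc]]].
    rewrite (flow_unique H g (fun t => fst x + d*tau t) (fun _ => snd x) 0 x AH Hg).
    + assert (e : tau 1 = 1) by (apply step_1; lra). rewrite e, Rmult_1_r. reflexivity.
    + intros t. set (y := fst x + d*tau t).
      assert (E : forall a b, Rabs (a - y) < r -> Rabs (b - snd x) < r -> H t a b = - d*Derive tau t*(b + c)).
      { intros a b ha hb. unfold H. f_equal. apply (Hc (a - d*tau t, b)). split; simpl; [|lra].
        replace (a - d*tau t - fst x) with (a - y) by pos. exact ha. }
      assert (e2 : partial 2 H t y (snd x) = - d*Derive tau t).
      { apply is_derive_unique. apply (is_derive_near _ (fun b => - d*Derive tau t*(b + c)) _ _ r Hr).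
        - intros b hb. apply E; [rabs|lra].
        - auto_derive; [trivial|ring]. }
      assert (e1 : partial 1 H t y (snd x) = 0).
      { apply is_derive_unique. apply (is_derive_near _ (fun _ => - d*Derive tau t*(snd x + c)) _ _ r Hr).
        - intros a ha. apply E; [lra|rabs].
        - apply @is_derive_const. }
      split.
      * unfold sg1. rewrite e2. assert (D := Dd t).
        apply (is_derive_ext (fun s => d*tau s + fst x)); [intros s; apply Rplus_comm|].
        apply (is_derive_plus_const_r (fun s => d*tau s) (fst x)). replace (- (- d*Derive tau t)) with (0*tau t + d*Derive tau t) by ring.
        apply (is_derive_mult_R (fun _ => d) tau); [apply @is_derive_const|exact D].
      * unfold sg2. rewrite e1. apply @is_derive_const.
    + rewrite (flow_0 _ g _ Hg). assert (e : tau 0 = 0) by (apply step_0; lra). rewrite e, Rmult_0_r, Rplus_0_r. destruct x; reflexivity.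
Qed.

Lemma reach_ext (phi psi : R * R -> R * R) (l : R) : (forall x, phi x = psi x) -> reach phi l -> reach psi l.
Proof. intros E [H [g [A [Hg [e L]]]]]. exists H, g. split; [exact A|split; [pos|split; [|exact L]]]. intros x. rewrite <- E. apply e. Qed.

(* Averaging over disjoint translates: up to a bounded error, [k (n s)] is the flow at time [s] of the sum of [n] translates
   of K, whose oscillation does not grow with [n]. *)
Lemma stack_reach (K V : R -> R -> R) (k : isotopy) (U : R * R -> Prop) (a : R) :
  adm K -> flow_of K k -> adm V -> (forall p q, 0 <= K p q <= 1) ->
  (forall p q, a < Rabs p -> K p q = 0) -> 0 <= a ->
  (forall x, ~ U x -> dP K (fst x) (snd x) = 0 /\ dQ K (fst x) (snd x) = 0) ->
  (forall x, U x -> exists c r, 0 < r /\ forall y, near r x y -> val V y = snd y + c) ->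
  forall n, exists S b C, adm S /\ flow_of S b /\ (forall p q, 0 <= S p q <= 1) /\
    (forall p q, INR n*(2*a + 2) + a < p -> S p q = 0) /\ forall s, reach (fun x => k (INR n*s) (b (- s) x)) C.
Proof.
  intros AK Fk AV K01 Ka Ha NU HV. induction n as [|n [S [b [C [AS [Fb [S01 [Sz HC]]]]]]]].
  - assert (A0 : admissible (autonomous (fun _ _ => 0))).
    { split; [apply smooth3_smooth; exact (smooth_const 0)|split; [intros t p q; reflexivity|exists 0; reflexivity]]. }
    destruct (ham_flow_exists _ A0) as [b Fb]. exists (fun _ _ => 0), b, (0*osc (fun _ _ => 0)).
    split; [pos|split; [pos|split; [intros; lra|split; [reflexivity|]]]]. intros s.
    apply (reach_ext (b 0)); [|apply reach_autonomous; [lra|pos|pos]]. intros x. rewrite Rmult_0_l, (flow_0 _ k _ Fk).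
    rewrite (flow_0 _ b _ Fb). symmetry. apply (flow_stationary (fun _ _ => 0)); try assumption; apply is_derive_unique; apply @is_derive_const.
  - set (d := INR (Datatypes.S n)*(2*a + 2)).
    assert (Ed : d = INR n*(2*a + 2) + (2*a + 2)) by (unfold d; rewrite S_INR; ring).
    destruct (admissible_translate d K AK) as [AK' DK']. assert (Fk' := flow_translate d K k AK Fk).
    set (k' := fun t x => (fst (k t (fst x - d, snd x)) + d, snd (k t (fst x - d, snd x)))) in *.
    assert (Z2 : forall p q, p < (INR n*(2*a + 2) + a + 1) + 1 -> translate d K p q = 0).
    { intros p q h. apply Ka. rabs. }
    destruct (flow_sum S (translate d K) b k' (INR n*(2*a + 2) + a + 1) AS AK' Fb Fk') as [AS' Fb'].
    { intros p q h. apply Sz. lra. } { exact Z2. }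
    destruct (reach_translation V d AV) as [psi [l [Rpsi [Inj Tr]]]].
    destruct (reach_inverse psi l Rpsi) as [psi' [Rpsi' [I1 I2]]].
    exists (fun p q => S p q + translate d K p q), (fun t x => k' t (b t x)), (C + (l + l)).
    split; [pos|split; [pos|split; [|split]]].
    + intros p q. destruct (Rlt_dec p (INR n*(2*a + 2) + a + 1)) as [h|h].
      * rewrite Z2 by lra. rewrite Rplus_0_r. apply S01.
      * rewrite Sz by lra. rewrite Rplus_0_l. apply K01.
    + intros p q h. rewrite Sz by lra. unfold translate. rewrite Ka; [ring|]. rewrite Rabs_pos_eq by lra. lra.
    + intros s.
      (* psi translates U, where the flow k moves points. Off U the point x is fixed by k, and by
         injectivity psi x misses the translate of U, so it is fixed by k' too. *)
      assert (Comm : forall r x, k' r (psi x) = psi (k r x)).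
      { intros r x. assert (St : forall y t, ~ U y -> k t y = y).
        { intros y t Hy. destruct (NU y Hy). apply (flow_stationary K); assumption. }
        destruct (classic (U x)) as [Hx|Hx].
        - assert (Hkx : U (k r x)).
          { apply NNPP. intros Hn. apply Hn. assert (e := St _ (- r) Hn). rewrite (flow_inv K k AK Fk) in e. rewrite <- e. exact Hx. }
          rewrite (Tr _ (HV x Hx)), (Tr _ (HV _ Hkx)). unfold k'. simpl.
          replace (fst x + d - d) with (fst x) by ring. rewrite <- surjective_pairing. reflexivity.
        - rewrite (St x r Hx). unfold k'. set (z := (fst (psi x) - d, snd (psi x))).
          assert (Hz : ~ U z).
          { intros Hz. apply Hx. replace x with z; [pos|]. apply Inj. rewrite (Tr _ (HV z Hz)). simpl.
            replace (fst (psi x) - d + d) with (fst (psi x)) by ring. symmetry. apply surjective_pairing. }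
          rewrite (St z r Hz). simpl. replace (fst (psi x) - d + d) with (fst (psi x)) by ring. symmetry. apply surjective_pairing. }
      (* k_s k'_{-s} equals the commutator k_s psi k_{-s} psi^{-1}. Conjugation preserves length, so
         the cost is at most 2 l for every s; this is why C is independent of time. *)
      assert (RD : reach (fun x => k s (k' (- s) x)) (l + l)).
      { apply (reach_ext (fun x => k s (psi (k (- s) (psi' x))))).
        - intros x. rewrite <- Comm, I1. reflexivity.
        - apply (reach_comp psi' (fun x => k s (psi (k (- s) x))) l l Rpsi'). apply (reach_conjugate K k s psi l AK Fk Rpsi). }
      assert (Rc := reach_comp _ _ _ _ (HC s) (reach_conjugate K k (INR n*s) _ _ AK Fk RD)). revert Rc. apply reach_ext.
      intros x. rewrite (flow_inv K k AK Fk), S_INR.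
      replace ((INR n + 1)*s) with (INR n*s + s) by ring. rewrite (flow_add K k AK Fk). reflexivity.
Qed.

Lemma E_level_facts (F : R -> R -> R) : adm F -> (forall p q, F p q <= 1) ->
  0 <= E_level F /\ (forall E gamma, noncontractible_embedded_circle_in_level F E gamma -> E <= E_level F) /\
  (forall e, e < E_level F -> exists E gamma, e < E /\ noncontractible_embedded_circle_in_level F E gamma).
Proof.
  intros A F1. set (S := fun E => exists gamma, noncontractible_embedded_circle_in_level F E gamma).
  assert (B : forall E, S E -> E <= 1).
  { intros E [g [_ [_ [_ H]]]]. rewrite <- (H 0). apply F1. }
  assert (Z : S 0).
  (* A circle p = const outside the support lies on level 0, so the set of levels is nonempty and
     E(F) is a genuine supremum, at least 0. *)
  { destruct A as [_ [_ [K HK]]]. exists (fun s => (Rabs K + 1, s)). split; [|split; [|split]].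
    - intros s. apply filterlim_locally. intros eps. exists eps. intros s' Hs'. split; [apply ball_center|pos].
    - exists 1%Z. split; [discriminate|]. intros s. reflexivity.
    - intros s s' _ [m Hm]. exists m. exact Hm.
    - intros s. apply (HK 0). simpl. rabs. }
  destruct (lub_real S 0 1 Z B) as [U L]. split; [auto|split].
  - intros E g H. exact (U E (ex_intro _ g H)).
  - intros e He. apply NNPP. intros Hn. apply (Rlt_not_le _ _ He). apply L. intros E [g Hg].
    apply Rnot_lt_le. intros h. apply Hn. exists E, g. auto.
Qed.

(** F is split as (F - kap(F)) + kap(F) with commuting flows. The first part takes values in [0, c]
    with c = E(F) + eps/2 and costs at most t c. The second lives on {F >= b3}, is averaged over N +
    1 translates, and costs t/(N + 1) <= t eps/2 up to a constant. *)
Lemma upper_bound (F : R -> R -> R) (f : isotopy) (eps : R) : adm F -> flow_of F f ->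
  (forall p q, 0 <= F p q) -> (forall p q, F p q <= 1) -> 0 < eps -> exists C, forall t, 0 < t -> reach (f t) (C + t*(E_level F + eps)).
Proof.
  intros A Hf F0 F1 He. destruct (E_level_facts F A F1) as [E0 [EU _]].
  destruct (regular_interval F (E_level F) (E_level F + eps/2) A E0) as [c1 [c2 [h1 [h2 [h3 Hreg]]]]]; [lra|].
  destruct (branch_exists F f c1 c2 A Hf) as [W [PW LW]]; [lra|lra|pos| |].
  { intros x Hx Hes. destruct (essential_embedded_circle F f (val F x) x A Hf) as [g Hg]; [lra| |lra|pos|].
    - intros y Hy. apply Hreg. change (F (fst y) (snd y)) with (val F y). lra.
    - assert (h := EU _ _ Hg). lra. }
  set (c := E_level F + eps/2) in *.
  (* V is the branch W cut off between b1 and b2, hence an exact branch of q near {F >= b3}, outside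
     which kap(F) is locally zero. *)
  set (b1 := c2 + (c - c2)/5). set (b2 := c2 + (c - c2)*2/5). set (b3 := c2 + (c - c2)*3/5).
  assert (hb1 : c2 < b1) by pos. assert (hb2 : b1 < b2) by pos.
  assert (hb3 : b2 < b3) by pos. assert (hb4 : b3 < c) by pos.
  set (V := fun p q => step b1 b2 (F p q)*W p q).
  assert (AV : adm V).
  { split; [|split].
    - apply smooth3_smooth. apply smooth_local. intros t p q. destruct (Rlt_dec c2 (F p q)) as [h|h].
      + destruct (LW p q) as [r [Hr H]]; [lra|]. exists r, (fun _ p' q' => step b1 b2 (F p' q')*(q' + (W p q - q))).
        split; [lra|split].
        * apply (smooth_mult (fun t p q => step b1 b2 (autonomous F t p q))).
          -- apply (smooth1_comp (step b1 b2)); [apply step_smooth; exact hb2|]. apply (admissible_smooth _ A).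
          -- apply (smooth_plus (fun _ _ q => q)); [apply smooth_q|apply smooth_const].
        * intros t' p' q' _ hp hq. unfold autonomous, V. specialize (H p' q' (conj hp hq)). f_equal. lra.
      + destruct (val_near F A (p, q) (b1 - c2)) as [r [Hr H]]; [lra|]. exists r, (fun _ _ _ => 0).
        split; [lra|split; [apply smooth_const|]]. intros t' p' q' _ hp hq. unfold autonomous, V.
        specialize (H (p', q') (conj hp hq)). unfold val in H. simpl in H. abs H. rewrite step_0 by lra. ring.
    - intros t p q. unfold autonomous, V. rewrite PW. f_equal. f_equal. destruct A as [_ [P _]]. exact (P 0 p q).
    - destruct (proj2 (proj2 A)) as [K HK]. exists K. intros t p q h. unfold autonomous, V. assert (e := HK 0 p q h). unfold autonomous in e.
      rewrite e, step_0 by lra. ring. }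
  set (kap := fun y => y*step b3 c y).
  assert (Sk : smooth1 kap) by (apply (smooth_mult (fun t _ _ => t)); [apply smooth_t|apply step_smooth; exact hb4]).
  assert (kap0 : kap 0 = 0) by (unfold kap; ring).
  assert (Sl : smooth1 (fun y => y - kap y)) by (apply (smooth_minus (fun t _ _ => t)); [apply smooth_t|pos]).
  destruct (admissible_post F kap A Sk kap0) as [AK DK]. destruct (admissible_post F (fun y => y - kap y) A Sl) as [AL DL]; [lra|].
  destruct (ham_flow_exists _ AK) as [k Fk]. destruct (ham_flow_exists _ AL) as [g Fg].
  assert (Ek := time_change F _ f k (fun x => Derive kap (val F x)) A Hf AK Fk (fun t x => f_equal (Derive kap) (val_flow F f A Hf t x)) DK).
  assert (Eg := time_change F _ f g (fun x => Derive (fun y => y - kap y) (val F x)) A Hf AL Fg (fun t x => f_equal (Derive (fun y => y - kap y)) (val_flow F f A Hf t x)) DL).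
  assert (Split : forall t x, f t x = k t (g t x)).
  { intros t x. rewrite Ek, Eg, (val_flow F f A Hf), <- (flow_add F f A Hf). f_equal.
    assert (D : Derive (fun y => y - kap y) (val F x) = 1 - Derive kap (val F x)).
    { apply is_derive_unique. apply (is_derive_minus_R (fun y => y) kap); [apply @is_derive_id|]. apply (smooth1_derive kap Sk). }
    rewrite D. ring. }
  assert (R01 : forall y, 0 <= step b3 c y <= 1) by (intros y; apply step_range; exact hb4).
  destruct (exists_large_nat (2/eps)) as [N [_ HN]].
  destruct (proj2 (proj2 A)) as [a0 Ha0].
  destruct (stack_reach (fun p q => kap (F p q)) V k (fun x => b3 <= val F x) (Rabs a0) AK Fk AV) with (n := S N) as [St [b [C [AS [Fb [S01 [_ HC]]]]]]].
  { intros p q. unfold kap. specialize (R01 (F p q)). specialize (F0 p q). specialize (F1 p q). nra. }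
  { intros p q h. assert (e := Ha0 0 p q). unfold autonomous in e. rewrite e; [lra|]. rabs. }
  { pos. }
  { intros x Hx. apply Rnot_le_lt in Hx. destruct (val_near F A x (b3 - val F x)) as [r [Hr H]]; [lra|].
    apply (gradient_locally_const _ x 0 r Hr). intros y Hy. specialize (H y Hy). abs H. unfold kap.
    unfold val in *. rewrite step_0 by lra. ring. }
  { intros x Hx. destruct (LW (fst x) (snd x)) as [r [Hr H]]; [unfold val in Hx; lra|].
    destruct (val_near F A x (b3 - b2)) as [r' [Hr' H']]; [lra|].
    exists (W (fst x) (snd x) - snd x), (Rmin r r'). split; [pos|]. intros y Hy.
    rewrite <- surjective_pairing in H. assert (n1 := near_mono _ r _ _ Hy (Rmin_l _ _)). rewrite (surjective_pairing y) in n1. specialize (H _ _ n1).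
    specialize (H' y (near_mono _ _ _ _ Hy (Rmin_r _ _))). abs H'.
    unfold val, V in *. rewrite step_1 by lra. lra. }
  exists C. intros t Ht. set (s := t/INR (S N)). assert (HN0 : 0 < INR (S N)) by (rewrite S_INR; assert (h := pos_INR N); lra).
  assert (Es : INR (S N)*s = t) by (unfold s; field; lra). assert (Hs : 0 < s) by pos.
  assert (O1 : osc (fun p q => F p q - kap (F p q)) <= c).
  { apply (osc_spec _ (admissible_bounded _ 0 AL)). assert (L : forall p q, 0 <= F p q - kap (F p q) <= c).
    { intros p q. unfold kap. specialize (R01 (F p q)). specialize (F0 p q).
      replace (F p q - F p q*step b3 c (F p q)) with (F p q*(1 - step b3 c (F p q))) by ring. split; [pos|].
      destruct (Rle_dec c (F p q)) as [h|h]; [rewrite step_1 by lra; lra|].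
      nra. }
    intros p q p' q'. assert (u := L p q). assert (v := L p' q'). unfold autonomous in *. lra. }
  assert (O2 : osc St <= 1).
  { apply (osc_spec _ (admissible_bounded _ 0 AS)). intros p q p' q'. assert (u := S01 p q). assert (v := S01 p' q'). unfold autonomous. lra. }
  assert (R1 := reach_autonomous _ g t (Rlt_le _ _ Ht) AL Fg). assert (R2 := reach_autonomous _ b s (Rlt_le _ _ Hs) AS Fb).
  assert (RR := reach_comp _ _ _ _ R1 (reach_comp _ _ _ _ R2 (HC s))).
  assert (Len : t*osc (fun p q => F p q - kap (F p q)) + (s*osc St + C) <= C + t*(E_level F + eps)).
  { assert (t*osc (fun p q => F p q - kap (F p q)) <= t*c) by pos.
    assert (s*osc St <= s*1) by pos.
    assert (s <= t*(eps/2)).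
    { rewrite <- Es. replace (INR (S N)*s*(eps/2)) with (s*(INR (S N)*(eps/2))) by ring. rewrite <- (Rmult_1_r s) at 1.
      apply Rmult_le_compat_l; [lra|]. rewrite S_INR. assert (e : 1 = 2/eps*(eps/2)) by (field; lra). nra. }
    pos. }
  destruct RR as [H [h [AH [Fh [Eh Lh]]]]]. exists H, h. split; [pos|split; [pos|split; [|lra]]].
  intros x. rewrite Eh, (flow_inv St b AS Fb), Es. auto.
Qed.

(** * A cubical Brouwer theorem *)

Fixpoint xs (k : nat) (f : nat -> bool) : bool := match k with O => false | S k => xorb (xs k f) (f k) end.

Lemma xs_ext (k : nat) (f g : nat -> bool) : (forall i, (i < k)%nat -> f i = g i) -> xs k f = xs k g.
Proof. induction k as [|k IH]; intros H; [reflexivity|]. simpl. rewrite IH, H; [reflexivity|lia|]. auto. Qed.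
Lemma xs_xor (k : nat) (f g : nat -> bool) : xs k (fun i => xorb (f i) (g i)) = xorb (xs k f) (xs k g).
Proof. induction k as [|k IH]; [reflexivity|]. simpl. rewrite IH. destruct (xs k f), (xs k g), (f k), (g k); reflexivity. Qed.
Lemma xs_and (k : nat) (b : bool) (f : nat -> bool) : xs k (fun i => andb b (f i)) = andb b (xs k f).
Proof. induction k as [|k IH]; [destruct b; reflexivity|]. simpl. rewrite IH. destruct b, (xs k f), (f k); reflexivity. Qed.
Lemma xs_false (k : nat) : xs k (fun _ => false) = false.
Proof. induction k as [|k IH]; [reflexivity|]. simpl. rewrite IH. reflexivity. Qed.
Lemma xs_swap (k l : nat) (F : nat -> nat -> bool) : xs k (fun i => xs l (fun j => F i j)) = xs l (fun j => xs k (fun i => F i j)).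
Proof. induction k as [|k IH]; simpl; [rewrite xs_false; reflexivity|]. rewrite IH, <- xs_xor. reflexivity. Qed.
(** Off the diagonal, the terms (i, j) and (j, i) cancel mod 2. *)
Lemma xs_symm (k : nat) (F : nat -> nat -> bool) : (forall i j, F i j = F j i) -> (forall i, F i i = false) ->
  xs k (fun i => xs k (fun j => F i j)) = false.
Proof.
  intros Hs Hd. induction k as [|k IH]; [reflexivity|]. simpl. rewrite xs_xor, IH, Hd, (xs_ext k (fun i => F i k) (fun j => F k j)) by auto.
  destruct (xs k (F k)); reflexivity.
Qed.
Lemma xs_single (k d : nat) (f : nat -> bool) : (d < k)%nat -> (forall i, (i < k)%nat -> i <> d -> f i = false) -> xs k f = f d.
Proof.
  induction k as [|k IH]; intros Hd H; [lia|]. simpl. destruct (Nat.eq_dec d k) as [->|hn].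
  - rewrite (xs_ext k f (fun _ => false)) by (intros; apply H; lia). rewrite xs_false. destruct (f k); reflexivity.
  - rewrite IH, (H k) by (try lia; intros; apply H; lia). destruct (f d); reflexivity.
Qed.
Lemma xs_telescope (N : nat) (g : nat -> bool) : xs N (fun x => xorb (g (S x)) (g x)) = xorb (g N) (g O).
Proof. induction N as [|N IH]; simpl; [destruct (g O); reflexivity|]. rewrite IH. destruct (g N), (g O), (g (S N)); reflexivity. Qed.
Lemma xs_true (k : nat) (f : nat -> bool) : xs k f = true -> exists i, (i < k)%nat /\ f i = true.
Proof.
  induction k as [|k IH]; simpl; intros H; [lra|]. destruct (f k) eqn:E; [exists k; split; [lia|exact E]|].
  rewrite xorb_false_r in H. destruct (IH H) as [i [hi fi]]. exists i. auto.
Qed.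

Definition upd (a : nat -> nat) (d x : nat) : nat -> nat := fun i => if Nat.eqb i d then x else a i.
Definition incr (d : nat) (a : nat -> nat) : nat -> nat := upd a d (S (a d)).
Definition off (D : nat -> bool) (d : nat) : nat -> bool := fun i => andb (D i) (negb (Nat.eqb i d)).
Definition diff (d : nat) (f : (nat -> nat) -> bool) (a : nat -> nat) : bool := xorb (f (incr d a)) (f a).

Lemma upd_eq (a : nat -> nat) (d x : nat) : upd a d x d = x.
Proof. unfold upd. rewrite Nat.eqb_refl. reflexivity. Qed.
Lemma upd_ne (a : nat -> nat) (d x i : nat) : i <> d -> upd a d x i = a i.
Proof. intros h. unfold upd. apply Nat.eqb_neq in h. rewrite h. reflexivity. Qed.
Lemma upd_upd (a : nat -> nat) (d x y : nat) : upd (upd a d x) d y = upd a d y.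
Proof. ext i. unfold upd. destruct (Nat.eqb i d); reflexivity. Qed.
Lemma upd_comm (a : nat -> nat) (d e x y : nat) : d <> e -> upd (upd a d x) e y = upd (upd a e y) d x.
Proof. intros h. ext i. unfold upd. destruct (Nat.eqb_spec i e), (Nat.eqb_spec i d); try reflexivity. congruence. Qed.
Lemma incr_comm (d e : nat) (a : nat -> nat) : incr d (incr e a) = incr e (incr d a).
Proof.
  ext i. unfold incr, upd.
  destruct (Nat.eqb_spec i d), (Nat.eqb_spec i e), (Nat.eqb_spec d e), (Nat.eqb_spec e d); subst; try congruence; reflexivity.
Qed.
Lemma off_comm (D : nat -> bool) (d e : nat) : off (off D d) e = off (off D e) d.
Proof. ext i. unfold off. destruct (D i), (Nat.eqb i d), (Nat.eqb i e); reflexivity. Qed.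

Section Cubical.
Context (k : nat).

(* The cup product of the mod 2 coboundaries of the functions in [l], evaluated on the cube at [a] with edges along [D]. *)
Fixpoint cup (l : list ((nat -> nat) -> bool)) (D : nat -> bool) (a : nat -> nat) : bool := match l with
  | nil => true
  | s :: l => xs k (fun d => andb (D d) (andb (diff d s a) (cup l (off D d) (incr d a)))) end.

(** The coboundary of a product splits into second differences of s, collected in X, and products of
    a first difference of s with the coboundary of the remaining factors, collected in Y. Second
    differences are symmetric in the two directions and cancel; Y vanishes by induction. *)
Lemma cup_closed (l : list ((nat -> nat) -> bool)) : forall D a, xs k (fun d => andb (D d) (diff d (cup l (off D d)) a)) = false.
Proof.
  induction l as [|s l IH]; intros D a.
  - rewrite (xs_ext k _ (fun _ => false)); [apply xs_false|]. intros i _. destruct (D i); reflexivity.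
  - set (X := fun d d' => andb (andb (andb (D d) (D d')) (negb (Nat.eqb d' d))) (andb (diff d' (diff d s) a) (cup l (off (off D d) d') (incr d' (incr d a))))).
    set (Y := fun d d' => andb (andb (D d') (diff d' s a)) (andb (off D d' d) (diff d (cup l (off (off D d') d)) (incr d' a)))).
    rewrite (xs_ext k _ (fun d => xorb (xs k (fun d' => X d d')) (xs k (fun d' => Y d d')))).
    + rewrite xs_xor, (xs_symm k X), xs_swap.
      * rewrite (xs_ext k _ (fun _ => false)); [rewrite xs_false; reflexivity|]. intros d' _. unfold Y. rewrite xs_and, IH. apply andb_false_r.
      * intros d d'. unfold X. rewrite (incr_comm d' d), (off_comm D d d'), (Nat.eqb_sym d' d). unfold diff. rewrite (incr_comm d' d).
        destruct (D d), (D d'), (Nat.eqb d d'), (s (incr d (incr d' a))), (s (incr d a)), (s (incr d' a)), (s a); reflexivity.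
      * intros d. unfold X. rewrite Nat.eqb_refl. destruct (D d); reflexivity.
    + intros d _. unfold diff at 1. cbn [cup]. rewrite <- !xs_xor, <- xs_and. apply xs_ext. intros d' _. unfold X, Y, diff.
      rewrite (off_comm D d' d), (incr_comm d d'), (incr_comm d' d). unfold off.
      set (u := cup l (fun i => andb (andb (D i) (negb (Nat.eqb i d))) (negb (Nat.eqb i d'))) (incr d (incr d' a))).
      set (v := cup l (fun i => andb (andb (D i) (negb (Nat.eqb i d))) (negb (Nat.eqb i d'))) (incr d' a)).
      rewrite (Nat.eqb_sym d d').
      destruct (D d), (D d'), (Nat.eqb d' d), (s (incr d (incr d' a))), (s (incr d a)), (s (incr d' a)), (s a), u, v; reflexivity.
Qed.

(** The remaining product is closed, so adding s a times its vanishing coboundary completes the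
    Leibniz rule: the product is the coboundary of s times the rest. *)
Lemma cup_exact (s : (nat -> nat) -> bool) (l : list ((nat -> nat) -> bool)) (D : nat -> bool) (a : nat -> nat) :
  cup (s :: l) D a = xs k (fun d => andb (D d) (diff d (fun b => andb (s b) (cup l (off D d) b)) a)).
Proof.
  rewrite <- (xorb_false_r (cup (s :: l) D a)). rewrite <- (andb_false_r (s a)), <- (cup_closed l D a), <- xs_and. cbn [cup]. rewrite <- xs_xor.
  apply xs_ext. intros d _. unfold diff.
  destruct (D d), (s (incr d a)), (s a), (cup l (off D d) (incr d a)), (cup l (off D d) a); reflexivity.
Qed.

(** Q singles out vertices on which s is constant, so every difference of s along the cube is zero.
    The condition b d = a d records that each direction is used only once, which fits both a single
    cell and a face of the grid. *)
Lemma cup_vanish (s : (nat -> nat) -> bool) (Q : (nat -> nat) -> Prop) (c : bool) (l : list ((nat -> nat) -> bool)) : In s l ->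
  (forall b, Q b -> s b = c) -> forall D a, (forall d, D d = true -> forall b, Q b -> b d = a d -> Q (incr d b)) -> Q a -> cup l D a = false.
Proof.
  intros Hin Hc. induction l as [|s' l IH]; [destruct Hin|]. intros D a HQ Ha. cbn [cup].
  rewrite (xs_ext k _ (fun _ => false)); [apply xs_false|]. intros d _. destruct (D d) eqn:Ed; [|lra].
  destruct Hin as [->|Hin].
  - unfold diff. rewrite !Hc; [destruct c; reflexivity|exact Ha|]. apply HQ; [exact Ed|exact Ha|reflexivity].
  - rewrite IH; [lra|exact Hin| |].
    + intros e He b Hb Eb. apply andb_true_iff in He. destruct He as [He1 He2].
      apply negb_true_iff, Nat.eqb_neq in He2. apply HQ; [exact He1|exact Hb|]. rewrite Eb. apply upd_ne. all: auto.
Qed.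

Context (N : nat).

(** Sum mod 2 over all base points whose coordinates i < j with D i range over 0, ..., N - 1, the
    other coordinates being those of a. *)
Fixpoint cube (D : nat -> bool) (j : nat) (f : (nat -> nat) -> bool) (a : nat -> nat) : bool := match j with
  | O => f a
  | S j => if D j then xs N (fun x => cube D j f (upd a j x)) else cube D j f a end.

Lemma cube_ext (D : nat -> bool) (j : nat) (f g : (nat -> nat) -> bool) : (forall b, f b = g b) -> forall a, cube D j f a = cube D j g a.
Proof. intros H. induction j as [|j IH]; intros a; simpl; [apply H|]. destruct (D j); [apply xs_ext; intros|]; apply IH. Qed.

Lemma cube_xs (D : nat -> bool) (j m : nat) (f : nat -> (nat -> nat) -> bool) : forall a,
  cube D j (fun b => xs m (fun x => f x b)) a = xs m (fun x => cube D j (f x) a).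
Proof.
  induction j as [|j IH]; intros a; simpl; [reflexivity|]. destruct (D j); [|apply IH].
  rewrite xs_swap. apply xs_ext. auto.
Qed.

Lemma cube_false (D : nat -> bool) (j : nat) : forall a, cube D j (fun _ => false) a = false.
Proof. induction j as [|j IH]; intros a; simpl; [lra|]. destruct (D j); [|apply IH]. rewrite (xs_ext N _ (fun _ => false)); [apply xs_false|]. auto. Qed.

Lemma cube_upd (D : nat -> bool) (j d x : nat) (f : (nat -> nat) -> bool) : ((j <= d)%nat \/ D d = false) -> forall a,
  cube D j (fun b => f (upd b d x)) a = cube D j f (upd a d x).
Proof.
  induction j as [|j IH]; intros H a; simpl; [reflexivity|]. assert (H' : (j <= d)%nat \/ D d = false) by (destruct H; [left; lia|auto]).
  destruct (D j) eqn:E; [|apply IH, H']. apply xs_ext. intros y _. rewrite IH by exact H'. rewrite upd_comm; [reflexivity|].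
  intros ->. destruct H as [H|H]; [lia|congruence].
Qed.

Lemma cube_off (D : nat -> bool) (d j : nat) (f : (nat -> nat) -> bool) : (j <= d)%nat -> forall a, cube (off D d) j f a = cube D j f a.
Proof.
  induction j as [|j IH]; intros H a; simpl; [reflexivity|]. assert (E : off D d j = D j).
  { unfold off. destruct (Nat.eqb_spec j d); [lia|]. apply andb_true_r. }
  rewrite E. destruct (D j); [apply xs_ext; intros; apply IH; lia|apply IH; lia].
Qed.

(** Discrete Stokes formula: the sum over the coordinate d telescopes and leaves the two faces. *)
Lemma cube_diff (D : nat -> bool) (d j : nat) (g : (nat -> nat) -> bool) : D d = true -> (d < j)%nat -> forall a,
  cube D j (diff d g) a = cube (off D d) j (fun b => xorb (g (upd b d N)) (g (upd b d 0))) a.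
Proof.
  intros Dd. induction j as [|j IH]; intros Hj a; [lia|]. simpl. destruct (Nat.eq_dec j d) as [->|hn].
  - rewrite Dd. unfold off at 1. rewrite Nat.eqb_refl, Dd. cbv [andb].
    rewrite (xs_ext N _ (fun x => cube D d (fun b => diff d g (upd b d x)) a)) by (intros; symmetry; apply cube_upd; left; lia).
    rewrite <- cube_xs, cube_off by lia. apply cube_ext. intros b.
    rewrite (xs_ext N _ (fun x => xorb (g (upd b d (S x))) (g (upd b d x)))).
    + apply (xs_telescope N (fun x => g (upd b d x))).
    + intros x _. unfold diff, incr. rewrite upd_eq, upd_upd. reflexivity.
  - assert (E : off D d j = D j) by (unfold off; destruct (Nat.eqb_spec j d); [congruence|apply andb_true_r]).
    rewrite E. destruct (D j); [apply xs_ext; intros; apply IH; lia|apply IH; lia].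
Qed.

Context (s : nat -> (nat -> nat) -> bool) (Hs0 : forall d b, b d = O -> s d b = false) (Hs1 : forall d b, b d = N -> s d b = true).

Fixpoint labels (j : nat) : list ((nat -> nat) -> bool) := match j with O => nil | S j => s j :: labels j end.

Lemma labels_in (j d : nat) : (d < j)%nat -> In (s d) (labels j).
Proof. induction j as [|j IH]; intros H; [lia|]. simpl. destruct (Nat.eq_dec d j) as [->|h]; [auto|right; apply IH; lia]. Qed.

(** A mod 2 degree, computed by induction on dimension. The top product is exact, so its sum reduces
    to faces. The face with coordinate j equal to N gives the degree one dimension lower, the
    opposite one gives 0 since s j vanishes there, and on faces in directions d < j the remaining
    factor s d is constant. *)
Lemma labels_degree (j : nat) : (j <= k)%nat -> forall a, cube (fun i => Nat.ltb i j) k (cup (labels j) (fun i => Nat.ltb i j)) a = true.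
Proof.
  induction j as [|j IH]; intros Hj a.
  - set (D := fun i => Nat.ltb i 0). assert (forall m a, cube D m (cup nil D) a = true).
    { induction m as [|m IH]; intros b; [reflexivity|]. apply IH. }
    apply H.
  - set (D := fun i => Nat.ltb i (S j)).
    assert (OffD : off D j = fun i => Nat.ltb i j).
    { ext i. unfold off, D. destruct (Nat.eqb_spec i j), (Nat.ltb_spec i (S j)), (Nat.ltb_spec i j); try reflexivity; lia. }
    rewrite (cube_ext D k _ _ (cup_exact (s j) (labels j) D)), cube_xs.
    rewrite (xs_single k j); [|lia|].
    + assert (Dj : D j = true) by (apply Nat.ltb_lt; lia). rewrite Dj.
      rewrite (cube_ext D k _ (diff j (fun b => andb (s j b) (cup (labels j) (off D j) b)))) by reflexivity.
      rewrite cube_diff by auto. rewrite OffD.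
      rewrite (cube_ext _ k _ (fun b => cup (labels j) (fun i => Nat.ltb i j) (upd b j N))).
      * rewrite cube_upd; [apply IH; lia|right; apply Nat.ltb_ge; lia].
      * intros b. rewrite (Hs1 j), (Hs0 j (upd b j 0)) by apply upd_eq. apply xorb_false_r.
    + intros d Hd Hn. destruct (D d) eqn:Dd.
      * rewrite (cube_ext D k _ (diff d (fun b => andb (s j b) (cup (labels j) (off D d) b)))) by reflexivity.
        rewrite cube_diff by auto. rewrite (cube_ext _ k _ (fun _ => false)); [apply cube_false|]. intros b.
        assert (Hdj : (d < j)%nat) by (apply Nat.ltb_lt in Dd; lia).
        assert (V : forall v c, (forall b, b d = v -> s d b = c) -> cup (labels j) (off D d) (upd b d v) = false).
        { intros v c Hc. apply (cup_vanish (s d) (fun b => b d = v) c (labels j) (labels_in j d Hdj) Hc); [|apply upd_eq].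
          intros e He b' Hb' _. apply andb_true_iff in He. destruct He as [_ He]. apply negb_true_iff, Nat.eqb_neq in He.
          unfold incr. rewrite upd_ne by congruence. exact Hb'. }
        rewrite (V N true (Hs1 d)), (V O false (Hs0 d)), !andb_false_r. reflexivity.
      * apply cube_false.
Qed.

Lemma cube_true (D : nat -> bool) (j : nat) (f : (nat -> nat) -> bool) : forall a, cube D j f a = true -> exists b, f b = true /\ forall i, (b i < N)%nat \/ b i = a i.
Proof.
  induction j as [|j IH]; intros a H; simpl in H; [exists a; split; [exact H|auto]|].
  destruct (D j); [|apply IH, H]. apply xs_true in H. destruct H as [x [Hx H]]. destruct (IH _ H) as [b [Hb L]].
  exists b. split; [exact Hb|]. intros i. destruct (L i) as [h|h]; [auto|]. unfold upd in h. destruct (Nat.eqb i j); [left; lia|auto].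
Qed.

(** The degree is nonzero, so some cell contributes; by [cup_vanish] no label can be constant on its
    vertices. *)
Lemma mixed_cell : exists a, forall d, (d < k)%nat -> exists b b', s d b = true /\ s d b' = false /\
  (forall i, (i < k)%nat -> (a i <= b i <= S (a i))%nat) /\ (forall i, (i < k)%nat -> (a i <= b' i <= S (a i))%nat).
Proof.
  destruct (cube_true _ _ _ _ (labels_degree k (le_n k) (fun _ => O))) as [a [Ha _]]. exists a. intros d Hd.
  set (Q := fun b : nat -> nat => forall i, (i < k)%nat -> (a i <= b i <= S (a i))%nat).
  assert (V : forall c, ~ (forall b, Q b -> s d b = c)).
  { intros c Hc. rewrite (cup_vanish (s d) (fun b => forall i, (i < k)%nat -> (a i <= b i <= S (a i))%nat) c) in Ha.
    - discriminate.
    - apply labels_in, Hd.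
    - exact Hc.
    - intros e He b Hb Eb i Hi. unfold incr. destruct (Nat.eq_dec i e) as [->|h]; [rewrite upd_eq; lia|rewrite upd_ne by exact h; apply Hb, Hi].
    - auto. }
  assert (W : forall c, exists b, Q b /\ s d b = negb c).
  { intros c. apply NNPP. intros Hn. apply (V c). intros b Hb. apply NNPP. intros h. apply Hn. exists b. split; [exact Hb|].
    destruct (s d b), c; try reflexivity; congruence. }
  destruct (W false) as [b [Qb Eb]]. destruct (W true) as [b' [Qb' Eb']]. exists b, b'. auto.
Qed.
End Cubical.

(** On a cube of half side r > B the displacement bound makes each component of phi negative on one
    face and positive on the opposite one. Labelling grid points by signs, a mixed cell has both
    signs in each component, and on a mesh below d each component is within eps of 0 there. *)
Theorem near_identity_zero (n : nat) (phi : (nat -> R) -> nat -> R) (B eps : R) : 0 < eps ->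
  (forall x i, (i < n)%nat -> Rabs (phi x i - x i) <= B) ->
  (forall e, 0 < e -> exists d, 0 < d /\ forall x y, (forall i, (i < n)%nat -> Rabs (x i - y i) <= d) -> forall i, (i < n)%nat -> Rabs (phi x i - phi y i) <= e) ->
  exists x, forall i, (i < n)%nat -> Rabs (phi x i) <= eps.
Proof.
  intros He HB HU. destruct (HU eps He) as [d [Hd U]]. set (r := Rabs B + 1).
  assert (Hr : B < r /\ 1 <= r) by (unfold r; assert (h := Rle_abs B); assert (h' := Rabs_pos B); lra). destruct Hr as [Hr Hr1].
  set (N := S (Z.to_nat (up (2*r/d)))).
  assert (HN : 2*r/d < INR N).
  { unfold N. destruct (archimed (2*r/d)) as [h _]. rewrite S_INR. assert (0 < 2*r/d) by (apply Rdiv_lt_0_compat; lra).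
    rewrite INR_IZR_INZ, Z2Nat.id; [lra|]. apply le_IZR. lra. }
  assert (HN0 : 0 < INR N) by (unfold N; apply lt_0_INR; lia).
  set (h := 2*r/INR N). assert (Hh : 0 < h <= d).
  { unfold h. split; [apply Rdiv_lt_0_compat; lra|]. apply (Rmult_le_reg_r (INR N)); [lra|].
    replace (2*r/INR N*INR N) with (2*r) by (field; lra). apply (Rmult_lt_compat_r d) in HN; [|lra].
    replace (2*r/d*d) with (2*r) in HN by (field; lra). lra. }
  set (pt := fun (b : nat -> nat) i => - r + h*INR (b i)).
  (* For i >= n this is a dummy label, chosen to meet the face conditions for all indices. *)
  set (s := fun i b => if Nat.ltb i n then (if Rlt_dec 0 (phi (pt b) i) then true else false) else Nat.eqb (b i) N).
  destruct (mixed_cell n N s) as [a Ha].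
  - intros i b Hb. unfold s. destruct (Nat.ltb_spec i n) as [hi|hi]; [|rewrite Hb; reflexivity].
    destruct (Rlt_dec 0 (phi (pt b) i)) as [hp|hp]; [|lra]. assert (q := HB (pt b) i hi). abs q.
    unfold pt at 2 4 in q. rewrite Hb in q. simpl INR in q. lra.
  - intros i b Hb. unfold s. destruct (Nat.ltb_spec i n) as [hi|hi]; [|rewrite Hb; apply Nat.eqb_refl].
    destruct (Rlt_dec 0 (phi (pt b) i)) as [hp|hp]; [lra|]. exfalso. apply hp. assert (q := HB (pt b) i hi). abs q.
    unfold pt at 2 4 in q. rewrite Hb in q. assert (e : h*INR N = 2*r) by (unfold h; field; lra). lra.
  - exists (pt a). intros i Hi. destruct (Ha i Hi) as [b [b' [S1 [S0 [Q1 Q0]]]]].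
    assert (Cl : forall b, (forall i, (i < n)%nat -> (a i <= b i <= S (a i))%nat) -> forall i, (i < n)%nat -> Rabs (pt a i - pt b i) <= d).
    { intros c Hc j Hj. destruct (Hc j Hj) as [c1 c2]. apply le_INR in c1. apply le_INR in c2. rewrite S_INR in c2. unfold pt.
      assert (h*INR (a j) <= h*INR (c j)) by (apply Rmult_le_compat_l; lra). assert (h*INR (c j) <= h*(INR (a j) + 1)) by (apply Rmult_le_compat_l; lra).
      apply Rabs_le_between. lra. }
    assert (u1 := U _ _ (Cl b Q1) i Hi). assert (u0 := U _ _ (Cl b' Q0) i Hi). unfold s in S1, S0.
    destruct (Nat.ltb_spec i n); [|lia]. destruct (Rlt_dec 0 (phi (pt b) i)); [|lra]. destruct (Rlt_dec 0 (phi (pt b') i)); [lra|].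
    abs u1. abs u0. apply Rabs_le_between. lra.
Qed.

(** * Minimax values *)

Fixpoint rs (n : nat) (f : nat -> R) : R := match n with O => 0 | S n => rs n f + f n end.

Lemma rs_ext (n : nat) (f g : nat -> R) : (forall i, (i < n)%nat -> f i = g i) -> rs n f = rs n g.
Proof. induction n as [|n IH]; intros H; [reflexivity|]. simpl. rewrite IH, H; [lra|lia|]. auto. Qed.
Lemma rs_plus (n : nat) (f g : nat -> R) : rs n (fun i => f i + g i) = rs n f + rs n g.
Proof. induction n as [|n IH]; simpl; [ring|]. lra. Qed.
Lemma rs_scal (n : nat) (c : R) (f : nat -> R) : rs n (fun i => c*f i) = c*rs n f.
Proof. induction n as [|n IH]; simpl; [ring|]. lra. Qed.
Lemma rs_minus (n : nat) (f g : nat -> R) : rs n (fun i => f i - g i) = rs n f - rs n g.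
Proof. induction n as [|n IH]; simpl; [ring|]. lra. Qed.
Lemma rs_le (n : nat) (f g : nat -> R) : (forall i, (i < n)%nat -> f i <= g i) -> rs n f <= rs n g.
Proof. induction n as [|n IH]; intros H; [pos|]. apply Rplus_le_compat; [auto|apply H; lia]. Qed.
Lemma rs_const (n : nat) (c : R) : rs n (fun _ => c) = INR n*c.
Proof. induction n as [|n IH]; [simpl; ring|]. simpl rs. rewrite IH, S_INR. ring. Qed.
Lemma rs_nonneg (n : nat) (f : nat -> R) : (forall i, (i < n)%nat -> 0 <= f i) -> 0 <= rs n f.
Proof. intros H. assert (h := rs_le n (fun _ => 0) f H). rewrite rs_const, Rmult_0_r in h. exact h. Qed.
Lemma rs_abs (n : nat) (f : nat -> R) : Rabs (rs n f) <= rs n (fun i => Rabs (f i)).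
Proof. induction n as [|n IH]; simpl; [rabs|]. rabs. Qed.
Lemma rs_app (n m : nat) (f : nat -> R) : rs (n + m) f = rs n f + rs m (fun i => f (n + i)%nat).
Proof. induction m as [|m IH]; [rewrite Nat.add_0_r; simpl; ring|]. rewrite Nat.add_succ_r. simpl. lra. Qed.
Lemma rs_term (n i : nat) (f : nat -> R) : (forall j, (j < n)%nat -> 0 <= f j) -> (i < n)%nat -> f i <= rs n f.
Proof.
  induction n as [|n IH]; intros H Hi; [lia|]. simpl. destruct (Nat.eq_dec i n) as [->|h].
  - assert (0 <= rs n f) by (apply rs_nonneg; intros; apply H; lia). lra.
  - assert (f i <= rs n f) by (apply IH; [auto|lia]). assert (0 <= f n) by auto. lra.
Qed.
Lemma rs_mono (n m : nat) (f : nat -> R) : (n <= m)%nat -> (forall j, (j < m)%nat -> 0 <= f j) -> rs n f <= rs m f.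
Proof.
  intros h H. replace m with (n + (m - n))%nat by lia. rewrite rs_app. assert (0 <= rs (m - n) (fun i => f (n + i)%nat)) by (apply rs_nonneg; intros; apply H; lia). lra.
Qed.
(** Summation by parts: an increment with index j displaces all positions with index above j, so its
    coefficient in a derivative is a tail sum. *)
Lemma rs_parts (n : nat) (a b : nat -> R) : rs n (fun i => a i*rs i b) = rs n (fun j => b j*(rs n a - rs (S j) a)).
Proof.
  induction n as [|n IH]; [reflexivity|]. cbn [rs]. rewrite IH.
  rewrite (rs_ext n (fun j => b j*(rs n a + a n - (rs j a + a j))) (fun j => b j*(rs n a - (rs j a + a j)) + a n*b j)) by (intros; ring).
  rewrite rs_plus, rs_scal. cbn [rs]. ring.
Qed.
Lemma rs_square (n : nat) (f : nat -> R) : (rs n f)*(rs n f) <= INR n*rs n (fun i => f i*f i).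
Proof.
  induction n as [|n IH]; [pos|]. cbn [rs]. rewrite S_INR. set (A := rs n f) in *. set (Q := rs n (fun i => f i*f i)) in *. set (x := f n).
  destruct n as [|n].
  - unfold A, Q. simpl. lra.
  - set (m := INR (S n)) in *. assert (Hm : 0 < m) by (apply lt_0_INR; lia).
    assert (2*(A*x) <= Q + m*(x*x)).
    { apply (Rmult_le_reg_l m); [lra|]. assert (s := Rle_0_sqr (A - m*x)). unfold Rsqr in s.
      lra. }
    lra.
Qed.

Section Minmax.
Context (n k : nat) (e : (nat -> R) -> nat -> R).

Definition uc (u : (nat -> R) -> nat -> R) : Prop := forall eps, 0 < eps -> exists d, 0 < d /\
  forall x y, (forall i, (i < n)%nat -> Rabs (x i - y i) <= d) -> forall j, (j < k)%nat -> Rabs (u x j - u y j) <= eps.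
(** Bounded distance from e replaces a boundary condition at infinity, and uniform continuity is
    what [near_identity_zero] asks for. Both survive one bounded Lipschitz descent step. *)
Definition linking (u : (nat -> R) -> nat -> R) : Prop := uc u /\ exists B, forall x j, (j < k)%nat -> Rabs (u x j - e x j) <= B.
Definition minmax (S : (nat -> R) -> R) : R := real (Glb_Rbar (fun v => exists u, linking u /\ forall x, S (u x) <= v)).

Lemma minmax_spec (S : (nat -> R) -> R) (m : R) : (forall u v, linking u -> (forall x, S (u x) <= v) -> m <= v) ->
  (exists u v, linking u /\ forall x, S (u x) <= v) -> m <= minmax S /\
  (forall u v, linking u -> (forall x, S (u x) <= v) -> minmax S <= v) /\
  (forall eps, 0 < eps -> exists u, linking u /\ forall x, S (u x) <= minmax S + eps).
Proof.
  intros Hm [u0 [v0 [L0 H0]]]. unfold minmax. set (X := fun v => exists u, linking u /\ forall x, S (u x) <= v).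
  assert (Hb : forall v, X v -> m <= v) by (intros v [u [L H]]; exact (Hm u v L H)).
  destruct (glb_real X v0 m (ex_intro _ u0 (conj L0 H0)) Hb) as [lb glb]. split; [auto|split].
  - intros u v L H. exact (lb v (ex_intro _ u (conj L H))).
  - intros eps He. apply NNPP. intros Hn. assert (real (Glb_Rbar X) + eps <= real (Glb_Rbar X)); [|lra].
    apply glb. intros v [u [L H]]. apply Rnot_lt_le. intros hv. apply Hn. exists u. split; [exact L|]. intros x. specialize (H x). lra.
Qed.

Definition sum_abs (z : nat -> R) : R := rs k (fun j => Rabs (z j)).
(** The gradient may be unbounded; dividing by 1 plus its norm keeps the displacement at most eta in
    each coordinate, so that a linking map stays linking. *)
Definition descent (eta : R) (g : (nat -> R) -> nat -> R) (z : nat -> R) (j : nat) : R := - eta*(g z j/(1 + sum_abs (g z))).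

Lemma sum_abs_nonneg (z : nat -> R) : 0 <= sum_abs z.
Proof. apply rs_nonneg. intros; apply Rabs_pos. Qed.
Lemma sum_abs_term (z : nat -> R) (j : nat) : (j < k)%nat -> Rabs (z j) <= sum_abs z.
Proof. apply (rs_term k j (fun j => Rabs (z j))). intros; apply Rabs_pos. Qed.

Lemma ratio_bound (z : nat -> R) (j : nat) : (j < k)%nat -> Rabs (z j/(1 + sum_abs z)) <= 1.
Proof.
  intros Hj. assert (h := sum_abs_nonneg z). assert (h' := sum_abs_term z j Hj). unfold Rdiv. rewrite Rabs_mult, Rabs_inv, (Rabs_pos_eq (1 + _)) by lra.
  apply (Rmult_le_reg_r (1 + sum_abs z)); [lra|]. rewrite Rmult_assoc, Rinv_l by lra. lra.
Qed.

Lemma ratio_lipschitz (z z' : nat -> R) (j : nat) : (j < k)%nat ->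
  Rabs (z j/(1 + sum_abs z) - z' j/(1 + sum_abs z')) <= 2*sum_abs (fun i => z i - z' i).
Proof.
  intros Hj. assert (h := sum_abs_nonneg z). assert (h' := sum_abs_nonneg z').
  assert (D : Rabs (sum_abs z' - sum_abs z) <= sum_abs (fun i => z i - z' i)).
  { unfold sum_abs. rewrite <- rs_minus. via rs_abs. apply rs_le. intros i _. rewrite (Rabs_minus_sym (z i)).
    apply Rabs_triang_inv2. }
  assert (T := sum_abs_term (fun i => z i - z' i) j Hj). assert (Q := ratio_bound z' j Hj).
  set (a := sum_abs z) in *. set (b := sum_abs z') in *. set (w := sum_abs (fun i => z i - z' i)) in *.
  replace (z j/(1 + a) - z' j/(1 + b)) with (((z j - z' j) + z' j/(1 + b)*(b - a))/(1 + a)) by (field; lra).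
  unfold Rdiv at 1. rewrite Rabs_mult, Rabs_inv, (Rabs_pos_eq (1 + a)) by lra.
  assert (N : Rabs (z j - z' j + z' j/(1 + b)*(b - a)) <= 2*w).
  { via Rabs_triang. rewrite Rabs_mult. assert (Rabs (z' j/(1 + b))*Rabs (b - a) <= 1*w) by pos. lra. }
  apply (Rmult_le_reg_r (1 + a)); [lra|]. rewrite Rmult_assoc, Rinv_l, Rmult_1_r by lra.
  assert (0 <= w) by rabs. nra.
Qed.

(* If the gradient were bounded below near the minmax level, one step of the normalized gradient descent would push
   a nearly optimal map below that level. *)
Lemma minmax_critical (S : (nat -> R) -> R) (g : (nat -> R) -> nat -> R) (L m : R) : 0 < L ->
  (forall z h, S (fun j => z j + h j) <= S z + rs k (fun j => g z j*h j) + L*(sum_abs h*sum_abs h)) ->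
  (forall z z' j, (j < k)%nat -> Rabs (g z j - g z' j) <= L*sum_abs (fun j => z j - z' j)) ->
  (forall u v, linking u -> (forall x, S (u x) <= v) -> m <= v) -> (exists u v, linking u /\ forall x, S (u x) <= v) ->
  forall eps, 0 < eps -> exists z, Rabs (S z - minmax S) <= eps /\ sum_abs (g z) <= eps.
Proof.
  intros HL HS Hg Hm Hne eps He. destruct (minmax_spec S m Hm Hne) as [_ [C1 C2]].
  apply NNPP. intros Hn.
  (* K compares the squared 1-norm of the gradient with its squared Euclidean norm. With eta =
     1/(2KL) the quadratic error takes at most half of the linear decrease. *)
  set (K := INR k + 1). assert (HK : 0 < K) by (unfold K; assert (h := pos_INR k); lra).
  set (eta := / (2*K*L)). assert (Heta : 0 < eta) by pos.
  assert (De : 2*K*L*eta = 1) by (unfold eta; field; lra).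
  assert (Step : forall z, S (fun j => z j + descent eta g z j) <= S z - eta*(sum_abs (g z)*sum_abs (g z))/(2*K*(1 + sum_abs (g z)))).
  { intros z. via HS. set (G := sum_abs (g z)). assert (HG : 0 <= G) by apply sum_abs_nonneg.
    set (Q := rs k (fun j => g z j*g z j)).
    assert (E1 : rs k (fun j => g z j*descent eta g z j) = - eta/(1 + G)*Q).
    { unfold Q. rewrite <- rs_scal. apply rs_ext. intros j _. unfold descent. pos. }
    assert (E2 : sum_abs (descent eta g z) = eta/(1 + G)*G).
    { transitivity (rs k (fun j => eta/(1 + G)*Rabs (g z j))); [|apply rs_scal]. apply rs_ext. intros j _. unfold descent. fold G.
      replace (- eta*(g z j/(1 + G))) with (- (eta/(1 + G))*g z j) by lra. rewrite Rabs_mult, Rabs_Ropp, Rabs_pos_eq; [lra|].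
      pos. }
    rewrite E1, E2.
    assert (CS : G*G <= K*Q).
    { assert (c := rs_square k (fun j => Rabs (g z j))). fold (sum_abs (g z)) in c.
      rewrite (rs_ext k _ (fun j => g z j*g z j)) in c by (intros; rewrite <- Rabs_mult; apply Rabs_pos_eq, Rle_0_sqr).
      assert (0 <= Q) by (apply rs_nonneg; intros; apply Rle_0_sqr). pos. }
    set (i := / (1 + G)). assert (Hi : 0 < i) by pos. assert (Hi1 : i <= 1).
    { rewrite <- Rinv_1. apply Rinv_le_contravar; lra. }
    replace (- eta/(1 + G)*Q) with (- (eta*i*Q)) by pos.
    replace (eta/(1 + G)*G) with (eta*i*G) by pos.
    replace (eta*(G*G)/(2*K*(1 + G))) with (eta*i*(G*G) * / (2*K)) by (unfold i; field; lra).
    assert (Hei : 0 < eta*i) by pos.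
    assert (q1 : eta*i*(G*G) * / K <= eta*i*Q).
    { rewrite Rmult_assoc. apply Rmult_le_compat_l; [lra|]. apply (Rmult_le_reg_l K); [lra|]. replace (K*(G*G * / K)) with (G*G) by (field; lra). exact CS. }
    assert (q2 : L*(eta*i*G*(eta*i*G)) <= eta*i*(G*G) * / (2*K)).
    { replace (L*(eta*i*G*(eta*i*G))) with ((eta*i*(G*G))*(L*eta*i)) by ring.
      assert (LE : L*eta = / (2*K)) by (apply (Rmult_eq_reg_l (2*K)); [|lra]; rewrite Rinv_r by lra; rewrite <- De; ring).
      rewrite LE. apply Rmult_le_compat_l; [pos|]. assert (0 < / (2*K)) by pos.
      nra. }
    replace (/ K) with (2 * / (2*K)) in q1 by (field; lra). lra. }
  set (gain := eta*(eps*eps)/(2*K*(1 + eps))).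
  assert (Gain : forall z, eps <= sum_abs (g z) -> gain <= eta*(sum_abs (g z)*sum_abs (g z))/(2*K*(1 + sum_abs (g z)))).
  { intros z h. set (G := sum_abs (g z)) in *. unfold gain.
    assert (M : eps*eps/(1 + eps) <= G*G/(1 + G)).
    { apply (Rmult_le_reg_r ((1 + eps)*(1 + G))); [pos|].
      replace (eps*eps/(1 + eps)*((1 + eps)*(1 + G))) with (eps*eps*(1 + G)) by (field; lra).
      replace (G*G/(1 + G)*((1 + eps)*(1 + G))) with (G*G*(1 + eps)) by (field; lra).
      assert (eps*eps <= G*G) by pos. assert (eps*G*eps <= eps*G*G) by pos. lra. }
    apply (Rmult_le_compat_l (eta/(2*K))) in M; [|pos].
    replace (eta*(eps*eps)/(2*K*(1 + eps))) with (eta/(2*K)*(eps*eps/(1 + eps))) by (field; lra).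
    replace (eta*(G*G)/(2*K*(1 + G))) with (eta/(2*K)*(G*G/(1 + G))) by (field; lra). exact M. }
  set (c := Rmin eps gain/2). assert (Hc : 0 < c /\ c < eps /\ c < gain).
  { assert (h := Rmin_l eps gain). assert (h' := Rmin_r eps gain). assert (0 < Rmin eps gain) by pos. pos. }
  destruct (C2 c) as [u [[Uu [B HB]] Hu]]; [lra|].
  set (u' := fun x j => u x j + descent eta g (u x) j).
  assert (Lu' : linking u').
  { split.
    - intros d Hd. set (r := d/(1 + 2*eta*(K*(L*K)))). assert (Hr1 : 0 < 2*eta*(K*(L*K))) by pos.
      assert (Hr : 0 < r) by pos.
      destruct (Uu r Hr) as [d' [Hd' U]]. exists d'. split; [lra|]. intros x y Hxy j Hj. specialize (U x y Hxy).
      unfold u', descent. replace (u x j + - eta*(g (u x) j/(1 + sum_abs (g (u x)))) - (u y j + - eta*(g (u y) j/(1 + sum_abs (g (u y))))))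
        with ((u x j - u y j) + - eta*(g (u x) j/(1 + sum_abs (g (u x))) - g (u y) j/(1 + sum_abs (g (u y))))) by ring.
      via Rabs_triang. rewrite Rabs_mult, Rabs_Ropp, (Rabs_pos_eq eta) by lra.
      assert (RL := ratio_lipschitz (g (u x)) (g (u y)) j Hj).
      assert (Z : sum_abs (fun i => u x i - u y i) <= K*r).
      { apply Rle_trans with (rs k (fun _ => r)); [apply rs_le; intros i Hi; apply U, Hi|]. rewrite rs_const. pos. }
      assert (Gz : sum_abs (fun i => g (u x) i - g (u y) i) <= K*(L*(K*r))).
      { apply Rle_trans with (rs k (fun _ => L*(K*r))).
        - apply rs_le. intros i Hi. eapply Rle_trans; [apply Hg, Hi|]. apply Rmult_le_compat_l; lra.
        - rewrite rs_const. pos. }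
      assert (E : d = r*(1 + 2*eta*(K*(L*K)))) by (unfold r; field; lra). specialize (U j Hj).
      assert (eta*Rabs (g (u x) j/(1 + sum_abs (g (u x))) - g (u y) j/(1 + sum_abs (g (u y)))) <= eta*(2*(K*(L*(K*r))))) by pos.
      lra.
    - exists (B + eta). intros x j Hj. unfold u', descent. specialize (HB x j Hj). assert (q := ratio_bound (g (u x)) j Hj).
      replace (u x j + - eta*(g (u x) j/(1 + sum_abs (g (u x)))) - e x j) with ((u x j - e x j) + - eta*(g (u x) j/(1 + sum_abs (g (u x))))) by ring.
      via Rabs_triang. rewrite Rabs_mult, Rabs_Ropp, (Rabs_pos_eq eta) by lra.
      nra. }
  assert (Low : forall x, S (u' x) <= minmax S - Rmin (gain - c) eps).
  { intros x. unfold u'. specialize (Step (u x)). specialize (Hu x). assert (h1 := Rmin_l (gain - c) eps). assert (h2 := Rmin_r (gain - c) eps).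
    destruct (Rlt_dec (S (u x)) (minmax S - eps)) as [h|h].
    - assert (0 <= eta*(sum_abs (g (u x))*sum_abs (g (u x)))/(2*K*(1 + sum_abs (g (u x))))).
      { assert (q := sum_abs_nonneg (g (u x))). pos. }
      lra.
    - assert (hg : eps <= sum_abs (g (u x))).
      { apply Rnot_lt_le. intros hg. apply Hn. exists (u x). split; [rabs|lra]. }
      specialize (Gain (u x) hg). lra. }
  assert (F := C1 u' _ Lu' Low). assert (0 < Rmin (gain - c) eps) by pos. lra.
Qed.

Lemma minmax_close (S S' : (nat -> R) -> R) (m m' d : R) : (forall z, S z <= S' z + d) ->
  (forall u v, linking u -> (forall x, S (u x) <= v) -> m <= v) -> (exists u v, linking u /\ forall x, S (u x) <= v) ->
  (forall u v, linking u -> (forall x, S' (u x) <= v) -> m' <= v) -> (exists u v, linking u /\ forall x, S' (u x) <= v) ->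
  minmax S <= minmax S' + d.
Proof.
  intros H Hm Hne Hm' Hne'. destruct (minmax_spec S m Hm Hne) as [_ [C1 _]]. destruct (minmax_spec S' m' Hm' Hne') as [_ [_ C2]].
  apply Rnot_lt_le. intros h. destruct (C2 ((minmax S - (minmax S' + d))/2)) as [u [L Hu]]; [lra|].
  assert (q := C1 u (minmax S' + (minmax S - (minmax S' + d))/2 + d) L). assert (minmax S <= minmax S' + (minmax S - (minmax S' + d))/2 + d).
  { apply q. intros x. specialize (H (u x)). specialize (Hu x). lra. }
  lra.
Qed.
End Minmax.

(** * The discrete action functional *)

Lemma mul_abs_le (a b c d : R) : Rabs a <= c -> Rabs b <= d -> Rabs (a*b) <= c*d.
Proof. intros h1 h2. rewrite Rabs_mult. pos. Qed.

Lemma abs_le_sum (a b c d : R) : Rabs a <= c -> Rabs b <= d -> Rabs (a + b) <= c + d.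
Proof. intros h1 h2. rabs. Qed.

(* The variables [z] are the momenta [P_i = z i], the position increments [r_i = z (n + i)] (i < n) and the base point
   [(z (2 n), z (2 n + 1))]; [th = 0] freezes the base point at [(bp, bq)]. The last Hamiltonian only sees the base point. *)
Section Discrete.
Context (n : nat) (K Kp Kq : nat -> R -> R -> R) (th bp bq : R).

Definition posp (z : nat -> R) (i : nat) : R := bp + th*z (n + n)%nat + (if Nat.ltb i n then z i else 0).
Definition posq (z : nat -> R) (i : nat) : R := bq + th*z (n + n + 1)%nat + (if Nat.ltb i n then rs i (fun j => z (n + j)%nat) else 0).
(** A discretization of the integral of p dq - K dt, with momenta taken relative to the base point.
    At a critical point r_i = dK_i/dp and the momentum drops by dK_i/dq, which is the symplectic
    Euler scheme; for th = 1 the base point equations say that the step of the last Hamiltonian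
    leads from the end back to the start. *)
Definition act (z : nat -> R) : R := rs n (fun i => z i*z (n + i)%nat) - rs (S n) (fun i => K i (posp z i) (posq z i)).
Definition tailq (z : nat -> R) (j : nat) : R :=
  rs n (fun i => Kq i (posp z i) (posq z i)) - rs (S j) (fun i => Kq i (posp z i) (posq z i)).
Definition grad (z : nat -> R) (j : nat) : R :=
  if Nat.ltb j n then z (n + j)%nat - Kp j (posp z j) (posq z j)
  else if Nat.ltb j (n + n) then z (j - n)%nat - tailq z (j - n)
  else if Nat.eqb j (n + n) then - th*rs (S n) (fun i => Kp i (posp z i) (posq z i))
  else - th*rs (S n) (fun i => Kq i (posp z i) (posq z i)).
(** The plane r = - P, where the quadratic part is - sum P_i^2 and the functional is bounded
    above. *)
Definition base_plane (x : nat -> R) (j : nat) : R :=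
  if Nat.ltb j n then x j else if Nat.ltb j (n + n) then - x (j - n)%nat else 0.
Definition value : R := minmax n (n + n + 2) base_plane act.

Lemma grad_P (z : nat -> R) (j : nat) : (j < n)%nat -> grad z j = z (n + j)%nat - Kp j (posp z j) (posq z j).
Proof. intros h. unfold grad. apply Nat.ltb_lt in h. rewrite h. lra. Qed.
Lemma grad_r (z : nat -> R) (j : nat) : (j < n)%nat -> grad z (n + j) = z j - tailq z j.
Proof.
  intros h. unfold grad. destruct (Nat.ltb_spec (n + j) n); [lia|]. destruct (Nat.ltb_spec (n + j) (n + n)); [|lia].
  replace (n + j - n)%nat with j by lia. lra.
Qed.
Lemma grad_bp (z : nat -> R) : grad z (n + n) = - th*rs (S n) (fun i => Kp i (posp z i) (posq z i)).
Proof. unfold grad. destruct (Nat.ltb_spec (n + n) n); [lia|]. destruct (Nat.ltb_spec (n + n) (n + n)); [lia|]. rewrite Nat.eqb_refl. lra. Qed.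
Lemma grad_bq (z : nat -> R) : grad z (n + n + 1) = - th*rs (S n) (fun i => Kq i (posp z i) (posq z i)).
Proof.
  unfold grad. destruct (Nat.ltb_spec (n + n + 1) n); [lia|]. destruct (Nat.ltb_spec (n + n + 1) (n + n)); [lia|].
  destruct (Nat.eqb_spec (n + n + 1) (n + n)); [lia|]. lra.
Qed.
Lemma rs_split (f : nat -> R) : rs (n + n + 2) f = rs n f + rs n (fun i => f (n + i)%nat) + f (n + n)%nat + f (n + n + 1)%nat.
Proof. rewrite rs_app, rs_app. simpl. rewrite Nat.add_0_r. ring. Qed.

Context (L M : R) (HL : 0 <= L) (Hth : 0 <= th <= 1).
Context (HT : forall i p q a b, Rabs (K i (p + a) (q + b) - K i p q - Kp i p q*a - Kq i p q*b) <= L*((Rabs a + Rabs b)*(Rabs a + Rabs b))).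
Context (HLp : forall i p q p' q', Rabs (Kp i p' q' - Kp i p q) <= L*(Rabs (p' - p) + Rabs (q' - q))).
Context (HLq : forall i p q p' q', Rabs (Kq i p' q' - Kq i p q) <= L*(Rabs (p' - p) + Rabs (q' - q))).
Context (HM : forall i p q, Rabs (K i p q) <= M).

Let A (h : nat -> R) : R := sum_abs (n + n + 2) h.

Definition dposp (h : nat -> R) (i : nat) : R := th*h (n + n)%nat + (if Nat.ltb i n then h i else 0).
Definition dposq (h : nat -> R) (i : nat) : R := th*h (n + n + 1)%nat + (if Nat.ltb i n then rs i (fun j => h (n + j)%nat) else 0).

Lemma coord_bound (h : nat -> R) (i : nat) : (i < n + n + 2)%nat -> Rabs (h i) <= A h.
Proof. apply sum_abs_term. Qed.

Lemma dpos_bound (h : nat -> R) (i : nat) : Rabs (dposp h i) + Rabs (dposq h i) <= A h.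
Proof.
  assert (E : A h = rs n (fun i => Rabs (h i)) + rs n (fun i => Rabs (h (n + i)%nat)) + Rabs (h (n + n)%nat) + Rabs (h (n + n + 1)%nat)) by (apply rs_split).
  assert (T : forall x, Rabs (th*x) <= Rabs x).
  { intros x. rewrite Rabs_mult, (Rabs_pos_eq th) by lra. assert (th*Rabs x <= 1*Rabs x) by pos. lra. }
  assert (t1 := T (h (n + n)%nat)). assert (t2 := T (h (n + n + 1)%nat)).
  assert (h1 : Rabs (if Nat.ltb i n then h i else 0) <= rs n (fun i => Rabs (h i))).
  { destruct (Nat.ltb_spec i n) as [hi|hi]; [apply (rs_term n i (fun i => Rabs (h i))); [intros; apply Rabs_pos|pos]|].
    rewrite Rabs_R0. apply rs_nonneg. intros; apply Rabs_pos. }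
  assert (h2 : Rabs (if Nat.ltb i n then rs i (fun j => h (n + j)%nat) else 0) <= rs n (fun i => Rabs (h (n + i)%nat))).
  { destruct (Nat.ltb_spec i n) as [hi|hi].
    - via rs_abs. apply rs_mono; [lia|]. intros; apply Rabs_pos.
    - rewrite Rabs_R0. apply rs_nonneg. intros; apply Rabs_pos. }
  assert (q1 := abs_le_sum _ _ _ _ t1 h1). assert (q2 := abs_le_sum _ _ _ _ t2 h2). unfold dposp, dposq. lra.
Qed.

Lemma pos_plus (z h : nat -> R) (i : nat) : posp (fun j => z j + h j) i = posp z i + dposp h i /\ posq (fun j => z j + h j) i = posq z i + dposq h i.
Proof. unfold posp, posq, dposp, dposq. rewrite rs_plus. split; destruct (Nat.ltb i n); ring. Qed.

Lemma A_nonneg (h : nat -> R) : 0 <= A h.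
Proof. apply sum_abs_nonneg. Qed.

Lemma act_expand (z h : nat -> R) :
  act (fun j => z j + h j) <= act z + rs (n + n + 2) (fun j => grad z j*h j) + (1 + 4*L*(INR n + 1))*(A h*A h).
Proof.
  set (P := fun i => Kp i (posp z i) (posq z i)). set (Q := fun i => Kq i (posp z i) (posq z i)).
  assert (G : rs (n + n + 2) (fun j => grad z j*h j) =
    rs n (fun i => z (n + i)%nat*h i + z i*h (n + i)%nat) - rs (S n) (fun i => P i*dposp h i + Q i*dposq h i)).
  { rewrite rs_split, grad_bp, grad_bq. fold P Q.
    rewrite (rs_ext n (fun j => grad z j*h j) (fun j => z (n + j)%nat*h j - P j*h j)) by (intros j hj; rewrite grad_P by exact hj; unfold P; ring).
    rewrite (rs_ext n (fun j => grad z (n + j)*h (n + j)%nat) (fun j => z j*h (n + j)%nat - h (n + j)%nat*(rs n Q - rs (S j) Q)))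
      by (intros j hj; rewrite grad_r by exact hj; unfold tailq, Q; ring).
    (* Summation by parts converts the tail sums of [grad] into derivatives along the accumulated
       increments. *)
    rewrite !rs_minus, rs_plus, <- (rs_parts n Q (fun j => h (n + j)%nat)).
    rewrite (rs_ext (S n) (fun i => P i*dposp h i + Q i*dposq h i)
      (fun i => (h (n + n)%nat*th*P i + h (n + n + 1)%nat*th*Q i) + (if Nat.ltb i n then P i*h i + Q i*rs i (fun j => h (n + j)%nat) else 0))).
    - rewrite rs_plus, rs_plus, !rs_scal. cbn [rs]. rewrite Nat.ltb_irrefl.
      rewrite (rs_ext n (fun i => if Nat.ltb i n then P i*h i + Q i*rs i (fun j => h (n + j)%nat) else 0)
        (fun i => P i*h i + Q i*rs i (fun j => h (n + j)%nat))) by (intros i hi; apply Nat.ltb_lt in hi; rewrite hi; reflexivity).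
      rewrite rs_plus. ring.
    - intros i _. unfold dposp, dposq. destruct (Nat.ltb i n); ring. }
  rewrite G. unfold act.
  rewrite (rs_ext n (fun i => (z i + h i)*(z (n + i)%nat + h (n + i)%nat))
    (fun i => (z i*z (n + i)%nat + (z (n + i)%nat*h i + z i*h (n + i)%nat)) + h i*h (n + i)%nat)) by (intros; ring).
  rewrite rs_plus, rs_plus.
  assert (B1 : rs n (fun i => h i*h (n + i)%nat) <= A h*A h).
  { apply Rle_trans with (rs n (fun i => A h*Rabs (h i))).
    - apply rs_le. intros i hi. via Rle_abs. rewrite Rabs_mult, Rmult_comm. apply Rmult_le_compat_r; [pos|].
      apply coord_bound. lia.
    - rewrite rs_scal. apply Rmult_le_compat_l; [apply A_nonneg|]. apply (rs_mono n (n + n + 2) (fun i => Rabs (h i))); [lia|]. intros; apply Rabs_pos. }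
  assert (B2 : rs (S n) (fun i => K i (posp z i) (posq z i)) + rs (S n) (fun i => P i*dposp h i + Q i*dposq h i) -
    rs (S n) (fun i => K i (posp (fun j => z j + h j) i) (posq (fun j => z j + h j) i)) <= L*(INR n + 1)*(A h*A h)).
  { rewrite <- rs_plus, <- rs_minus. apply Rle_trans with (rs (S n) (fun _ => L*(A h*A h))).
    - apply rs_le. intros i _. destruct (pos_plus z h i) as [-> ->]. assert (t := HT i (posp z i) (posq z i) (dposp h i) (dposq h i)).
      abs t. assert (db := dpos_bound h i). unfold P, Q.
      assert (0 <= Rabs (dposp h i) + Rabs (dposq h i)) by rabs.
      assert (L*((Rabs (dposp h i) + Rabs (dposq h i))*(Rabs (dposp h i) + Rabs (dposq h i))) <= L*(A h*A h)) by pos.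
      lra.
    - rewrite rs_const, S_INR. lra. }
  assert (0 <= L*(INR n + 1)*(A h*A h)).
  { apply Rmult_le_pos; [apply Rmult_le_pos; [lra|assert (q := pos_INR n); lra]|apply Rle_0_sqr]. }
  lra.
Qed.

Lemma grad_lipschitz (z z' : nat -> R) (j : nat) : (j < n + n + 2)%nat ->
  Rabs (grad z j - grad z' j) <= (1 + 4*L*(INR n + 1))*A (fun j => z j - z' j).
Proof.
  intros Hj. set (w := fun j => z j - z' j). assert (HA := A_nonneg w). assert (Hn := pos_INR n).
  assert (Ep : forall i, posp z i - posp z' i = dposp w i) by (intros i; unfold posp, dposp, w; destruct (Nat.ltb i n); ring).
  assert (Eq : forall i, posq z i - posq z' i = dposq w i).
  { intros i. unfold posq, dposq, w. rewrite rs_minus. destruct (Nat.ltb i n); ring. }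
  assert (Bp : forall i, Rabs (Kp i (posp z i) (posq z i) - Kp i (posp z' i) (posq z' i)) <= L*A w).
  { intros i. via HLp. rewrite Ep, Eq. apply Rmult_le_compat_l; [lra|apply dpos_bound]. }
  assert (Bq : forall i, Rabs (Kq i (posp z i) (posq z i) - Kq i (posp z' i) (posq z' i)) <= L*A w).
  { intros i. via HLq. rewrite Ep, Eq. apply Rmult_le_compat_l; [lra|apply dpos_bound]. }
  assert (Bs : forall m (a b : nat -> R), (m <= S n)%nat -> (forall i, Rabs (a i - b i) <= L*A w) -> Rabs (rs m a - rs m b) <= L*(INR n + 1)*A w).
  { intros m a b Hm Hab. rewrite <- rs_minus. via rs_abs. apply Rle_trans with (rs m (fun _ => L*A w)).
    - apply rs_le. intros i _. apply Hab.
    - rewrite rs_const. apply le_INR in Hm. rewrite S_INR in Hm. replace (L*(INR n + 1)*A w) with ((INR n + 1)*(L*A w)) by ring.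
      pos. }
  assert (Pos : 0 <= L*A w /\ 0 <= L*INR n*A w) by (split; repeat apply Rmult_le_pos; assumption). destruct Pos as [Po1 Po2].
  assert (Th : forall a b c, Rabs (a - b) <= c -> Rabs (- th*a - - th*b) <= c).
  { intros a b c h. replace (- th*a - - th*b) with (th*(b - a)) by ring. replace c with (1*c) by ring. apply mul_abs_le.
    - all: rabs. }
  destruct (lt_dec j n) as [h1|h1].
  - rewrite !grad_P by exact h1. assert (c : Rabs (z (n + j)%nat - z' (n + j)%nat) <= A w) by (apply (coord_bound w (n + j)); lia). specialize (Bp j).
    abs c. abs Bp. apply Rabs_le_between. lra.
  - destruct (lt_dec j (n + n)) as [h2|h2].
    + replace j with (n + (j - n))%nat by lia. assert (h3 : (j - n < n)%nat) by lia. set (i := (j - n)%nat) in *. rewrite !grad_r by exact h3.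
      assert (c : Rabs (z i - z' i) <= A w) by (apply (coord_bound w i); lia). unfold tailq.
      assert (b1 := Bs n _ _ (le_S _ _ (le_n n)) Bq). assert (b2 := Bs (S i) _ _ ltac:(lia) Bq).
      abs c. abs b1. abs b2. apply Rabs_le_between. lra.
    + destruct (Nat.eq_dec j (n + n)) as [->|h3].
      * rewrite !grad_bp. assert (b := Th _ _ _ (Bs (S n) _ _ (le_n _) Bp)). lra.
      * replace j with (n + n + 1)%nat by lia. rewrite !grad_bq. assert (b := Th _ _ _ (Bs (S n) _ _ (le_n _) Bq)). lra.
Qed.

Lemma linking_base_plane : linking n (n + n + 2) base_plane base_plane.
Proof.
  split.
  - intros eps He. exists eps. split; [lra|]. intros x y H j Hj. unfold base_plane.
    destruct (Nat.ltb_spec j n); [auto|]. destruct (Nat.ltb_spec j (n + n)).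
    + replace (- x (j - n)%nat - - y (j - n)%nat) with (- (x (j - n)%nat - y (j - n)%nat)) by ring. rewrite Rabs_Ropp. apply H. lia.
    + rewrite Rminus_diag, Rabs_R0. lra.
  - exists 0. intros x j _. rabs.
Qed.

Lemma act_above : exists u v, linking n (n + n + 2) base_plane u /\ forall x, act (u x) <= v.
Proof.
  exists base_plane, (INR (S n)*M). split; [apply linking_base_plane|]. intros x. unfold act.
  assert (h1 : rs n (fun i => base_plane x i*base_plane x (n + i)%nat) <= 0).
  { replace 0 with (rs n (fun _ => 0)) by (rewrite rs_const; ring). apply rs_le. intros i Hi. unfold base_plane.
    destruct (Nat.ltb_spec i n); [|lia]. destruct (Nat.ltb_spec (n + i) n); [lia|]. destruct (Nat.ltb_spec (n + i) (n + n)); [|lia].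
    replace (n + i - n)%nat with i by lia. nra. }
  assert (h2 : - (INR (S n)*M) <= rs (S n) (fun i => K i (posp (base_plane x) i) (posq (base_plane x) i))).
  { replace (- (INR (S n)*M)) with (rs (S n) (fun _ => - M)) by (rewrite rs_const; ring). apply rs_le. intros i _.
    assert (m := HM i (posp (base_plane x) i) (posq (base_plane x) i)). rabs. }
  lra.
Qed.

(* Every linking map hits the diagonal [P = r] up to a small error, and there the quadratic part is nonnegative. *)
Lemma act_linking_bound (kap : nat -> R) : (forall i p q, (i <= n)%nat -> K i p q <= kap i) ->
  forall u v, linking n (n + n + 2) base_plane u -> (forall x, act (u x) <= v) -> - rs (S n) kap <= v.
Proof.
  intros Hk u v [Uu [B HB]] Hv. apply Rnot_lt_le. intros Hlt.
  set (d := - rs (S n) kap - v) in *. assert (Hn := pos_INR n).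
  set (eps := Rmin 1 (d/(2*(INR n + 1)))). assert (He : 0 < eps) by pos.
  (* On the base plane (P - r)/2 is the parameter itself, so for a linking map it is near the
     identity. *)
  destruct (near_identity_zero n (fun x i => (u x i - u x (n + i)%nat)/2) B eps He) as [x Hx].
  - intros x i Hi. assert (b1 := HB x i ltac:(lia)). assert (b2 := HB x (n + i)%nat ltac:(lia)). unfold base_plane in b1, b2.
    destruct (Nat.ltb_spec i n); [|lia]. destruct (Nat.ltb_spec (n + i) n); [lia|]. destruct (Nat.ltb_spec (n + i) (n + n)); [|lia].
    replace (n + i - n)%nat with i in b2 by lia. abs b1. abs b2. apply Rabs_le_between. lra.
  - intros e0 He0. destruct (Uu e0 He0) as [dl [Hdl U]]. exists dl. split; [lra|]. intros x y Hxy i Hi.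
    assert (b1 := U x y Hxy i ltac:(lia)). assert (b2 := U x y Hxy (n + i)%nat ltac:(lia)).
    abs b1. abs b2. apply Rabs_le_between. lra.
  - specialize (Hv x). unfold act in Hv.
    assert (h1 : - (INR n*eps) <= rs n (fun i => u x i*u x (n + i)%nat)).
    { replace (- (INR n*eps)) with (rs n (fun _ => - eps)) by (rewrite rs_const; ring). apply rs_le. intros i Hi. specialize (Hx i Hi).
      set (a := u x i) in *. set (b := u x (n + i)%nat) in *. assert (s := Rle_0_sqr (a + b)). unfold Rsqr in s.
      assert (t : Rabs ((a - b)/2*((a - b)/2)) <= eps*eps) by (apply mul_abs_le; exact Hx). abs t.
      assert (eps*eps <= 1*eps) by (apply Rmult_le_compat_r; [lra|apply Rmin_l]).
      lra. }
    assert (h2 : rs (S n) (fun i => K i (posp (u x) i) (posq (u x) i)) <= rs (S n) kap) by (apply rs_le; intros i Hi; apply Hk; lia).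
    assert (h3 : INR n*eps <= d/2).
    { assert (eps <= d/(2*(INR n + 1))) by apply Rmin_r. apply Rle_trans with ((INR n + 1)*(d/(2*(INR n + 1)))).
      - apply Rmult_le_compat; lra.
      - right. field. lra. }
    pos.
Qed.

Lemma act_below (u : (nat -> R) -> nat -> R) (v : R) : linking n (n + n + 2) base_plane u -> (forall x, act (u x) <= v) -> - (INR (S n)*M) <= v.
Proof.
  intros Lu Hv. rewrite <- rs_const. apply (act_linking_bound (fun _ => M)) with (u := u); [|pos|pos].
  intros i p q _. assert (h := HM i p q). rabs.
Qed.

Lemma value_lower (kap : nat -> R) : (forall i p q, (i <= n)%nat -> K i p q <= kap i) -> - rs (S n) kap <= value.
Proof. intros Hk. apply (minmax_spec _ _ _ act _ (act_linking_bound kap Hk) act_above). Qed.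

Lemma value_critical (eps : R) : 0 < eps -> exists z, Rabs (act z - value) <= eps /\ sum_abs (n + n + 2) (grad z) <= eps.
Proof.
  assert (Hn := pos_INR n). assert (Hp : 0 <= 4*L*(INR n + 1)) by pos.
  apply (minmax_critical n (n + n + 2) base_plane act grad (1 + 4*L*(INR n + 1)) (- (INR (S n)*M))).
  - lra.
  - apply act_expand.
  - intros z z' j Hj. apply grad_lipschitz, Hj.
  - apply act_below.
  - apply act_above.
Qed.
End Discrete.

Lemma value_close (n : nat) (K K' : nat -> R -> R -> R) (th bp bq M d : R) : (forall i p q, Rabs (K i p q) <= M) -> (forall i p q, Rabs (K' i p q) <= M) ->
  (forall i p q, (i <= n)%nat -> K' i p q <= K i p q + d) -> value n K th bp bq <= value n K' th bp bq + INR (S n)*d.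
Proof.
  intros H H' Hd. apply (minmax_close _ _ _ _ _ (- (INR (S n)*M)) (- (INR (S n)*M))).
  - intros z. unfold act. assert (h : rs (S n) (fun i => K' i (posp n th bp z i) (posq n th bq z i)) <=
      rs (S n) (fun i => K i (posp n th bp z i) (posq n th bq z i) + d)) by (apply rs_le; intros; apply Hd; lia).
    rewrite rs_plus, rs_const in h. lra.
  - intros u v. apply (act_below n K th bp bq M H).
  - apply (act_above n K th bp bq M H).
  - intros u v. apply (act_below n K' th bp bq M H').
  - apply (act_above n K' th bp bq M H').
Qed.

(** A linking map of the problem with frozen base point becomes one of the free problem by setting
    the base coordinates to the constant (bp, bq), at bounded distance from the base plane. So
    freeing the base point can only lower the minimax. *)
Lemma value_fiber (n : nat) (K : nat -> R -> R -> R) (bp bq M : R) : (forall i p q, Rabs (K i p q) <= M) -> value n K 1 0 0 <= value n K 0 bp bq.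
Proof.
  intros HM. assert (b0 := act_below n K 0 bp bq M HM). assert (b1 := act_below n K 1 0 0 M HM).
  destruct (minmax_spec _ _ _ (act n K 0 bp bq) _ b0 (act_above n K 0 bp bq M HM)) as [_ [_ C0]].
  destruct (minmax_spec _ _ _ (act n K 1 0 0) _ b1 (act_above n K 1 0 0 M HM)) as [_ [C1 _]].
  apply Rnot_lt_le. intros h. destruct (C0 ((value n K 1 0 0 - value n K 0 bp bq)/2)) as [u [[Uu [B HB]] Hu]]; [lra|].
  set (w := fun x j => if Nat.ltb j (n + n) then u x j else if Nat.eqb j (n + n) then bp else bq).
  assert (Lo : forall x j, (j < n + n)%nat -> w x j = u x j) by (intros x j hj; unfold w; apply Nat.ltb_lt in hj; rewrite hj; reflexivity).
  assert (E : forall x, act n K 1 0 0 (w x) = act n K 0 bp bq (u x)).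
  { intros x. unfold act. rewrite (rs_ext n (fun i => w x i*w x (n + i)%nat) (fun i => u x i*u x (n + i)%nat)) by (intros; rewrite !Lo by lia; reflexivity).
    f_equal. apply rs_ext. intros i _.
    assert (W0 : w x (n + n)%nat = bp) by (unfold w; destruct (Nat.ltb_spec (n + n) (n + n)); [lia|]; rewrite Nat.eqb_refl; reflexivity).
    assert (W1 : w x (n + n + 1)%nat = bq).
    { unfold w. destruct (Nat.ltb_spec (n + n + 1) (n + n)); [lia|]. destruct (Nat.eqb_spec (n + n + 1) (n + n)); [lia|lra]. }
    unfold posp, posq. rewrite W0, W1. f_equal.
    - destruct (Nat.ltb_spec i n); [rewrite Lo by lia|]; ring.
    - destruct (Nat.ltb_spec i n); [rewrite (rs_ext i (fun j => w x (n + j)%nat) (fun j => u x (n + j)%nat)) by (intros; apply Lo; lia)|]; ring. }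
  assert (q : value n K 1 0 0 <= value n K 0 bp bq + (value n K 1 0 0 - value n K 0 bp bq)/2).
  { apply (C1 w); [|intros x; rewrite E; apply Hu]. split.
    - intros eps He. destruct (Uu eps He) as [d [Hd U]]. exists d. split; [lra|]. intros x y Hxy j Hj. unfold w.
      destruct (Nat.ltb_spec j (n + n)); [auto|]. destruct (Nat.eqb j (n + n)); rewrite Rminus_diag, Rabs_R0; lra.
    - exists (Rabs B + Rabs bp + Rabs bq). intros x j Hj. specialize (HB x j Hj). unfold w.
      assert (p1 := Rabs_pos B). assert (p2 := Rabs_pos bp). assert (p3 := Rabs_pos bq). assert (p4 := Rle_abs B).
      destruct (Nat.ltb_spec j (n + n)); [lra|]. assert (Z : base_plane n x j = 0).
      { unfold base_plane. destruct (Nat.ltb_spec j n); [lia|]. destruct (Nat.ltb_spec j (n + n)); [lia|lra]. }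
      rewrite Z, Rminus_0_r. destruct (Nat.eqb j (n + n)); lra. }
  lra.
Qed.

(** * Euler trajectories and actions *)

Lemma is_derive_scal_id (c x : R) : is_derive (fun r => c*r) x c.
Proof. auto_derive; [trivial|ring]. Qed.

Definition reg (M : R) (u : Ham3) : Prop := (forall t p q, Rabs t <= 1 -> Rabs (u t p q) <= M) /\
  forall t t' p q p' q', Rabs t <= 1 -> Rabs t' <= 1 -> Rabs (u t p q - u t' p' q') <= M*(Rabs (t - t') + Rabs (p - p') + Rabs (q - q')).

Lemma reg_nonneg (M : R) (u : Ham3) : reg M u -> 0 <= M.
Proof. intros [H _]. assert (h := H 0 0 0). rewrite Rabs_R0 in h. rabs. Qed.

Lemma reg_mono (M M' : R) (u : Ham3) : M <= M' -> reg M u -> reg M' u.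
Proof.
  intros h [H1 H2]. split; [intros; eapply Rle_trans; [auto|exact h]|]. intros t t' p q p' q' ht ht'.
  eapply Rle_trans; [auto|]. apply Rmult_le_compat_r; [|exact h].
  rabs.
Qed.

Lemma reg_exists (u : Ham3) : smooth u -> pc u -> exists M, 0 < M /\ reg M u.
Proof.
  intros S P. destruct (pc_bounded u (S O) P 1) as [M1 [h1 B1]]. destruct (smooth_pc_lipschitz u S P 1) as [M2 [h2 B2]].
  destruct (smooth_partials u S) as [D SP]. destruct (pc_bounded _ (SP O O) (pc_partial u 0 S P) 1) as [M3 [h3 B3]].
  exists (M1 + M2 + M3). split; [lra|]. split.
  - intros t p q ht. specialize (B1 t p q ht). lra.
  - intros t t' p q p' q' ht ht'. replace (u t p q - u t' p' q') with ((u t p q - u t' p q) + (u t' p q - u t' p' q')) by ring.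
    assert (a : Rabs (u t p q - u t' p q) <= M3*Rabs (t - t')).
    { apply (mvt_bound (fun r => u r p q) (fun r => partial 0 u r p q)). intros r Hr. split; [exact (proj1 (D r p q))|]. apply B3.
      abs ht. abs ht'. apply Rabs_le_between. apply (in_between t' t); [lra|lra|lra]. }
    specialize (B2 t' p q p' q' ht').
    assert (a2 := Rabs_pos (p - p')). assert (a3 := Rabs_pos (q - q')).
    assert (0 <= (M1 + M2)*Rabs (t - t')) by pos. assert (0 <= (M1 + M3)*(Rabs (p - p') + Rabs (q - q'))) by pos.
    rabs.
Qed.

Lemma reg_lincomb (a b M M' : R) (u v : Ham3) : reg M u -> reg M' v -> reg (Rabs a*M + Rabs b*M') (fun t p q => a*u t p q + b*v t p q).
Proof.
  intros [U1 U2] [V1 V2]. split.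
  - intros t p q ht. via Rabs_triang. rewrite !Rabs_mult.
    apply Rplus_le_compat; apply Rmult_le_compat_l; try apply Rabs_pos; auto.
  - intros t t' p q p' q' ht ht'.
    replace (a*u t p q + b*v t p q - (a*u t' p' q' + b*v t' p' q')) with (a*(u t p q - u t' p' q') + b*(v t p q - v t' p' q')) by ring.
    via Rabs_triang. rewrite !Rabs_mult. rewrite Rmult_plus_distr_r, !Rmult_assoc.
    apply Rplus_le_compat; apply Rmult_le_compat_l; try apply Rabs_pos; auto.
Qed.

Lemma discrete_gronwall (m : nat) (a d0 : R) (d e : nat -> R) : 0 <= a -> 0 <= d0 -> d O <= d0 -> (forall i, 0 <= e i) ->
  (forall i, (i < m)%nat -> d (S i) <= (1 + a)*d i + e i) -> forall i, (i <= m)%nat -> d i <= exp (a*INR i)*(d0 + rs i e).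
Proof.
  intros Ha Hd0 H0 He H. induction i as [|i IH]; intros Hi; [simpl; rewrite Rmult_0_r, exp_0; lra|].
  specialize (H i Hi). specialize (IH ltac:(lia)). cbn [rs]. rewrite S_INR. replace (a*(INR i + 1)) with (a + a*INR i) by ring. rewrite exp_plus.
  assert (E1 := exp_ineq1_le a).
  assert (E2 : 1 <= exp (a*INR i)) by (assert (q := exp_ineq1_le (a*INR i)); assert (0 <= a*INR i) by pos; lra).
  assert (S0 : 0 <= rs i e) by (apply rs_nonneg; intros; apply He). specialize (He i).
  assert (T1 : (1 + a)*d i <= exp a*(exp (a*INR i)*(d0 + rs i e))).
  { apply Rle_trans with ((1 + a)*(exp (a*INR i)*(d0 + rs i e))); [pos|]. pos. }
  assert (T2 : 1*e i <= (exp a*exp (a*INR i))*e i).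
  { apply Rmult_le_compat_r; [lra|]. nra. }
  lra.
Qed.

(** One step error for a single tracked quantity v with rate V. The rate is evaluated at the new
    momentum p' and the old position q, as the discrete functional dictates; the bound on p' - p
    repairs the mismatch. *)
Lemma euler_component (M h t : R) (V : Ham3) (x y X : R -> R) (p q p' v v' e d : R) : 0 <= h <= 1 -> 0 <= t -> t + h <= 1 -> reg M V ->
  (forall r, is_derive X r (V r (x r) (y r))) ->
  (forall r, t <= r <= t + h -> Rabs (x r - x t) <= M*h /\ Rabs (y r - y t) <= M*h) ->
  Rabs (v' - v - h*V t p' q) <= e -> Rabs (p' - p) <= M*h + e -> Rabs (p - x t) + Rabs (q - y t) <= d ->
  Rabs (v' - X (t + h)) <= Rabs (v - X t) + M*(h*(M*h + e + d)) + M*(h*(h + 2*(M*h))) + e.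
Proof.
  intros Hh Ht Hth [B L] HX Hx He Hp Hd. assert (HM := reg_nonneg M V (conj B L)).
  assert (ht : Rabs t <= 1) by rabs.
  set (c := V t (x t) (y t)).
  assert (T1 : Rabs (X (t + h) - c*(t + h) - (X t - c*t)) <= M*(h + 2*(M*h))*Rabs (t + h - t)).
  { apply (mvt_bound (fun r => X r - c*r) (fun r => V r (x r) (y r) - c)). intros r Hr. split.
    - apply is_derive_minus_R; [apply HX|apply is_derive_scal_id].
    - assert (Hr' : t <= r <= t + h) by (rewrite Rmin_left, Rmax_right in Hr by lra; lra). destruct (Hx r Hr') as [a b].
      eapply Rle_trans; [apply L; [rabs|lra]|]. apply Rmult_le_compat_l; [lra|].
      assert (Rabs (r - t) <= h) by rabs. lra. }
  replace (t + h - t) with h in T1 by ring. rewrite (Rabs_pos_eq h) in T1 by lra.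
  assert (T2 : Rabs (V t p' q - c) <= M*(M*h + e + d)).
  { unfold c. eapply Rle_trans; [auto|]. rewrite Rminus_diag, Rabs_R0. apply Rmult_le_compat_l; [lra|].
    replace (p' - x t) with ((p' - p) + (p - x t)) by ring. assert (a := Rabs_triang (p' - p) (p - x t)). lra. }
  replace (v' - X (t + h)) with ((v - X t) + (v' - v - h*V t p' q) + h*(V t p' q - c) + - (X (t + h) - c*(t + h) - (X t - c*t))) by ring.
  assert (T3 : Rabs (h*(V t p' q - c)) <= h*(M*(M*h + e + d))) by (apply mul_abs_le; [rabs|lra]).
  rabs.
Qed.

Lemma curve_speed (M : R) (V : Ham3) (x y X : R -> R) (t h : R) : 0 <= t -> 0 <= h -> t + h <= 1 -> reg M V -> (forall r, is_derive X r (V r (x r) (y r))) ->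
  forall r, t <= r <= t + h -> Rabs (X r - X t) <= M*h.
Proof.
  intros Ht Hh Hth RV HX r Hr. assert (HM := reg_nonneg M V RV). destruct RV as [B _].
  apply Rle_trans with (M*Rabs (r - t)).
  - apply (mvt_bound X (fun r => V r (x r) (y r))). intros s Hs. split; [apply HX|]. apply B.
    rewrite Rmin_left, Rmax_right in Hs by lra. rewrite Rabs_pos_eq; lra.
  - apply Rmult_le_compat_l; [lra|]. rabs.
Qed.

(** Besides p and q, a third quantity w with rate V3 is followed, which will be the accumulated
    action. Only the sum of the defects matters, and C depends on M alone, hence is uniform in the
    mesh and in the Hamiltonians. *)
Lemma euler_tracking (M : R) : 0 <= M -> exists C, 0 < C /\ forall (V1 V2 V3 : Ham3) (x y s : R -> R) (m : nat) (p q w E : nat -> R) (d0 delta : R),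
  reg M V1 -> reg M V2 -> reg M V3 -> (forall t, is_derive x t (V1 t (x t) (y t))) -> (forall t, is_derive y t (V2 t (x t) (y t))) ->
  (forall t, is_derive s t (V3 t (x t) (y t))) -> (0 < m)%nat -> Rabs (p O - x 0) + Rabs (q O - y 0) + Rabs (w O - s 0) <= d0 -> (forall i, 0 <= E i) -> rs m E <= delta ->
  (forall i, (i < m)%nat -> Rabs (p (S i) - p i - / INR m*V1 (INR i/INR m) (p (S i)) (q i)) <= E i /\
     Rabs (q (S i) - q i - / INR m*V2 (INR i/INR m) (p (S i)) (q i)) <= E i /\
     Rabs (w (S i) - w i - / INR m*V3 (INR i/INR m) (p (S i)) (q i)) <= E i) ->
  Rabs (p m - x 1) + Rabs (q m - y 1) + Rabs (w m - s 1) <= C*(d0 + delta + / INR m).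
Proof.
  intros HM. set (c1 := 3*(M*(1 + 3*M))). set (c2 := 3*M + 3). exists (exp (3*M)*(c1 + c2)).
  assert (Hc1 : 0 <= c1) by pos.
  split; [pos|].
  intros V1 V2 V3 x y s m p q w E d0 delta R1 R2 R3 Dx Dy Ds Hm I0 HE HD H.
  assert (Hm1 : 1 <= INR m) by (apply (le_INR 1); lia).
  set (h := / INR m). assert (Hh : 0 < h <= 1).
  { split; [pos|]. rewrite <- Rinv_1. apply Rinv_le_contravar; lra. }
  set (d := fun i => Rabs (p i - x (INR i*h)) + Rabs (q i - y (INR i*h)) + Rabs (w i - s (INR i*h))).
  assert (G : forall i, (i <= m)%nat -> d i <= exp (3*M*h*INR i)*(d0 + rs i (fun i => c1*(h*h) + c2*E i))).
  { apply (discrete_gronwall m (3*M*h) d0 d).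
    - repeat apply Rmult_le_pos; lra.
    - assert (a1 := Rabs_pos (p O - x 0)). assert (a2 := Rabs_pos (q O - y 0)). assert (a3 := Rabs_pos (w O - s 0)). lra.
    - unfold d. rewrite Rmult_0_l. exact I0.
    - intros i. specialize (HE i). assert (0 <= c1*(h*h)) by pos.
      assert (0 <= c2*E i) by pos. lra.
    - intros i Hi. destruct (H i Hi) as [e1 [e2 e3]]. specialize (HE i).
      set (t := INR i*h). assert (Et : INR (S i)*h = t + h) by (rewrite S_INR; unfold t; ring).
      assert (Ht : 0 <= t) by pos.
      assert (Hth : t + h <= 1).
      { rewrite <- Et. apply (Rmult_le_reg_r (INR m)); [lra|]. unfold h. rewrite Rmult_assoc, Rinv_l by lra. apply le_INR in Hi. lra. }
      replace (INR i/INR m) with t in e1, e2, e3 by reflexivity. fold h in e1, e2, e3.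
      assert (Ap : Rabs t <= 1) by rabs.
      assert (Hp : Rabs (p (S i) - p i) <= M*h + E i).
      { replace (p (S i) - p i) with (h*V1 t (p (S i)) (q i) + (p (S i) - p i - h*V1 t (p (S i)) (q i))) by ring.
        apply abs_le_sum; [|lra]. rewrite Rmult_comm. apply mul_abs_le; [apply R1, Ap|rabs]. }
      assert (Sx := fun r Hr => conj (curve_speed M V1 x y x t h Ht (proj1 (conj (Rlt_le _ _ (proj1 Hh)) I)) Hth R1 Dx r Hr)
        (curve_speed M V2 x y y t h Ht (proj1 (conj (Rlt_le _ _ (proj1 Hh)) I)) Hth R2 Dy r Hr)).
      assert (Hd : Rabs (p i - x t) + Rabs (q i - y t) <= d i) by (unfold d; fold t; assert (a := Rabs_pos (w i - s t)); lra).
      assert (Hh' : 0 <= h <= 1) by lra.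
      assert (k1 := euler_component M h t V1 x y x (p i) (q i) (p (S i)) (p i) (p (S i)) (E i) (d i) Hh' Ht Hth R1 Dx Sx e1 Hp Hd).
      assert (k2 := euler_component M h t V2 x y y (p i) (q i) (p (S i)) (q i) (q (S i)) (E i) (d i) Hh' Ht Hth R2 Dy Sx e2 Hp Hd).
      assert (k3 := euler_component M h t V3 x y s (p i) (q i) (p (S i)) (w i) (w (S i)) (E i) (d i) Hh' Ht Hth R3 Ds Sx e3 Hp Hd).
      unfold d at 1. rewrite Et.
      assert (Ed : d i = Rabs (p i - x t) + Rabs (q i - y t) + Rabs (w i - s t)) by reflexivity.
      assert (Hs : M*(h*E i) <= M*(1*E i)) by pos.
      pos. }
  assert (Gm := G m (le_n m)). unfold d in Gm. assert (E1 : INR m*h = 1) by (unfold h; field; lra).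
  replace (3*M*h*INR m) with (3*M) in Gm by (unfold h; field; lra). rewrite rs_plus, rs_const, rs_scal in Gm.
  replace (INR m*(c1*(h*h))) with (c1*h*(INR m*h)) in Gm by ring. rewrite E1, Rmult_1_r in Gm.
  eapply Rle_trans; [exact Gm|]. rewrite Rmult_assoc. apply Rmult_le_compat_l; [left; apply exp_pos|].
  assert (Sm : 0 <= rs m E) by (apply rs_nonneg; intros; apply HE).
  assert (c2*rs m E <= c2*delta) by pos.
  assert (P0 : 0 <= d0) by rabs.
  assert (1*d0 <= c2*d0) by pos. assert (0 <= c1*d0) by pos.
  assert (0 <= c1*delta) by pos. assert (0 <= c2*h) by pos. lra.
Qed.

Lemma taylor2 (M : R) (u : Ham3) : smooth u -> reg M (partial 1 u) -> reg M (partial 2 u) -> forall t p q a b, Rabs t <= 1 ->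
  Rabs (u t (p + a) (q + b) - u t p q - partial 1 u t p q*a - partial 2 u t p q*b) <= M*((Rabs a + Rabs b)*(Rabs a + Rabs b)).
Proof.
  intros S R1 R2 t p q a b Ht. assert (HM := reg_nonneg _ _ R1). destruct R1 as [_ L1]. destruct R2 as [_ L2]. destruct (smooth_partials u S) as [D _].
  assert (T1 : Rabs (u t (p + a) (q + b) - partial 1 u t p q*(p + a) - (u t p (q + b) - partial 1 u t p q*p)) <= M*(Rabs a + Rabs b)*Rabs (p + a - p)).
  { apply (mvt_bound (fun r => u t r (q + b) - partial 1 u t p q*r) (fun r => partial 1 u t r (q + b) - partial 1 u t p q)). intros r Hr. split.
    - apply is_derive_minus_R; [exact (proj1 (proj2 (D t r (q + b))))|apply is_derive_scal_id].
    - eapply Rle_trans; [auto|]. apply Rmult_le_compat_l; [lra|]. rewrite Rminus_diag, Rabs_R0.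
      assert (Rabs (r - p) <= Rabs a).
      { assert (h := between_dist p (p + a) r Hr). replace (p + a - p) with a in h by ring. exact h. }
      replace (q + b - q) with b by ring. lra. }
  assert (T2 : Rabs (u t p (q + b) - partial 2 u t p q*(q + b) - (u t p q - partial 2 u t p q*q)) <= M*Rabs b*Rabs (q + b - q)).
  { apply (mvt_bound (fun r => u t p r - partial 2 u t p q*r) (fun r => partial 2 u t p r - partial 2 u t p q)). intros r Hr. split.
    - apply is_derive_minus_R; [exact (proj2 (proj2 (D t p r)))|apply is_derive_scal_id].
    - eapply Rle_trans; [auto|]. apply Rmult_le_compat_l; [lra|]. rewrite !Rminus_diag, Rabs_R0.
      assert (Rabs (r - q) <= Rabs b).
      { assert (h := between_dist q (q + b) r Hr). replace (q + b - q) with b in h by ring. exact h. }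
      lra. }
  replace (p + a - p) with a in T1 by ring. replace (q + b - q) with b in T2 by ring.
  replace (u t (p + a) (q + b) - u t p q - partial 1 u t p q*a - partial 2 u t p q*b) with
    ((u t (p + a) (q + b) - partial 1 u t p q*(p + a) - (u t p (q + b) - partial 1 u t p q*p)) +
     (u t p (q + b) - partial 2 u t p q*(q + b) - (u t p q - partial 2 u t p q*q))) by ring.
  via Rabs_triang. assert (0 <= M*(Rabs a*Rabs b)) by pos. lra.
Qed.

(** * The action along a Hamiltonian flow *)

Definition lagr (K : Ham3) : Ham3 := fun t p q => p*partial 1 K t p q - K t p q.

Lemma lagr_smooth (K : Ham3) : admissible K -> smooth (lagr K) /\ pc (lagr K).
Proof.
  intros A. destruct (admissible_smooth K A) as [S P]. destruct (smooth_partials K S) as [_ SP]. split.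
  - apply (smooth_minus (fun t p q => p*partial 1 K t p q)); [|exact S]. apply (smooth_mult (fun _ p _ => p)); [apply smooth_p|apply SP].
  - destruct (pc_partial K 1 S P) as [P1 [a Ha]]. destruct P as [P2 [b Hb]]. split.
    + intros t p q. unfold lagr. rewrite P1, P2. reflexivity.
    + exists (Rmax a b). intros t p q h. assert (h1 := Rmax_l a b). assert (h2 := Rmax_r a b). unfold lagr. rewrite Ha, Hb by lra. ring.
Qed.

Definition action (K : Ham3) (phi : isotopy) (x : R * R) (t : R) : R :=
  RInt (fun s => lagr K s (fst (phi s x)) (snd (phi s x))) 0 t.

Lemma action_derive (K : Ham3) (phi : isotopy) (x : R * R) (t : R) : admissible K -> is_flow K phi ->
  is_derive (action K phi x) t (lagr K t (fst (phi t x)) (snd (phi t x))).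
Proof.
  intros A Hf. apply (RInt_cont_derive (fun s => lagr K s (fst (phi s x)) (snd (phi s x)))). intros s.
  destruct (flow_curve K phi x Hf s) as [d1 d2]. apply (cont3_curve (lagr K) (fun s => fst (phi s x)) (fun s => snd (phi s x))).
  - exact (proj1 (lagr_smooth K A) O).
  - exact (is_derive_cont _ _ _ d1).
  - exact (is_derive_cont _ _ _ d2).
Qed.

Lemma action_0 (K : Ham3) (phi : isotopy) (x : R * R) : action K phi x 0 = 0.
Proof. apply (RInt_point (V := R_CompleteNormedModule)). Qed.

Definition dist1 (x y : R * R) : R := Rabs (fst y - fst x) + Rabs (snd y - snd x).

(* The differential of the action is [p1 dq1 - p0 dq0]. *)
Lemma action_variation (K : Ham3) (phi : isotopy) : admissible K -> is_flow K phi -> exists C, 0 < C /\ forall x x',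
  Rabs (action K phi x' 1 - action K phi x 1 -
    (fst (phi 1 x)*(snd (phi 1 x') - snd (phi 1 x)) - fst x*(snd x' - snd x))) <= C*(dist1 x x'*dist1 x x').
Proof.
  intros A Hf. destruct (admissible_smooth K A) as [S P]. destruct (smooth_partials K S) as [_ SP].
  destruct (reg_exists _ (SP 1%nat) (pc_partial K 1 S P)) as [M1 [h1 R1]]. destruct (reg_exists _ (SP 2%nat) (pc_partial K 2 S P)) as [M2 [h2 R2]].
  set (M := M1 + M2). apply (reg_mono _ M) in R1; [|pos]. apply (reg_mono _ M) in R2; [|pos].
  destruct (flow_lipschitz K phi A Hf 1 Rle_0_1) as [Cf [HCf Lf]].
  exists (2*M*(Cf*Cf)). split; [pos|]. intros x x'.
  set (D := dist1 x x').
  set (a := fun t => action K phi x' t - action K phi x t - fst (phi t x)*(snd (phi t x') - snd (phi t x))).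
  set (da := fun t => lagr K t (fst (phi t x')) (snd (phi t x')) - lagr K t (fst (phi t x)) (snd (phi t x)) -
     (sg1 K t (fst (phi t x)) (snd (phi t x))*(snd (phi t x') - snd (phi t x)) +
      fst (phi t x)*(sg2 K t (fst (phi t x')) (snd (phi t x')) - sg2 K t (fst (phi t x)) (snd (phi t x))))).
  assert (Bd : Rabs (a 1 - a 0) <= 2*M*(Cf*Cf)*(D*D)*Rabs (1 - 0)).
  { apply (mvt_bound a da). intros t Ht. rewrite Rmin_left, Rmax_right in Ht by lra. split.
    - destruct (flow_curve K phi x Hf t) as [d1 d2]. destruct (flow_curve K phi x' Hf t) as [_ d2'].
      apply is_derive_minus_R; [apply is_derive_minus_R; apply action_derive; assumption|].
      apply (is_derive_mult_R (fun t => fst (phi t x)) (fun t => snd (phi t x') - snd (phi t x))); [pos|]. apply is_derive_minus_R; assumption.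
    - assert (Ht1 : Rabs t <= 1) by rabs.
      specialize (Lf t x' x Ht1). replace (Rabs (fst x' - fst x) + Rabs (snd x' - snd x)) with D in Lf by reflexivity.
      unfold da, lagr, sg1, sg2.
      set (p := fst (phi t x)) in *. set (q := snd (phi t x)) in *. set (p' := fst (phi t x')) in *. set (q' := snd (phi t x')) in *.
      assert (T := taylor2 M K S R1 R2 t p q (p' - p) (q' - q) Ht1). replace (p + (p' - p)) with p' in T by ring. replace (q + (q' - q)) with q' in T by ring.
      assert (L := proj2 R1 t t p' q' p q Ht1 Ht1). rewrite Rminus_diag, Rabs_R0 in L.
      set (X := Rabs (p' - p)) in *. set (Y := Rabs (q' - q)) in *. assert (hX : 0 <= X) by apply Rabs_pos. assert (hY : 0 <= Y) by apply Rabs_pos.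
      assert (T2 : Rabs ((p' - p)*(partial 1 K t p' q' - partial 1 K t p q)) <= X*(M*(0 + X + Y))) by (apply mul_abs_le; [pos|exact L]).
      assert (Sq2 : M*((X + Y)*(X + Y)) <= M*((Cf*D)*(Cf*D))) by pos.
      assert (Sq3 : X*(M*(0 + X + Y)) <= M*((X + Y)*(X + Y))).
      { assert (0 <= M*(Y*(X + Y))) by pos. lra. }
      rabs. }
  rewrite (Rminus_0_r 1), Rabs_R1, Rmult_1_r in Bd. unfold a in Bd. rewrite !action_0, !(flow_0 K phi _ Hf) in Bd.
  rabs.
Qed.

Lemma quadratic_derive0 (g : R -> R) (s C : R) : (forall s', Rabs (g s' - g s) <= C*((s' - s)*(s' - s))) -> is_derive g s 0.
Proof.
  intros H. apply slope_derive. intros eps He. set (d := eps/(Rabs C + 1)). assert (hC := Rabs_pos C).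
  assert (Hd : 0 < d) by pos. exists d. split; [lra|]. intros y Hy.
  destruct (Req_dec y s) as [->|hn]; [exists 0; split; [ring|rabs]|].
  exists ((g y - g s)/(y - s)). split; [field; lra|]. rewrite Rminus_0_r. unfold Rdiv. rewrite Rabs_mult, Rabs_inv.
  assert (hp : 0 < Rabs (y - s)) by rabs.
  apply (Rmult_lt_reg_r (Rabs (y - s))); [lra|]. rewrite Rmult_assoc, Rinv_l, Rmult_1_r by lra.
  lt_via H. assert (E : (y - s)*(y - s) = Rabs (y - s)*Rabs (y - s)) by (rewrite <- Rabs_mult; symmetry; apply Rabs_pos_eq, Rle_0_sqr).
  rewrite E, <- Rmult_assoc. apply Rmult_lt_compat_r; [lra|]. apply Rle_lt_trans with (Rabs C*Rabs (y - s)).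
  - apply Rmult_le_compat_r; [lra|rabs].
  - assert (e : eps = (Rabs C + 1)*d) by (unfold d; field; lra). nra.
Qed.

Lemma action_outside (K : Ham3) (phi : isotopy) (a : R) : admissible K -> is_flow K phi -> (forall t p q, a < Rabs p -> K t p q = 0) ->
  forall p q, a < Rabs p -> action K phi (p, q) 1 = 0.
Proof.
  intros A Hf Ha p q Hp. unfold action. assert (E : RInt (fun s => lagr K s (fst (phi s (p, q))) (snd (phi s (p, q)))) 0 1 = RInt (fun _ => 0) 0 1).
  { apply RInt_ext. intros s _. rewrite (flow_outside K phi a A Hf Ha) by exact Hp. simpl. unfold lagr. rewrite Ha by exact Hp.
    assert (Z : partial 1 K s p q = 0).
    { apply is_derive_unique. apply (is_derive_near _ (fun _ => 0) _ _ (Rabs p - a)); [lra| |apply @is_derive_const]. intros y Hy. apply Ha.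
      assert (t := Rabs_triang_inv p y). rewrite Rabs_minus_sym in Hy. lra. }
    rewrite Z. ring. }
  rewrite E. assert (Z : RInt (fun _ => 0) 0 1 = scal (1 - 0) 0) by apply (RInt_const (V := R_CompleteNormedModule)). rewrite Z. apply Rmult_0_r.
Qed.

(* Isotopies with the same time-one map have the same action, because both actions have the same differential and vanish at infinity. *)
Lemma actions_agree (H G P : Ham3) (h g y : isotopy) : admissible H -> admissible G -> admissible P -> is_flow H h -> is_flow G g ->
  is_flow P y -> (forall x, g 1 (h 1 x) = y 1 x) -> forall x, action H h x 1 + action G g (h 1 x) 1 = action P y x 1.
Proof.
  intros AH AG AP Fh Fg Fy E x.
  destruct (action_variation H h AH Fh) as [C1 [c1 V1]]. destruct (action_variation G g AG Fg) as [C2 [c2 V2]]. destruct (action_variation P y AP Fy) as [C3 [c3 V3]].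
  destruct (flow_lipschitz H h AH Fh 1 Rle_0_1) as [Cf [HCf Lf]].
  set (D := fun x => action H h x 1 + action G g (h 1 x) 1 - action P y x 1).
  assert (Q : forall x x', Rabs (D x' - D x) <= (C1 + C2*(Cf*Cf) + C3)*(dist1 x x'*dist1 x x')).
  { intros u u'. specialize (V1 u u'). specialize (V2 (h 1 u) (h 1 u')). specialize (V3 u u'). rewrite !E in V2.
    specialize (Lf 1 u' u). rewrite Rabs_R1 in Lf. specialize (Lf (Rle_refl _)).
    assert (Sq : C2*(dist1 (h 1 u) (h 1 u')*dist1 (h 1 u) (h 1 u')) <= C2*((Cf*dist1 u u')*(Cf*dist1 u u'))).
    { apply Rmult_le_compat_l; [lra|]. assert (0 <= dist1 (h 1 u) (h 1 u')) by (unfold dist1; apply Rplus_le_le_0_compat; apply Rabs_pos).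
      pos. }
    abs V1. abs V2. abs V3. apply Rabs_le_between. unfold D. lra. }
  assert (Z : D x = 0).
  { destruct (proj2 (proj2 AH)) as [a Ha]. destruct (proj2 (proj2 AG)) as [b Hb]. destruct (proj2 (proj2 AP)) as [c Hc].
    set (p0 := Rabs a + Rabs b + Rabs c + 1). assert (ha := Rle_abs a). assert (hb := Rle_abs b). assert (hc := Rle_abs c).
    assert (ha' := Rabs_pos a). assert (hb' := Rabs_pos b). assert (hc' := Rabs_pos c). assert (hp : Rabs p0 = p0) by (apply Rabs_pos_eq; unfold p0; lra).
    transitivity (D (p0, snd x)).
    - destruct x as [p q]. apply (is_derive_zero_const (fun s => D (s, q))). intros s.
      apply (quadratic_derive0 _ _ (C1 + C2*(Cf*Cf) + C3)). intros s'. specialize (Q (s, q) (s', q)). unfold dist1 in Q. simpl in Q.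
      rewrite Rminus_diag, Rabs_R0, Rplus_0_r, <- Rabs_mult in Q. rewrite (Rabs_pos_eq ((s' - s)*(s' - s))) in Q by apply Rle_0_sqr. exact Q.
    - unfold D. rewrite (flow_outside H h a AH Fh Ha) by pos.
      rewrite (action_outside H h a AH Fh Ha), (action_outside G g b AG Fg Hb), (action_outside P y c AP Fy Hc) by pos. ring. }
  unfold D in Z. lra.
Qed.

Section Trajectory.
Context (n : nat) (K Kp Kq : nat -> R -> R -> R) (th bp bq : R) (z : nat -> R).

Let pp := posp n th bp z.
Let qq := posq n th bq z.

(** The momentum after step i is the one at which step i is evaluated, hence the shift of the index.
    The initial momentum is not a variable; it is defined so that the first momentum step is
    exact. *)
Definition traj_p (i : nat) : R := match i with O => pp O + Kq O (pp O) (qq O) | S i => pp i end.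
Definition traj_q (i : nat) : R := bq + th*z (n + n + 1)%nat + rs i (fun j => z (n + j)%nat).
(** A momentum step is the difference of two consecutive tail equations, so the gradient components
    for the increments i and i - 1 both enter. *)
Definition defect (i : nat) : R := Rabs (grad n Kp Kq th bp bq z i) + Rabs (grad n Kp Kq th bp bq z (n + i)) +
  match i with O => 0 | S j => Rabs (grad n Kp Kq th bp bq z (n + j)) end.

Lemma traj_q_pos (i : nat) : (i < n)%nat -> qq i = traj_q i.
Proof. intros h. unfold qq, posq, traj_q. apply Nat.ltb_lt in h. rewrite h. lra. Qed.

Lemma base_pos : pp n = bp + th*z (n + n)%nat /\ qq n = traj_q 0.
Proof. unfold pp, qq, posp, posq, traj_q. rewrite Nat.ltb_irrefl. simpl. lra. Qed.

Lemma pos_offset (i : nat) : (i < n)%nat -> pp i = pp n + z i.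
Proof. intros h. rewrite (proj1 base_pos). unfold pp, posp. apply Nat.ltb_lt in h. rewrite h. lra. Qed.

(** The variables z i are momenta relative to the base point; passing to absolute momenta produces
    the term base momentum times total displacement. *)
Lemma act_traj : act n K th bp bq z = rs n (fun i => traj_p (S i)*(traj_q (S i) - traj_q i) - K i (traj_p (S i)) (traj_q i)) -
  pp n*(traj_q n - traj_q 0) - K n (pp n) (qq n).
Proof.
  unfold act. change (posp n th bp z) with pp. change (posq n th bq z) with qq. cbn [rs].
  assert (E : traj_q n - traj_q 0 = rs n (fun j => z (n + j)%nat)) by (unfold traj_q; simpl; ring). rewrite E, <- rs_scal.
  match goal with |- _ = ?a - ?b - ?c => transitivity ((a - b) - c); [|lra] end. rewrite <- rs_minus.
  transitivity ((rs n (fun i => z i*z (n + i)%nat) - rs n (fun i => K i (pp i) (qq i))) - K n (pp n) (qq n)); [ring|].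
  rewrite <- rs_minus. f_equal. apply rs_ext. intros i Hi. rewrite (traj_q_pos i Hi). simpl traj_p. rewrite (pos_offset i Hi).
  unfold traj_q. cbn [rs]. ring.
Qed.

Lemma defect_nonneg (i : nat) : 0 <= defect i.
Proof. destruct i; repeat apply Rplus_le_le_0_compat; try apply Rabs_pos; lra. Qed.

Lemma tail_step (j : nat) : tailq n Kq th bp bq z j = tailq n Kq th bp bq z (S j) + Kq (S j) (pp (S j)) (qq (S j)).
Proof. unfold tailq. cbn [rs]. change (posp n th bp z) with pp. change (posq n th bq z) with qq. ring. Qed.

Lemma traj_step (i : nat) : (i < n)%nat -> Rabs (traj_p (S i) - traj_p i + Kq i (traj_p (S i)) (traj_q i)) <= defect i /\
  Rabs (traj_q (S i) - traj_q i - Kp i (traj_p (S i)) (traj_q i)) <= defect i.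
Proof.
  intros Hi. assert (Eg := grad_P n Kp Kq th bp bq z i Hi). change (posp n th bp z) with pp in Eg. change (posq n th bq z) with qq in Eg.
  simpl traj_p. rewrite <- (traj_q_pos i Hi). split.
  - destruct i as [|j].
    + simpl traj_p. replace (pp O - (pp O + Kq O (pp O) (qq O)) + Kq O (pp O) (qq O)) with 0 by ring. rewrite Rabs_R0. apply (defect_nonneg 0).
    + simpl traj_p. assert (E1 := grad_r n Kp Kq th bp bq z j ltac:(lia)). assert (E2 := grad_r n Kp Kq th bp bq z (S j) Hi).
      assert (T := tail_step j). rewrite (pos_offset j) by lia. rewrite (pos_offset (S j) Hi) at 1.
      replace (pp n + z (S j) - (pp n + z j) + Kq (S j) (pp (S j)) (qq (S j))) with (grad n Kp Kq th bp bq z (n + S j) + - grad n Kp Kq th bp bq z (n + j)) by lra.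
      via Rabs_triang. rewrite Rabs_Ropp. unfold defect. assert (h := Rabs_pos (grad n Kp Kq th bp bq z (S j))). lra.
  - replace (traj_q (S i) - qq i) with (z (n + i)%nat) by (rewrite (traj_q_pos i Hi); unfold traj_q; cbn [rs]; ring). rewrite <- Eg. unfold defect.
    assert (h := Rabs_pos (grad n Kp Kq th bp bq z (n + i))). destruct i; [lra|]. rabs.
Qed.

Context (eps : R) (Hg : sum_abs (n + n + 2) (grad n Kp Kq th bp bq z) <= eps).

Lemma grad_parts : rs n (fun i => Rabs (grad n Kp Kq th bp bq z i)) + rs n (fun i => Rabs (grad n Kp Kq th bp bq z (n + i))) +
  Rabs (grad n Kp Kq th bp bq z (n + n)) + Rabs (grad n Kp Kq th bp bq z (n + n + 1)) <= eps.
Proof. unfold sum_abs in Hg. rewrite rs_split in Hg. exact Hg. Qed.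

Lemma defect_sum : rs n defect <= 2*eps.
Proof.
  unfold defect. rewrite !rs_plus. assert (h := grad_parts).
  assert (h1 : rs n (fun i => match i with O => 0 | S j => Rabs (grad n Kp Kq th bp bq z (n + j)) end) <= rs n (fun i => Rabs (grad n Kp Kq th bp bq z (n + i)))).
  { assert (G : forall f k, (forall j, 0 <= f j) -> rs k (fun i => match i with O => 0 | S j => f j end) <= rs k f).
    { intros f k Hf. assert (G : forall k, rs k (fun i => match i with O => 0 | S j => f j end) <= rs (k - 1) f).
      { induction k0 as [|[|k0] IH]; [pos|simpl; lra|]. cbn [rs] in *. simpl Nat.sub in *. rewrite Nat.sub_0_r in IH. cbn [rs]. lra. }
      via G. apply rs_mono; [lia|]. auto. }
    apply (G (fun j => Rabs (grad n Kp Kq th bp bq z (n + j)))). intros; apply Rabs_pos. }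
  assert (a := Rabs_pos (grad n Kp Kq th bp bq z (n + n))). assert (b := Rabs_pos (grad n Kp Kq th bp bq z (n + n + 1))).
  assert (c : 0 <= rs n (fun i => Rabs (grad n Kp Kq th bp bq z i))) by (apply rs_nonneg; intros; apply Rabs_pos). lra.
Qed.

Lemma grad_r_bound (i : nat) : (i < n)%nat -> Rabs (z i - tailq n Kq th bp bq z i) <= eps.
Proof.
  intros Hi. rewrite <- (grad_r n Kp Kq th bp bq z i Hi). eapply Rle_trans; [|exact Hg]. apply sum_abs_term. lia.
Qed.

Lemma traj_end : (0 < n)%nat -> Rabs (traj_p n - pp n) <= eps.
Proof.
  intros Hn. assert (G : forall k, (0 < k)%nat -> traj_p k = pp (k - 1)).
  { intros [|k] hk; [lia|]. simpl. rewrite Nat.sub_0_r. lra. }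
  assert (Hi : (n - 1 < n)%nat) by lia. rewrite (G n Hn), (pos_offset (n - 1) Hi).
  replace (pp n + z (n - 1)%nat - pp n) with (z (n - 1)%nat - tailq n Kq th bp bq z (n - 1)).
  - apply grad_r_bound, Hi.
  - unfold tailq. replace (S (n - 1)) with n by lia. ring.
Qed.

(** These are the derivatives of the free functional in the base point, combined with the first tail
    equation and with the sum of the equations for the increments. *)
Lemma traj_closing : (0 < n)%nat -> th = 1 -> Rabs (traj_p 0 - pp n + Kq n (pp n) (qq n)) <= 2*eps /\
  Rabs (traj_q n - traj_q 0 + Kp n (pp n) (qq n)) <= 2*eps.
Proof.
  intros Hn Hth. assert (h := grad_parts). rewrite grad_bp, grad_bq in h. cbn [rs] in h.
  change (posp n th bp z) with pp in h. change (posq n th bq z) with qq in h.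
  assert (HX : forall u, Rabs (- th*u) = Rabs u) by (intros u; rewrite Hth, Rabs_mult, Rabs_Ropp, Rabs_R1; ring). rewrite !HX in h.
  set (X := rs n (fun i => Kp i (pp i) (qq i))) in *. set (Y := rs n (fun i => Kq i (pp i) (qq i))) in *.
  assert (a : 0 <= rs n (fun i => Rabs (grad n Kp Kq th bp bq z i))) by (apply rs_nonneg; intros; apply Rabs_pos).
  assert (b : 0 <= rs n (fun i => Rabs (grad n Kp Kq th bp bq z (n + i)))) by (apply rs_nonneg; intros; apply Rabs_pos).
  assert (c1 := Rabs_pos ((X + Kp n (pp n) (qq n)))). assert (c2 := Rabs_pos ((Y + Kq n (pp n) (qq n)))). split.
  - simpl traj_p. rewrite (pos_offset 0 Hn) at 1. assert (g := grad_r_bound 0 Hn). unfold tailq in g. cbn [rs] in g.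
    change (posp n th bp z) with pp in g. change (posq n th bq z) with qq in g. fold Y in g.
    replace (pp n + z O + Kq O (pp O) (qq O) - pp n + Kq n (pp n) (qq n)) with ((z O - (Y - (0 + Kq O (pp O) (qq O)))) + (Y + Kq n (pp n) (qq n))) by ring.
    via Rabs_triang. lra.
  - assert (E : traj_q n - traj_q 0 = rs n (grad n Kp Kq th bp bq z) + X).
    { unfold X. rewrite <- rs_plus. unfold traj_q. rewrite Rplus_0_r.
      rewrite (rs_ext n (fun i => grad n Kp Kq th bp bq z i + Kp i (pp i) (qq i)) (fun j => z (n + j)%nat)); [ring|].
      intros i Hi. rewrite grad_P by exact Hi. change (posp n th bp z) with pp. change (posq n th bq z) with qq. ring. }
    rewrite E. replace (rs n (grad n Kp Kq th bp bq z) + X + Kp n (pp n) (qq n)) with (rs n (grad n Kp Kq th bp bq z) + (X + Kp n (pp n) (qq n))) by ring.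
    via Rabs_triang. assert (s := rs_abs n (grad n Kp Kq th bp bq z)). lra.
Qed.

(** The final momentum is almost the base momentum, and the momentum changes by at most M/n per step
    plus the defect. The whole trajectory is thus localized by its base point although p ranges over
    a line. *)
Lemma traj_drift (M : R) : (0 < n)%nat -> 0 <= M -> (forall i p q, (i < n)%nat -> Rabs (Kq i p q) <= M/INR n) ->
  forall i, (i <= n)%nat -> Rabs (traj_p i - pp n) <= M + 3*eps.
Proof.
  intros Hn HM HK i Hi. assert (Hn0 : 0 < INR n) by (apply lt_0_INR; exact Hn).
  assert (G : forall j, (i + j <= n)%nat -> Rabs (traj_p (i + j) - traj_p i) <= rs (i + j) (fun i => M/INR n + defect i)).
  { induction j as [|j IH]; intros Hj.
    - rewrite Nat.add_0_r, Rminus_diag, Rabs_R0. apply rs_nonneg. intros k _. assert (h := defect_nonneg k).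
      assert (0 <= M/INR n) by pos. lra.
    - rewrite Nat.add_succ_r. cbn [rs]. specialize (IH ltac:(lia)). destruct (traj_step (i + j) ltac:(lia)) as [s _].
      specialize (HK (i + j)%nat (traj_p (S (i + j))) (traj_q (i + j)) ltac:(lia)).
      rabs. }
  specialize (G (n - i)%nat ltac:(lia)). replace (i + (n - i))%nat with n in G by lia. rewrite rs_plus, rs_const in G.
  replace (INR n*(M/INR n)) with M in G by (field; lra). assert (e := traj_end Hn). assert (d := defect_sum).
  rabs.
Qed.
End Trajectory.

(** m steps of length 1/m along a, then m along b frozen at time 0, and finally one full step of c
    for the base point. *)
Definition mix (m : nat) (a b c : Ham3) (i : nat) (p q : R) : R :=
  if Nat.ltb i m then/INR m*a (INR i/INR m) p q else if Nat.ltb i (m + m) then/INR m*b 0 p q else c 0 p q.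

Lemma mix_first (m : nat) (a b c : Ham3) (i : nat) (p q : R) : (i < m)%nat -> mix m a b c i p q = / INR m*a (INR i/INR m) p q.
Proof. intros h. unfold mix. apply Nat.ltb_lt in h. rewrite h. lra. Qed.
Lemma mix_second (m : nat) (a b c : Ham3) (i : nat) (p q : R) : (i < m)%nat -> mix m a b c (m + i) p q = / INR m*b 0 p q.
Proof. intros h. unfold mix. destruct (Nat.ltb_spec (m + i) m); [lia|]. destruct (Nat.ltb_spec (m + i) (m + m)); [lra|lia]. Qed.
Lemma mix_base (m : nat) (a b c : Ham3) (p q : R) : mix m a b c (m + m) p q = c 0 p q.
Proof. unfold mix. destruct (Nat.ltb_spec (m + m) m); [lia|]. rewrite Nat.ltb_irrefl. lra. Qed.

Lemma flow_component_derive (K : Ham3) (phi : isotopy) (x : R * R) (t : R) : is_flow K phi ->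
  is_derive (fun t => fst (phi t x)) t (sg1 K t (fst (phi t x)) (snd (phi t x))) /\ is_derive (fun t => snd (phi t x)) t (sg2 K t (fst (phi t x)) (snd (phi t x))).
Proof. intros Hf. exact (flow_curve K phi x Hf t). Qed.

(** The two flows are tracked one after the other, the final error of the first being the initial
    error of the second. C depends only on M and B, so one constant serves all parameters tau. *)
Lemma euler_action (M B : R) : 0 <= M -> 0 <= B -> exists C, 0 < C /\ forall (H : Ham3) (h : isotopy) (G0 : R -> R -> R) (g : isotopy)
  (V : Ham3) (m : nat) (z : nat -> R) (eps th bp bq : R), let G := autonomous G0 in
  admissible H -> is_flow H h -> admissible G -> is_flow G g ->
  reg M (sg1 H) -> reg M (sg2 H) -> reg M (lagr H) -> reg M (sg1 G) -> reg M (sg2 G) -> reg M (lagr G) -> (0 < m)%nat -> 0 <= eps <= 1 ->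
  let n := (m + m)%nat in let K := mix m H G V in let Kp := mix m (partial 1 H) (partial 1 G) (partial 1 V) in
  let Kq := mix m (partial 2 H) (partial 2 G) (partial 2 V) in
  sum_abs (n + n + 2) (grad n Kp Kq th bp bq z) <= eps -> Rabs (posp n th bp z n) <= B ->
  let x := (traj_p n Kq th bp bq z 0, traj_q n th bq z 0) in let e := (traj_p n Kq th bp bq z n, traj_q n th bq z n) in
  dist1 (g 1 (h 1 x)) e <= C*(eps + / INR m) /\
  Rabs (act n K th bp bq z - (action H h x 1 + action G g (h 1 x) 1 - posp n th bp z n*(snd e - snd x) - V 0 (posp n th bp z n) (posq n th bq z n))) <= C*(eps + / INR m).
Proof.
  intros HM HB. destruct (euler_tracking M HM) as [C1 [HC1 ET]]. set (B1 := B + 2*M + 3). set (c := 2*(1 + B1) + 1).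
  assert (HB1 : 3 <= B1) by pos. assert (Hc : 1 <= c) by pos.
  exists (C1*(C1*c) + C1*c). split; [apply Rplus_lt_0_compat; repeat apply Rmult_lt_0_compat; lra|].
  intros H h G0 g V m z eps th bp bq G AH Fh AG Fg RH1 RH2 RH3 RG1 RG2 RG3 Hm Heps n K Kp Kq Hgr HBp x e.
  set (p := traj_p n Kq th bp bq z) in *. set (q := traj_q n th bq z) in *. set (b := posp n th bp z n) in *.
  assert (Hn : (0 < n)%nat) by (unfold n; lia). assert (Hm0 : 0 < INR m) by (apply lt_0_INR; exact Hm).
  assert (Hi0 : 0 < / INR m) by pos.
  assert (Tm : forall i, (i < m)%nat -> Rabs (INR i/INR m) <= 1).
  { intros i Hi. rewrite Rabs_pos_eq by pos. apply (Rmult_le_reg_r (INR m)); [lra|].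
    unfold Rdiv. rewrite Rmult_assoc, Rinv_l by lra. apply lt_INR in Hi. lra. }
  assert (Bp : forall i, (i <= n)%nat -> Rabs (p i) <= B1).
  { intros i Hi. assert (d := traj_drift n Kp Kq th bp bq z eps Hgr (2*M) Hn ltac:(lra)).
    assert (d' : Rabs (p i - b) <= 2*M + 3*eps).
    { apply d; [|pos]. intros j p' q' Hj. assert (En : 2*M/INR n = / INR m*M) by (unfold n; rewrite plus_INR; field; lra). rewrite En.
      unfold Kq. destruct (lt_dec j m) as [hj|hj].
      - rewrite mix_first by exact hj. apply mul_abs_le; [rabs|]. assert (r := proj1 RH1 (INR j/INR m) p' q' (Tm j hj)).
        unfold sg1 in r. rewrite Rabs_Ropp in r. exact r.
      - replace j with (m + (j - m))%nat by lia. rewrite mix_second by (unfold n in Hj; lia). apply mul_abs_le; [rabs|].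
        assert (r := proj1 RG1 0 p' q'). unfold sg1 in r. rewrite Rabs_Ropp in r. apply r. rabs. }
    abs d'. abs HBp. apply Rabs_le_between. pos. }
  set (w := fun i => rs i (fun j => p (S j)*(q (S j) - q j) - K j (p (S j)) (q j))).
  set (df := defect n Kp Kq th bp bq z).
  assert (St : forall i, (i < n)%nat -> Rabs (p (S i) - p i + Kq i (p (S i)) (q i)) <= df i /\ Rabs (q (S i) - q i - Kp i (p (S i)) (q i)) <= df i /\
     Rabs (w (S i) - w i + K i (p (S i)) (q i) - p (S i)*Kp i (p (S i)) (q i)) <= B1*df i).
  { intros i Hi. destruct (traj_step n Kp Kq th bp bq z i Hi) as [s1 s2]. split; [pos|split; [pos|]].
    unfold w. cbn [rs]. match goal with |- Rabs ?u <= _ => replace u with (p (S i)*(q (S i) - q i - Kp i (p (S i)) (q i))) by ring end.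
    apply mul_abs_le; [auto|pos]. }
  assert (Dn : forall i, 0 <= df i) by (intros i; apply defect_nonneg).
  assert (Wd : forall d, 0 <= d -> d <= (1 + B1)*d /\ B1*d <= (1 + B1)*d).
  { intros d hd. nra. }
  assert (Sm : rs m df + rs m (fun i => df (m + i)%nat) <= 2*eps) by (rewrite <- rs_app; exact (defect_sum n Kp Kq th bp bq z eps Hgr)).
  assert (P1 : 0 <= rs m df) by (apply rs_nonneg; intros; apply Dn). assert (P2 : 0 <= rs m (fun i => df (m + i)%nat)) by (apply rs_nonneg; intros; apply Dn).
  assert (Half : forall (X : Ham3) (xi : isotopy) (y : R * R) (o : nat) (A0 d0 : R), admissible X -> is_flow X xi ->
    reg M (sg1 X) -> reg M (sg2 X) -> reg M (lagr X) -> (o + m <= n)%nat ->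
    (forall i, (i < m)%nat -> forall p q, K (o + i)%nat p q = / INR m*X (INR i/INR m) p q /\
      Kp (o + i)%nat p q = / INR m*partial 1 X (INR i/INR m) p q /\ Kq (o + i)%nat p q = / INR m*partial 2 X (INR i/INR m) p q) ->
    rs m (fun i => df (o + i)%nat) <= 2*eps -> Rabs (p o - fst y) + Rabs (q o - snd y) + Rabs (w o - A0) <= d0 ->
    Rabs (p (o + m)%nat - fst (xi 1 y)) + Rabs (q (o + m)%nat - snd (xi 1 y)) + Rabs (w (o + m)%nat - (A0 + action X xi y 1))
      <= C1*(d0 + 2*(1 + B1)*eps + / INR m)).
  { intros X xi y o A0 d0 AX FX R1 R2 R3 Ho EK Es S0.
    apply (ET (sg1 X) (sg2 X) (lagr X) (fun t => fst (xi t y)) (fun t => snd (xi t y)) (fun t => A0 + action X xi y t) m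
      (fun i => p (o + i)%nat) (fun i => q (o + i)%nat) (fun i => w (o + i)%nat) (fun i => (1 + B1)*df (o + i)%nat)); try assumption.
    - exact (fun t => proj1 (flow_component_derive X xi y t FX)).
    - exact (fun t => proj2 (flow_component_derive X xi y t FX)).
    - intros t. apply (is_derive_plus_const (action X xi y) A0), action_derive; assumption.
    - rewrite Nat.add_0_r, (flow_0 X xi y FX), action_0, Rplus_0_r. exact S0.
    - intros i. apply Rmult_le_pos; [lra|apply Dn].
    - rewrite rs_scal. nra.
    - intros i Hi. rewrite Nat.add_succ_r. destruct (St (o + i)%nat ltac:(lia)) as [s1 [s2 s3]]. destruct (Wd _ (Dn (o + i)%nat)) as [d1 d2].
      destruct (EK i Hi (p (S (o + i))) (q (o + i)%nat)) as [k1 [k2 k3]]. rewrite k3 in s1. rewrite k2 in s2. rewrite k1, k2 in s3.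
      unfold sg1, sg2, lagr. split; [rabs|split; rabs]. }
  assert (J1 := Half H h x O 0 0 AH Fh RH1 RH2 RH3 ltac:(unfold n; lia)
    (fun i hi p q => conj (mix_first m H G V i p q hi) (conj (mix_first m _ _ _ i p q hi) (mix_first m _ _ _ i p q hi)))).
  rewrite Rplus_0_l in J1. assert (Sm1 : rs m df <= 2*eps) by lra.
  specialize (J1 Sm1 ltac:(rewrite !Rminus_diag, Rabs_R0; lra)).
  set (y := h 1 x) in *.
  assert (J2 := Half G g y m (action H h x 1) _ AG Fg RG1 RG2 RG3 (Nat.le_refl _)
    (fun i hi p q => conj (mix_second m H G V i p q hi) (conj (mix_second m _ _ _ i p q hi) (mix_second m _ _ _ i p q hi))) ltac:(lra) J1).
  assert (Bd : C1*(C1*(0 + 2*(1 + B1)*eps + / INR m) + 2*(1 + B1)*eps + / INR m) <= (C1*(C1*c) + C1*c)*(eps + / INR m)).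
  { assert (u : 0 + 2*(1 + B1)*eps + / INR m <= c*(eps + / INR m)).
    { unfold c. nra. }
    nra. }
  assert (a1 := Rabs_pos (p (m + m)%nat - fst (g 1 y))). assert (a2 := Rabs_pos (q (m + m)%nat - snd (g 1 y))).
  assert (a3 := Rabs_pos (w (m + m)%nat - (action H h x 1 + action G g y 1))). fold n in J2, a1, a2, a3. split.
  - unfold dist1, e. simpl fst. simpl snd. lra.
  - assert (E := act_traj n K Kq th bp bq z). fold p q b in E. rewrite E. unfold K at 2. rewrite mix_base.
    change (rs n (fun i => p (S i)*(q (S i) - q i) - K i (p (S i)) (q i))) with (w (m + m)%nat). simpl snd.
    fold n. match goal with |- Rabs ?u <= _ => replace u with (w n - (action H h x 1 + action G g y 1)) by (unfold x; ring) end. lra.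
Qed.

(** * The plateau Hamiltonian *)

Section Essential.
Context (F : R -> R -> R) (f : isotopy) (c1 c2 : R) (x0 : R * R).
Context (A : adm F) (Hf : flow_of F f) (F0 : forall p q, 0 <= F p q).
Context (Hc1 : 0 < c1) (Hreg : regular_on F c1 c2) (Hx0 : c1 < val F x0 < c2) (Hess : essential f x0).

Let c' := val F x0.
(** Half the distance from the level of x0 to the nearer end of the band, which leaves a margin
    where the bump vanishes. *)
Let wd := Rmin (c' - c1) (c2 - c')/2.

Lemma wd_facts : 0 < wd /\ c1 < c' - wd /\ c' + wd < c2.
Proof.
  unfold wd, c'. assert (h1 := Rmin_l (val F x0 - c1) (c2 - val F x0)). assert (h2 := Rmin_r (val F x0 - c1) (c2 - val F x0)).
  assert (0 < Rmin (val F x0 - c1) (c2 - val F x0)) by pos. lra.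
Qed.

Definition bump_arg (y : R) : R := 1 - (y - c')/wd*((y - c')/wd).
(** The factor exp 1 cancels the value exp (-1) of [flat 0] at 1, so the maximum is c1, attained at
    the level of x0. *)
Definition bump (y : R) : R := c1*exp 1*flat 0 (bump_arg y).
Definition dbump (y : R) : R := c1*exp 1*(flat 2 (bump_arg y)*(- 2*(y - c')/(wd*wd))).

Lemma bump_derive (y : R) : is_derive bump y (dbump y).
Proof.
  destruct wd_facts as [h _]. unfold bump, dbump.
  assert (D : is_derive bump_arg y (- 2*(y - c')/(wd*wd))) by (unfold bump_arg; auto_derive; [trivial|field; lra]).
  assert (E := flat_derive 0 (bump_arg y)). rewrite Rmult_0_l, Rminus_0_r in E.
  assert (C := is_derive_comp_R (flat 0) bump_arg y _ _ E D).
  assert (S := is_derive_mult_R (fun _ => c1*exp 1) _ y 0 _ (is_derive_const _ _) C).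
  match type of S with is_derive _ _ ?l => match goal with |- is_derive _ _ ?l' => replace l' with l by ring end end. exact S.
Qed.

Lemma bump_smooth : smooth1 bump.
Proof.
  apply (smooth_mult (fun _ _ _ => c1*exp 1)); [apply smooth_const|]. apply (smooth1_comp (flat 0) (fun t _ _ => bump_arg t)); [intros k; apply flat_CK|].
  assert (S : smooth (fun t _ _ => (t - c')/wd)).
  { apply (smooth_mult (fun t _ _ => t - c')); [|apply smooth_const]. apply (smooth_minus (fun t _ _ => t)); [apply smooth_t|apply smooth_const]. }
  apply (smooth_minus (fun _ _ _ => 1)); [apply smooth_const|]. apply (smooth_mult (fun t _ _ => (t - c')/wd)); exact S.
Qed.

Lemma bump_outside (y : R) : wd <= Rabs (y - c') -> bump y = 0 /\ dbump y = 0.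
Proof.
  intros h. destruct wd_facts as [hw _]. assert (N : bump_arg y <= 0).
  { unfold bump_arg. assert (E : (y - c')/wd*((y - c')/wd) = Rabs (y - c')/wd*(Rabs (y - c')/wd)).
    { replace ((y - c')/wd*((y - c')/wd)) with ((y - c')*(y - c')/(wd*wd)) by (field; lra).
      replace (Rabs (y - c')/wd*(Rabs (y - c')/wd)) with (Rabs (y - c')*Rabs (y - c')/(wd*wd)) by (field; lra).
      rewrite <- Rabs_mult, Rabs_pos_eq by apply Rle_0_sqr. lra. }
    assert (1 <= Rabs (y - c')/wd).
    { apply (Rmult_le_reg_r wd); [lra|]. unfold Rdiv. rewrite Rmult_assoc, Rinv_l by lra. lra. }
    nra. }
  unfold bump, dbump. rewrite !flat_neg by exact N. lra.
Qed.

Lemma bump_arg_le (y : R) : bump_arg y <= 1.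
Proof. unfold bump_arg. assert (h := Rle_0_sqr ((y - c')/wd)). unfold Rsqr in h. lra. Qed.

Lemma bump_range (y : R) : 0 <= bump y <= c1.
Proof.
  assert (0 < c1*exp 1) by pos. unfold bump. split.
  - apply Rmult_le_pos; [lra|apply flat_nonneg].
  - assert (h := flat_increasing _ _ (bump_arg_le y)). replace c1 with (c1*exp 1*flat 0 1) at 2.
    + apply Rmult_le_compat_l; lra.
    + rewrite flat_pos_eq by lra. rewrite Rinv_1. assert (E1 : exp 1*exp (- (1)) = 1) by (rewrite <- exp_plus, Rplus_opp_r; apply exp_0).
      nra.
Qed.

Lemma bump_max : bump c' = c1.
Proof.
  unfold bump. replace (bump_arg c') with 1 by (unfold bump_arg; rewrite Rminus_diag; unfold Rdiv; ring).
  rewrite flat_pos_eq by lra. rewrite Rinv_1. assert (E1 : exp 1*exp (- (1)) = 1) by (rewrite <- exp_plus, Rplus_opp_r; apply exp_0).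
  nra.
Qed.

(** Within d of the level of x0 the bump is close to its maximum by continuity. Further away its
    derivative is at least 2d/wd^2 times its value, because [flat 2] dominates [flat 0] at arguments
    up to 1; so a small derivative forces a small value. *)
Lemma bump_dichotomy (rho : R) : 0 < rho -> exists kap, 0 < kap /\ forall y, Rabs (dbump y) <= kap -> bump y <= rho \/ c1 - rho <= bump y.
Proof.
  intros Hr. destruct wd_facts as [hw _].
  destruct (continuous_eps bump c' rho (is_derive_cont _ _ _ (bump_derive c')) Hr) as [d [Hd Hc]].
  exists (rho*(2*d/(wd*wd))). split; [pos|].
  intros y Hy. destruct (Rlt_dec (Rabs (y - c')) d) as [h|h].
  - right. specialize (Hc y h). rewrite bump_max in Hc. abs Hc. lra.
  - left. assert (G : bump y*(2*d/(wd*wd)) <= Rabs (dbump y)).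
    { assert (E1 := exp_pos 1). assert (HC : 0 <= c1*exp 1) by pos.
      assert (Hi : 0 < / (wd*wd)) by pos.
      unfold dbump, bump. rewrite !Rabs_mult, (Rabs_pos_eq c1), (Rabs_pos_eq (exp 1)), (Rabs_pos_eq (flat 2 _)) by (try apply flat_nonneg; lra).
      unfold Rdiv. assert (R2 : Rabs (-2) = 2) by (rewrite Rabs_left; lra). rewrite !Rabs_mult, (Rabs_pos_eq (/ _)), R2 by lra. rewrite Rmult_assoc. apply Rmult_le_compat_l; [lra|].
      assert (F2 : flat 0 (bump_arg y) <= flat 2 (bump_arg y)).
      { destruct (Rlt_dec 0 (bump_arg y)) as [hp|hp]; [|rewrite !flat_neg by lra; lra]. rewrite !flat_pos_eq by exact hp.
        apply Rmult_le_compat_r; [left; apply exp_pos|]. assert (1 <= / bump_arg y) by (rewrite <- Rinv_1; apply Rinv_le_contravar; [lra|apply bump_arg_le]).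
        nra. }
      apply Rmult_le_compat; [apply flat_nonneg| |lra|].
      - all: pos. }
    assert (Hp : 0 < 2*d/(wd*wd)) by pos.
    nra.
Qed.

Definition plateau (p q : R) : R := if em (essential f (p, q)) then bump (F p q) else 0.
(** The factor in d(plateau) = slope dF; it is constant along orbits, so [time_change] applies. *)
Definition slope (x : R * R) : R := if em (essential f x) then dbump (val F x) else 0.

(** In the band, a period persists with its deck shift, so essential and inessential points form
    open sets and the definition by cases is locally a single formula. Outside the band, the margin
    of [wd] makes the bump vanish in a neighbourhood. *)
Lemma plateau_local (x : R * R) : exists r, 0 < r /\
  ((regular F x /\ forall y, near r x y -> essential f y /\ plateau (fst y) (snd y) = bump (val F y) /\ slope y = dbump (val F y)) \/
   (forall y, near r x y -> plateau (fst y) (snd y) = 0 /\ slope y = 0)).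
Proof.
  destruct wd_facts as [hw [hw1 hw2]].
  destruct (classic (c1 < val F x < c2)) as [hx|hx].
  - assert (Rx : regular F x) by (apply Hreg; unfold val in hx; lra).
    destruct (regular_level_periodic F f A Hf (val F x)) with (x := x) as [t [k [Ht Pt]]]; [lra| |lra|].
    { intros y Hy. apply Hreg. unfold val in *. lra. }
    destruct (per_stable F f A Hf x t (t/2) k Rx Pt) as [r [Hr Hs]]; [lra|]. exists r. split; [lra|].
    destruct (Z.eq_dec k 0) as [->|hk].
    + right. intros y Hy. destruct (Hs y Hy) as [t' [Ht' Pt']]. abs Ht'.
      assert (Ne : ~ essential f y) by (apply (closed_orbit_inessential F f A Hf y t'); [lra|pos]).
      unfold plateau, slope. rewrite <- surjective_pairing. destruct (em (essential f y)); [contradiction|lra].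
    + left. split; [pos|]. intros y Hy. destruct (Hs y Hy) as [t' [Ht' Pt']]. assert (Es : essential f y) by (exists t', k; split; assumption).
      split; [pos|]. unfold plateau, slope. rewrite <- surjective_pairing. destruct (em (essential f y)); [auto|contradiction].
  - destruct (val_near F A x wd hw) as [r [Hr Hv]]. exists r. split; [lra|]. right. intros y Hy. specialize (Hv y Hy).
    assert (O : wd <= Rabs (val F y - c')).
    { assert (B : 2*wd <= Rabs (val F x - c')).
      { assert (m1 := Rmin_l (c' - c1) (c2 - c')). assert (m2 := Rmin_r (c' - c1) (c2 - c')). unfold wd.
        rabs. }
      assert (T := Rabs_triang_inv (val F x - c') (val F x - val F y)). replace (val F x - c' - (val F x - val F y)) with (val F y - c') in T by ring.
      rewrite Rabs_minus_sym in Hv. lra. }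
    destruct (bump_outside _ O) as [b1 b2]. unfold plateau, slope. rewrite <- surjective_pairing.
    destruct (em (essential f y)); split; try reflexivity; assumption.
Qed.

Lemma plateau_gradient (p q : R) : dP plateau p q = slope (p, q)*dP F p q /\ dQ plateau p q = slope (p, q)*dQ F p q.
Proof.
  destruct (plateau_local (p, q)) as [r [Hr [[_ H]|H]]].
  - assert (H0 := H (p, q) (near_refl r (p, q) Hr)). destruct H0 as [_ [_ Es]]. rewrite Es.
    destruct (autonomous_partials F A p q) as [d1 d2]. assert (D := bump_derive (F p q)). rewrite !(Rmult_comm (dbump _)). split; apply is_derive_unique.
    + apply (is_derive_near _ (fun s => bump (F s q)) _ _ r Hr); [|exact (is_derive_comp_R bump (fun s => F s q) p _ _ D d1)].
      intros s Hs. destruct (H (s, q)) as [_ [h _]]; [split; simpl; [lra|rabs]|exact h].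
    + apply (is_derive_near _ (fun s => bump (F p s)) _ _ r Hr); [|exact (is_derive_comp_R bump (fun s => F p s) q _ _ D d2)].
      intros s Hs. destruct (H (p, s)) as [_ [h _]]; [split; simpl; [rabs|lra]|exact h].
  - destruct (H (p, q) (near_refl r (p, q) Hr)) as [_ Es]. rewrite Es, !Rmult_0_l.
    apply (gradient_locally_const plateau (p, q) 0 r Hr). intros y Hy. exact (proj1 (H y Hy)).
Qed.

Lemma essential_invariant (t : R) (x : R * R) : essential f (f t x) <-> essential f x.
Proof.
  split; intros h; [|apply (essential_flow F f A Hf x t h)]. rewrite <- (flow_inv F f A Hf t x). apply (essential_flow F f A Hf (f t x) (- t) h).
Qed.

Lemma essential_deck (k : Z) (x : R * R) : essential f (shiftq x k) <-> essential f x.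
Proof.
  split; intros h; [|apply (essential_shift F f A Hf x k h)]. replace x with (shiftq (shiftq x k) (- k)); [apply (essential_shift F f A Hf _ _ h)|].
  rewrite shiftq_shiftq. replace (k + - k)%Z with 0%Z by ring. apply shiftq_0.
Qed.

Lemma slope_flow (t : R) (x : R * R) : slope (f t x) = slope x.
Proof.
  unfold slope. assert (h := essential_invariant t x). rewrite (val_flow F f A Hf).
  destruct (em (essential f (f t x))), (em (essential f x)); try reflexivity; tauto.
Qed.

Lemma slope_shift (k : Z) (x : R * R) : slope (shiftq x k) = slope x.
Proof.
  unfold slope. assert (h := essential_deck k x). rewrite (val_shift F A).
  destruct (em (essential f (shiftq x k))), (em (essential f x)); try reflexivity; tauto.
Qed.

Lemma bump_0 : bump 0 = 0 /\ dbump 0 = 0.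
Proof. destruct wd_facts as [h1 [h2 h3]]. apply bump_outside. rabs. Qed.

Lemma plateau_admissible : adm plateau.
Proof.
  split; [|split].
  - apply smooth3_smooth, smooth_local. intros t p q. destruct (plateau_local (p, q)) as [r [Hr [[_ H]|H]]].
    + exists r, (autonomous (fun p q => bump (F p q))). split; [lra|split].
      * apply (smooth1_comp bump (autonomous F)); [apply bump_smooth|apply (admissible_smooth _ A)].
      * intros t' p' q' _ hp hq. exact (proj1 (proj2 (H (p', q') (conj hp hq)))).
    + exists r, (fun _ _ _ => 0). split; [lra|split; [apply smooth_const|]]. intros t' p' q' _ hp hq. exact (proj1 (H (p', q') (conj hp hq))).
  - intros t p q. unfold autonomous, plateau. assert (h := essential_deck 1 (p, q)).
    assert (E : F p (q + 1) = F p q) by (destruct A as [_ [P _]]; exact (P 0 p q)). rewrite E.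
    destruct (em (essential f (p, q + 1))), (em (essential f (p, q))); try reflexivity; tauto.
  - destruct (proj2 (proj2 A)) as [K HK]. exists K. intros t p q h. unfold autonomous, plateau. assert (E := HK 0 p q h). unfold autonomous in E. rewrite E, (proj1 bump_0).
    destruct (em (essential f (p, q))); reflexivity.
Qed.

Lemma plateau_range (p q : R) : 0 <= plateau p q <= c1 /\ plateau p q <= F p q.
Proof.
  unfold plateau. assert (b := bump_range (F p q)). specialize (F0 p q). destruct (em (essential f (p, q))); [|lra].
  split; [exact b|]. destruct (Rle_dec c1 (F p q)) as [h|h]; [lra|]. destruct wd_facts as [h1 [h2 h3]].
  rewrite (proj1 (bump_outside (F p q) ltac:(rabs))). exact F0.
Qed.

Lemma plateau_max : plateau (fst x0) (snd x0) = c1.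
Proof. unfold plateau. rewrite <- surjective_pairing. destruct (em (essential f x0)); [apply bump_max|contradiction]. Qed.

Lemma plateau_dichotomy (rho : R) : 0 < rho -> exists kap, 0 < kap /\ forall x, Rabs (slope x) <= kap ->
  plateau (fst x) (snd x) <= rho \/ c1 - rho <= plateau (fst x) (snd x).
Proof.
  intros Hr. destruct (bump_dichotomy rho Hr) as [kap [Hk H]]. exists kap. split; [lra|]. intros x. unfold slope, plateau. rewrite <- surjective_pairing.
  destruct (em (essential f x)); intros h; [auto|lra].
Qed.

Lemma slope_bounded : exists M, 0 < M /\ forall x, Rabs (slope x) <= M.
Proof.
  destruct (cont_bounded dbump (c' - wd) (c' + wd)) as [M [HM B]].
  - intros x. assert (S := smooth1_derive bump bump_smooth). apply (continuous_ext (Derive bump)).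
    + intros y. apply is_derive_unique, bump_derive.
    + exact (is_derive_cont _ _ _ (proj2 (smooth1_derive _ (proj1 S)) x)).
  - exists M. split; [lra|]. intros x. unfold slope. destruct (em (essential f x)); [|rabs].
    destruct (Rle_dec wd (Rabs (val F x - c'))) as [h|h]; [rewrite (proj2 (bump_outside _ h)), Rabs_R0; lra|].
    apply B. rabs.
Qed.

(* Essential orbits never close up in the universal cover, so on the support of the slope the flow moves points at a definite rate. *)
Lemma escape_rate (T : R) : exists eta, 0 < eta /\ forall s x, Rabs s <= T -> slope x <> 0 -> eta*Rabs s <= dist1 x (f s x).
Proof.
  destruct (level_bounded F A) as [K [HK0 HK]].
  destruct (box3_unif (- T) T (- K) K 0 1 (fun s p q r => slope (p, q) <> 0 -> r*Rabs s <= dist1 (p, q) (f s (p, q)))) as [r [Hr Bx]].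
  - intros s p q r r' H Hr Hs. assert (r'*Rabs s <= r*Rabs s) by pos. lra.
  - intros s p q Hs _ _. destruct (plateau_local (p, q)) as [r0 [Hr0 [[Rx H]|H]]].
    2:{ exists r0. split; [lra|]. intros s' p' q' _ hp hq hs. exfalso. apply hs. exact (proj2 (H (p', q') (conj hp hq))). }
    (* Near s = 0 the linear rate comes from the transit estimate. For s away from 0 the
       displacement is positive, as a return would close up an essential orbit in the cover, and it
       stays bounded below nearby. *)
    destruct (H _ (near_refl r0 (p, q) Hr0)) as [Es _]. destruct (Req_dec s 0) as [->|hs].
    + destruct (flow_transit F f A Hf (p, q) Rx) as [HG [r1 [Hr1 [a [Ha [_ [_ P3]]]]]]].
      set (gp := dP F (fst (p, q)) (snd (p, q))) in *. set (gq := dQ F (fst (p, q)) (snd (p, q))) in *. set (G := gp*gp + gq*gq) in *.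
      set (N := Rabs gp + Rabs gq + 1). assert (g1 := Rabs_pos gp). assert (g2 := Rabs_pos gq).
      exists (Rmin (r1/2) (Rmin a (G/2/N))). split; [pos|].
      intros s' p' q' h1 h2 h3 _. rmin h1 [_ h1]. rmin h1 [h1 _].
      apply Rmin_lt_inv in h2. apply Rmin_lt_inv in h3.
      set (y := (p', q')). assert (Ny : near (r1/2) (p, q) y) by (split; simpl; tauto).
      set (D := (fst (f s' y) - fst y) * - gq + (snd (f s' y) - snd y)*gp).
      assert (LB : G/2*Rabs s' <= Rabs D).
      { abs h1. unfold D. destruct (Rle_dec 0 s') as [hp|hp].
        - assert (P := P3 y 0 s' Ny ltac:(lra) ltac:(lra)). rewrite !(flow_0 _ f y Hf) in P. rewrite (Rabs_pos_eq s') by lra. rewrite Rminus_0_r in P.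
          eapply Rle_trans; [exact P|rabs].
        - assert (P := P3 y s' 0 Ny ltac:(lra) ltac:(lra)). rewrite !(flow_0 _ f y Hf) in P. rewrite (Rabs_left1 s') by lra.
          rabs. }
      assert (UB : Rabs D <= dist1 y (f s' y)*N).
      { unfold D, dist1, N. via Rabs_triang. rewrite !Rabs_mult, Rabs_Ropp.
        set (X := Rabs (fst (f s' y) - fst y)). set (Y := Rabs (snd (f s' y) - snd y)). assert (hX : 0 <= X) by apply Rabs_pos. assert (hY : 0 <= Y) by apply Rabs_pos.
        nra. }
      assert (HN : 0 < N) by pos. apply (Rmult_le_reg_r N); [lra|].
      apply Rle_trans with (G/2/N*Rabs s'*N).
      * apply Rmult_le_compat_r; [lra|]. apply Rmult_le_compat_r; [pos|]. eapply Rle_trans; [apply Rmin_r|apply Rmin_r].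
      * replace (G/2/N*Rabs s'*N) with (G/2*Rabs s') by (field; lra). lra.
    + assert (Dp : 0 < dist1 (p, q) (f s (p, q))).
      { destruct (Rle_lt_dec (dist1 (p, q) (f s (p, q))) 0) as [h|h]; [|exact h]. exfalso. unfold dist1 in h.
        set (u := fst (f s (p, q)) - fst (p, q)) in *. set (v := snd (f s (p, q)) - snd (p, q)) in *.
        assert (u0 : u = 0) by rabs.
        assert (v0 : v = 0) by rabs.
        apply (closed_orbit_inessential F f A Hf (p, q) s hs); [|pos]. unfold per. rewrite shiftq_0. unfold u, v in *.
        apply injective_projections; lra. }
      set (dd := dist1 (p, q) (f s (p, q))) in *. set (T' := Rabs T + 2).
      assert (HT : 2 <= T') by (unfold T'; assert (h := Rabs_pos T); lra).
      destruct (flow_near F f A Hf 0 s (p, q) (dd/8)) as [r1 [Hr1 Fn]]; [lra|].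
      exists (Rmin r1 (Rmin 1 (Rmin (dd/8) (dd/2/T')))). split; [pos|].
      intros s' p' q' h1 h2 h3 _. rmin h1 [h1 h1']. rmin h1' [h1' _].
      rmin h2 [h2 h2']. rmin h2' [_ h2']. rmin h2' [h2' _].
      rmin h3 [h3 h3']. rmin h3' [_ h3']. rmin h3' [h3' _].
      destruct (Fn (p', q') s' (conj h2 h3) h1) as [n1 n2].
      assert (LB : dd/2 <= dist1 (p', q') (f s' (p', q'))).
      { unfold dd in *. unfold dist1 in *. simpl fst in *. simpl snd in *.
        set (a := fst (f s' (p', q'))) in *. set (b := snd (f s' (p', q'))) in *. set (a0 := fst (f s (p, q))) in *. set (b0 := snd (f s (p, q))) in *.
        assert (t1 : Rabs (a0 - p) <= Rabs (a - p') + Rabs (a - a0) + Rabs (p' - p)) by rabs.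
        assert (t2 : Rabs (b0 - q) <= Rabs (b - q') + Rabs (b - b0) + Rabs (q' - q)) by rabs.
        lra. }
      apply Rle_trans with (dd/2/T'*T').
      * apply Rmult_le_compat; [left; repeat apply Rmin_pos; try lra; apply Rdiv_lt_0_compat; lra| | |].
        -- apply Rabs_pos.
        -- via Rmin_r. eapply Rle_trans; [apply Rmin_r|apply Rmin_r].
        -- assert (T3 := Rabs_triang (s' - s) s). replace (s' - s + s) with s' in T3 by ring. assert (Rabs s <= T) by rabs.
           assert (TT := Rle_abs T). unfold T'. lra.
      * replace (dd/2/T'*T') with (dd/2) by (field; lra). exact LB.
  - exists r. split; [lra|]. intros s x Hs Hx. destruct (exists_frac x) as [k Hk].
    assert (V : val F x <> 0).
    { intros V. apply Hx. unfold slope. rewrite V, (proj2 bump_0). destruct (em (essential f x)); reflexivity. }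
    assert (hx := HK x V). assert (B := Bx s (fst x) (snd (shiftq x k)) ltac:(rabs) hx Hk).
    replace (fst x, snd (shiftq x k)) with (shiftq x k) in B by reflexivity. rewrite slope_shift in B. specialize (B Hx).
    rewrite (flow_shift F f A Hf) in B. unfold dist1 in *. simpl in B. replace (snd (f s x) + IZR k - (snd x + IZR k)) with (snd (f s x) - snd x) in B by ring. exact B.
Qed.
End Essential.

(** * Almost critical values *)

Lemma dist1_triang (x y w : R * R) : dist1 x w <= dist1 x y + dist1 y w.
Proof.
  unfold dist1. assert (h1 := Rabs_triang (fst w - fst y) (fst y - fst x)). assert (h2 := Rabs_triang (snd w - snd y) (snd y - snd x)).
  replace (fst w - fst y + (fst y - fst x)) with (fst w - fst x) in h1 by ring. replace (snd w - snd y + (snd y - snd x)) with (snd w - snd x) in h2 by ring. lra.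
Qed.

Lemma admissible_scal (G : R -> R -> R) (c : R) : adm G -> admissible (autonomous (fun p q => c*G p q)) /\
  (forall p q, dP (fun p q => c*G p q) p q = c*dP G p q /\ dQ (fun p q => c*G p q) p q = c*dQ G p q).
Proof.
  intros A. assert (S1 : smooth1 (fun y => c*y)) by (apply (smooth_mult (fun _ _ _ => c)); [apply smooth_const|apply smooth_t]).
  destruct (admissible_post G (fun y => c*y) A S1) as [A' D]; [ring|]. split; [pos|]. intros p q. destruct (D p q) as [d1 d2].
  assert (E : Derive (fun y => c*y) (G p q) = c) by (apply is_derive_unique, is_derive_scal_id). nra.
Qed.

Lemma autonomous_reg (G : R -> R -> R) : adm G -> exists M, 0 < M /\ (forall p q, Rabs (G p q) <= M) /\
  (forall x y, Rabs (G (fst x) (snd x) - G (fst y) (snd y)) <= M*dist1 x y) /\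
  (forall p q, Rabs (dP G p q) <= M /\ Rabs (dQ G p q) <= M) /\
  (forall x y, Rabs (dP G (fst x) (snd x) - dP G (fst y) (snd y)) <= M*dist1 x y /\ Rabs (dQ G (fst x) (snd x) - dQ G (fst y) (snd y)) <= M*dist1 x y).
Proof.
  intros A. destruct (admissible_smooth _ A) as [S P]. destruct (smooth_partials _ S) as [_ SP].
  destruct (reg_exists _ S P) as [M0 [h0 R0]]. destruct (reg_exists _ (SP 1%nat) (pc_partial _ 1 S P)) as [M1 [h1 R1]]. destruct (reg_exists _ (SP 2%nat) (pc_partial _ 2 S P)) as [M2 [h2 R2]].
  set (M := M0 + M1 + M2). apply (reg_mono _ M) in R0; [|pos]. apply (reg_mono _ M) in R1; [|pos]. apply (reg_mono _ M) in R2; [|pos].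
  assert (Z : Rabs 0 <= 1) by rabs.
  assert (Lip : forall u : Ham3, reg M u -> forall x y, Rabs (u 0 (fst x) (snd x) - u 0 (fst y) (snd y)) <= M*dist1 x y).
  { intros u R x y. eapply Rle_trans; [apply R; exact Z|]. apply Rmult_le_compat_l; [pos|]. unfold dist1.
    rewrite Rminus_diag, Rabs_R0, (Rabs_minus_sym (fst x)), (Rabs_minus_sym (snd x)). lra. }
  exists M. split; [pos|]. split; [intros p q; exact (proj1 R0 0 p q Z)|]. split; [exact (Lip _ R0)|].
  split; [intros p q; split; [exact (proj1 R1 0 p q Z)|exact (proj1 R2 0 p q Z)]|]. intros x y. split; [exact (Lip _ R1 x y)|exact (Lip _ R2 x y)].
Qed.

Section Closing.
Context (F P : R -> R -> R) (f : isotopy) (slope : R * R -> R).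
Context (A : adm F) (Hf : flow_of F f) (AP : adm P).
Context (Hsl : forall t x, slope (f t x) = slope x) (Hgr : forall p q, dP P p q = slope (p, q)*dP F p q /\ dQ P p q = slope (p, q)*dQ F p q).

Lemma scaled_flow (tau : R) (y : isotopy) : is_flow (autonomous (fun p q => tau*P p q)) y -> forall t x, y t x = f (t*(tau*slope x)) x.
Proof.
  intros Fy. destruct (admissible_scal P tau AP) as [A' D]. apply (time_change F _ f y (fun x => tau*slope x) A Hf A' Fy).
  - intros t x. rewrite Hsl. reflexivity.
  - intros p q. destruct (D p q) as [d1 d2]. destruct (Hgr p q) as [g1 g2]. nra.
Qed.

(** Along the flow of tau P both P and slope are constant, so the integrand relative to the momentum
    b is (p - b) tau slope dF/dp - tau P. The first term is O(tau |slope|), since dF vanishes for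
    large |p|. *)
Lemma scaled_action (B : R) : 0 <= B -> exists C, 0 < C /\ forall tau y, 0 <= tau -> is_flow (autonomous (fun p q => tau*P p q)) y ->
  forall x b, Rabs b <= B -> Rabs (action (autonomous (fun p q => tau*P p q)) y x 1 - b*(snd (y 1 x) - snd x) + tau*P (fst x) (snd x)) <= C*(tau*Rabs (slope x)).
Proof.
  intros HB. destruct (autonomous_reg F A) as [MF [HMF [_ [_ [BF _]]]]]. destruct (proj2 (proj2 A)) as [K HK].
  exists ((Rabs K + B + 1)*MF). assert (hK := Rabs_pos K). split; [pos|]. intros tau y Ht Fy x b Hb.
  destruct (admissible_scal P tau AP) as [A' D]. set (a := fun t => action (autonomous (fun p q => tau*P p q)) y x t - b*snd (y t x) + t*(tau*P (fst x) (snd x))).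
  assert (Cons : forall t, tau*P (fst (y t x)) (snd (y t x)) = tau*P (fst x) (snd x)).
  { intros t. exact (flow_conserves (fun p q => tau*P p q) y A' Fy t x). }
  assert (Sy : forall t, slope (y t x) = slope x) by (intros t; rewrite (scaled_flow tau y Fy); apply Hsl).
  set (da := fun t => lagr (autonomous (fun p q => tau*P p q)) t (fst (y t x)) (snd (y t x)) - b*dP (fun p q => tau*P p q) (fst (y t x)) (snd (y t x)) + tau*P (fst x) (snd x)).
  assert (Bd : Rabs (a 1 - a 0) <= (Rabs K + B + 1)*MF*(tau*Rabs (slope x))*Rabs (1 - 0)).
  { apply (mvt_bound a da). intros t _. split.
    - destruct (flow_sg _ y x t Fy) as [_ d2].
      assert (D1 := is_derive_mult_R (fun _ => b) (fun t => snd (y t x)) t 0 _ (is_derive_const _ _) d2). rewrite Rmult_0_l, Rplus_0_l in D1.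
      assert (D2 := is_derive_minus_R _ _ _ _ _ (action_derive _ y x t A' Fy) D1).
      assert (D3 : is_derive (fun t => t*(tau*P (fst x) (snd x))) t (tau*P (fst x) (snd x))) by (auto_derive; [trivial|ring]).
      exact (is_derive_plus _ _ _ _ _ D2 D3).
    - unfold da. change (lagr (autonomous (fun p q => tau*P p q)) t (fst (y t x)) (snd (y t x))) with
        (fst (y t x)*dP (fun p q => tau*P p q) (fst (y t x)) (snd (y t x)) - tau*P (fst (y t x)) (snd (y t x))).
      rewrite Cons. destruct (D (fst (y t x)) (snd (y t x))) as [-> _]. destruct (Hgr (fst (y t x)) (snd (y t x))) as [-> _]. rewrite <- surjective_pairing, Sy.
      set (p := fst (y t x)). set (q := snd (y t x)). set (gp := dP F p q).
      match goal with |- Rabs ?e <= _ => replace e with ((p - b)*gp*(tau*slope x)) by ring end.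
      rewrite Rabs_mult, (Rabs_mult tau), (Rabs_pos_eq tau) by exact Ht. apply Rmult_le_compat_r; [pos|].
      destruct (Rle_dec (Rabs p) (Rabs K)) as [hp|hp].
      + apply mul_abs_le; [|apply BF]. assert (t1 := Rabs_triang p (- b)). rewrite Rabs_Ropp in t1. replace (p + - b) with (p - b) in t1 by ring. lra.
      + assert (Z : gp = 0).
        { apply (gradient_locally_const F (p, q) 0 (Rabs p - Rabs K)); [lra|]. intros u [hu _]. simpl in hu. apply (HK 0).
          assert (t1 := Rabs_triang_inv p (fst u)). rewrite Rabs_minus_sym in hu. rabs. }
        rewrite Z, Rmult_0_r, Rabs_R0. pos. }
  rewrite (Rminus_0_r 1), Rabs_R1, Rmult_1_r in Bd. unfold a in Bd. rewrite action_0, (flow_0 _ y x Fy) in Bd.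
  rabs.
Qed.

(* [x] and [e] are the end points of an almost closed trajectory: up to [err], the flow of F for time [tau * slope x] maps [x] to [e],
   and one Euler step of [v P] leads back. Hence the flow for time [(tau + v) * slope x] moves [x] by [O (v^2 |slope x| + err)],
   which contradicts the escape rate unless the slope is small. *)
Lemma closing_estimate (eta T Ms : R) : 0 < eta -> 0 <= T -> (forall x, Rabs (slope x) <= Ms) ->
  (forall s x, Rabs s <= (T + 1)*Ms -> slope x <> 0 -> eta*Rabs s <= dist1 x (f s x)) ->
  exists v, 0 < v <= 1 /\ exists C, 0 < C /\ forall tau err b x e, 0 <= tau <= T -> 0 <= err ->
    Rabs (fst x - fst b + v*dQ P (fst b) (snd b)) <= err -> snd x = snd b -> Rabs (fst e - fst b) <= err ->
    Rabs (snd e - snd x + v*dP P (fst b) (snd b)) <= err -> dist1 (f (tau*slope x) x) e <= err ->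
    Rabs (slope x) <= C*err /\ Rabs (P (fst b) (snd b) - P (fst x) (snd x)) <= C*err.
Proof.
  intros Heta HT HMs Esc. destruct (autonomous_reg F A) as [MF [HMF [_ [_ [BF _]]]]]. destruct (autonomous_reg P AP) as [MP [HMP [_ [LP [_ LG]]]]].
  assert (Hd : 0 < 24*MP*MF) by pos.
  (* With v MP <= 1/4 and 24 v MP MF <= eta, the terms in |slope x| caused by replacing the flow of
     v P by one Euler step are absorbed by the escape term eta v |slope x|. *)
  set (v := Rmin 1 (Rmin (/ (4*MP)) (eta/(24*MP*MF)))).
  assert (Hv : 0 < v) by pos.
  assert (Hv1 : v <= 1) by apply Rmin_l.
  assert (Hv2 : v*MP <= / 4).
  { assert (h : v <= / (4*MP)) by (eapply Rle_trans; [apply Rmin_r|apply Rmin_l]). apply (Rmult_le_compat_r MP) in h; [|lra].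
    replace (/ (4*MP)*MP) with (/ 4) in h by (field; lra). exact h. }
  assert (Hv3 : v*(24*MP*MF) <= eta).
  { assert (h : v <= eta/(24*MP*MF)) by (eapply Rle_trans; [apply Rmin_r|apply Rmin_r]). apply (Rmult_le_compat_r (24*MP*MF)) in h; [|lra].
    replace (eta/(24*MP*MF)*(24*MP*MF)) with eta in h by (field; repeat split; lra). exact h. }
  exists v. split; [lra|]. set (C0 := 12/(eta*v)). assert (Hev : 0 < eta*v) by pos.
  assert (HC0 : 0 < C0) by pos.
  exists (C0 + MP*(4*MF*C0 + 4*MP + 1)). assert (HX : 0 < MP*(4*MF*C0 + 4*MP + 1)) by nra.
  split; [lra|]. intros tau err b x e Ht He h1 h2 h3 h4 h5. set (m := slope x) in *. set (am := Rabs m). assert (Ham : 0 <= am) by apply Rabs_pos.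
  set (bq := dQ P (fst b) (snd b)) in *. set (bp := dP P (fst b) (snd b)) in *. set (g := Rabs bp + Rabs bq).
  assert (a1 := Rabs_pos bp). assert (a2 := Rabs_pos bq).
  assert (vb : Rabs (v*bp) <= v*g /\ Rabs (v*bq) <= v*g).
  { rewrite !Rabs_mult, (Rabs_pos_eq v) by lra. split; apply Rmult_le_compat_l; unfold g; lra. }
  assert (dxb : dist1 x b <= v*g + err).
  { unfold dist1. rewrite h2, Rminus_diag, Rabs_R0, (Rabs_minus_sym (fst b)). assert (t := Rabs_triang (fst x - fst b + v*bq) (- (v*bq))).
    rewrite Rabs_Ropp in t. replace (fst x - fst b + v*bq + - (v*bq)) with (fst x - fst b) in t by ring. lra. }
  assert (gradP : forall u, slope u = m -> Rabs (dP P (fst u) (snd u)) <= am*MF /\ Rabs (dQ P (fst u) (snd u)) <= am*MF).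
  { intros u Hu. destruct (Hgr (fst u) (snd u)) as [e1 e2]. rewrite <- surjective_pairing, Hu in e1, e2. rewrite e1, e2. destruct (BF (fst u) (snd u)).
    split; apply mul_abs_le; try assumption; apply Rle_refl. }
  (* At x the gradient of P is slope times that of F; since b is within v g + err of x and v MP <=
     1/4, the gradient at b is controlled by the same slope. *)
  assert (Hg : g <= 4*MF*am + 4*MP*err).
  { destruct (LG b x) as [l1 l2]. destruct (gradP x eq_refl) as [g1 g2].
    assert (t1 := Rabs_triang_inv bp (dP P (fst x) (snd x))). assert (t2 := Rabs_triang_inv bq (dQ P (fst x) (snd x))).
    assert (S : dist1 b x = dist1 x b) by (unfold dist1; rewrite (Rabs_minus_sym (fst x)), (Rabs_minus_sym (snd x)); reflexivity). rewrite S in l1, l2.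
    assert (l3 : MP*dist1 x b <= MP*(v*g + err)) by pos.
    assert (l4 : v*MP*g <= / 4*g) by pos. pos. }
  assert (Main : am <= C0*err).
  { destruct (Req_dec m 0) as [hm|hm]; [unfold am; rewrite hm, Rabs_R0; apply Rmult_le_pos; lra|].
    set (w := f (tau*m) x) in *. assert (Ew : f ((tau + v)*m) x = f (v*m) w).
    { unfold w. rewrite <- (flow_add F f A Hf). f_equal. ring. }
    assert (L : eta*((tau + v)*am) <= dist1 x (f (v*m) w)).
    { rewrite <- Ew. assert (E : Rabs ((tau + v)*m) = (tau + v)*am) by (rewrite Rabs_mult, (Rabs_pos_eq (tau + v)) by lra; reflexivity). rewrite <- E.
      apply Esc; [|pos]. rewrite E. apply Rmult_le_compat; [lra|lra|lra|apply HMs]. }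
    set (D := 3*err + v*g + 2*(v*(am*MF))).
    assert (Sl : forall r, slope (f (r*m) w) = m) by (intros r; unfold w; rewrite !Hsl; reflexivity).
    assert (Speed : forall r, is_derive (fun r => fst (f (r*m) w)) r (- dQ P (fst (f (r*m) w)) (snd (f (r*m) w))) /\
                              is_derive (fun r => snd (f (r*m) w)) r (dP P (fst (f (r*m) w)) (snd (f (r*m) w)))).
    { intros r. destruct (flow_sg F f w (r*m) Hf) as [k1 k2]. destruct (Hgr (fst (f (r*m) w)) (snd (f (r*m) w))) as [e1 e2].
      rewrite <- surjective_pairing, Sl in e1, e2. rewrite e1, e2.
      assert (Dm : is_derive (fun r => r*m) r m) by (auto_derive; [trivial|ring]).
      replace (- (m*dQ F (fst (f (r*m) w)) (snd (f (r*m) w)))) with (m * - dQ F (fst (f (r*m) w)) (snd (f (r*m) w))) by ring.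
      split; [exact (is_derive_comp_R (fun s => fst (f s w)) (fun r => r*m) r _ _ k1 Dm)|exact (is_derive_comp_R (fun s => snd (f s w)) (fun r => r*m) r _ _ k2 Dm)]. }
    assert (W0 : f (0*m) w = w) by (rewrite Rmult_0_l; apply (flow_0 _ f w Hf)).
    assert (Disp : forall r, 0 <= r <= v -> dist1 w (f (r*m) w) <= 2*(v*(am*MF))).
    { intros r Hr. assert (b1 : Rabs (fst (f (r*m) w) - fst (f (0*m) w)) <= am*MF*Rabs (r - 0)).
      { apply (mvt_bound (fun r => fst (f (r*m) w)) (fun r => - dQ P (fst (f (r*m) w)) (snd (f (r*m) w)))). intros s _.
        split; [exact (proj1 (Speed s))|]. rewrite Rabs_Ropp. exact (proj2 (gradP _ (Sl s))). }
      assert (b2 : Rabs (snd (f (r*m) w) - snd (f (0*m) w)) <= am*MF*Rabs (r - 0)).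
      { apply (mvt_bound (fun r => snd (f (r*m) w)) (fun r => dP P (fst (f (r*m) w)) (snd (f (r*m) w)))). intros s _.
        split; [exact (proj2 (Speed s))|]. exact (proj1 (gradP _ (Sl s))). }
      rewrite W0, Rminus_0_r, (Rabs_pos_eq r) in b1, b2 by lra. unfold dist1.
      assert (r*(am*MF) <= v*(am*MF)) by pos. lra. }
    assert (Near : forall r, 0 <= r <= v -> dist1 b (f (r*m) w) <= D).
    { intros r Hr. assert (d1 := dist1_triang b e (f (r*m) w)). assert (d2 := dist1_triang e w (f (r*m) w)). specialize (Disp r Hr).
      assert (d3 : dist1 b e <= 2*err + v*g).
      { unfold dist1. assert (t := Rabs_triang (snd e - snd x + v*bp) (- (v*bp))). rewrite Rabs_Ropp in t.
        replace (snd e - snd x + v*bp + - (v*bp)) with (snd e - snd b) in t by lra. lra. }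
      assert (d4 : dist1 e w = dist1 w e) by (unfold dist1; rewrite (Rabs_minus_sym (fst w)), (Rabs_minus_sym (snd w)); reflexivity). pos. }
    assert (S1 : Rabs (fst (f (v*m) w) - - bq*v - (fst (f (0*m) w) - - bq*0)) <= MP*D*Rabs (v - 0)).
    { apply (mvt_bound (fun r => fst (f (r*m) w) - - bq*r) (fun r => - dQ P (fst (f (r*m) w)) (snd (f (r*m) w)) - - bq)). intros r Hr.
      rewrite Rmin_left, Rmax_right in Hr by lra. split; [apply is_derive_minus_R; [exact (proj1 (Speed r))|apply is_derive_scal_id]|].
      replace (- dQ P (fst (f (r*m) w)) (snd (f (r*m) w)) - - bq) with (bq - dQ P (fst (f (r*m) w)) (snd (f (r*m) w))) by ring.
      eapply Rle_trans; [exact (proj2 (LG b (f (r*m) w)))|]. apply Rmult_le_compat_l; [lra|auto]. }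
    assert (S2 : Rabs (snd (f (v*m) w) - bp*v - (snd (f (0*m) w) - bp*0)) <= MP*D*Rabs (v - 0)).
    { apply (mvt_bound (fun r => snd (f (r*m) w) - bp*r) (fun r => dP P (fst (f (r*m) w)) (snd (f (r*m) w)) - bp)). intros r Hr.
      rewrite Rmin_left, Rmax_right in Hr by lra. split; [apply is_derive_minus_R; [exact (proj2 (Speed r))|apply is_derive_scal_id]|].
      rewrite Rabs_minus_sym. eapply Rle_trans; [exact (proj1 (LG b (f (r*m) w)))|]. apply Rmult_le_compat_l; [lra|auto]. }
    rewrite W0, (Rminus_0_r v), (Rabs_pos_eq v) in S1, S2 by lra.
    assert (U : dist1 x (f (v*m) w) <= 2*(MP*D*v) + 4*err).
    { unfold dist1 in *. set (w1 := fst w) in *. set (w2 := snd w) in *. set (y1 := fst (f (v*m) w)) in *. set (y2 := snd (f (v*m) w)) in *.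
      assert (k1 : Rabs (y1 - fst x) <= MP*D*v + Rabs (fst e - w1) + 2*err) by rabs.
      assert (k2 : Rabs (y2 - snd x) <= MP*D*v + Rabs (snd e - w2) + err) by rabs.
      lra. }
    assert (E1 : MP*D*v <= / 4*(3*err) + MP*v*(v*(4*MF*am + 4*MP*err)) + MP*v*(2*(v*(am*MF)))).
    { assert (q1 : v*MP*(3*err) <= / 4*(3*err)) by pos.
      assert (q2 : MP*v*(v*g) <= MP*v*(v*(4*MF*am + 4*MP*err))) by pos.
      pos. }
    assert (E2 : MP*v*(v*(4*MP*err)) <= / 4*err).
    {
      assert (v*MP*(v*MP)*(4*err) <= / 4 * / 4*(4*err)) by pos. lra. }
    assert (E3 : v*(v*(24*MP*MF))*am <= v*eta*am) by pos.
    assert (L2 : eta*(v*am) <= eta*((tau + v)*am)) by pos.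
    assert (Fin : am*(eta*v) <= 12*err) by lra.
    apply (Rmult_le_reg_r (eta*v)); [lra|]. unfold C0. replace (12/(eta*v)*err*(eta*v)) with (12*err) by (field; lra). exact Fin. }
  split.
  - assert (0 <= MP*(4*MF*C0 + 4*MP + 1)*err) by pos. lra.
  - via LP. assert (S : dist1 b x = dist1 x b) by (unfold dist1; rewrite (Rabs_minus_sym (fst x)), (Rabs_minus_sym (snd x)); reflexivity). rewrite S.
    assert (v*g <= 1*g) by pos. nra.
Qed.
End Closing.

(** A single choice of weight l, time s and Hamiltonian u serves the step and its partial
    derivatives at once, which is why phi is quantified inside. *)
Lemma mix_cases (m : nat) (a b c : Ham3) (i : nat) : (0 < m)%nat -> exists l s u, 0 <= l <= 1 /\ 0 <= s <= 1 /\ (u = a \/ u = b \/ u = c) /\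
  forall (phi : Ham3 -> Ham3) p q, mix m (phi a) (phi b) (phi c) i p q = l*phi u s p q.
Proof.
  intros Hm. assert (h1 : 1 <= INR m) by (apply (le_INR 1); lia).
  assert (Hi : 0 <= / INR m <= 1).
  { split; [pos|]. rewrite <- Rinv_1. apply Rinv_le_contravar; lra. }
  destruct (lt_dec i m) as [h|h].
  - exists (/ INR m), (INR i/INR m), a. split; [lra|]. split.
    + split; [pos|]. apply (Rmult_le_reg_r (INR m)); [lra|].
      unfold Rdiv. rewrite Rmult_assoc, Rinv_l by lra. apply lt_INR in h. lra.
    + split; [auto|]. intros phi p q. apply mix_first, h.
  - destruct (lt_dec i (m + m)) as [h'|h'].
    + exists (/ INR m), 0, b. split; [lra|split; [lra|split; [auto|]]]. intros phi p q.
      replace i with (m + (i - m))%nat by lia. apply mix_second. lia.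
    + exists 1, 0, c. split; [lra|split; [lra|split; [auto|]]]. intros phi p q. unfold mix.
      destruct (Nat.ltb_spec i m); [lia|]. destruct (Nat.ltb_spec i (m + m)); [lia|]. ring.
Qed.

Definition ham_regular (M : R) (K : Ham3) : Prop :=
  smooth K /\ reg M K /\ reg M (partial 1 K) /\ reg M (partial 2 K) /\ reg M (sg1 K) /\ reg M (lagr K).

Lemma ham_regular_exists (K : Ham3) : admissible K -> exists M, 0 < M /\ ham_regular M K.
Proof.
  intros A. destruct (admissible_smooth K A) as [S P]. destruct (smooth_partials K S) as [_ SP]. destruct (lagr_smooth K A) as [SL PL].
  destruct (sg_smooth K A) as [[S1 P1] _].
  destruct (reg_exists _ S P) as [M0 [h0 R0]]. destruct (reg_exists _ (SP 1%nat) (pc_partial K 1 S P)) as [M1 [h1 R1]].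
  destruct (reg_exists _ (SP 2%nat) (pc_partial K 2 S P)) as [M2 [h2 R2]]. destruct (reg_exists _ S1 P1) as [M3 [h3 R3]]. destruct (reg_exists _ SL PL) as [M4 [h4 R4]].
  exists (M0 + M1 + M2 + M3 + M4). split; [lra|]. split; [exact S|].
  split; [apply (reg_mono M0); [lra|pos]|]. split; [apply (reg_mono M1); [lra|pos]|]. split; [apply (reg_mono M2); [lra|pos]|].
  split; [apply (reg_mono M3); [lra|pos]|apply (reg_mono M4); [lra|pos]].
Qed.

Lemma ham_regular_mono (M M' : R) (K : Ham3) : M <= M' -> ham_regular M K -> ham_regular M' K.
Proof.
  intros h [S [R0 [R1 [R2 [R3 R4]]]]]. split; [exact S|]. split; [exact (reg_mono _ _ _ h R0)|]. split; [exact (reg_mono _ _ _ h R1)|].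
  split; [exact (reg_mono _ _ _ h R2)|]. split; [exact (reg_mono _ _ _ h R3)|exact (reg_mono _ _ _ h R4)].
Qed.

Lemma reg_ext (M : R) (u v : Ham3) : (forall t p q, u t p q = v t p q) -> reg M u -> reg M v.
Proof.
  intros E [R1 R2]. split; [intros t p q h; rewrite <- E; apply R1, h|]. intros t t' p q p' q' h h'. rewrite <- !E. auto.
Qed.

Lemma ham_regular_lincomb (a b M T : R) (K1 K2 : Ham3) : 0 <= M -> Rabs a <= T -> Rabs b <= T -> ham_regular M K1 -> ham_regular M K2 ->
  ham_regular (2*T*M) (fun t p q => a*K1 t p q + b*K2 t p q).
Proof.
  intros HM Ha Hb [S1 [U0 [U1 [U2 [U3 U4]]]]] [S2 [V0 [V1 [V2 [V3 V4]]]]].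
  assert (Bd : Rabs a*M + Rabs b*M <= 2*T*M) by nra.
  assert (LC : forall u v, reg M u -> reg M v -> reg (2*T*M) (fun t p q => a*u t p q + b*v t p q)).
  { intros u v Ru Rv. apply (reg_mono _ _ _ Bd). apply reg_lincomb; assumption. }
  destruct (smooth_partials K1 S1) as [D1 _]. destruct (smooth_partials K2 S2) as [D2 _].
  assert (LD : forall u v x lu lv, is_derive u x lu -> is_derive v x lv -> Derive (fun s : R => a*u s + b*v s) x = a*lu + b*lv).
  { intros u v x lu lv Hu Hv. apply is_derive_unique. assert (X := is_derive_mult_R (fun _ => a) u x 0 lu (is_derive_const _ _) Hu). assert (Y := is_derive_mult_R (fun _ => b) v x 0 lv (is_derive_const _ _) Hv).
    rewrite Rmult_0_l, Rplus_0_l in X, Y. exact (is_derive_plus _ _ _ _ _ X Y). }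
  assert (E1 : forall t p q, a*partial 1 K1 t p q + b*partial 1 K2 t p q = partial 1 (fun t p q => a*K1 t p q + b*K2 t p q) t p q).
  { intros t p q. symmetry. exact (LD _ _ _ _ _ (proj1 (proj2 (D1 t p q))) (proj1 (proj2 (D2 t p q)))). }
  assert (E2 : forall t p q, a*partial 2 K1 t p q + b*partial 2 K2 t p q = partial 2 (fun t p q => a*K1 t p q + b*K2 t p q) t p q).
  { intros t p q. symmetry. exact (LD _ _ _ _ _ (proj2 (proj2 (D1 t p q))) (proj2 (proj2 (D2 t p q)))). }
  split; [|split; [auto|split; [|split; [|split]]]].
  - apply (smooth_plus (fun t p q => a*K1 t p q)); [apply (smooth_mult (fun _ _ _ => a))|apply (smooth_mult (fun _ _ _ => b))]; try assumption; apply smooth_const.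
  - exact (reg_ext _ _ _ E1 (LC _ _ U1 V1)).
  - exact (reg_ext _ _ _ E2 (LC _ _ U2 V2)).
  - refine (reg_ext _ _ _ _ (LC _ _ U3 V3)). intros t p q. unfold sg1. rewrite <- E2. ring.
  - refine (reg_ext _ _ _ _ (LC _ _ U4 V4)). intros t p q. unfold lagr. rewrite <- E1. ring.
Qed.

Lemma mix_regular (M : R) (m : nat) (a b c : Ham3) : (0 < m)%nat -> ham_regular M a -> ham_regular M b -> ham_regular M c ->
  (forall i p q x y, Rabs (mix m a b c i (p + x) (q + y) - mix m a b c i p q - mix m (partial 1 a) (partial 1 b) (partial 1 c) i p q*x -
     mix m (partial 2 a) (partial 2 b) (partial 2 c) i p q*y) <= M*((Rabs x + Rabs y)*(Rabs x + Rabs y))) /\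
  (forall i p q p' q', Rabs (mix m (partial 1 a) (partial 1 b) (partial 1 c) i p' q' - mix m (partial 1 a) (partial 1 b) (partial 1 c) i p q) <= M*(Rabs (p' - p) + Rabs (q' - q))) /\
  (forall i p q p' q', Rabs (mix m (partial 2 a) (partial 2 b) (partial 2 c) i p' q' - mix m (partial 2 a) (partial 2 b) (partial 2 c) i p q) <= M*(Rabs (p' - p) + Rabs (q' - q))) /\
  (forall i p q, Rabs (mix m a b c i p q) <= M).
Proof.
  intros Hm Ra Rb Rc. assert (HM : 0 <= M) by (destruct Ra as [_ [R0 _]]; exact (reg_nonneg _ _ R0)).
  assert (Red : forall l x y, 0 <= l <= 1 -> 0 <= y -> Rabs x <= y -> Rabs (l*x) <= y).
  { intros l x y hl hy hx. rewrite Rabs_mult, (Rabs_pos_eq l) by lra. nra. }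
  assert (Ab : forall x y, 0 <= M*(Rabs x + Rabs y) /\ 0 <= M*((Rabs x + Rabs y)*(Rabs x + Rabs y))).
  { intros x y. assert (u := Rabs_pos x). assert (v := Rabs_pos y). split; repeat apply Rmult_le_pos; lra. }
  assert (Key : forall i, exists l s u, 0 <= l <= 1 /\ Rabs s <= 1 /\ ham_regular M u /\ forall (phi : Ham3 -> Ham3) p q, mix m (phi a) (phi b) (phi c) i p q = l*phi u s p q).
  { intros i. destruct (mix_cases m a b c i Hm) as [l [s [u [hl [hs [hu E]]]]]]. exists l, s, u. split; [lra|]. split; [rabs|].
    split; [destruct hu as [->|[->| ->]]; assumption|exact E]. }
  split; [|split; [|split]].
  - intros i p q x y. destruct (Key i) as [l [s [u [hl [hs [[S [R0 [R1 [R2 _]]]] E]]]]]]. rewrite !(E (fun u => u)), (E (partial 1)), (E (partial 2)).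
    assert (t := taylor2 M u S R1 R2 s p q x y hs).
    match goal with |- Rabs ?e <= _ => replace e with (l*(u s (p + x) (q + y) - u s p q - partial 1 u s p q*x - partial 2 u s p q*y)) by ring end.
    apply Red; [lra|apply Ab|exact t].
  - intros i p q p' q'. destruct (Key i) as [l [s [u [hl [hs [[S [R0 [R1 [R2 _]]]] E]]]]]]. rewrite !(E (partial 1)), <- Rmult_minus_distr_l. apply Red; [lra|apply Ab|].
    assert (t := proj2 R1 s s p' q' p q hs hs). rewrite Rminus_diag, Rabs_R0, Rplus_0_l in t. exact t.
  - intros i p q p' q'. destruct (Key i) as [l [s [u [hl [hs [[S [R0 [R1 [R2 _]]]] E]]]]]]. rewrite !(E (partial 2)), <- Rmult_minus_distr_l. apply Red; [lra|apply Ab|].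
    assert (t := proj2 R2 s s p' q' p q hs hs). rewrite Rminus_diag, Rabs_R0, Rplus_0_l in t. exact t.
  - intros i p q. destruct (Key i) as [l [s [u [hl [hs [[S [R0 _]] E]]]]]]. rewrite (E (fun u => u)). apply Red; [lra|lra|]. exact (proj1 R0 s p q hs).
Qed.

Lemma partial_outside (K : Ham3) (a : R) (i : nat) : (forall t p q, a < Rabs p -> K t p q = 0) -> forall t p q, a < Rabs p -> partial (S i) K t p q = 0.
Proof.
  intros H t p q Hp. assert (r : 0 < Rabs p - a) by lra. destruct i as [|i]; simpl; apply is_derive_unique.
  - apply (is_derive_near _ (fun _ => 0) _ _ (Rabs p - a) r); [|apply @is_derive_const]. intros y Hy. apply H.
    assert (T := Rabs_triang_inv p y). rewrite Rabs_minus_sym in Hy. lra.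
  - apply (is_derive_near _ (fun _ => 0) _ _ 1 Rlt_0_1); [|apply @is_derive_const]. auto.
Qed.

(* Almost critical points whose base point lies far away stay in the region where all Hamiltonians vanish. *)
Lemma act_far (M a eps : R) (m : nat) (H G V : Ham3) (z : nat -> R) (th bp bq : R) : (0 < m)%nat -> 0 <= eps <= 1 -> ham_regular M H -> ham_regular M G ->
  (forall t p q, a < Rabs p -> H t p q = 0) -> (forall t p q, a < Rabs p -> G t p q = 0) -> (forall t p q, a < Rabs p -> V t p q = 0) ->
  let n := (m + m)%nat in
  sum_abs (n + n + 2) (grad n (mix m (partial 1 H) (partial 1 G) (partial 1 V)) (mix m (partial 2 H) (partial 2 G) (partial 2 V)) th bp bq z) <= eps ->
  a + 2*M + 4 <= Rabs (posp n th bp z n) -> Rabs (act n (mix m H G V) th bp bq z) <= (2*M + 4)*(2*eps).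
Proof.
  intros Hm He RH RG ZH ZG ZV n Hgr Hb. set (Kp := mix m (partial 1 H) (partial 1 G) (partial 1 V)) in *. set (Kq := mix m (partial 2 H) (partial 2 G) (partial 2 V)) in *.
  destruct RH as [_ [_ [_ [RH2 _]]]]. destruct RG as [_ [_ [_ [RG2 _]]]]. assert (HM := reg_nonneg _ _ RH2).
  assert (Hn : (0 < n)%nat) by (unfold n; lia). assert (Hm0 : 0 < INR m) by (apply lt_0_INR; exact Hm). assert (Hi0 : 0 < / INR m) by pos.
  set (b := posp n th bp z n) in *. set (p := traj_p n Kq th bp bq z). set (q := traj_q n th bq z).
  assert (Dr : forall i, (i <= n)%nat -> Rabs (p i - b) <= 2*M + 3*eps).
  { apply (traj_drift n Kp Kq th bp bq z eps Hgr (2*M) Hn ltac:(lra)). intros j p' q' Hj.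
    assert (En : 2*M/INR n = / INR m*M) by (unfold n; rewrite plus_INR; field; lra). rewrite En. unfold Kq. destruct (lt_dec j m) as [hj|hj].
    - rewrite mix_first by exact hj. apply mul_abs_le; [rabs|]. apply RH2. rewrite Rabs_pos_eq by pos.
      apply (Rmult_le_reg_r (INR m)); [lra|]. unfold Rdiv. rewrite Rmult_assoc, Rinv_l by lra. apply lt_INR in hj. lra.
    - replace j with (m + (j - m))%nat by lia. rewrite mix_second by (unfold n in Hj; lia). apply mul_abs_le; [rabs|]. apply RG2. rabs. }
  assert (Far : forall i, (i <= n)%nat -> a < Rabs (p i)).
  { intros i Hi. specialize (Dr i Hi). assert (T := Rabs_triang_inv b (p i)). rewrite Rabs_minus_sym in Dr. lra. }
  assert (Zm : forall (phi : Ham3 -> Ham3) i p q, (forall u : Ham3, (forall t p q, a < Rabs p -> u t p q = 0) -> forall t p q, a < Rabs p -> phi u t p q = 0) -> a < Rabs p -> mix m (phi H) (phi G) (phi V) i p q = 0).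
  { intros phi i p' q' Hphi Hp. destruct (mix_cases m H G V i Hm) as [l [s [u [_ [_ [hu E]]]]]]. rewrite E. rewrite Hphi; [ring| |lra]. destruct hu as [->|[->| ->]]; assumption. }
  assert (E := act_traj n (mix m H G V) Kq th bp bq z). fold p q b in E. rewrite E.
  rewrite (Zm (fun u => u) n b) by (auto; lra).
  rewrite (rs_ext n _ (fun i => p (S i)*(q (S i) - q i))) by (intros i Hi; rewrite (Zm (fun u => u) i) by auto; ring).
  assert (Tel : forall k, rs k (fun i => q (S i) - q i) = q k - q O) by (induction k as [|k IH]; simpl; [ring|lra]).
  rewrite <- Tel, <- rs_scal, Rminus_0_r, <- rs_minus.
  apply Rle_trans with (rs n (fun i => (2*M + 4)*defect n Kp Kq th bp bq z i)).
  - via rs_abs. apply rs_le. intros i Hi. rewrite <- Rmult_minus_distr_r. apply mul_abs_le; [specialize (Dr (S i) Hi); lra|].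
    destruct (traj_step n Kp Kq th bp bq z i Hi) as [_ s]. fold p q in s. rewrite (Zm (partial 1)) in s; [rabs| |auto].
    intros u Hu. apply (partial_outside u a 0 Hu).
  - rewrite rs_scal. apply Rmult_le_compat_l; [lra|]. exact (defect_sum n Kp Kq th bp bq z eps Hgr).
Qed.

Lemma riemann_sum_osc (H : Ham3) : admissible H -> exists C, 0 < C /\ forall m, (0 < m)%nat ->
  rs m (fun i => / INR m*osc (H (INR i/INR m))) <= hofer_length H + C/INR m.
Proof.
  intros A. destruct (admissible_time_lipschitz H 1 A) as [M [HM L]]. exists (2*M). split; [lra|]. intros m Hm.
  assert (Hm0 : 0 < INR m) by (apply lt_0_INR; exact Hm). set (h := / INR m). assert (Hh : 0 < h) by pos.
  assert (Tot : INR m*h = 1) by (unfold h; field; lra).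
  assert (G : forall k, (k <= m)%nat -> rs k (fun i => h*osc (H (INR i/INR m))) <= RInt (fun t => osc (H t)) 0 (INR k*h) + INR k*(2*M*h*h)).
  { induction k as [|k IH]; intros Hk.
    - simpl. assert (Z : RInt (fun t => osc (H t)) 0 0 = 0) by (apply (RInt_point (V := R_CompleteNormedModule))). rewrite Rmult_0_l, Z. lra.
    - cbn [rs]. specialize (IH ltac:(lia)). rewrite S_INR. set (t := INR k*h) in *. replace ((INR k + 1)*h) with (t + h) by pos.
      replace (INR k/INR m) with t by reflexivity. assert (Ch := RInt_chasles_R (fun t => osc (H t)) 0 t (t + h) (osc_continuous H A)).
      assert (Ht : 0 <= t) by pos.
      assert (Hth : t + h <= 1) by (rewrite <- Tot; unfold t; apply le_INR in Hk; rewrite S_INR in Hk; assert (INR k*h + 1*h <= INR m*h) by (rewrite <- Rmult_plus_distr_r; apply Rmult_le_compat_r; lra); lra).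
      assert (Cst : RInt (fun _ => osc (H t) - 2*M*h) t (t + h) <= RInt (fun t => osc (H t)) t (t + h)).
      { apply RInt_le; [lra|apply ex_RInt_cont; intros; apply continuous_const|apply ex_RInt_cont, osc_continuous, A|]. intros s Hs.
        assert (c := osc_close (H s) (H t) (M*h) (admissible_bounded H s A) (admissible_bounded H t A)).
        assert (c' : Rabs (osc (H s) - osc (H t)) <= 2*(M*h)).
        { apply c. intros p q. eapply Rle_trans; [apply L; rewrite Rabs_pos_eq; lra|]. apply Rmult_le_compat_l; [lra|]. rabs. }
        rabs. }
      assert (Ec : RInt (fun _ => osc (H t) - 2*M*h) t (t + h) = (t + h - t)*(osc (H t) - 2*M*h)) by (apply (RInt_const (V := R_CompleteNormedModule))).
      lra. }
  assert (Gm := G m (le_n m)). replace (INR m*(2*M*h*h)) with (INR m*h*(2*M*h)) in Gm by ring. rewrite Tot, Rmult_1_l in Gm. exact Gm.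
Qed.

(** * The lower bound *)

Section LowerBound.
Context (F P : R -> R -> R) (f : isotopy) (slope : R * R -> R) (c T Ms eta : R) (x0 : R * R).
Context (A : adm F) (Hf : flow_of F f) (AP : adm P).
Context (Hsl : forall t x, slope (f t x) = slope x) (Hgr : forall p q, dP P p q = slope (p, q)*dP F p q /\ dQ P p q = slope (p, q)*dQ F p q).
Context (HP : forall p q, 0 <= P p q <= c /\ P p q <= F p q) (Hmax : P (fst x0) (snd x0) = c) (Hc : 0 < c) (HT : 0 < T).
Context (Hdich : forall rho, 0 < rho -> exists kap, 0 < kap /\ forall x, Rabs (slope x) <= kap -> P (fst x) (snd x) <= rho \/ c - rho <= P (fst x) (snd x)).
Context (HMs : forall x, Rabs (slope x) <= Ms) (Heta : 0 < eta).
Context (Esc : forall s x, Rabs s <= (T + 1)*Ms -> slope x <> 0 -> eta*Rabs s <= dist1 x (f s x)).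
Context (H : Ham3) (h : isotopy) (AH : admissible H) (Fh : is_flow H h) (Hh : forall x, h 1 x = f T x).

Let G (tau : R) (p q : R) : R := - T*F p q + tau*P p q.

Lemma unwind_admissible (tau : R) : admissible (autonomous (G tau)).
Proof. exact (admissible_plus _ _ (proj1 (admissible_scal F (- T) A)) (proj1 (admissible_scal P tau AP))). Qed.

(** The field of G tau is (- T + tau slope) times that of F, so its time-one map is f at time - T +
    tau slope; composed with f T this leaves tau slope. *)
Lemma unwind_flow (tau : R) (g : isotopy) : is_flow (autonomous (G tau)) g -> forall x, g 1 (h 1 x) = f (tau*slope x) x.
Proof.
  intros Fg x. rewrite Hh.
  rewrite (time_change F (G tau) f g (fun x => - T + tau*slope x) A Hf (unwind_admissible tau) Fg).
  - rewrite Hsl, <- (flow_add F f A Hf). f_equal. ring.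
  - intros t y. rewrite Hsl. reflexivity.
  - intros p q. destruct (autonomous_partials F A p q) as [d1 d2]. destruct (autonomous_partials P AP p q) as [e1 e2]. destruct (Hgr p q) as [g1 g2]. rewrite g1 in e1. rewrite g2 in e2.
    assert (LD : forall (u v : R -> R) x lu lv, is_derive u x lu -> is_derive v x lv -> Derive (fun s => - T*u s + tau*v s) x = - T*lu + tau*lv).
    { intros u v y lu lv Hu Hv. apply is_derive_unique. assert (X := is_derive_mult_R (fun _ => - T) u y 0 lu (is_derive_const _ _) Hu).
      assert (Y := is_derive_mult_R (fun _ => tau) v y 0 lv (is_derive_const _ _) Hv). rewrite Rmult_0_l, Rplus_0_l in X, Y. exact (is_derive_plus _ _ _ _ _ X Y). }
    split.
    + unfold dP at 1, G. rewrite (LD _ _ _ _ _ d1 e1). ring.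
    + unfold dQ at 1, G. rewrite (LD _ _ _ _ _ d2 e2). ring.
Qed.

Lemma total_action (tau : R) (g y : isotopy) : is_flow (autonomous (G tau)) g -> is_flow (autonomous (fun p q => tau*P p q)) y ->
  (forall x, y 1 x = g 1 (h 1 x)) /\ forall x, action H h x 1 + action (autonomous (G tau)) g (h 1 x) 1 = action (autonomous (fun p q => tau*P p q)) y x 1.
Proof.
  intros Fg Fy. assert (E : forall x, y 1 x = g 1 (h 1 x)).
  { intros x. rewrite (unwind_flow tau g Fg), (scaled_flow F P f slope A Hf AP Hsl Hgr tau y Fy), Rmult_1_l. reflexivity. }
  split; [exact E|]. apply (actions_agree H _ _ h g y AH (unwind_admissible tau) (proj1 (admissible_scal P tau AP)) Fh Fg Fy). auto.
Qed.

Let V (v : R) : Ham3 := autonomous (fun p q => v*P p q).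
Let steps (v tau : R) (m : nat) : nat -> R -> R -> R := mix m H (autonomous (G tau)) (V v).
Let steps_p (v tau : R) (m : nat) : nat -> R -> R -> R := mix m (partial 1 H) (partial 1 (autonomous (G tau))) (partial 1 (V v)).
Let steps_q (v tau : R) (m : nat) : nat -> R -> R -> R := mix m (partial 2 H) (partial 2 (autonomous (G tau))) (partial 2 (V v)).
Let gsize (v tau : R) (m : nat) (th bp bq : R) (z : nat -> R) : R :=
  sum_abs (m + m + (m + m) + 2) (grad (m + m) (steps_p v tau m) (steps_q v tau m) th bp bq z).

Lemma uniform_constants : exists M a, 0 < M /\ 0 < a /\ ham_regular M H /\ (forall tau, 0 <= tau <= T -> ham_regular M (autonomous (G tau))) /\
  (forall v, 0 <= v <= 1 -> ham_regular M (V v)) /\ (forall t p q, a < Rabs p -> H t p q = 0) /\ (forall p q, a < Rabs p -> F p q = 0) /\ (forall p q, a < Rabs p -> P p q = 0).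
Proof.
  destruct (ham_regular_exists H AH) as [M1 [h1 R1]]. destruct (ham_regular_exists _ A) as [M2 [h2 R2]]. destruct (ham_regular_exists _ AP) as [M3 [h3 R3]].
  destruct (proj2 (proj2 AH)) as [a1 Ha1]. destruct (proj2 (proj2 A)) as [a2 Ha2]. destruct (proj2 (proj2 AP)) as [a3 Ha3].
  assert (Hp : 0 < 2*(T + 1)*(M2 + M3)) by pos.
  apply (ham_regular_mono _ (M2 + M3)) in R2; [|lra]. apply (ham_regular_mono _ (M2 + M3)) in R3; [|lra].
  assert (b1 := Rle_abs a1). assert (b2 := Rle_abs a2). assert (b3 := Rle_abs a3). assert (b1' := Rabs_pos a1). assert (b2' := Rabs_pos a2). assert (b3' := Rabs_pos a3).
  exists (M1 + 2*(T + 1)*(M2 + M3)), (Rabs a1 + Rabs a2 + Rabs a3 + 1). split; [lra|]. split; [lra|]. split; [apply (ham_regular_mono M1); [lra|pos]|].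
  split; [|split; [|split; [|split]]].
  - intros tau Ht. apply (ham_regular_mono (2*(T + 1)*(M2 + M3))); [lra|].
    apply (ham_regular_lincomb (- T) tau (M2 + M3) (T + 1) (autonomous F) (autonomous P)); try assumption; try lra.
    + rewrite Rabs_Ropp, Rabs_pos_eq; lra.
    + rewrite Rabs_pos_eq; lra.
  - intros v Hv. apply (ham_regular_mono (2*(T + 1)*(M2 + M3))); [lra|].
    assert (E : V v = fun t p q => v*autonomous P t p q + 0*autonomous P t p q).
    { unfold V, autonomous. ext t. ext p. ext q. ring. }
    rewrite E. apply (ham_regular_lincomb v 0 (M2 + M3) (T + 1)); try assumption; try lra.
    + rewrite Rabs_pos_eq; lra.
    + rewrite Rabs_R0; lra.
  - intros t p q hp. apply Ha1. lra.
  - intros p q hp. apply (Ha2 0). lra.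
  - intros p q hp. apply (Ha3 0). lra.
Qed.

(* Almost critical values of the free problem are close to [0] or to [- (tau + v) c]; freezing the base point at a maximum of P
   leaves only [- v c] when [tau = 0]. *)
Lemma critical_value_dichotomy : exists v, 0 < v <= 1 /\ forall rho, 0 < rho -> exists kap, 0 < kap /\ forall m eps, (0 < m)%nat -> 0 <= eps -> eps + / INR m <= kap ->
  (forall tau z, 0 <= tau <= T -> gsize v tau m 1 0 0 z <= eps ->
     Rabs (act (m + m) (steps v tau m) 1 0 0 z) <= rho \/ Rabs (act (m + m) (steps v tau m) 1 0 0 z + (tau + v)*c) <= rho) /\
  (forall z, gsize v 0 m 0 (fst x0) (snd x0) z <= eps -> Rabs (act (m + m) (steps v 0 m) 0 (fst x0) (snd x0) z + v*c) <= rho).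
Proof.
  destruct uniform_constants as [M [a [HM [Ha [RH [RG [RV [ZH [ZF ZP]]]]]]]]].
  destruct (closing_estimate F P f slope A Hf AP Hsl Hgr eta T Ms Heta (Rlt_le _ _ HT) HMs Esc) as [v [Hv [Cc [HCc Clo]]]].
  set (B := a + 2*M + 4). assert (HB : 0 <= B) by pos.
  destruct (euler_action M B (Rlt_le _ _ HM) HB) as [C1 [HC1 EA]].
  destruct (scaled_action F P f slope A Hf AP Hsl Hgr B HB) as [C2 [HC2 SA]].
  exists v. split; [lra|]. intros rho Hr. set (rho1 := rho/(2*(T + 1))). assert (Hr1 : 0 < rho1) by pos.
  destruct (Hdich rho1 Hr1) as [kd [Hkd Di]].
  (* C5 adds up the losses from far base points, from the closing estimate and from the action, so
     that C5 d stays below both rho and the threshold kd of the dichotomy. *)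
  set (C3 := 2 + C1). set (C4 := 1 + C2*(T*Cc) + B + Cc). set (C5 := (2*M + 4)*2 + Cc*C3 + 2*(C4*C3)).
  assert (HTC : 0 < C2*(T*Cc)) by pos.
  assert (q2 : 0 < Cc*C3) by pos. assert (q3 : 0 < 2*(C4*C3)) by pos.
  assert (HC5 : 0 < C5) by pos.
  exists (Rmin 1 (Rmin rho kd/C5)). split; [pos|].
  intros m eps Hm He Hk. assert (Hm0 : 0 < / INR m) by (apply Rinv_0_lt_compat, lt_0_INR, Hm).
  set (d := eps + / INR m) in *. assert (Hd1 : d <= 1) by (eapply Rle_trans; [exact Hk|apply Rmin_l]).
  assert (Hd5 : C5*d <= Rmin rho kd).
  { assert (u : d <= Rmin rho kd/C5) by (eapply Rle_trans; [exact Hk|apply Rmin_r]). apply (Rmult_le_compat_l C5) in u; [|lra].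
    replace (C5*(Rmin rho kd/C5)) with (Rmin rho kd) in u by (field; lra). exact u. }
  assert (Hmr := Rmin_l rho kd). assert (Hmk := Rmin_r rho kd).
  assert (d1 : 0 <= (2*M + 4)*2*d) by pos. assert (d2 : 0 <= Cc*C3*d) by pos. assert (d3 : 0 <= 2*(C4*C3)*d) by pos.
  assert (Sum : (2*M + 4)*2*d + Cc*C3*d + 2*(C4*C3)*d <= Rmin rho kd) by pos.
  assert (Heps : 0 <= eps <= 1) by pos.
  set (n := (m + m)%nat) in *. assert (Hn : (0 < n)%nat) by (unfold n; lia).
  (* An almost critical point with bounded base point is tracked by an exact orbit of [tau P] from x
     to almost e. Up to small errors and a multiple of tau |slope x|, its value is - tau P x - v P
     b. *)
  assert (Ev : forall tau th bp bq z, 0 <= tau <= T -> gsize v tau m th bp bq z <= eps -> Rabs (posp n th bp z n) <= B ->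
    let b := (posp n th bp z n, posq n th bq z n) in exists x e, snd x = snd b /\ Rabs (fst e - fst b) <= C3*d /\ dist1 (f (tau*slope x) x) e <= C3*d /\
     (th = 1 -> Rabs (fst x - fst b + v*dQ P (fst b) (snd b)) <= C3*d /\ Rabs (snd e - snd x + v*dP P (fst b) (snd b)) <= C3*d) /\
     Rabs (act n (steps v tau m) th bp bq z + tau*P (fst x) (snd x) + v*P (fst b) (snd b)) <= C3*d*(1 + B) + C2*(tau*Rabs (slope x)) + 0).
  { intros tau th bp bq z Ht Hgs Hbp b. destruct (ham_flow_exists _ (unwind_admissible tau)) as [g Fg].
    destruct (ham_flow_exists _ (proj1 (admissible_scal P tau AP))) as [y Fy]. destruct (total_action tau g y Fg Fy) as [Ey TA].
    assert (RH' := RH). destruct RH' as [_ [_ [RH2 [_ [RH1 RH3]]]]].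
    destruct (RG tau Ht) as [_ [_ [RG2 [_ [RG1 RG3]]]]].
    assert (E := EA H h (G tau) g (V v) m z eps th bp bq AH Fh (unwind_admissible tau) Fg RH1 RH2 RH3 RG1 RG2 RG3 Hm Heps Hgs Hbp).
    set (x := (traj_p n (steps_q v tau m) th bp bq z 0, traj_q n th bq z 0)). set (e := (traj_p n (steps_q v tau m) th bp bq z n, traj_q n th bq z n)).
    destruct E as [E1 E2]. change (dist1 (g 1 (h 1 x)) e <= C1*d) in E1. rewrite (unwind_flow tau g Fg) in E1.
    change (Rabs (act n (steps v tau m) th bp bq z - (action H h x 1 + action (autonomous (G tau)) g (h 1 x) 1 - fst b*(snd e - snd x) - v*P (fst b) (snd b))) <= C1*d) in E2.
    rewrite TA in E2. assert (S := SA tau y (proj1 Ht) Fy x (fst b) Hbp). rewrite Ey, (unwind_flow tau g Fg) in S.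
    assert (I : C1*d <= C3*d) by pos. assert (I2 : 2*eps <= C3*d) by pos.
    exists x, e. split; [symmetry; exact (proj2 (base_pos n th bp bq z))|]. split; [|split; [lra|split]].
    - assert (te := traj_end n (steps_p v tau m) (steps_q v tau m) th bp bq z eps Hgs Hn). simpl fst. lra.
    - intros Hth. destruct (traj_closing n (steps_p v tau m) (steps_q v tau m) th bp bq z eps Hgs Hn Hth) as [k1 k2].
      assert (Bq : steps_q v tau m n (fst b) (snd b) = v*dQ P (fst b) (snd b)).
      { unfold steps_q, n. rewrite mix_base. exact (proj2 (proj2 (admissible_scal P v AP) (fst b) (snd b))). }
      assert (Bp : steps_p v tau m n (fst b) (snd b) = v*dP P (fst b) (snd b)).
      { unfold steps_p, n. rewrite mix_base. exact (proj1 (proj2 (admissible_scal P v AP) (fst b) (snd b))). }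
      rewrite <- Bq, <- Bp. split; [exact (Rle_trans _ _ _ k1 I2)|exact (Rle_trans _ _ _ k2 I2)].
    - set (ac := act n (steps v tau m) th bp bq z) in *. set (W := action (autonomous (fun p q => tau*P p q)) y x 1) in *.
      assert (Q : Rabs (fst b*(snd e - snd (f (tau*slope x) x))) <= B*(C3*d)).
      { apply mul_abs_le; [pos|]. unfold dist1 in E1. rabs. }
      match goal with |- Rabs ?u <= _ => replace u with ((ac - (W - fst b*(snd e - snd x) - v*P (fst b) (snd b))) +
        (W - fst b*(snd (f (tau*slope x) x) - snd x) + tau*P (fst x) (snd x)) + - (fst b*(snd e - snd (f (tau*slope x) x)))) by ring end.
      rabs. }
  assert (HCd : 0 <= C3*d) by pos.
  assert (HBd : C3*d*(1 + B) <= C4*C3*d).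
  { replace (C4*C3*d) with (C3*d*C4) by ring. pos. }
  split.
  - intros tau z Ht Hgs. destruct (Rle_dec (Rabs (posp n 1 0 z n)) B) as [hb|hb].
    + destruct (Ev tau 1 0 0 z Ht Hgs hb) as [x [e [e1 [e2 [e3 [e4 e5]]]]]]. destruct (e4 eq_refl) as [e4a e4b].
      set (b := (posp n 1 0 z n, posq n 1 0 z n)) in *.
      destruct (Clo tau (C3*d) b x e Ht HCd e4a e1 e2 e4b e3) as [Sl Pd].
      set (ac := act n (steps v tau m) 1 0 0 z) in *. set (Px := P (fst x) (snd x)) in *. set (Pb := P (fst b) (snd b)) in *.
      assert (t1 : C2*(tau*Rabs (slope x)) <= C2*(T*(Cc*(C3*d)))) by pos.
      assert (t2 : Rabs (v*(Pb - Px)) <= 1*(Cc*(C3*d))) by (apply mul_abs_le; [rabs|lra]).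
      assert (Tot : Rabs (ac + (tau + v)*Px) <= rho/2).
      { replace (ac + (tau + v)*Px) with ((ac + tau*Px + v*Pb) + - (v*(Pb - Px))) by ring. via Rabs_triang. rewrite Rabs_Ropp.
        (* Here P b has been replaced by P x at the cost of the closing estimate. *)
        pos. }
      assert (Rr : rho1*(T + 1) = rho/2) by (unfold rho1; field; lra). destruct (HP (fst x) (snd x)) as [HPx _].
      assert (Sk : Rabs (slope x) <= kd) by lra.
      destruct (Di x Sk) as [l|l]; fold Px in l.
      * left. assert (w : 0 <= (tau + v)*Px <= rho/2).
        { split; [pos|]. rewrite <- Rr, Rmult_comm. pos. }
        abs Tot. apply Rabs_le_between. lra.
      * right. assert (w : 0 <= (tau + v)*(c - Px) <= rho/2).
        { split; [pos|]. rewrite <- Rr, Rmult_comm. pos. }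
        abs Tot. apply Rabs_le_between. lra.
    + left. assert (Fa := act_far M a eps m H (autonomous (G tau)) (V v) z 1 0 0 Hm Heps RH (RG tau Ht) ZH).
      apply Rle_trans with ((2*M + 4)*(2*eps)).
      * apply Fa; [| |pos|fold n; unfold B in hb; lra].
        -- intros t p q hp. unfold autonomous, G. rewrite ZF, ZP by exact hp. ring.
        -- intros t p q hp. unfold V, autonomous. rewrite ZP by exact hp. ring.
      * assert ((2*M + 4)*(2*eps) <= (2*M + 4)*(2*d)) by pos. lra.
  - intros z Hgs. assert (Ep : posp n 0 (fst x0) z n = fst x0) by (unfold posp; rewrite Nat.ltb_irrefl; ring).
    assert (Eq : posq n 0 (snd x0) z n = snd x0) by (unfold posq; rewrite Nat.ltb_irrefl; ring).
    assert (hb : Rabs (posp n 0 (fst x0) z n) <= B).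
    { rewrite Ep. apply Rnot_lt_le. intros hx. rewrite ZP in Hmax by pos. lra. }
    destruct (Ev 0 0 (fst x0) (snd x0) z ltac:(lra) Hgs hb) as [x [e [_ [_ [_ [_ e5]]]]]]. rewrite Ep, Eq in e5. cbn [fst snd] in e5. rewrite Hmax, !Rmult_0_l in e5.
    rabs.
Qed.

Lemma mix_close (m : nat) (a b b' c' : Ham3) (d : R) : (0 < m)%nat -> 0 <= d -> (forall p q, b' 0 p q <= b 0 p q + d) ->
  forall i p q, mix m a b' c' i p q <= mix m a b c' i p q + / INR m*d.
Proof.
  intros Hm Hd Hb i p q. assert (Hi : 0 < / INR m) by (apply Rinv_0_lt_compat, lt_0_INR, Hm). assert (0 <= / INR m*d) by pos.
  unfold mix. destruct (Nat.ltb i m); [lra|]. destruct (Nat.ltb i (m + m)); [|lra]. rewrite <- Rmult_plus_distr_l. apply Rmult_le_compat_l; [lra|apply Hb].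
Qed.

(** The minimax value starts near - v c at tau = 0 and follows the branch - (tau + v) c up to tau =
    T. There it is bounded below by minus the sum of the suprema of the steps, that is by - (length
    of H) - v c up to a small error; the terms v c cancel. *)
Theorem hofer_length_lower : T*c <= hofer_length H.
Proof.
  apply Rnot_lt_le. intros Hlt. destruct critical_value_dichotomy as [v [Hv CV]].
  destruct uniform_constants as [M [a [HM [Ha [RH [RG [RV [ZH [ZF ZP]]]]]]]]]. destruct (riemann_sum_osc H AH) as [Cr [HCr Rs]].
  set (gap := T*c - hofer_length H) in *.
  (* The first bound separates the two branches by more than the errors and one step in tau, the
     second makes the final errors smaller than the supposed gap. *)
  set (rho := Rmin (v*c/16) (gap/8)). assert (Hrho : 0 < rho) by pos.
  assert (Hrho1 : rho <= v*c/16) by apply Rmin_l. assert (Hrho2 : rho <= gap/8) by apply Rmin_r.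
  destruct (CV rho Hrho) as [kap [Hkap Di]].
  destruct (exists_large_nat (2/kap + 1/rho + Cr/rho)) as [m [Hm HmL]].
  assert (p1 : 0 < 2/kap) by pos. assert (p2 : 0 < 1/rho) by pos. assert (p3 : 0 < Cr/rho) by pos.
  assert (Big : forall u w, 0 < w -> u/w <= INR m -> u/INR m <= w).
  { intros u w hw hu. apply (Rmult_le_reg_r (INR m)); [lra|]. unfold Rdiv. rewrite Rmult_assoc, Rinv_l by lra.
    apply (Rmult_le_compat_r w) in hu; [|lra]. replace (u/w*w) with u in hu by (field; lra). lra. }
  assert (B1 := Big 2 kap Hkap ltac:(lra)). assert (B2 := Big 1 rho Hrho ltac:(lra)). assert (B3 := Big Cr rho Hrho ltac:(lra)).
  set (eps := / INR m). assert (He : 0 < eps) by pos. replace (1/INR m) with eps in B2 by pos.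
  replace (2/INR m) with (eps + eps) in B1 by pos.
  destruct (Di m eps Hm (Rlt_le _ _ He) B1) as [DiT Di0]. set (n := (m + m)%nat) in *.
  assert (MR : forall tau, 0 <= tau <= T -> _) by (intros tau Ht; exact (mix_regular M m H (autonomous (G tau)) (V v) Hm RH (RG tau Ht) (RV v (conj (Rlt_le _ _ (proj1 Hv)) (proj2 Hv))))).
  set (val_ := fun tau => value n (steps v tau m) 1 0 0).
  assert (Dic : forall tau, 0 <= tau <= T -> Rabs (val_ tau) <= 2*rho \/ Rabs (val_ tau + (tau + v)*c) <= 2*rho).
  { intros tau Ht. destruct (MR tau Ht) as [m1 [m2 [m3 m4]]].
    destruct (value_critical n (steps v tau m) (steps_p v tau m) (steps_q v tau m) 1 0 0 M M (Rlt_le _ _ HM) ltac:(lra) m1 m2 m3 m4 eps He) as [z [z1 z2]].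
    fold (val_ tau) in z1. abs z1. destruct (DiT tau z Ht z2) as [k|k]; abs k; [left|right]; apply Rabs_le_between; lra. }
  assert (Start : val_ 0 <= - (v*c) + 2*rho).
  { destruct (MR 0 ltac:(lra)) as [m1 [m2 [m3 m4]]].
    destruct (value_critical n (steps v 0 m) (steps_p v 0 m) (steps_q v 0 m) 0 (fst x0) (snd x0) M M (Rlt_le _ _ HM) ltac:(lra) m1 m2 m3 m4 eps He) as [z [z1 z2]].
    assert (vf := value_fiber n (steps v 0 m) (fst x0) (snd x0) M m4). fold (val_ 0) in vf. assert (k := Di0 z z2).
    rabs. }
  (* Only the m steps along G depend on tau, but the crude estimate counts all 2m + 1 steps with
     weight 1/m, whence the factor 3. *)
  assert (Cont : forall t t', 0 <= t <= T -> 0 <= t' <= T -> val_ t' <= val_ t + 3*(Rabs (t - t')*c)).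
  { intros t t' Ht Ht'. destruct (MR t Ht) as [_ [_ [_ m4]]]. destruct (MR t' Ht') as [_ [_ [_ m4']]].
    assert (Hd : 0 <= Rabs (t - t')*c) by pos.
    assert (vc := value_close n (steps v t' m) (steps v t m) 1 0 0 M (/ INR m*(Rabs (t - t')*c)) m4' m4).
    assert (vc' : val_ t' <= val_ t + INR (S n)*(/ INR m*(Rabs (t - t')*c))).
    { apply vc. intros i p q _. apply mix_close; [pos|lra|]. intros p' q'. unfold autonomous, G. destruct (HP p' q') as [hP _].
      assert (u : Rabs ((t - t')*P p' q') <= Rabs (t - t')*c) by (apply mul_abs_le; [lra|rabs]). rabs. }
    eapply Rle_trans; [exact vc'|]. apply Rplus_le_compat_l. rewrite <- Rmult_assoc. apply Rmult_le_compat_r; [lra|].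
    apply (Rmult_le_reg_r (INR m)); [lra|]. rewrite Rmult_assoc, Rinv_l, Rmult_1_r by lra. unfold n. rewrite S_INR, plus_INR.
    assert (1 <= INR m) by (apply (le_INR 1); lia). lra. }
  destruct (exists_large_nat (3*(T*c)/(v*c/4))) as [N [HN0 HN]]. assert (HNp : 0 < INR N) by (apply lt_0_INR; exact HN0).
  assert (Hstep : 3*(T/INR N*c) <= v*c/4).
  { apply (Rmult_le_reg_r (INR N)); [lra|]. replace (3*(T/INR N*c)*INR N) with (3*(T*c)) by (field; lra).
    apply (Rmult_le_compat_r (v*c/4)) in HN; [|lra]. replace (3*(T*c)/(v*c/4)*(v*c/4)) with (3*(T*c)) in HN by (field; lra). lra. }
  (* Each of the N increments of tau moves the value by at most v c/4. A jump to the branch near 0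
     would need at least 3 v c/4 up to 4 rho <= v c/4. *)
  assert (Ind : forall k, (k <= N)%nat -> val_ (INR k*(T/INR N)) <= - ((INR k*(T/INR N) + v)*c) + 2*rho).
  { assert (HTN : 0 < T/INR N) by pos.
    assert (Rg : forall k, (k <= N)%nat -> 0 <= INR k*(T/INR N) <= T).
    { intros k hk. split; [pos|]. apply le_INR in hk. apply Rle_trans with (INR N*(T/INR N)); [pos|right; field; lra]. }
    induction k as [|k IH]; intros Hk.
    - rewrite Rmult_0_l, Rplus_0_l. exact Start.
    - specialize (IH ltac:(lia)). assert (R1 := Rg k ltac:(lia)). assert (R2 := Rg (S k) Hk). assert (Co := Cont _ _ R1 R2).
      assert (Ed : Rabs (INR k*(T/INR N) - INR (S k)*(T/INR N)) = T/INR N).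
      { rewrite S_INR. replace (INR k*(T/INR N) - (INR k + 1)*(T/INR N)) with (- (T/INR N)) by ring. rewrite Rabs_Ropp. apply Rabs_pos_eq. lra. }
      rewrite Ed in Co. assert (0 <= INR k*(T/INR N)*c) by pos.
      destruct (Dic _ R2) as [k1|k1]; abs k1; lra. }
  specialize (Ind N (le_n N)). replace (INR N*(T/INR N)) with T in Ind by (field; lra).
  (* Suprema of the steps: H vanishes far out, so it is at most its oscillation; T (P - F) is at
     most 0; v P is at most v c. *)
  set (kappa := fun i => if Nat.ltb i m then/INR m*osc (H (INR i/INR m)) else if Nat.ltb i (m + m) then 0 else v*c).
  destruct (MR T ltac:(lra)) as [_ [_ [_ m4]]].
  assert (Low : - rs (S n) kappa <= val_ T).
  { apply (value_lower n (steps v T m) 1 0 0 M m4). intros i p q Hi. unfold steps, mix, kappa.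
    destruct (Nat.ltb_spec i m).
    - apply Rmult_le_compat_l; [pos|]. set (s := INR i/INR m). destruct (osc_spec (H s) (admissible_bounded H s AH)) as [U _].
      specialize (U p q (a + 1) 0). rewrite (ZH s (a + 1) 0) in U by rabs. lra.
    - destruct (Nat.ltb_spec i (m + m)).
      + replace 0 with (eps*0) by ring. apply Rmult_le_compat_l; [lra|]. unfold autonomous, G. destruct (HP p q) as [_ hq].
        assert (T*P p q <= T*F p q) by pos. lra.
      + apply Rmult_le_compat_l; [lra|]. destruct (HP p q) as [hq _]. lra. }
  assert (Ek : rs (S n) kappa = rs m (fun i => / INR m*osc (H (INR i/INR m))) + v*c).
  { cbn [rs]. unfold n. rewrite rs_app. rewrite (rs_ext m kappa (fun i => / INR m*osc (H (INR i/INR m)))).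
    - rewrite (rs_ext m (fun i => kappa (m + i)%nat) (fun _ => 0)).
      + rewrite rs_const. unfold kappa at 1. destruct (Nat.ltb_spec (m + m) m); [lia|]. rewrite Nat.ltb_irrefl. ring.
      + intros i Hi. unfold kappa. destruct (Nat.ltb_spec (m + i) m); [lia|]. destruct (Nat.ltb_spec (m + i) (m + m)); [lra|lia].
    - intros i Hi. unfold kappa. apply Nat.ltb_lt in Hi. rewrite Hi. lra. }
  specialize (Rs m Hm). pos.
Qed.
End LowerBound.

(* The deck shift between two lifts is a continuous integer-valued function that vanishes at infinity. *)
Lemma same_cyl_map_lifts (H K : Ham3) (h k : isotopy) (s t : R) : admissible H -> admissible K -> is_flow H h -> is_flow K k ->
  same_cyl_map (h s) (k t) -> forall x, h s x = k t x.
Proof.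
  intros AH AK Fh Fk Sm [p q]. destruct (Sm (p, q)) as [E1 _]. apply injective_projections; [lra|].
  destruct (proj2 (proj2 AH)) as [a Ha]. destruct (proj2 (proj2 AK)) as [b Hb].
  set (p0 := Rabs a + Rabs b + 1). assert (ha := Rle_abs a). assert (hb := Rle_abs b). assert (ha' := Rabs_pos a). assert (hb' := Rabs_pos b).
  assert (hp : Rabs p0 = p0) by (apply Rabs_pos_eq; unfold p0; lra).
  assert (D : snd (h s (p, q)) - snd (k t (p, q)) = snd (h s (p0, q)) - snd (k t (p0, q))).
  { apply (integer_valued_const (fun r => snd (h s (r, q)) - snd (k t (r, q)))).
    - intros r. apply eps_continuous. intros e He. destruct (flow_cont3 H h AH Fh) as [_ C1]. destruct (flow_cont3 K k AK Fk) as [_ C2].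
      destruct (cont3_eps _ C1 s r q (e/2)) as [d1 [Hd1 D1]]; [lra|]. destruct (cont3_eps _ C2 t r q (e/2)) as [d2 [Hd2 D2]]; [lra|].
      exists (Rmin d1 d2). split; [pos|]. intros y Hy. rmin Hy [y1 y2].
      assert (z1 := D1 s y q ltac:(rabs) y1 ltac:(rabs)).
      assert (z2 := D2 t y q ltac:(rabs) y2 ltac:(rabs)).
      abs z1. abs z2. apply Rabs_lt_between. lra.
    - intros r. destruct (Sm (r, q)) as [_ [n Hn]]. exists n. lra. }
  rewrite (flow_outside H h a AH Fh Ha s p0) in D by pos. rewrite (flow_outside K k b AK Fk Hb t p0) in D by pos. lra.
Qed.

(** For positive e choose a circle on a level E > e and a regular band between e and E. The band
    contains an essential orbit, on which the plateau of height c1 > e is built. For e <= 0 the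
    bound is the nonnegativity of length. *)
Lemma lower_bound (F : R -> R -> R) (f : isotopy) (e t : R) : adm F -> flow_of F f ->
  (forall p q, 0 <= F p q) -> (forall p q, F p q <= 1) -> e < E_level F -> 0 < t -> t*e <= hofer_dist_id (f t).
Proof.
  intros A Hf F0 F1 He Ht. apply hofer_dist_ge.
  - exists (t*osc F). apply reach_autonomous; [lra|exact A|pos].
  - intros H h AH Fh Sm. assert (Eq := same_cyl_map_lifts H _ h f 1 t AH A Fh Hf Sm).
    destruct (Rle_dec e 0) as [h0|h0].
    + assert (n := hofer_length_nonneg H AH). assert (t*e <= t*0) by pos. lra.
    + destruct (E_level_facts F A F1) as [_ [_ EL]]. destruct (EL e He) as [E [gamma [hE Cg]]].
      destruct (regular_interval F e E A) as [c1 [c2 [h1 [h2 [h3 Hreg]]]]]; [lra|lra|]. assert (Hc1 : 0 < c1) by lra.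
      destruct (essential_orbit_below_loop F f c1 c2 E gamma A Hf Hc1 h2 Hreg (Rlt_le _ _ h3) Cg) as [x0 [Hx0 Hess]].
      destruct (slope_bounded F f c1 c2 x0 Hx0) as [Ms [_ HMs]].
      destruct (escape_rate F f c1 c2 x0 A Hf Hc1 Hreg Hx0 ((t + 1)*Ms)) as [eta [Heta Esc]].
      assert (L := hofer_length_lower F (plateau F f c1 c2 x0) f (slope F f c1 c2 x0) c1 t Ms eta x0 A Hf
        (plateau_admissible F f c1 c2 x0 A Hf Hc1 Hreg Hx0) (slope_flow F f c1 c2 x0 A Hf Hx0) (plateau_gradient F f c1 c2 x0 A Hf Hc1 Hreg Hx0)
        (plateau_range F f c1 c2 x0 F0 Hc1 Hx0) (plateau_max F f c1 c2 x0 Hc1 Hess) Hc1 Ht (plateau_dichotomy F f c1 c2 x0 Hc1 Hx0) HMs Heta Esc H h AH Fh Eq).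
      nra.
Qed.

Lemma osc_normalized (F : R -> R -> R) : adm F -> (forall p q, 0 <= F p q) -> (forall p q, F p q <= 1) ->
  (exists p q, F p q = 1) -> osc F = 1.
Proof.
  intros A F0 F1 [p1 [q1 E1]]. destruct (osc_spec F (admissible_bounded _ 0 A)) as [U L]. apply Rle_antisym.
  - apply L. intros p q p' q'. specialize (F0 p' q'). specialize (F1 p q). lra.
  - destruct (proj2 (proj2 A)) as [K HK].
    assert (Z := HK 0 (Rabs K + 1) 0 ltac:(rabs)). unfold autonomous in Z. specialize (U p1 q1 (Rabs K + 1) 0). lra.
Qed.

Theorem theorem8p2 :
  forall (F : R -> R -> R),
    admissible (autonomous F) ->
    (forall p q, 0 <= F p q) ->
    (forall p q, F p q <= 1) ->
    (exists p q, F p q = 1) ->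
    forall f : R -> R * R -> R * R,
      is_flow (autonomous F) f ->
      is_lim (fun t => hofer_dist_id (f t) / (t * osc F)) p_infty (Finite (E_level F)).
Proof.
  intros F A F0 F1 Hm f Hf. apply is_lim_spec. intros eps. assert (He := cond_pos eps).
  rewrite (osc_normalized F A F0 F1 Hm).
  destruct (upper_bound F f (eps/3) A Hf F0 F1) as [C HC]; [lra|].
  exists (Rabs C*3/eps + 1). intros t Ht. assert (hC' := Rle_abs C).
  assert (H0 : 0 <= Rabs C*3/eps) by pos. assert (Ht0 : 0 < t) by lra.
  assert (Up := hofer_dist_le _ _ (HC t Ht0)). assert (Lo := lower_bound F f (E_level F - eps/2) t A Hf F0 F1 ltac:(lra) Ht0).
  assert (HCt : Rabs C <= t*(eps/3)).
  { apply Rle_trans with ((Rabs C*3/eps + 1)*(eps/3)); [|pos].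
    replace ((Rabs C*3/eps + 1)*(eps/3)) with (Rabs C + eps/3) by (field; lra). lra. }
  rewrite Rmult_1_r. set (d := hofer_dist_id (f t)) in *. assert (Ed : d = t*(d/t)) by (field; lra). rewrite Ed in Up, Lo.
  apply Rabs_lt_between. nra.
Qed.
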